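(* Let $B_1\subset\mathbb{R}^2$ be the unit ball and let $\lambda_1,\lambda_2>0$, $\lambda_1\neq\lambda_2$, be fixed. For every $\alpha>0$ there is $\varepsilon>0$ such that if $c\in H^1(\partial B_1)$ is a function satisfying $\int_{\partial B_1} c^+>\alpha$ and $\int_{\partial B_1} c^->\alpha$, then there is a function $h\in H^1(B_1)$ such that $h=c$ on $\partial B_1$ and $$W^{DP}(h)-(\lambda_1+\lambda_2)\frac{\pi}{2}\leq (1-\varepsilon)\left(W^{DP}(z)-(\lambda_1+\lambda_2)\frac{\pi}{2}\right),$$ where $z\in H^1(B_1)$ is the one-homogeneous extension of $c$ to $B_1$.
   Context: $B_1$ is the open unit ball of $\mathbb{R}^2$ centered at the origin; $c^\pm=\max\{\pm c,0\}$. For $v\in H^1(B_1)$, $$W^{DP}(v)=\int_{B_1}|\nabla v|^2\,dx-\int_{\partial B_1}v^2\,d\mathcal{H}^{1}+\lambda_1\big|\{v>0\}\cap B_1\big|+\lambda_2\big|\{v<0\}\cap B_1\big|,$$ where $|\cdot|$ is Lebesgue measure. The one-homogeneous extension of $c$ is $z(r,\theta)=r\,c(\theta)$ in polar coordinates. The equality $h=c$ on $\partial B_1$ is in the sense of traces. *)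

(* Defs.v *)
From mathcomp Require Import all_boot all_order all_algebra.
From mathcomp Require Import all_classical all_reals all_analysis.

Set Implicit Arguments.
Unset Strict Implicit.
Unset Printing Implicit Defensive.

Import Order.TTheory GRing.Theory Num.Theory.
Import numFieldNormedType.Exports.

Local Open Scope classical_set_scope.
Local Open Scope ring_scope.

(** Functions are Borel representatives of their a.e. classes. The normed space
    [R * R] carries the sup norm, which gives the usual topology of the plane;
    the Euclidean norm is [enorm]. *)

Section Plane.
Context {R : realType}.
Local Notation plane := (R * R)%type.

Definition leb2 : set plane -> \bar R :=
  (@lebesgue_measure R \x @lebesgue_measure R)%E.

Definition enorm (x : plane) : R := Num.sqrt (x.1 ^+ 2 + x.2 ^+ 2).

Definition ball1 : set plane := [set x | enorm x < 1].
Definition cball1 : set plane := [set x | enorm x <= 1].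

Definition bint (f : plane -> R) : R := (\int[leb2]_(x in ball1) f x)%R.

(** The measure H^1 on the unit circle is arc length, so boundary integrals are
    computed in the arc length parametrization [circ] over [arcs]. A function on
    the circle is a function on the plane of which only the values on the circle
    matter. *)
Definition circ (t : R) : plane := (cos t, sin t).
Definition arcs : set R := `[0, 2 * pi].
Definition cint (f : plane -> R) : R :=
  (\int[lebesgue_measure]_(t in arcs) f (circ t))%R.

Definition L2 d (T : measurableType d) (mu : set T -> \bar R) (D : set T)
    (f : T -> R) : Prop :=
  measurable_fun D f /\ (\int[mu]_(x in D) (f x ^+ 2)%:E < +oo)%E.

Definition pd1 (f : plane -> R) : plane -> R := fun x => 'D_((1, 0) : plane) f x.
Definition pd2 (f : plane -> R) : plane -> R := fun x => 'D_((0, 1) : plane) f x.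

Fixpoint Ck (k : nat) (f : plane -> R) : Prop :=
  if k is k'.+1 then
    [/\ forall x, derivable f x ((1, 0) : plane),
        forall x, derivable f x ((0, 1) : plane),
        continuous f, Ck k' (pd1 f) & Ck k' (pd2 f)]
  else continuous f.

Definition test_fun (phi : plane -> R) : Prop :=
  (forall k, Ck k phi) /\
  exists K : set plane,
    [/\ compact K, K `<=` ball1 & forall x, ~ K x -> phi x = 0].

Definition weak_gradient (v : plane -> R) (g : plane -> plane) : Prop :=
  [/\ L2 leb2 ball1 (fun x => (g x).1), L2 leb2 ball1 (fun x => (g x).2) &
      forall phi, test_fun phi ->
        bint (fun x => v x * pd1 phi x) = - bint (fun x => (g x).1 * phi x) /\
        bint (fun x => v x * pd2 phi x) = - bint (fun x => (g x).2 * phi x)].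

Definition H1 (v : plane -> R) : Prop :=
  L2 leb2 ball1 v /\ exists g, weak_gradient v g.

(** Unique up to a null subset of [ball1] when [H1 v]. *)
Definition grad (v : plane -> R) : plane -> plane :=
  xget (cst (0, 0)) [set g | weak_gradient v g].

Definition H1_dist2 (u v : plane -> R) : R :=
  bint (fun x => (u x - v x) ^+ 2) +
  bint (fun x => enorm (grad u x - grad v x) ^+ 2).

(** The trace operator is the continuous extension to H^1 of the restriction to
    the circle of the functions of H^1 that are continuous up to the boundary;
    [has_trace] is its graph. *)
Definition has_trace (v tau : plane -> R) : Prop :=
  [/\ H1 v, L2 lebesgue_measure arcs (tau \o circ) &
      exists w : nat -> plane -> R,
        [/\ forall n, H1 (w n) /\ {within cball1, continuous (w n)},
            H1_dist2 (w n) v @[n --> \oo] --> (0 : R) &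
            cint (fun x => (w n x - tau x) ^+ 2) @[n --> \oo] --> (0 : R)]].

(** Unique up to a null subset of the circle when [H1 v]. *)
Definition trace (v : plane -> R) : plane -> R :=
  xget (cst 0) [set tau | has_trace v tau].

Definition periodic_smooth (phi : R -> R) : Prop :=
  (forall n t, derivable (derive1n n phi) t 1) /\
  (forall t, phi (t + 2 * pi) = phi t).

(** [dc] is the weak derivative of [c] with respect to the angle. *)
Definition H1_circle (c : plane -> R) : Prop :=
  L2 lebesgue_measure arcs (c \o circ) /\
  exists2 dc : R -> R, L2 lebesgue_measure arcs dc &
    forall phi, periodic_smooth phi ->
      (\int[lebesgue_measure]_(t in arcs) (c (circ t) * derive1 phi t))%R =
      - (\int[lebesgue_measure]_(t in arcs) (dc t * phi t))%R.

Definition WDP (l1 l2 : R) (v : plane -> R) : R :=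
  bint (fun x => enorm (grad v x) ^+ 2) - cint (fun x => trace v x ^+ 2)
  + l1 * fine (leb2 ([set x | 0 < v x] `&` ball1))
  + l2 * fine (leb2 ([set x | v x < 0] `&` ball1)).

Definition one_homogeneous_extension (c : plane -> R) : plane -> R :=
  fun x => enorm x * c (x.1 / enorm x, x.2 / enorm x).

End Plane.

(* Main.v *)
From HB Require Import structures.
Require Import Defs.
From mathcomp Require Import all_boot all_order all_algebra.
From mathcomp Require Import all_classical all_reals all_analysis.
From mathcomp Require Import measurable_realfun.
From mathcomp Require Import ring lra.
Import Order.TTheory GRing.Theory Num.Theory.
Import numFieldNormedType.Exports.
Local Open Scope classical_set_scope.
Local Open Scope ring_scope.

Set Implicit Arguments.
Unset Strict Implicit.
Unset Printing Implicit Defensive.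

(** Why the theorem holds. Let [C] be the continuous representative of [c] in
    the angle, [p] its derivative and [lam] the weight [l1] or [l2] of the phase
    in which [C] lies. In polar coordinates the functional splits over the
    circles, and for the homogeneous extension [z] it equals half of
    E = int (p^2 - C^2 + lam). The goal is thus to lower E - (l1 + l2) pi by a
    fixed fraction.

    The competitor [competitor] takes, on the circle of radius [r], the values
    r (C - N s (C - w)) with s = kappa (1 - r), at the angle x + s eta(x), where
    [eta] is a primitive of [m] (see [tw_angle]). On small circles the values are
    pulled towards a better profile [w], and the circle is stretched at rate [m],
    which moves the zeros of [C]; the signs of [C] are kept and the boundary
    values are untouched. Its energy ([competitor_energy]) is the average over
    [r] of the energy E_s of the modified profile, plus a term of order kappa^2.
    So it is enough to find [w] and [m] with
    E_s <= (1 - s) E + s (Q - Delta), where Q - (l1 + l2) pi <= Delta / 2, and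
    with a kappa^2 term bounded by a multiple of Delta: then a small kappa gives
    the theorem with eps = kappa / 3 ([comp_total_bound],
    [improvement_arithmetic]). Such data are found arc by arc
    ([piece_estimate], [piece_concat]).

    The arcs are cut at zeros of [C]. Call a component of [C <> 0] long if its
    length theta exceeds 2 pi / 3; a circle holds at most two of them.
    - A gap, where no component is long, takes [w = 0]: there the Poincare
      inequality has the constant 9/4 > 1 ([gap_poincare]) and pulling the values
      to zero gains (N - 1) int (p^2 - C^2) ([piece_gap]).
    - A long component with theta <= 3 pi / 2 takes for [w] the projection of [C]
      on its half wave sine, and is stretched towards the length pi, at which the
      sine has energy zero and the phase costs l_i pi ([piece_arc]).
    - A wider component is cut into thirds, and [w] solves w'' = - w with the
      values of [C] at the ends; its energy is nonpositive ([piece_third]).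
    The stretching of the long components is compensated by contracting the gaps.
    If there are two long components, of opposite signs, then Q is exactly
    (l1 + l2) pi. In all other cases one of the two phases lies in the gaps, so
    that the lower bound alpha on its integral bounds the gain of the gaps from
    below; a large [N] makes it dominate Q, which never exceeds 2 (l1 + l2) pi
    ([gaps_dominate]). This is where alpha enters, and [exists_improvable] is the
    outcome.

    On the side of partial differential equations, the weak gradient of the
    competitor is computed by parts in the coordinates (r, x)
    ([competitor_by_parts]), and gradients and traces, which are chosen among all
    admissible ones, are compared with the computed ones through their uniqueness
    ([weak_gradient_unique], [trace_unique]). *)

(** * Square integrable functions *)

Section SquareIntegrable.
Context {d} {T : measurableType d} {R : realType}.
Variable mu : {measure set T -> \bar R}.
Implicit Types (D : set T) (f g : T -> R).

Lemma L2_sqr_integrable D f : measurable D -> L2 mu D f ->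
  mu.-integrable D (EFin \o (fun x => f x ^+ 2)).
Proof.
move=> mD [mf fi]; apply/integrableP; split.
  by apply/measurable_EFinP/measurable_funX.
rewrite (eq_integral (fun x => (f x ^+ 2)%:E)) // => x _.
by rewrite /= ger0_norm// sqr_ge0.
Qed.

Lemma L2M D f g : measurable D -> L2 mu D f -> L2 mu D g ->
  mu.-integrable D (EFin \o (fun x => f x * g x)).
Proof.
move=> mD Lf Lg.
have [mf _] := Lf; have [mg _] := Lg.
apply: (@le_integrable _ _ _ _ D _ _ (fun x => (f x ^+ 2)%:E + (g x ^+ 2)%:E)%E) => //.
- exact/measurable_EFinP/measurable_funM.
- move=> x Dx; rewrite /= lee_fin.
  rewrite [leRHS]ger0_norm ?addr_ge0 ?sqr_ge0//.
  by rewrite ler_norml; apply/andP; split; nra.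
- exact: (integrableD _ (L2_sqr_integrable mD Lf) (L2_sqr_integrable mD Lg)).
Qed.

Lemma L2_of_integrable D f : measurable_fun D f ->
  mu.-integrable D (EFin \o (fun x => f x ^+ 2)) -> L2 mu D f.
Proof.
move=> mf /integrableP[_ h]; split=> //.
rewrite (eq_integral (fun x => `|(f x ^+ 2)%:E|)%E) // => x _.
by rewrite /= ger0_norm// sqr_ge0.
Qed.

Lemma L2_le D f g : measurable D -> measurable_fun D f -> L2 mu D g ->
  (forall x, D x -> `|f x| <= `|g x|) -> L2 mu D f.
Proof.
move=> mD mf [mg gi] fg; split=> //; apply: le_lt_trans gi.
apply: ge0_le_integral => //.
- by move=> x _; rewrite lee_fin sqr_ge0.
- by apply/measurable_EFinP/measurable_funX.
- by apply/measurable_EFinP/measurable_funX.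
- move=> x Dx; rewrite lee_fin -(real_normK (num_real (f x))).
  by rewrite -(real_normK (num_real (g x))) lerXn2r ?nnegrE// fg.
Qed.

Lemma L2_addr D f g : measurable D -> L2 mu D f -> L2 mu D g ->
  L2 mu D (fun x => f x + g x).
Proof.
move=> mD Lf Lg; have [mf _] := Lf; have [mg _] := Lg.
apply: L2_of_integrable; first exact: measurable_funD.
have i1 := integrableD mD (L2_sqr_integrable mD Lf) (L2_sqr_integrable mD Lg).
have := integrableD mD i1 (integrableD mD (L2M mD Lf Lg) (L2M mD Lf Lg)).
apply: eq_integrable => // x _ /=; rewrite -!EFinD; congr EFin; ring.
Qed.

Lemma L2_mulr_bounded D f (b : T -> R) (M : R) : measurable D ->
  measurable_fun D b -> (forall x, D x -> `|b x| <= M) -> L2 mu D f ->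
  L2 mu D (fun x => b x * f x).
Proof.
move=> mD mb bM [mf fi].
have fi2 : mu.-integrable D (EFin \o (fun x => f x ^+ 2)) by exact: L2_sqr_integrable.
apply: L2_of_integrable; first exact: measurable_funM.
have := integrableZl mD (M ^+ 2) fi2; apply: le_integrable => //.
  by apply/measurable_EFinP/measurable_funX/measurable_funM.
move=> x Dx /=; rewrite lee_fin exprMn !normrM ler_wpM2r//.
by have := bM x Dx; have := ler_norm M; have := normr_ge0 (b x); nra.
Qed.

Lemma L2_scale D f (k : R) : measurable D -> L2 mu D f ->
  L2 mu D (fun x => k * f x).
Proof.
by move=> mD; apply: (@L2_mulr_bounded D f (cst k) `|k|) => //.
Qed.

Lemma L2_opp D f : measurable D -> L2 mu D f -> L2 mu D (fun x => - f x).
Proof.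
move=> mD /(L2_scale (-1) mD); congr L2; apply/funext => x; ring.
Qed.

Lemma L2_subr D f g : measurable D -> L2 mu D f -> L2 mu D g ->
  L2 mu D (fun x => f x - g x).
Proof. by move=> mD Lf Lg; apply: L2_addr => //; exact: L2_opp. Qed.

Lemma L2_bounded D (b : T -> R) (M : R) : measurable D -> (mu D < +oo)%E ->
  measurable_fun D b -> (forall x, D x -> `|b x| <= M) -> L2 mu D b.
Proof.
move=> mD Dfin mb bM.
have L1 : L2 mu D (cst 1 : T -> R).
  split; first exact: measurable_cst.
  under eq_integral do rewrite expr1n.
  by rewrite integral_cst// mul1e.
have := L2_mulr_bounded mD mb bM L1.
by congr L2; apply/funext => x; rewrite /= mulr1.
Qed.

Lemma L2_cst D (k : R) : measurable D -> (mu D < +oo)%E -> L2 mu D (fun=> k).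
Proof. by move=> mD fD; apply: (@L2_bounded D _ `|k|). Qed.

Lemma L2S D D' f : measurable D -> measurable D' -> D' `<=` D ->
  L2 mu D f -> L2 mu D' f.
Proof.
move=> mD mD' DD' [mf fi]; split; first exact: measurable_funS mf.
apply: le_lt_trans fi; apply: ge0_subset_integral => //.
  by apply/measurable_EFinP/measurable_funX.
by move=> x _; rewrite lee_fin sqr_ge0.
Qed.

Lemma L2_integrable D f : measurable D -> (mu D < +oo)%E -> L2 mu D f ->
  mu.-integrable D (EFin \o f).
Proof.
move=> mD fD Lf; have := L2M mD Lf (L2_cst 1 mD fD).
by apply: eq_integrable => // x _ /=; rewrite mulr1.
Qed.

Lemma L2_eq D f g : {in D, f =1 g} -> L2 mu D f -> L2 mu D g.
Proof.
move=> fg [mf fi]; split; first exact: eq_measurable_fun mf.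
by under eq_integral => x xD do rewrite -fg//.
Qed.

End SquareIntegrable.

(** * Primitives of square integrable functions *)

Section IntervalIntegrals.
Context {R : realType}.
Notation mu := (@lebesgue_measure R).
Implicit Types (a b x y : R) (f g u v p q : R -> R).

Lemma mu_segment_lty a b : (mu `[a, b] < +oo)%E.
Proof. by rewrite /= lebesgue_measure_itv/=; case: ifP => // _; rewrite -EFinD ltry. Qed.

Lemma mu_segment a b : a <= b -> mu `[a, b] = (b - a)%:E.
Proof.
rewrite le_eqVlt => /predU1P[->|ab]; rewrite lebesgue_measure_itv/= lte_fin.
  by rewrite ltxx subrr.
by rewrite ab.
Qed.

Lemma Rintegral_split f a x b : a <= x -> x <= b ->
  mu.-integrable `[a, b] (EFin \o f) ->
  \int[mu]_(t in `[a, b]) f t =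
  \int[mu]_(t in `[a, x]) f t + \int[mu]_(t in `[x, b]) f t.
Proof.
move=> ax xb fi.
have := Rintegral_itvB (x := x) fi; rewrite !bnd_simp => /(_ ax xb).
rewrite Rintegral_itv_obnd_cbnd//; first by move=> <-; ring.
apply: integrableS fi => //; apply: subset_itvr.
by rewrite bnd_simp.
Qed.

Lemma integrable_sub f a b a' b' : a <= a' -> b' <= b ->
  mu.-integrable `[a, b] (EFin \o f) -> mu.-integrable `[a', b'] (EFin \o f).
Proof.
move=> aa bb; apply: integrableS => //; apply: subset_itv; by rewrite bnd_simp.
Qed.

Lemma L2_sub f a b a' b' : a <= a' -> b' <= b ->
  L2 mu `[a, b] f -> L2 mu `[a', b'] f.
Proof.
move=> aa bb; apply: L2S => //; apply: subset_itv; by rewrite bnd_simp.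
Qed.

Lemma continuous_L2 f a b : {within `[a, b], continuous f} -> L2 mu `[a, b] f.
Proof.
move=> cf; have mf : measurable_fun `[a, b] f by exact: subspace_continuous_measurable_fun.
apply: L2_of_integrable => //.
apply: continuous_compact_integrable; first exact: segment_compact.
rewrite (_ : (fun x => f x ^+ 2) = (fun x => f x * f x)); last first.
  by apply/funext => x; rewrite expr2.
by move=> x; apply: continuousM; exact: cf.
Qed.

Lemma continuous_integrable f a b : continuous f ->
  mu.-integrable `[a, b] (EFin \o f).
Proof.
move=> cf; apply: continuous_compact_integrable; first exact: segment_compact.
exact: continuous_subspaceT.
Qed.

Lemma Rintegral_eq_oo f g a b : measurable_fun `]a, b[ f ->
  (forall x, a < x < b -> f x = g x) ->
  \int[mu]_(t in `[a, b]) f t = \int[mu]_(t in `[a, b]) g t.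
Proof.
move=> mf fg; rewrite /Rintegral; congr fine.
have mg : measurable_fun `]a, b[ g.
  by apply: eq_measurable_fun mf => x /[!inE]/=; rewrite in_itv/= => /fg.
apply: eq_integral_itv_bounded => // x; rewrite inE/= in_itv/=; exact: fg.
Qed.

(** The endpoints form a measurable set on which any function is measurable. *)
Lemma measurable_oo_cc f a b : measurable_fun `]a, b[ f <-> measurable_fun `[a, b] f.
Proof.
split => mf; last by apply: measurable_funS mf => //; exact: subset_itv_oo_cc.
by apply/measurable_fun_itv_bndo_bndcP/measurable_fun_itv_obnd_cbndP.
Qed.

Lemma L2_eq_oo f g a b : (forall x, a < x < b -> f x = g x) ->
  L2 mu `[a, b] f -> L2 mu `[a, b] g.
Proof.
move=> fg [mf fi].
have mf' : measurable_fun `]a, b[ f by exact/measurable_oo_cc.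
have mg' : measurable_fun `]a, b[ g.
  by apply: eq_measurable_fun mf' => x /[!inE]/=; rewrite in_itv/= => /fg.
split; first exact/measurable_oo_cc.
rewrite (@eq_integral_itv_bounded R a b (fun x => g x ^+ 2) (fun x => f x ^+ 2) true false) in fi => //.
- exact: measurable_funX.
- exact: measurable_funX.
- by move=> x; rewrite in_itv/= => /fg ->.
Qed.

Lemma integral_point f a : \int[mu]_(t in `[a, a]) f t = 0.
Proof. by rewrite set_itv1 Rintegral_set1. Qed.

Lemma Rintegral_empty f a b : b < a -> \int[mu]_(t in `[a, b]) f t = 0.
Proof.
by move=> ba; rewrite set_itv_ge ?Rintegral_set0// bnd_simp -ltNge.
Qed.

(** [u] is absolutely continuous with square integrable derivative [p]. The
    pair is carried explicitly because [p] need not be a classical derivative;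
    nothing is asked outside the segment. *)
Definition prim a b u p := L2 mu `[a, b] p /\
  forall x, a <= x <= b -> u x = u a + \int[mu]_(t in `[a, x]) p t.

Lemma L2_int p a b : L2 mu `[a, b] p -> mu.-integrable `[a, b] (EFin \o p).
Proof. by move=> Lp; apply: L2_integrable => //; exact: mu_segment_lty. Qed.

Lemma prim_diff a b u p x y : prim a b u p -> a <= x -> x <= y -> y <= b ->
  u y - u x = \int[mu]_(t in `[x, y]) p t.
Proof.
move=> [Lp up] ax xy yb.
rewrite (up y) ?(le_trans ax)// (up x) ?ax ?(le_trans xy)//.
rewrite (@Rintegral_split p a x y)//; first ring.
exact: integrable_sub (L2_int Lp).
Qed.

Lemma prim_sub a b a' b' u p : a <= a' -> b' <= b -> prim a b u p -> prim a' b' u p.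
Proof.
move=> aa bb [Lp up]; split; first exact: L2_sub Lp.
move=> x /andP[ax xb]; rewrite -(prim_diff (conj Lp up))//; first ring.
exact: le_trans bb.
Qed.

Lemma L2_glue p a x b : a <= x -> x <= b -> L2 mu `[a, x] p -> L2 mu `[x, b] p ->
  L2 mu `[a, b] p.
Proof.
move=> ax xb L1 L2'.
have ab : `[a, b]%classic = `[a, x] `|` `[x, b] :> set R.
  apply/seteqP; split=> t /=; rewrite !in_itv/=.
    by move=> /andP[at_ tb]; case: (leP t x) => tx; [left|right]; rewrite ?at_ ?tb ?(ltW tx).
  by case=> /andP[t1 t2]; rewrite ?t1 ?t2 ?(le_trans t2)// ?(le_trans ax).
have mp : measurable_fun `[a, b] p.
  by rewrite ab; apply/measurable_funU => //; split; [case: L1|case: L2'].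
apply: L2_of_integrable => //.
have mcc y z : measurable (`[y, z]%classic : set (measurableTypeR R)) by [].
have i1 := L2_sqr_integrable (mcc _ _) L1.
have i2 := L2_sqr_integrable (mcc _ _) L2'.
apply/integrableP; split.
  exact/measurable_EFinP/measurable_funX.
rewrite (@itv_bndbnd_setU _ _ _ (BRight x))//.
rewrite ge0_integral_setU//=.
- apply: lte_add_pinfty.
    by case/integrableP : i1.
  case/integrableP : i2 => _; apply: le_lt_trans; apply: ge0_subset_integral => //.
    apply/measurable_EFinP; apply: measurableT_comp => //; apply/measurable_funX.
    by apply: measurable_funS mp => //; apply: subset_itvr; rewrite bnd_simp.
  by apply: subset_itvr; rewrite bnd_simp.
- rewrite -itv_bndbnd_setU//.
  by apply/measurable_EFinP; apply: measurableT_comp => //; exact/measurable_funX.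
- apply/disj_setPS => y [/=]; rewrite 2!in_itv/= => /andP[_ yx] /andP[].
  by rewrite ltNge yx.
Qed.

Lemma prim_glue a x b u p : a <= x -> x <= b -> prim a x u p -> prim x b u p ->
  prim a b u p.
Proof.
move=> ax xb [L1 u1] [L2' u2]; have Lp := L2_glue ax xb L1 L2'.
split=> // y /andP[ay yb]; case: (leP y x) => yx; first by apply: u1; rewrite ay.
rewrite u2 ?(ltW yx)// u1 ?ax ?lexx// -addrA -Rintegral_split// ?(ltW yx)//.
exact: integrable_sub (L2_int Lp).
Qed.

Lemma prim_eq_oo a b u u' p p' : (forall x, a <= x <= b -> u x = u' x) ->
  (forall x, a < x < b -> p x = p' x) -> prim a b u p -> prim a b u' p'.
Proof.
move=> uu pp [Lp up]; split; first exact: L2_eq_oo Lp.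
move=> x /andP[ax xb]; rewrite -!uu ?ax ?xb ?lexx ?(le_trans ax)//.
rewrite up ?ax//; congr (_ + _); apply: Rintegral_eq_oo.
  apply: measurable_funS (Lp.1) => //; apply: subset_itv; by rewrite bnd_simp.
by move=> t /andP[at_ tx]; apply: pp; rewrite at_ (lt_le_trans tx).
Qed.

Lemma prim_continuous a b u p : prim a b u p -> {within `[a, b], continuous u}.
Proof.
move=> [Lp up]; case: (leP a b) => ab; last first.
  by rewrite set_itv_ge -?leNgt ?bnd_simp -?ltNge//; exact: continuous_subspace0.
have := parameterized_integral_continuous ab (L2_int Lp) => h.
apply: (@subspace_eq_continuous _ _ _ (fun x => u a + parameterized_integral mu a x p)).
  by move=> x; rewrite inE/= in_itv/= /parameterized_integral => /up.
by move=> x; apply: cvgD; [exact: cvg_cst|exact: h].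
Qed.

Lemma prim_L2 a b u p : prim a b u p -> L2 mu `[a, b] u.
Proof. by move=> /prim_continuous /continuous_L2. Qed.

Lemma prim_bounded a b u p : prim a b u p ->
  exists2 M : R, 0 <= M & forall x, a <= x <= b -> `|u x| <= M.
Proof.
move=> h; case: (leP a b) => ab; last first.
  by exists 0 => // x /andP[ax /(le_trans ax)]; rewrite leNgt ab.
have := EVT_max ab (prim_continuous h) => -[c1 _ c1P].
have := EVT_min ab (prim_continuous h) => -[c2 _ c2P].
exists (`|u c1| + `|u c2|); first by rewrite addr_ge0.
move=> x xab; have := c1P x; have := c2P x; rewrite in_itv/= => /(_ xab) h2 /(_ xab) h1.
have := ler_norm (u c1); have := ler_normr (- u c2) `|u c2|; have := normr_ge0 (u c1).
have := normr_ge0 (u c2); have := lerNnormlW (lexx `|u c2|).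
rewrite ler_norml; lra.
Qed.

Lemma prim_addr a b u p v q : prim a b u p -> prim a b v q ->
  prim a b (fun x => u x + v x) (fun x => p x + q x).
Proof.
move=> [Lp up] [Lq vq]; split; first exact: L2_addr.
move=> x /andP[ax xb]; rewrite up ?ax// vq ?ax// RintegralD//; first ring.
- exact: integrable_sub (L2_int Lp).
- exact: integrable_sub (L2_int Lq).
Qed.

Lemma prim_scale a b u p k : prim a b u p ->
  prim a b (fun x => k * u x) (fun x => k * p x).
Proof.
move=> [Lp up]; split; first exact: L2_scale.
move=> x /andP[ax xb]; rewrite up ?ax// RintegralZl//; first ring.
exact: integrable_sub (L2_int Lp).
Qed.

Lemma prim_subr a b u p v q : prim a b u p -> prim a b v q ->
  prim a b (fun x => u x - v x) (fun x => p x - q x).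
Proof.
move=> h1 /(prim_scale (-1)) /(prim_addr h1).
by apply: prim_eq_oo => x _; ring.
Qed.

Lemma prim_cst a b k : prim a b (fun=> k) (fun=> 0).
Proof.
split; first by apply: L2_cst => //; exact: mu_segment_lty.
by move=> x _; rewrite Rintegral_cst// mul0r addr0.
Qed.

Lemma prim_C1 a b u p : (forall x, is_derive x 1 u (p x)) -> continuous p ->
  prim a b u p.
Proof.
move=> du cp; have cpw A : {within A, continuous p} by exact: continuous_subspaceT.
split; first exact: continuous_L2.
have cu : continuous u.
  by move=> y; apply: differentiable_continuous; apply/derivable1_diffP; case: (du y).
move=> x /andP[]; rewrite le_eqVlt => /predU1P[<- _|ax _].
  by rewrite integral_point addr0.
rewrite /Rintegral (@continuous_FTC2 _ p u)//=; first by ring.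
- split; first by move=> y _; case: (du y).
    by apply: cvg_at_right_filter; exact: cu.
  by apply: cvg_at_left_filter; exact: cu.
- by move=> y _; rewrite derive1E; case: (du y).
Qed.

End IntervalIntegrals.

Section FubiniRectangle.
Context {R : realType}.
Notation mu := (@lebesgue_measure R).
Notation mu2 := (@lebesgue_measure R \x @lebesgue_measure R)%E.
Implicit Types (A B : set R).

Let mkcond_rect A B (K : R * R -> R) x :
  (fun y => (K \_ (A `*` B)) (x, y)) = ((fun y => if x \in A then K (x, y) else 0) \_ B).
Proof.
apply/funext => y; rewrite !patchE in_setX /=.
by case: (x \in A); case: (y \in B).
Qed.

Lemma fubini_rect12 A B (K : R * R -> R) : measurable A -> measurable B ->
  mu2.-integrable (A `*` B) (EFin \o K) ->
  \int[mu2]_(z in A `*` B) K z = \int[mu]_(x in A) \int[mu]_(y in B) K (x, y).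
Proof.
move=> mA mB iK; have mAB : measurable (A `*` B) by exact: measurableX.
have := iK; rewrite integrable_mkcond// restrict_EFin => iK'.
rewrite Rintegral_mkcond [RHS]Rintegral_mkcond /Rintegral.
rewrite -[X in fine X](integral12_prod_meas1 iK') /fubini_F /=.
have iF := integrable_fubini_F iK'; rewrite /fubini_F in iF.
congr fine; apply: ae_eq_integral => //=.
- exact: (measurable_int _ iF).
- have h : (fun x : R => (((fun x0 : R => fine (\int[mu]_(x1 in B) (K (x0, x1))%:E)) \_ A) x)%:E) =
     EFin \o (fine \o (fun x => \int[mu]_y ((K \_ (A `*` B)) (x, y))%:E)%E).
    apply/funext => x; rewrite /= patchE.
    rewrite (_ : (fun y => ((K \_ (A `*` B)) (x, y))%:E) =
       (fun y => (if x \in A then K (x, y) else 0)%:E) \_ B); last first.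
      by rewrite -[LHS]/(EFin \o (fun y => (K \_ (A `*` B)) (x, y))) mkcond_rect -restrict_EFin.
    rewrite -integral_mkcond; case: ifPn => // _.
    by rewrite integral0.
  rewrite h; apply/measurable_EFinP; apply: measurableT_comp => //.
  exact: (measurable_int _ iF).
- apply: filterS (integrable_ae _ iF) => // x /(_ I) Fx _.
  rewrite -(fineK Fx) patchE; congr EFin.
  rewrite (_ : (fun y => ((K \_ (A `*` B)) (x, y))%:E) =
     (fun y => (if x \in A then K (x, y) else 0)%:E) \_ B); last first.
    by rewrite -[LHS]/(EFin \o (fun y => (K \_ (A `*` B)) (x, y))) mkcond_rect -restrict_EFin.
  by rewrite -integral_mkcond; case: ifPn => // _; rewrite integral0.
Qed.

Let mkcond_rect2 A B (K : R * R -> R) y :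
  (fun x => (K \_ (A `*` B)) (x, y)) = ((fun x => if y \in B then K (x, y) else 0) \_ A).
Proof.
apply/funext => x; rewrite !patchE in_setX /=.
by case: (x \in A); case: (y \in B).
Qed.

Lemma fubini_rect21 A B (K : R * R -> R) : measurable A -> measurable B ->
  mu2.-integrable (A `*` B) (EFin \o K) ->
  \int[mu2]_(z in A `*` B) K z = \int[mu]_(y in B) \int[mu]_(x in A) K (x, y).
Proof.
move=> mA mB iK; have mAB : measurable (A `*` B) by exact: measurableX.
have := iK; rewrite integrable_mkcond// restrict_EFin => iK'.
rewrite Rintegral_mkcond [RHS]Rintegral_mkcond /Rintegral.
rewrite -[X in fine X](integral21_prod_meas1 iK') /fubini_G /=.
have mG := measurable_fubini_G iK'; rewrite /fubini_G in mG.
have fG := ae_integrable2 iK'.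
congr fine; apply: ae_eq_integral => //=.
- have h : (fun x : R => (((fun x0 : R => fine (\int[mu]_(x1 in A) (K (x1, x0))%:E)) \_ B) x)%:E) =
     EFin \o (fine \o (fun y => \int[mu]_x ((K \_ (A `*` B)) (x, y))%:E)%E).
    apply/funext => x; rewrite /= patchE.
    rewrite (_ : (fun y => ((K \_ (A `*` B)) (y, x))%:E) =
       (fun y => (if x \in B then K (y, x) else 0)%:E) \_ A); last first.
      by rewrite -[LHS]/(EFin \o (fun y => (K \_ (A `*` B)) (y, x))) mkcond_rect2 -restrict_EFin.
    rewrite -integral_mkcond; case: ifPn => // _.
    by rewrite integral0.
  rewrite h; apply/measurable_EFinP; apply: measurableT_comp => //.
- apply: filterS fG => // x /(integrable_fin_num measurableT) Fx _; rewrite /= in Fx.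
  rewrite -(fineK Fx) patchE; congr EFin.
  rewrite (_ : (fun y => ((K \_ (A `*` B)) (y, x))%:E) =
     (fun y => (if x \in B then K (y, x) else 0)%:E) \_ A); last first.
    by rewrite -[LHS]/(EFin \o (fun y => (K \_ (A `*` B)) (y, x))) mkcond_rect2 -restrict_EFin.
  by rewrite -integral_mkcond; case: ifPn => // _; rewrite integral0.
Qed.

Lemma integrable_rect_dominated A B (K : R * R -> R) (p q : R -> R) :
  measurable A -> measurable B -> measurable_fun (A `*` B) K ->
  mu.-integrable A (EFin \o p) -> mu.-integrable B (EFin \o q) ->
  (forall x y, A x -> B y -> `|K (x, y)| <= `|p x| * `|q y|) ->
  mu2.-integrable (A `*` B) (EFin \o K).
Proof.
move=> mA mB mK ip iq Kpq; have mAB : measurable (A `*` B) by exact: measurableX.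
rewrite integrable_mkcond// restrict_EFin.
have mK' : measurable_fun [set: measurableTypeR R * measurableTypeR R] (EFin \o (K \_ (A `*` B))).
  by apply/measurable_EFinP; apply/(measurable_restrictT _ _).1.
apply: (integrable12ltyP mu mu mK').2.
have ip' := ip; rewrite integrable_mkcond// restrict_EFin in ip'.
have iq' := iq; rewrite integrable_mkcond// restrict_EFin in iq'.
have /integrableP[mp fp] := ip'; have /integrableP[mq fq] := iq'.
apply: (@le_lt_trans _ _ (\int[mu]_x \int[mu]_y (`|(p \_ A) x|%:E * `|(q \_ B) y|%:E))%E).
  apply: ge0_le_integral => //.
  - by move=> x _; apply: integral_ge0.
  - apply: (measurable_fun_fubini_tonelli_F (m2 := mu) (abse \o (EFin \o (K \_ (A `*` B))))) => [|x].
      exact: measurableT_comp.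
    exact: abse_ge0.
  - apply: (measurable_fun_fubini_tonelli_F (m2 := mu) (fun z => (`|(p \_ A) z.1|%:E * `|(q \_ B) z.2|%:E)%E)) => [|x]; last by rewrite mule_ge0.
    + apply: emeasurable_funM.
        apply/measurable_EFinP; apply: measurableT_comp => //.
        apply: measurableT_comp; [exact/measurable_EFinP|exact: measurable_fst].
      apply/measurable_EFinP; apply: measurableT_comp => //.
      apply: measurableT_comp; [exact/measurable_EFinP|exact: measurable_snd].
  - move=> x _; apply: ge0_le_integral => //=.
    + by have := measurableT_comp (measurableT_comp (@abse_measurable R setT) mK') (pair1_measurable x); exact.
    + apply/measurable_EFinP; apply: measurable_funM => //.
      by apply: measurableT_comp => //; exact/measurable_EFinP.
    + move=> y _; rewrite lee_fin !patchE in_setX /=.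
      have [xA|] := boolP (x \in A); have [yB|] := boolP (y \in B); rewrite /= ?normr0 ?mulr0 ?mul0r//.
      by apply: Kpq; exact/set_mem.
have hq : (\int[mu]_y `|(q \_ B) y|%:E < +oo)%E by [].
have hp : (\int[mu]_y `|(p \_ A) y|%:E < +oo)%E by [].
under eq_integral => x _.
  rewrite ge0_integralZl//; last first.
    by apply/measurable_EFinP; apply: measurableT_comp => //; exact/measurable_EFinP.
  over.
rewrite ge0_integralZr//.
- by apply: lte_mul_pinfty => //; [exact: integral_ge0|rewrite ge0_fin_numE//; exact: integral_ge0].
- by apply/measurable_EFinP; apply: measurableT_comp => //; exact/measurable_EFinP.
- exact: integral_ge0.
Qed.

End FubiniRectangle.

Section IntegrationByParts.
Context {R : realType}.
Notation mu := (@lebesgue_measure R).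
Notation mu2 := (@lebesgue_measure R \x @lebesgue_measure R)%E.
Implicit Types (a b x y : R) (f g u v p q : R -> R).

Lemma measurable_fst_comp (A B : set R) p : measurable A -> measurable B ->
  measurable_fun A p -> measurable_fun (A `*` B) (fun z => p z.1).
Proof.
move=> mA mB mp; apply: (measurable_comp mA _ mp).
  by move=> x [z [Az _] <-].
exact: measurable_funTS.
Qed.

Lemma measurable_snd_comp (A B : set R) p : measurable A -> measurable B ->
  measurable_fun B p -> measurable_fun (A `*` B) (fun z => p z.2).
Proof.
move=> mA mB mp; apply: (measurable_comp mB _ mp).
  by move=> x [z [_ Bz] <-].
exact: measurable_funTS.
Qed.

Lemma Rintegral_cut_le q a b x : a <= x -> x <= b -> mu.-integrable `[a, b] (EFin \o q) ->
  \int[mu]_(y in `[a, b]) (if y <= x then q y else 0) = \int[mu]_(y in `[a, x]) q y.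
Proof.
move=> ax xb iq; rewrite [RHS]Rintegral_mkcond [LHS]Rintegral_mkcond.
apply: eq_Rintegral => y _; rewrite !patchE !mem_setE !in_itv/=.
case: (leP y x) => yx; last by rewrite andbF; case: ifP.
by rewrite (le_trans yx xb).
Qed.

Lemma Rintegral_cut_ge q a b x : a <= x -> x <= b -> mu.-integrable `[a, b] (EFin \o q) ->
  \int[mu]_(y in `[a, b]) (if x <= y then q y else 0) = \int[mu]_(y in `[x, b]) q y.
Proof.
move=> ax xb iq; rewrite [RHS]Rintegral_mkcond [LHS]Rintegral_mkcond.
apply: eq_Rintegral => y _; rewrite !patchE !mem_setE !in_itv/=.
case: (leP x y) => yx; last by case: ifP.
by rewrite (le_trans ax yx).
Qed.

Lemma L2_cst_segment a b (k : R) : L2 mu `[a, b] (fun=> k).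
Proof. by apply: L2_cst => //; exact: mu_segment_lty. Qed.

(** Fubini on a triangle; this is what makes integration by parts available
    for primitives of functions that are merely square integrable. *)
Lemma prim_fubini a b p q : L2 mu `[a, b] p -> L2 mu `[a, b] q ->
  \int[mu]_(x in `[a, b]) (p x * \int[mu]_(y in `[a, x]) q y) =
  \int[mu]_(y in `[a, b]) ((\int[mu]_(x in `[y, b]) p x) * q y).
Proof.
move=> Lp Lq.
have ip := L2_int Lp; have iq := L2_int Lq.
pose K (z : R * R) := if z.2 <= z.1 then p z.1 * q z.2 else 0.
have mcc : measurable (`[a, b]%classic : set (measurableTypeR R)) by [].
have iK : mu2.-integrable (`[a, b] `*` `[a, b]) (EFin \o K).
  apply: (@integrable_rect_dominated R _ _ K p q) => //.
    apply: measurable_fun_if => //; first exact: measurableX.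
    - apply: (measurable_funS (E := setT)) => //.
      exact: measurable_fun_ler.
    - apply: (measurable_funS (E := `[a, b] `*` `[a, b])) => //.
        exact: measurableX.
      by apply: measurable_funM; [apply: measurable_fst_comp => //; case: Lp|apply: measurable_snd_comp => //; case: Lq].
  move=> x y _ _; rewrite /K /=; case: ifP; rewrite ?normrM// normr0 => _.
  by rewrite mulr_ge0.
have e1 := fubini_rect12 mcc mcc iK; have e2 := fubini_rect21 mcc mcc iK.
transitivity (\int[mu]_(x in `[a, b]) \int[mu]_(y in `[a, b]) K (x, y)).
  apply: eq_Rintegral => x; rewrite inE/= in_itv/= => /andP[ax xb].
  rewrite -(Rintegral_cut_le ax xb iq) -RintegralZl//; last first.
    have mif : measurable_fun `[a, b] (fun y => if y <= x then q y else 0).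
      apply: measurable_fun_if => //.
        by apply: measurable_fun_ler => //; exact: measurable_cst.
      by apply: measurable_funS (Lq.1) => //.
    apply: le_integrable iq => //; first exact/measurable_EFinP.
    by move=> y _ /=; case: ifP => // _; rewrite normr0 lee_fin.
  by apply: eq_Rintegral => y _; rewrite /K /=; case: ifP => // _; rewrite mulr0.
rewrite -e1 e2.
apply: eq_Rintegral => y; rewrite inE/= in_itv/= => /andP[ay yb].
rewrite -(Rintegral_cut_ge ay yb ip) -RintegralZr//; last first.
  have mif : measurable_fun `[a, b] (fun x => if y <= x then p x else 0).
    apply: measurable_fun_if => //.
      by apply: measurable_fun_ler => //; exact: measurable_cst.
    by apply: measurable_funS (Lp.1) => //.
  apply: le_integrable ip => //; first exact/measurable_EFinP.
  by move=> x _ /=; case: ifP => // _; rewrite normr0 lee_fin.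
by apply: eq_Rintegral => x _; rewrite /K /=; case: ifP => // _; rewrite mul0r.
Qed.

Lemma prim_by_parts a b u p v q : a <= b -> prim a b u p -> prim a b v q ->
  \int[mu]_(x in `[a, b]) (p x * v x + u x * q x) = u b * v b - u a * v a.
Proof.
move=> ab hu hv; have [Lp up] := hu; have [Lq vq] := hv.
have ip := L2_int Lp; have iq := L2_int Lq.
have mcc : measurable (`[a, b]%classic : set (measurableTypeR R)) by [].
pose P x := \int[mu]_(t in `[a, x]) p t; pose Q x := \int[mu]_(t in `[a, x]) q t.
have hP : prim a b P p.
  by split=> // x xab; rewrite /P integral_point add0r.
have hQ : prim a b Q q.
  by split=> // x xab; rewrite /Q integral_point add0r.
have LP := prim_L2 hP; have LQ := prim_L2 hQ.
have ipQ := L2M mcc Lp LQ; have iPq := L2M mcc LP Lq.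
have main : \int[mu]_(x in `[a, b]) (p x * Q x) + \int[mu]_(x in `[a, b]) (P x * q x) = P b * Q b.
  rewrite prim_fubini//.
  have Lb : L2 mu `[a, b] (fun y => P b - P y).
    apply: L2_subr; [by []|exact: L2_cst_segment|exact: LP].
  have -> : \int[mu]_(y in `[a, b]) ((\int[mu]_(x in `[y, b]) p x) * q y) =
            \int[mu]_(y in `[a, b]) ((P b - P y) * q y).
    apply: eq_Rintegral => y; rewrite inE/= in_itv/= => /andP[ay yb].
    by rewrite (prim_diff hP).
  rewrite -RintegralD//; last exact: L2M.
  rewrite -RintegralZl//; apply: eq_Rintegral => y _; ring.
have -> : \int[mu]_(x in `[a, b]) (p x * v x + u x * q x) =
  \int[mu]_(x in `[a, b]) ((p x * Q x + P x * q x) + (v a * p x + u a * q x)).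
  apply: eq_Rintegral => x; rewrite inE/= in_itv/= => xab.
  by rewrite up// vq// /P /Q; ring.
rewrite RintegralD//; last 2 first.
- exact: (integrableD _ ipQ iPq).
- exact: (integrableD _ (integrableZl _ (v a) ip) (integrableZl _ (u a) iq)).
rewrite RintegralD// main RintegralD//; last 2 first.
- exact: (integrableZl _ (v a) ip).
- exact: (integrableZl _ (u a) iq).
rewrite !RintegralZl// (up b) ?ab ?lexx// (vq b) ?ab ?lexx//.
by rewrite /P /Q; ring.
Qed.

Lemma prim_bounded_L2 a b u p g : prim a b u p -> L2 mu `[a, b] g ->
  L2 mu `[a, b] (fun x => u x * g x).
Proof.
move=> hu Lg; have [M _ uM] := prim_bounded hu.
apply: (L2_mulr_bounded (M := M)) => //; first by case: (prim_L2 hu).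
Qed.

Lemma prim_mulr a b u p v q : prim a b u p -> prim a b v q ->
  prim a b (fun x => u x * v x) (fun x => p x * v x + u x * q x).
Proof.
move=> hu hv; split.
  apply: L2_addr => //; last exact: (prim_bounded_L2 hu hv.1).
  have := prim_bounded_L2 hv hu.1; congr (L2 _ _ _).
  by apply/funext => x; rewrite mulrC.
move=> x /andP[ax xb]; rewrite prim_by_parts//; first ring.
- exact: prim_sub hu.
- exact: prim_sub hv.
Qed.

End IntegrationByParts.

(** * Change of variables and polar coordinates *)

Section Density.
Local Open Scope ereal_scope.
Context {d} {T : measurableType d} {R : realType}.
Variables (m : {measure set T -> \bar R}) (g : T -> \bar R).
Hypotheses (mg : measurable_fun setT g) (g0 : forall x, 0 <= g x).

(** The hypotheses are arguments so that the measure structure can be inferred. *)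
Definition density of measurable_fun setT g & (forall x, 0 <= g x) :=
  fun A : set T => \int[m]_(x in A) g x.

Let dens := density mg g0.

Let dens0 : dens set0 = 0. Proof. exact: integral_set0. Qed.

Let dens_ge0 A : 0 <= dens A.
Proof. by apply: integral_ge0. Qed.

Let dens_sigma_additive : semi_sigma_additive dens.
Proof.
move=> /= F mF tF mUF; rewrite /dens /density; apply: cvg_toP.
  apply: ereal_nondecreasing_is_cvgn => k n kn.
  by apply: lee_sum_nneg_natr => // i _ _; exact: integral_ge0.
by rewrite ge0_integral_bigcup//=; exact: measurable_funTS.
Qed.

HB.instance Definition _ := isMeasure.Build _ _ _ dens
  dens0 dens_ge0 dens_sigma_additive.

Import HBNNSimple.

Let integral_density_nnsfun (f : {nnsfun T >-> R}) :
  \int[dens]_x (f x)%:E = \int[m]_x ((f x)%:E * g x).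
Proof.
under [LHS]eq_integral do rewrite fimfunE -fsumEFin//.
rewrite [LHS]ge0_integral_fsum//; last 2 first.
  - by move=> r; exact/measurable_EFinP/measurableT_comp.
  - by move=> n x _; rewrite EFinM nnfun_muleindic_ge0.
under [RHS]eq_integral.
  move=> x xD; rewrite fimfunE -fsumEFin// muleC ge0_mule_fsumr; last first.
    by move=> r; rewrite EFinM nnfun_muleindic_ge0.
  over.
rewrite [RHS]ge0_integral_fsum//; last 2 first.
  - by move=> r; apply: emeasurable_funM => //; exact/measurable_EFinP/measurableT_comp.
  - by move=> n x _; rewrite mule_ge0// nnfun_muleindic_ge0.
apply: eq_fsbigr => r _.
rewrite integralZl_indic_nnsfun//= integral_indic//= setIT.
have [r0|r0] := leP 0%R r; last first.
  have f0 : f @^-1` [set r] = set0 by rewrite preimage_nnfun0.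
  rewrite f0 measure0 mule0 integral0_eq// => x _.
  by rewrite indic0 /= mulr0 mule0.
under [RHS]eq_integral do rewrite EFinM muleCA.
rewrite ge0_integralZl//; last 2 first.
  - by apply: emeasurable_funM => //; exact/measurable_EFinP.
  - by move=> x _; rewrite mule_ge0// lee_fin.
by rewrite /dens /density integral_mkcond epatch_indic.
Qed.

Lemma integral_density (f : T -> \bar R) : (forall x, g x \is a fin_num) ->
  measurable_fun setT f ->
  (forall x, 0 <= f x) -> \int[dens]_x f x = \int[m]_x (f x * g x).
Proof.
move=> gfin mf f0.
pose f_ := nnsfun_approx measurableT mf.
have f_f x : (f_ n x)%:E @[n --> \oo] --> f x by exact: cvg_nnsfun_approx.
have nd_f x : {homo (fun n => (f_ n x)%:E) : i j / (i <= j)%N >-> i <= j}.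
  by move=> i j ij; rewrite lee_fin; exact/lefP/nd_nnsfun_approx.
transitivity (lim (\int[dens]_x (f_ n x)%:E @[n --> \oo])).
  rewrite -monotone_convergence//=.
  - by apply: eq_integral => x _; apply/esym/cvg_lim.
  - by move=> n; exact/measurable_EFinP/measurable_funTS.
  - by move=> n x _; rewrite lee_fin.
rewrite [RHS](_ : _ = lim (\int[m]_x ((f_ n x)%:E * g x) @[n --> \oo])).
  by apply: congr_lim; apply/funext => n; exact: integral_density_nnsfun.
rewrite -monotone_convergence//=.
- apply: eq_integral => x _; apply/esym/cvg_lim => //.
  by apply: cvgeZr.
- by move=> n; apply: emeasurable_funM => //; exact/measurable_EFinP/measurable_funTS.
- by move=> n x _; rewrite mule_ge0// lee_fin.
- by move=> x _ i j ij; rewrite lee_wpmul2r//; exact: nd_f.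
Qed.

End Density.

Section ChangeOfVariables.
Local Open Scope ereal_scope.
Context {R : realType}.
Notation mu := (@lebesgue_measure R).

(** The image of the measure with density [rho] under [psi] agrees with
    Lebesgue measure on half-open intervals, hence everywhere. *)
Lemma change_of_variables (D : set (measurableTypeR R))
    (psi : R -> R) (rho : R -> R) (F : R -> \bar R) :
  measurable D -> measurable_fun D psi -> measurable_fun D rho ->
  (forall x, D x -> 0 <= rho x)%R ->
  (forall u v : R, (u < v)%R ->
    \int[mu]_(x in D `&` psi @^-1` `]u, v]) (rho x)%:E = (v - u)%:E) ->
  measurable_fun setT F -> (forall y, 0 <= F y) ->
  \int[mu]_y F y = \int[mu]_(x in D) (F (psi x) * (rho x)%:E).
Proof.
move=> mD mpsi mrho rho0 H mF F0.
pose psi' : measurableTypeR R -> measurableTypeR R := (psi \_ D)%R.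
pose g := (EFin \o (rho \_ D))%R.
have mpsi' : measurable_fun setT psi' by apply/(measurable_restrictT _ _).1.
have mg : measurable_fun [set: measurableTypeR R] g.
  by apply/measurable_EFinP; apply/(measurable_restrictT _ _).1.
have g0 x : 0 <= g x.
  by rewrite /g /= patchE lee_fin; case: ifPn => // /set_mem; exact: rho0.
pose nu := pushforward (density mu mg g0) psi'.
have E A : measurable A -> mu A = nu A.
  pose mpsi'' : {mfun measurableTypeR R >-> measurableTypeR R} :=
    HB.pack psi' (isMeasurableFun.Build _ _ _ _ psi' mpsi').
  apply: (@lebesgue_measure_unique R (pushforward (density mu mg g0) mpsi'')).
  move=> _ [[u v] _ <-]; rewrite /=.
  case: (ltP u v) => uv; last first.
    by rewrite set_itv_ge ?measure0// bnd_simp -leNgt.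
  rewrite lebesgue_measure_itv/= lte_fin uv -EFinD -H//.
  rewrite /pushforward /density /g [LHS]integral_mkcond [RHS]integral_mkcond.
  apply: eq_integral => x _; rewrite !patchE in_setI /psi' /= patchE.
  have [xD|xD] := boolP (x \in D); rewrite ?xD/=; last by case: ifP.
  have -> : (x \in psi @^-1` `]u, v]) = (x \in psi' @^-1` `]u, v]).
    by apply/idP/idP; rewrite !inE/= /psi' patchE xD.
  by case: ifP => //; rewrite /= patchE xD.
rewrite (eq_measure_integral nu); last by move=> A mA _; exact: E.
rewrite ge0_integral_pushforward//=.
rewrite preimage_setT integral_density//; last exact: measurableT_comp.
rewrite [RHS]integral_mkcond; apply: eq_integral => x _.
rewrite /g /psi' /= !patchE; case: ifPn => // _.
by rewrite mule0.
Qed.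

End ChangeOfVariables.

Section SignedSubstitution.
Local Open Scope ereal_scope.
Context {d1 d2} {T1 : measurableType d1} {T2 : measurableType d2} {R : realType}.

(** A substitution formula for nonnegative functions extends to all measurable
    ones, because both sides are defined from positive and negative parts. *)
Lemma signed_substitution (m1 : {measure set T1 -> \bar R})
    (m2 : {measure set T2 -> \bar R}) (D1 : set T1) (D2 : set T2)
    (P : T1 -> T2) (J : T1 -> R) :
  measurable D2 -> (forall x, D1 x -> D2 (P x)) -> (forall x, D1 x -> 0 <= J x)%R ->
  (forall F : T2 -> \bar R, measurable_fun setT F -> (forall y, 0 <= F y) ->
    \int[m2]_(y in D2) F y = \int[m1]_(x in D1) (F (P x) * (J x)%:E)) ->
  forall F : T2 -> \bar R, measurable_fun D2 F ->
    \int[m2]_(y in D2) F y = \int[m1]_(x in D1) (F (P x) * (J x)%:E).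
Proof.
move=> mD2 PD J0 H.
have H' (F : T2 -> \bar R) : measurable_fun D2 F -> (forall y, 0 <= F y) ->
    \int[m2]_(y in D2) F y = \int[m1]_(x in D1) (F (P x) * (J x)%:E).
  move=> mF F0; have := H (F \_ D2); rewrite -integral_mkcondr setIid => ->.
  - apply: eq_integral => x /set_mem D1x.
    by rewrite patchE mem_set//; exact: PD.
  - exact/(measurable_restrictT _ _).1.
  - by move=> y; apply: erestrict_ge0 => *; exact: F0.
move=> F mF; rewrite integralE (H' F^\+) ?(H' F^\-)//.
- rewrite [RHS]integralE; congr (_ - _); apply: eq_integral => x /set_mem D1x.
  + by rewrite !funeposE maxe_pMl ?mul0e// lee_fin; exact: J0.
  + by rewrite !funenegE maxe_pMl ?mul0e ?mulNe// lee_fin; exact: J0.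
- exact: measurable_funeneg.
- exact: measurable_funepos.
Qed.

End SignedSubstitution.

Section LineSubstitutions.
Context {R : realType}.
Notation mu := (@lebesgue_measure R).
Notation mu2 := (@lebesgue_measure R \x @lebesgue_measure R)%E.

Lemma measurable_invr : measurable_fun [set: R] (fun x => x^-1).
Proof.
have -> : [set: R] = [set x | x != 0] `|` [set 0].
  apply/seteqP; split=> x // _ /=.
  by have [->|] := eqVneq x 0; [right|left].
have o : open [set x : R | x != 0].
  have -> : [set x : R | x != 0] = ~` [set 0].
    by apply/seteqP; split=> x /= /eqP.
  by apply: closed_openC; exact: closed_eq.
apply/measurable_funU; [exact: open_measurable|exact: measurable_set1|].
split; last exact: measurable_fun_set1.
apply: open_continuous_measurable_fun => // x; rewrite inE/= => x0.
exact: inv_continuous.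
Qed.

Lemma measurable_tan : measurable_fun [set: R] tan.
Proof.
rewrite /tan; apply: measurable_funM.
  by apply: continuous_measurable_fun; exact: continuous_sin.
apply: (measurableT_comp measurable_invr).
by apply: continuous_measurable_fun; exact: continuous_cos.
Qed.

Lemma change_affine (k c : R) (F : R -> \bar R) : 0 < k ->
  measurable_fun setT F -> (forall y, 0 <= F y)%E ->
  (\int[mu]_y F y = \int[mu]_x (F (k * x + c)%R * k%:E))%E.
Proof.
move=> k0 mF F0; apply: (change_of_variables (rho := cst k)) => //.
- exact: measurable_funD.
- by move=> x _; exact: ltW.
- move=> u v uv; rewrite setTI.
  have -> : (fun x => k * x + c) @^-1` `]u, v] = `](u - c) / k, (v - c) / k]%classic.
    apply/seteqP; split=> x /=; rewrite !in_itv/= ltr_pdivrMr// ler_pdivlMr//;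
    move=> /andP[h1 h2]; apply/andP; split; lra.
  rewrite (eq_integral (cst k%:E))// integral_cst//= lebesgue_measure_itv/= lte_fin ltr_pM2r ?invr_gt0//.
  rewrite ltrD2r uv -EFinD -EFinM; congr EFin.
  by field; rewrite gt_eqF.
Qed.

Lemma change_reflection (c : R) (F : R -> \bar R) :
  measurable_fun setT F -> (forall y, 0 <= F y)%E ->
  (\int[mu]_y F y = \int[mu]_x F (c - x)%R)%E.
Proof.
move=> mF F0; rewrite (@change_of_variables _ setT (fun x => c - x) (cst 1))//.
- by apply: eq_integral => x _; rewrite mule1.
- exact: measurable_funB.
- move=> u v uv; rewrite setTI.
  have -> : (fun x => c - x) @^-1` `]u, v] = `[c - v, c - u[%classic.
    by apply/seteqP; split=> x /=; rewrite !in_itv/= => /andP[h1 h2]; apply/andP; split; lra.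
  rewrite (eq_integral (cst 1%:E))// integral_cst//= lebesgue_measure_itv/= lte_fin ltrD2l ltrN2 uv.
  by rewrite mul1e -EFinD; congr EFin; lra.
Qed.

(** The substitution y = x tan t turns the lines through the origin into
    coordinate lines, which reduces polar coordinates to Tonelli's theorem and
    substitutions in one variable. *)
Lemma change_tan (x : R) (F : R -> \bar R) : 0 < x ->
  measurable_fun setT F -> (forall y, 0 <= F y)%E ->
  (\int[mu]_y F y =
   \int[mu]_(t in `](- (pi / 2))%R, (pi / 2)%R[) (F (x * tan t)%R * (x * (cos t)^-2)%R%:E))%E.
Proof.
move=> x0 mF F0; apply: change_of_variables => //.
- by apply: measurable_funTS; apply: measurable_funM => //; exact: measurable_tan.
- apply: measurable_funTS; apply: measurable_funM => //.
  apply: (measurableT_comp measurable_invr).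
  by apply: measurable_funX; apply: continuous_measurable_fun; exact: continuous_cos.
- by move=> t _; rewrite mulr_ge0 ?(ltW x0)// invr_ge0 sqr_ge0.
- move=> u v uv.
  have -> : `](- (pi / 2)), (pi / 2)[ `&` (fun t => x * tan t) @^-1` `]u, v] =
            `]atan (u / x), atan (v / x)]%classic.
    apply/seteqP; split => t /=.
      rewrite !in_itv/= => -[tpi /andP[h1 h2]].
      have e : t = atan (tan t) by rewrite tanK// in_itv.
      apply/andP; split; rewrite e.
        by apply: lt_atan; rewrite ltr_pdivrMr// mulrC.
      by apply: le_atan; rewrite ler_pdivlMr// mulrC.
    rewrite !in_itv/= => /andP[h1 h2].
    have tpi : - (pi / 2) < t < pi / 2.
      by rewrite (lt_trans (atan_gtNpi2 _) h1) (le_lt_trans h2 (atan_ltpi2 _)).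
    split=> //; apply/andP; split.
      rewrite mulrC -ltr_pdivrMr// -(atanK (u / x)) ltr_tan ?in_itv//=.
      by rewrite atan_gtNpi2 atan_ltpi2.
    rewrite mulrC -ler_pdivlMr// -(atanK (v / x)) leNgt ltr_tan ?in_itv//= -?leNgt//.
    by rewrite atan_gtNpi2 atan_ltpi2.
  have cosn0 t : t \in `[atan (u / x), atan (v / x)] -> cos t != 0.
    rewrite in_itv/= => /andP[h1 h2]; rewrite gt_eqF// cos_gt0_pihalf//.
    by rewrite (lt_le_trans (atan_gtNpi2 _) h1) (le_lt_trans h2 (atan_ltpi2 _)).
  have auv : atan (u / x) < atan (v / x) by apply: lt_atan; rewrite ltr_pM2r ?invr_gt0.
  have dtan t : t \in `[atan (u / x), atan (v / x)] ->
      is_derive t 1 (fun t => x * tan t) (x * (cos t)^-2).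
    move=> tI; have := is_derive_tan (cosn0 _ tI) => ?.
    exact: is_deriveZ.
  have ccos : {within `[atan (u / x), atan (v / x)], continuous (fun t => x * (cos t)^-2)}.
    apply: continuous_in_subspaceT => t /set_mem tI.
    apply: cvgM; first exact: cvg_cst.
    apply: cvgV; first by rewrite expf_neq0// cosn0.
    apply: (@continuous_comp _ _ _ cos (fun y => y ^+ 2)); first exact: continuous_cos.
    exact: exprn_continuous.
  rewrite integral_itv_obnd_cbnd; last first.
    apply/measurable_EFinP; apply: measurable_funS (subspace_continuous_measurable_fun _ ccos) => //.
    exact: subset_itv_oc_cc.
  rewrite (@continuous_FTC2 _ _ (fun t => x * tan t) _ _ auv ccos).
  + rewrite !atanK -EFinB; congr EFin; field; exact: lt0r_neq0.
  + split.
    * move=> t tI; have /dtan[] // : t \in `[atan (u / x), atan (v / x)].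
      exact: subset_itv_oo_cc.
    * apply: cvg_at_right_filter; apply: cvgM; first exact: cvg_cst.
      by apply: continuous_tan; apply: cosn0; rewrite bound_itvE ltW.
    * apply: cvg_at_left_filter; apply: cvgM; first exact: cvg_cst.
      by apply: continuous_tan; apply: cosn0; rewrite bound_itvE ltW.
  + move=> t tI; rewrite derive1E.
    by have /dtan[] : t \in `[atan (u / x), atan (v / x)] by exact: subset_itv_oo_cc.
Qed.

End LineSubstitutions.

Section Polar.
Local Open Scope ereal_scope.
Context {R : realType}.
Notation mu := (@lebesgue_measure R).
Notation mu2 := (@lebesgue_measure R \x @lebesgue_measure R)%E.
Implicit Types (F : R * R -> \bar R) (H : R -> \bar R).

Definition polar (q : R * R) : R * R := (q.1 * cos q.2, q.1 * sin q.2)%R.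

Lemma measurable_polar : measurable_fun setT polar.
Proof.
have mc : measurable_fun [set: R] cos.
  by apply: continuous_measurable_fun; exact: continuous_cos.
have ms : measurable_fun [set: R] sin.
  by apply: continuous_measurable_fun; exact: continuous_sin.
by apply: measurable_fun_pair; apply: measurable_funM => //; exact: measurableT_comp.
Qed.

(** Integral of [F] along the ray of angle [t] against the polar weight. *)
Definition ray_integral F (t : R) : \bar R :=
  \int[mu]_r (if (0 < r)%R then F (polar (r, t)) * r%:E else 0).

Let mray F : measurable_fun setT F -> measurable_fun [set: R * R]
  (fun q : R * R => if (0 < q.1)%R then F (polar q) * q.1%:E else 0).
Proof.
move=> mF; apply: measurable_fun_ifT => //.
  by apply: measurable_fun_ltr => //; exact: measurable_cst.
apply: emeasurable_funM; last by apply/measurable_EFinP.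
exact: (measurableT_comp mF measurable_polar).
Qed.

Let ray0 F : (forall z, 0 <= F z) -> forall q : R * R,
  0 <= (if (0 < q.1)%R then F (polar q) * q.1%:E else 0).
Proof. by move=> F0 q; case: ifP => // q0; rewrite mule_ge0// lee_fin ltW. Qed.

Lemma ray_integral_ge0 F t : (forall z, 0 <= F z) -> 0 <= ray_integral F t.
Proof. by move=> F0; apply: integral_ge0 => r _; exact: (ray0 F0 (r, t)). Qed.

Lemma measurable_ray_integral F : measurable_fun setT F -> (forall z, 0 <= F z) ->
  measurable_fun setT (ray_integral F).
Proof.
move=> mF F0.
exact: (measurable_fun_fubini_tonelli_G (m1 := mu) _ (mray mF) (ray0 F0)).
Qed.

(** On the right half plane, Tonelli in Cartesian coordinates and the
    substitution y = x tan t in the inner integral, followed by Tonelli again,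
    lead to the rays. *)
Lemma polar_right F : measurable_fun setT F -> (forall z, 0 <= F z) ->
  \int[mu2]_z (if (0 < z.1)%R then F z else 0) =
  \int[mu]_(t in `](- (pi / 2))%R, (pi / 2)%R[) ray_integral F t.
Proof.
move=> mF F0; set D := `]_, _[%classic.
have mif : measurable_fun [set: R * R] (fun z => if (0 < z.1)%R then F z else 0).
  by apply: measurable_fun_ifT => //; apply: measurable_fun_ltr => //; exact: measurable_cst.
rewrite fubini_tonelli1; [|exact: mif|by move=> z; case: ifP].
rewrite /fubini_F /=.
pose G (z : R * R) := if ((0 < z.1)%R && ((- (pi / 2) < z.2) && (z.2 < pi / 2))%R) then
   F (z.1, z.1 * tan z.2)%R * (z.1 * (cos z.2)^-2)%R%:E else 0.
have mG : measurable_fun [set: R * R] G.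
  apply: measurable_fun_ifT => //.
    by apply: measurable_and; [|apply: measurable_and]; apply: measurable_fun_ltr => //;
      exact: measurable_cst.
  apply: emeasurable_funM.
    apply: (measurableT_comp mF); apply: measurable_fun_pair => //.
    apply: measurable_funM => //.
    exact: (measurableT_comp measurable_tan).
  apply/measurable_EFinP; apply: measurable_funM => //.
  apply: (measurableT_comp measurable_invr); apply: measurable_funX.
  apply: (measurableT_comp (f := cos)) => //.
  by apply: continuous_measurable_fun; exact: continuous_cos.
have G0 z : 0 <= G z.
  rewrite /G; case: ifP => // /andP[z0 _]; rewrite mule_ge0// lee_fin mulr_ge0 ?(ltW z0)//.
  by rewrite invr_ge0 sqr_ge0.
transitivity (\int[mu]_x \int[mu]_t G (x, t)).
  apply: eq_integral => x _; rewrite /G /=.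
  have [x0|x0] := ltP 0%R x; last by rewrite integral0.
  rewrite (change_tan x0)//; last exact: measurableT_comp.
  rewrite integral_mkcond; apply: eq_integral => t _.
  by rewrite patchE mem_setE in_itv/=.
rewrite fubini_tonelli; [|exact: mG|exact: G0].
rewrite [RHS]integral_mkcond; apply: eq_integral => t _; rewrite patchE /G /= mem_setE in_itv/=.
case: ifPn => [tD|tD]; last first.
  by under eq_integral do rewrite andbF; rewrite integral0.
have ct : (0 < cos t)%R by apply: cos_gt0_pihalf.
rewrite (@change_affine R (cos t) 0%R)//; last 2 first.
- by have := measurableT_comp mG (pair2_measurable t); rewrite /G /comp/= tD.
- by move=> y; have := G0 (y, t); rewrite /G /= tD.
apply: eq_integral => r _; rewrite addr0 andbT pmulr_rgt0//.
case: ifP => // r0; last by rewrite mul0e.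
rewrite -muleA -EFinM /polar /=; congr (F (_, _) * _%:E).
- by rewrite mulrC.
- by rewrite /tan; field; rewrite gt_eqF.
- by field; rewrite gt_eqF.
Qed.

Lemma polar_left F : measurable_fun setT F -> (forall z, 0 <= F z) ->
  \int[mu2]_z (if (z.1 < 0)%R then F z else 0) =
  \int[mu]_(t in `](pi / 2)%R, (3 * (pi / 2))%R[) ray_integral F t.
Proof.
move=> mF F0.
pose F' (z : R * R) := F (- z.1, z.2)%R.
have mF' : measurable_fun setT F'.
  by apply: (measurableT_comp mF); apply: measurable_fun_pair => //; exact: measurableT_comp.
have mif : measurable_fun [set: R * R] (fun z => if (z.1 < 0)%R then F z else 0).
  by apply: measurable_fun_ifT => //; apply: measurable_fun_ltr => //; exact: measurable_cst.
have mif' : measurable_fun [set: R * R] (fun z => if (0 < z.1)%R then F' z else 0).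
  by apply: measurable_fun_ifT => //; apply: measurable_fun_ltr => //; exact: measurable_cst.
have mr := measurable_ray_integral mF' (fun z => F0 _).
transitivity (\int[mu2]_z (if (0 < z.1)%R then F' z else 0)).
  rewrite fubini_tonelli2; [|exact: mif|by move=> z; case: ifP].
  rewrite fubini_tonelli2; [|exact: mif'|by move=> z; case: ifP => // _; exact: F0].
  apply: eq_integral => y _; rewrite /fubini_G /=.
  rewrite (change_reflection 0%R).
  + by apply: eq_integral => x _; rewrite sub0r oppr_lt0.
  + exact: (measurableT_comp mif (pair2_measurable y)).
  + by move=> x; case: ifP.
rewrite polar_right; [|exact: mF'|by move=> z; exact: F0].
rewrite integral_mkcond (change_reflection pi); last 2 first.
- exact/(measurable_restrictT _ _).1/measurable_funTS.
- by move=> t; apply: erestrict_ge0 => s _; apply: ray_integral_ge0 => z; exact: F0.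
rewrite [RHS]integral_mkcond; apply: eq_integral => t _; rewrite !patchE.
have -> : ((pi - t)%R \in `](- (pi / 2))%R, (pi / 2)%R[%classic) =
          (t \in `](pi / 2)%R, (3 * (pi / 2))%R[%classic).
  by apply/idP/idP; rewrite !inE/= !in_itv/= => /andP[h1 h2]; apply/andP; split; lra.
case: ifP => // _; apply: eq_integral => r _; case: ifP => // _.
rewrite /F' /polar /=; congr (F (_, _) * _).
- by rewrite cosB cospi sinpi; ring.
- by rewrite sinB cospi sinpi; ring.
Qed.

Lemma integral_shift (a b T : R) H : measurable_fun setT H -> (forall t, 0 <= H t) ->
  (forall t, H (t + T)%R = H t) ->
  \int[mu]_(t in `[a, b[) H t = \int[mu]_(t in `[(a + T)%R, (b + T)%R[) H t.
Proof.
move=> mH H0 HT; rewrite [RHS]integral_mkcond (@change_affine R 1%R T)//.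
- rewrite [LHS]integral_mkcond; apply: eq_integral => t _.
  rewrite !patchE mul1r HT mule1.
  have -> // : (t \in `[a, b[%classic) = ((t + T)%R \in `[(a + T)%R, (b + T)%R[%classic).
  by rewrite !mem_setE !in_itv/= lerD2r ltrD2r.
- exact/(measurable_restrictT _ _).1/measurable_funTS.
- by move=> t; apply: erestrict_ge0.
Qed.

Lemma itv_setU_co (a b c : R) : (a <= b)%R -> (b <= c)%R ->
  `[a, c[%classic = `[a, b[ `|` `[b, c[.
Proof. by move=> ab bc; rewrite -itv_bndbnd_setU// bnd_simp. Qed.

Lemma ge0_integral_co (a b c : R) H : (a <= b)%R -> (b <= c)%R ->
  measurable_fun setT H -> (forall t, 0 <= H t) ->
  \int[mu]_(t in `[a, c[) H t = \int[mu]_(t in `[a, b[) H t + \int[mu]_(t in `[b, c[) H t.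
Proof.
move=> ab bc mH H0; rewrite (itv_setU_co ab bc) ge0_integral_setU//=.
- exact: measurable_funTS.
- apply/disj_setPS => y [/=]; rewrite 2!in_itv/= => /andP[_ yx] /andP[].
  by rewrite leNgt yx.
Qed.

Lemma integral_period (a b T : R) H : (0 < T)%R -> measurable_fun setT H ->
  (forall t, 0 <= H t) -> (forall t, H (t + T)%R = H t) ->
  \int[mu]_(t in `[a, (a + T)%R[) H t = \int[mu]_(t in `[b, (b + T)%R[) H t.
Proof.
move=> T0 mH H0 HT.
pose I (x : R) := \int[mu]_(t in `[x, (x + T)%R[) H t.
have step x y : (x <= y)%R -> (y <= x + T)%R -> I x = I y.
  move=> xy yxT; rewrite /I (@ge0_integral_co x y)// (@ge0_integral_co y (x + T)%R (y + T)%R)//; last first.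
    by rewrite lerD2r.
  by rewrite -(@integral_shift x y T)// addeC.
have steps n : forall x y, (x <= y)%R -> (y <= x + n%:R * T)%R -> I x = I y.
  elim: n => [|n IH] x y xy yx.
    by have -> : x = y by lra.
  have [h|h] := leP y (x + T)%R; first exact: step.
  rewrite (step x (x + T)%R) ?lexx//; last lra.
  apply: IH; first exact: ltW.
  by move: yx; rewrite -natr1; lra.
wlog ab : a b / (a <= b)%R.
  by move=> W; have [|/ltW] := leP a b; [exact: W|move=> h; rewrite (W b a h)].
apply: (steps (Num.bound ((b - a) / T)%R)) => //.
have := archi_boundP (x := ((b - a) / T)%R).
rewrite divr_ge0 ?subr_ge0 ?(ltW T0)// => /(_ isT).
by rewrite ltr_pdivrMr//; lra.
Qed.

End Polar.

Section TwistedPolar.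
Context {R : realType}.
Notation mu := (@lebesgue_measure R).
Notation mu2 := (@lebesgue_measure R \x @lebesgue_measure R)%E.
Notation plane := (R * R)%type.

Lemma polar_ge0 (a : R) (F : plane -> \bar R) : measurable_fun setT F ->
  (forall z, 0 <= F z)%E ->
  (\int[mu2]_z F z = \int[mu]_(t in `[a, (a + 2 * pi)%R[) ray_integral F t)%E.
Proof.
move=> mF F0.
have mr := measurable_ray_integral mF F0; have r0 t := ray_integral_ge0 t F0.
have pi0 := pi_gt0 R.
have m0 : measurable_fun [set: plane] (fun z : plane => (0 < z.1)).
  by apply: measurable_fun_ltr => //; exact: measurable_cst.
have m1 : measurable_fun [set: plane] (fun z : plane => (z.1 < 0)).
  by apply: measurable_fun_ltr => //; exact: measurable_cst.
have mp : measurable_fun [set: plane] (fun z => if (0 < z.1)%R then F z else 0%E).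
  exact: measurable_fun_ifT.
have mn : measurable_fun [set: plane] (fun z => if (z.1 < 0)%R then F z else 0%E).
  exact: measurable_fun_ifT.
have mz : measurable_fun [set: plane] (fun z => if (z.1 == 0)%R then F z else 0%E).
  rewrite (_ : (fun _ => _) = (fun z => if (0 < z.1)%R then 0%E else if (z.1 < 0)%R then 0%E else F z)).
    by do 2 (apply: measurable_fun_ifT; [by []|exact: measurable_cst|]).
  by apply/funext => z; case: ltgtP.
have mpn : measurable_fun [set: plane] (fun z => (if (0 < z.1)%R then F z else 0%E) +
      (if (z.1 < 0)%R then F z else 0%E))%E by exact: emeasurable_funD.
transitivity (\int[mu2]_z (((if (0 < z.1)%R then F z else 0%E) +
   (if (z.1 < 0)%R then F z else 0%E)) + (if (z.1 == 0)%R then F z else 0%E)))%E.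
  by apply: eq_integral => z _; case: ltgtP => _; rewrite ?add0e ?adde0.
rewrite ge0_integralD; [|by []| |exact: mpn| |exact: mz]; last 2 first.
  by move=> z _; apply: adde_ge0; case: ifP.
  by move=> z _; case: ifP.
rewrite ge0_integralD; [|by []| |exact: mp| |exact: mn]; last 2 first.
  by move=> z _; case: ifP.
  by move=> z _; case: ifP.
rewrite polar_right// polar_left//.
have -> : (\int[mu2]_z (if (z.1 == 0)%R then F z else 0))%E = 0%E.
  rewrite fubini_tonelli1; [|exact: mz|by move=> z; case: ifP].
  rewrite /fubini_F /= -[RHS](integral_set1 (fun x => \int[mu]_y F (x, y))%E 0).
  rewrite [RHS]integral_mkcond; apply: eq_integral => x _.
  rewrite patchE; have -> : (x \in [set 0]) = (x == 0).
    by apply/idP/idP; rewrite inE/= => /eqP.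
  by case: ifP => // _; rewrite integral0.
rewrite adde0.
have per t : ray_integral F (t + 2 * pi) = ray_integral F t.
  apply: eq_integral => r _; rewrite /polar /=.
  by rewrite -(cosD2pi t) -(sinD2pi t) mulr_natl.
rewrite (@integral_period _ a (- (pi / 2)) _ (ray_integral F))//; last by rewrite mulr_gt0.
rewrite (@ge0_integral_co _ _ (pi / 2))//; [|lra|lra].
rewrite !integral_itv_obnd_cbnd; [|exact: measurable_funTS|exact: measurable_funTS].
by have -> : - (pi / 2) + 2 * pi = 3 * (pi / 2) :> R by lra.
Qed.

(** No differentiability of [psi] is used: an interval pulls back to an
    interval, over which [rho] integrates to the increment of [psi]. *)
Lemma increasing_substitution (psi rho : R -> R) (delta : R) (F : R -> \bar R) :
  0 < delta -> (forall x y, x <= y -> prim x y psi rho) ->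
  (forall x, delta <= rho x) -> measurable_fun setT rho ->
  measurable_fun setT F -> (forall y, 0 <= F y)%E ->
  (\int[mu]_y F y = \int[mu]_x (F (psi x) * (rho x)%:E))%E.
Proof.
move=> d0 hp rd mrho mF F0.
have mono x y : x <= y -> delta * (y - x) <= psi y - psi x.
  move=> xy; rewrite (prim_diff (hp x y xy))//.
  have := @le_Rintegral _ _ _ mu `[x, y] (fun=> delta) rho.
  rewrite Rintegral_cst//= mu_segment//=; apply => //.
  - by apply: L2_int; exact: L2_cst_segment.
  - by apply: L2_int; case: (hp x y xy).
have lt_psi x y : x < y -> psi x < psi y.
  by move=> xy; rewrite -subr_gt0; apply: lt_le_trans (mono _ _ (ltW xy)); rewrite mulr_gt0// subr_gt0.
have le_psi x y : (psi x <= psi y) = (x <= y).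
  have [xy|yx] := leP x y; last by rewrite leNgt lt_psi.
  by move: xy; rewrite le_eqVlt => /predU1P[->|/lt_psi/ltW//]; rewrite lexx.
have surj u : exists x, psi x = u.
  pose X := `|u - psi 0| / delta.
  have X0 : 0 <= X by rewrite divr_ge0// ltW.
  have hX : delta * X = `|u - psi 0| by rewrite /X mulrC divfK// gt_eqF.
  have h1 := mono _ _ X0; have h2 := mono (- X) 0.
  have {}h2 := h2 ltac:(lra).
  have NX : - X <= X by lra.
  have hn := ler_norm (u - psi 0); have hn' := lerNnormlW (lexx `|u - psi 0|).
  have [x _ <-] := IVT NX (prim_continuous (hp _ _ NX)) (v := u) ltac:(
    rewrite min_l ?le_psi// max_r ?le_psi//; apply/andP; split; lra).
  by exists x.
apply: (change_of_variables (rho := rho)) => //.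
- apply: continuous_measurable_fun => x.
  have := prim_continuous (hp (x - 1) (x + 1) ltac:(lra)).
  move=> /continuous_within_itvP => /(_ ltac:(lra))[+ _ _].
  by apply; rewrite in_itv/=; lra.
- by move=> x _; apply: le_trans (rd x); exact: ltW.
- move=> u v uv; rewrite setTI.
  have [x xu] := surj u; have [y yv] := surj v.
  have xy : x < y by rewrite ltNge -le_psi xu yv -ltNge.
  have -> : psi @^-1` `]u, v] = `]x, y]%classic.
    apply/seteqP; split=> t /=; rewrite !in_itv/= -xu -yv le_psi;
    by rewrite !ltNge le_psi.
  have irho := L2_int (hp x y (ltW xy)).1.
  rewrite integral_itv_obnd_cbnd; last by apply/measurable_EFinP; exact: measurable_funTS.
  rewrite -xu -yv (prim_diff (hp x y (ltW xy)))//; last exact: ltW.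
  rewrite /Rintegral fineK//; exact: integrable_fin_num.
Qed.

Lemma enorm_lt1 (z : plane) : (enorm z < 1) = (z.1 ^+ 2 + z.2 ^+ 2 < 1).
Proof.
rewrite /enorm; have s0 : 0 <= z.1 ^+ 2 + z.2 ^+ 2 by rewrite addr_ge0 ?sqr_ge0.
by rewrite -[X in _ < X]sqrtr1 ltr_sqrt.
Qed.

Lemma enorm_le1 (z : plane) : (enorm z <= 1) = (z.1 ^+ 2 + z.2 ^+ 2 <= 1).
Proof.
by rewrite /enorm -[X in _ <= X]sqrtr1 ler_sqrt// ltr01.
Qed.

Lemma enorm_polar (q : plane) : 0 <= q.1 -> enorm (polar q) = q.1.
Proof.
move=> q0; rewrite /enorm /polar /= !exprMn -mulrDr cos2sin2 subrK mulr1.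
by rewrite sqrtr_sqr ger0_norm.
Qed.

Lemma measurable_ball1 : measurable (ball1 : set plane).
Proof.
have -> : ball1 = (fun z : plane => z.1 ^+ 2 + z.2 ^+ 2) @^-1` [set x : R | x < 1].
  by apply/seteqP; split=> z; rewrite /ball1 /= enorm_lt1.
rewrite -[X in measurable X]setTI.
have mf : measurable_fun [set: plane] (fun z : plane => z.1 ^+ 2 + z.2 ^+ 2).
  by apply: measurable_funD; apply: measurable_funX.
apply: mf => //; by rewrite (_ : [set x : R | x < 1] = `]-oo, 1[%classic).
Qed.

(** Polar coordinates in which the angle on the circle of radius [r] is
    reparametrized by [psi (r, -)]. *)
Lemma twisted_polar (a : R) (psi rho : plane -> R) (delta : R) : 0 < delta ->
  measurable_fun setT psi -> measurable_fun setT rho ->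
  (forall r, 0 < r < 1 ->
    [/\ forall x y, x <= y -> prim x y (fun t => psi (r, t)) (fun t => rho (r, t)),
        forall x, delta <= rho (r, x), psi (r, a) = a & psi (r, a + 2 * pi) = a + 2 * pi]) ->
  forall F : plane -> \bar R, measurable_fun ball1 F ->
  (\int[mu2]_(z in ball1) F z =
   \int[mu2]_(q in `]0%R, 1%R[ `*` `[a, (a + 2 * pi)%R[)
     (F (polar (q.1, psi q)) * (q.1 * rho q)%:E))%E.
Proof.
move=> d0 mpsi mrho H; set b := a + 2 * pi; set Q := _ `*` _.
have mQ : measurable (Q : set plane) by exact: measurableX.
have QP q : Q q -> 0 < q.1 < 1 by move=> [/=]; rewrite in_itv.
have S := @signed_substitution _ _ (measurableTypeR R * measurableTypeR R)%type
  (measurableTypeR R * measurableTypeR R)%type R mu2 mu2 Q ball1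
  (fun q : plane => polar (q.1, psi q)) (fun q : plane => q.1 * rho q).
apply: S.
- exact: measurable_ball1.
- move=> q /QP /andP[q0 q1]; rewrite /ball1 /= (@enorm_polar (q.1, psi q)) ?ltW//.
- move=> q /QP q01; have /andP[q0 q1] := q01; have [_ h _ _] := H _ q01.
  rewrite mulr_ge0 ?ltW// (lt_le_trans d0)//.
  by rewrite [q]surjective_pairing; exact: h.
move=> F0' mF0' F00'; pose F : plane -> \bar R := F0'.
have mF : measurable_fun [set: plane] F by exact: mF0'.
have F0 z : (0 <= F z)%E by exact: F00'.
rewrite -/F; clearbody F; clear F0' mF0' F00'.
pose Fb := (F \_ ball1)%E.
have mFb : measurable_fun setT Fb.
  exact: ((measurable_restrictT F measurable_ball1).1 (measurable_funTS mF)).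
have Fb0 z : (0 <= Fb z)%E by apply: erestrict_ge0.
rewrite [LHS]integral_mkcond (polar_ge0 a mFb Fb0) [LHS]integral_mkcond.
pose G (q : plane) := (if ((0 < q.1) && (a <= q.2 < b))%R then Fb (polar q) * q.1%:E else 0)%E.
have mcond : measurable_fun [set: plane] (fun q : plane => (0 < q.1) && (a <= q.2 < b)).
  apply: measurable_and; last apply: measurable_and.
  - by apply: measurable_fun_ltr => //; exact: measurable_cst.
  - by apply: measurable_fun_ler => //; exact: measurable_cst.
  - by apply: measurable_fun_ltr => //; exact: measurable_cst.
have mG : measurable_fun setT G.
  apply: measurable_fun_ifT => //; apply: emeasurable_funM; last exact/measurable_EFinP.
  exact: (measurableT_comp mFb measurable_polar).
have G0 q : (0 <= G q)%E.
  by rewrite /G; case: ifP => // /andP[q0 _]; rewrite mule_ge0// lee_fin ltW.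
transitivity (\int[mu]_t \int[mu]_r G (r, t))%E.
  apply: eq_integral => t _; rewrite patchE mem_setE in_itv/= /G /=.
  case: ifP => tab; last by under eq_integral do rewrite andbF; rewrite integral0.
  by apply: eq_integral => r _; rewrite andbT.
rewrite -fubini_tonelli; [|exact: mG|exact: G0].
pose G' (q : plane) := (F (polar (q.1, psi q)) * (q.1 * rho q)%:E)%E.
have mG' : measurable_fun setT G'.
  apply: emeasurable_funM.
    apply: (measurableT_comp mF); apply: (measurableT_comp measurable_polar).
    exact: measurable_fun_pair.
  by apply/measurable_EFinP; exact: measurable_funM.
have mGQ : measurable_fun setT (G' \_ Q)%E.
  exact: ((measurable_restrictT G' mQ).1 (measurable_funTS mG')).
have GQ0 q : (0 <= (G' \_ Q) q)%E.
  rewrite patchE; case: ifPn => // /set_mem /QP q01; have /andP[q0 q1] := q01.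
  rewrite mule_ge0// lee_fin mulr_ge0 ?(ltW q0)//; have [_ h _ _] := H _ q01.
  by rewrite [q]surjective_pairing (le_trans (ltW d0))//; exact: h.
rewrite [RHS]integral_mkcond fubini_tonelli1; [|exact: mGQ|exact: GQ0].
apply: eq_integral => r _; rewrite /fubini_F /=.
have [r01|r01] := boolP (0 < r < 1); last first.
  transitivity (0%E : \bar R); [|apply/esym]; apply: integral0_eq => t _.
    rewrite /G /=; case: ifP => // /andP[r0 _]; rewrite /Fb patchE.
    case: ifPn => [|_]; last by rewrite mul0e.
    rewrite inE /ball1 /= (@enorm_polar (r, t)) ?(ltW r0)//= => r1.
    by rewrite r0 r1 in r01.
  by rewrite patchE in_setX /= mem_setE in_itv/= (negbTE r01).
have /andP[r0 r1] := r01; have [hp rd pa pb] := H _ r01.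
have mr : measurable_fun setT (fun t : R => G (r, t)).
  exact: (measurableT_comp mG (pair1_measurable r)).
have mrhor : measurable_fun setT (fun t : R => rho (r, t)).
  exact: (measurableT_comp mrho (pair1_measurable r)).
rewrite (increasing_substitution d0 hp rd mrhor mr) => [|t]; last exact: G0.
apply: eq_integral => t _; rewrite patchE in_setX /= !mem_setE !in_itv/= r01 /=.
rewrite /G /= r0 /=.
have -> : (a <= psi (r, t) < b) = (a <= t < b).
  have mono x y : x <= y -> psi (r, x) <= psi (r, y).
    move=> xy; rewrite -subr_ge0 (prim_diff (hp x y xy))//.
    by apply: Rintegral_ge0 => s _; apply: le_trans (rd s); exact: ltW.
  have smono x y : x < y -> psi (r, x) < psi (r, y).
    move=> xy; rewrite -subr_gt0 (prim_diff (hp x y (ltW xy)))//; last exact: ltW.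
    have := @le_Rintegral _ _ _ mu `[x, y] (fun=> delta) (fun t => rho (r, t)).
    rewrite Rintegral_cst//= mu_segment ?(ltW xy)//= => h.
    apply: lt_le_trans (h _ _ _ _) => //; first by rewrite mulr_gt0// subr_gt0.
    - by apply: L2_int; exact: L2_cst_segment.
    - by apply: L2_int; case: (hp x y (ltW xy)).
  rewrite -{1}pa /b -{1}pb; congr (_ && _).
    have [/mono ->//|/smono] := leP a t; by rewrite ltNge => /negbTE.
  have [/smono ->//|/mono] := ltP t (a + 2 * pi); by rewrite leNgt => /negbTE.
case: ifP => _; last by rewrite mul0e.
have -> : Fb (polar (r, psi (r, t))) = F (polar (r, psi (r, t))).
  by rewrite /Fb patchE ifT// inE /ball1 /= (@enorm_polar (r, psi (r, t)))//= ltW.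
by rewrite EFinM muleA.
Qed.

End TwistedPolar.

(** * Smooth functions *)

Section Smooth.
Context {R : realType}.
Implicit Types (f g : R -> R) (n k : nat).

(** [n] times differentiable; smooth means [forall n, diffn n f]. *)
Fixpoint diffn n f : Prop :=
  if n is n'.+1 then exists2 f' : R -> R, (forall t : R, is_derive t 1 f (f' t)) & diffn n' f'
  else True.

Lemma diffn_pred n f : diffn n.+1 f -> diffn n f.
Proof.
elim: n f => [//|n IH] f [f' df sf']; exists f' => //; exact: IH.
Qed.

Lemma diffn_ext n f g : f =1 g -> diffn n f -> diffn n g.
Proof. by move=> /funext ->. Qed.

Lemma diffn_cst n (c : R) : diffn n (fun=> c).
Proof.
elim: n c => [//|n IH] c; exists (fun=> 0); last exact: IH.
by move=> t; exact: is_derive_cst.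
Qed.

Lemma diffn_id n : diffn n (fun t => t).
Proof.
case: n => [//|n]; exists (fun=> 1); last exact: diffn_cst.
by move=> t; exact: is_derive_id.
Qed.

Lemma diffnD n f g : diffn n f -> diffn n g -> diffn n (fun t => f t + g t).
Proof.
elim: n f g => [//|n IH] f g [f' df sf] [g' dg sg].
exists (fun t => f' t + g' t); last exact: IH.
by move=> t; exact: (is_deriveD (df t) (dg t)).
Qed.

Lemma diffnM n f g : diffn n f -> diffn n g -> diffn n (fun t => f t * g t).
Proof.
elim: n f g => [//|n IH] f g hf hg.
have [f' df sf] := hf; have [g' dg sg] := hg.
exists (fun t => f t * g' t + g t * f' t).
  by move=> t; exact: (is_deriveM (df t) (dg t)).
by apply: diffnD; apply: IH => //; exact: diffn_pred.
Qed.

Lemma diffn_comp n f g : diffn n f -> diffn n g -> diffn n (fun t => f (g t)).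
Proof.
elim: n f g => [//|n IH] f g hf hg.
have [f' df sf] := hf; have [g' dg sg] := hg.
exists (fun t => f' (g t) * g' t).
  by move=> t; exact: (is_derive1_comp (df (g t)) (dg t)).
by apply: diffnM => //; apply: IH => //; exact: diffn_pred.
Qed.

Lemma diffn_sin_cos n : diffn n (@sin R) /\ diffn n (@cos R).
Proof.
elim: n => [//|n [IHs IHc]]; split.
  by exists cos => // t; exact: is_derive_sin.
exists (fun t => - 1 * sin t); first by move=> t; rewrite mulN1r; exact: is_derive_cos.
by apply: diffnM => //; exact: diffn_cst.
Qed.

Lemma diffn_derive1 n f : diffn n.+1 f -> diffn n (derive1 f).
Proof.
move=> [f' df]; apply: diffn_ext => t; rewrite derive1E; exact/esym/derive_val.
Qed.

Lemma diffn_derivable n f (t : R) : diffn n.+1 f -> derivable f t 1.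
Proof. by move=> [f' df _]; case: (df t). Qed.

Lemma diffn_continuous f : diffn 1 f -> continuous f.
Proof.
move=> h t; apply: differentiable_continuous; apply/derivable1_diffP.
exact: diffn_derivable h.
Qed.

Lemma smooth_derivable_derive1n f : (forall n, diffn n f) ->
  forall n t, derivable (derive1n n f) t 1.
Proof.
move=> sf n t; suff : forall m, diffn m (derive1n n f).
  by move=> /(_ 1%N); exact: diffn_derivable.
elim: n => [//|n IH] m; rewrite derive1nS; apply: diffn_derive1; exact: IH.
Qed.

(** The family is closed under differentiation up to linear combination, see
    [is_derive_flat]; this gives smoothness of exp(-1/y) without computing its
    derivatives. *)
Definition flat (k : nat) (y : R) : R := if 0 < y then y^-1 ^+ k * expR (- y^-1) else 0.

Lemma flat_bound k : exists C : R, forall y, `|flat k y| <= C * y ^+ 2.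
Proof.
exists (k.+2%:R ^+ k.+2) => y; rewrite /flat; case: ifP => y0; last first.
  by rewrite normr0 mulr_ge0 ?sqr_ge0 ?exprn_ge0.
have z0 : 0 < y^-1 by rewrite invr_gt0.
rewrite ger0_norm ?mulr_ge0 ?expR_ge0 ?exprn_ge0 ?(ltW z0)//.
have -> : y^-1 ^+ k * expR (- y^-1) = y^-1 ^+ k.+2 * expR (- y^-1) * y ^+ 2.
  have yn0 : y != 0 by rewrite gt_eqF.
  by rewrite -addn2 exprD exprVn; field; rewrite yn0 expf_neq0.
rewrite ler_wpM2r ?sqr_ge0// expRN ler_pdivrMr ?expR_gt0//.
have k0 : 0 < k.+2%:R :> R by rewrite ltr0n.
have -> : expR y^-1 = expR (y^-1 / k.+2%:R) ^+ k.+2.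
  by rewrite -expRM_natl mulrC divfK// gt_eqF.
rewrite -exprMn lerXn2r ?nnegrE ?(ltW z0)//.
have := @expR_ge1Dx R (y^-1 / k.+2%:R); rewrite -(ler_pM2l k0) mulrDr mulr1.
by rewrite [_ * (_ / _)]mulrC divfK ?gt_eqF//; lra.
Qed.

Lemma flat_le0 k y : y <= 0 -> flat k y = 0.
Proof. by rewrite /flat leNgt => /negbTE ->. Qed.

(** For [flat] at the origin, where it has no formula. *)
Lemma is_derive_quadratic f (x C : R) :
  (forall y, `|f y - f x| <= C * (y - x) ^+ 2) -> is_derive x 1 f 0.
Proof.
move=> fC.
have cv : h^-1 *: (f (h *: 1 + x) - f x) @[h --> 0^'] --> (0 : R).
  apply/cvgrPdist_lt => e e0.
  have C1 : 0 < `|C| + 1 by rewrite ltr_wpDl.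
  near=> h; rewrite sub0r normrN normrZ normfV.
  have h0 : h != 0 by near: h; exact: nbhs_dnbhs_neq.
  have h1 : `|h| < e / (`|C| + 1).
    near: h; apply: dnbhs0_lt; exact: divr_gt0.
  rewrite ltr_pdivrMl ?normr_gt0//.
  apply: le_lt_trans (fC _) _.
  have -> : h *: (1 : R) + x - x = h by rewrite addrK /GRing.scale/= mulr1.
  rewrite -(real_normK (num_real h)) expr2 mulrA mulrC ltr_pM2l ?normr_gt0//.
  rewrite ltr_pdivlMr// in h1; apply: le_lt_trans h1.
  rewrite mulrC ler_wpM2l//; have := ler_norm C; lra.
apply: DeriveDef; first by apply/cvg_ex; exists 0.
exact/cvg_lim.
Unshelve. all: by end_near. Qed.

Lemma is_derive_near f g (x d : R) : (\forall y \near x, f y = g y) ->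
  is_derive x 1 f d -> is_derive x 1 g d.
Proof.
move=> fg [df <-]; have fx : f x = g x by exact: nbhs_singleton fg.
apply: DeriveDef.
  by apply: near_eq_derivable df => //; rewrite oner_eq0.
by apply/esym; apply: near_eq_derive => //; rewrite oner_eq0.
Qed.

Lemma is_derive_flat k (y : R) : is_derive y 1 (flat k) (flat k.+2 y - k%:R * flat k.+1 y).
Proof.
have [y0|y0|->] := ltgtP y 0.
- rewrite !flat_le0 ?ltW// mulr0 subr0.
  apply: (@is_derive_near (cst 0) _ _ _ _ (is_derive_cst _ _ _)).
  near=> t; rewrite flat_le0//.
  by apply: ltW; near: t; exact: lt_nbhsl.
- apply: (@is_derive_near (fun t => t^-1 ^+ k * expR (- t^-1))).
    near=> t; rewrite /flat.
    have -> // : 0 < t.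
    by near: t; exact: lt_nbhsr.
  have du : is_derive y 1 (fun t : R => t^-1) (- (y ^- 2)).
    have := @is_deriveV R (fun t => t) y 1 1 (lt0r_neq0 y0) (is_derive_id _ _).
    by rewrite /GRing.scale/= mulr1.
  have dX := is_deriveX k du.
  have dE : is_derive y 1 (fun t => expR (- t^-1)) (expR (- y^-1) * (- - y ^- 2)) :=
    @is_derive1_comp R expR (fun t => - t^-1) y _ _ (is_derive_expR _) (is_deriveN du).
  have := is_deriveM dX dE; rewrite /flat y0.
  rewrite (_ : _ *: _ + _ = y^-1 ^+ k.+2 * expR (- y^-1) - k%:R * (y^-1 ^+ k.+1 * expR (- y^-1))).
    by apply: is_derive_near; near=> t; rewrite /= exprfctE.
  rewrite /GRing.scale /= exprfctE opprK !exprVn.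
  case: (k) => [|m] /=.
    by rewrite !mul0r; field; rewrite gt_eqF.
  have yn0 : y != 0 by rewrite gt_eqF.
  by rewrite !exprS; field; rewrite yn0 expf_neq0.
- rewrite !flat_le0// mulr0 subr0.
  have [C hC] := flat_bound k.
  apply: (@is_derive_quadratic _ 0 C) => t.
  by rewrite [flat k 0]flat_le0// !subr0.
Unshelve. all: by end_near. Qed.

Lemma diffn_flat n k : diffn n (flat k).
Proof.
elim: n k => [//|n IH] k; exists (fun y => flat k.+2 y + (- k%:R) * flat k.+1 y).
  by move=> y; rewrite mulNr; exact: is_derive_flat.
by apply: diffnD => //; apply: diffnM => //; exact: diffn_cst.
Qed.

Definition smooth_step (y : R) : R := flat 0 y.

Lemma smooth_stepE y : smooth_step y = if 0 < y then expR (- y^-1) else 0.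
Proof. by rewrite /smooth_step /flat expr0 mul1r. Qed.

Lemma diffn_smooth_step n : diffn n smooth_step.
Proof. exact: diffn_flat. Qed.

Lemma smooth_step_ge0 y : 0 <= smooth_step y.
Proof. by rewrite smooth_stepE; case: ifP => // _; exact: expR_ge0. Qed.

Lemma smooth_step_le1 y : smooth_step y <= 1.
Proof.
rewrite smooth_stepE; case: ifP => // y0; rewrite -expR0 ler_expR oppr_le0 invr_ge0.
exact: ltW.
Qed.

Lemma smooth_step_le0 y : y <= 0 -> smooth_step y = 0.
Proof. by move=> y0; rewrite smooth_stepE ltNge y0. Qed.

Lemma smooth_step_homo x y : x <= y -> smooth_step x <= smooth_step y.
Proof.
move=> xy; have [x0|x0] := leP x 0; first by rewrite (smooth_step_le0 x0) smooth_step_ge0.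
have y0 := lt_le_trans x0 xy.
by rewrite !smooth_stepE x0 y0 ler_expR lerN2 lef_pV2.
Qed.

Lemma continuous_smooth_step : continuous smooth_step.
Proof. exact: diffn_continuous (diffn_smooth_step 1). Qed.

(** Squeezed bumps are smooth approximations of the indicator of the positive
    half-line. *)
Lemma smooth_step_cvg (y : R) : smooth_step (n%:R * y) @[n --> \oo] --> ((if 0 < y then 1 else 0) : R).
Proof.
case: ifP => y0; last first.
  have -> : (fun n : nat => smooth_step (n%:R * y)) = cst 0.
    by apply/funext => n; rewrite smooth_step_le0// mulr_ge0_le0// leNgt y0.
  exact: cvg_cst.
have h : (fun n : nat => expR (- (n%:R * y)^-1)) @ \oo --> expR (- 0 : R).
  apply: (@cvg_comp _ _ _ (fun n : nat => (n%:R * y)^-1) (fun x : R => expR (- x)) _ (nbhs (0 : R))); last first.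
    by apply: continuous_comp; [exact: oppr_continuous|exact: continuous_expR].
  apply/gtr0_cvgV0; first by exists 1%N => // n /= n0; rewrite mulr_gt0// ltr0n.
  apply/cvgryPge => A; have /cvgryPge/(_ (A / y)) := @cvgr_idn R; apply: filterS => n; by rewrite ler_pdivrMr.
rewrite oppr0 expR0 in h; apply: cvg_trans h; apply: near_eq_cvg; exists 1%N => // n /= n0.
by rewrite smooth_stepE mulr_gt0// ltr0n.
Qed.

End Smooth.

Section PlaneSmooth.
Context {R : realType}.
Notation plane := (R * R)%type.
Implicit Types (u v : plane -> R) (f : R -> R) (x : plane).

Let slice1 u x : (fun h : R => h^-1 *: ((u \o shift x) (h *: ((1, 0) : plane)) - u x)) =
  (fun h : R => h^-1 *: (((fun t => u (t, x.2)) \o shift x.1) (h *: 1) - u (x.1, x.2))).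
Proof.
apply/funext => h /=; rewrite -surjective_pairing; congr (_ *: (u _ - _)).
by apply: injective_projections; rewrite /= ?scaler0 ?add0r.
Qed.

Let slice2 u x : (fun h : R => h^-1 *: ((u \o shift x) (h *: ((0, 1) : plane)) - u x)) =
  (fun h : R => h^-1 *: (((fun t => u (x.1, t)) \o shift x.2) (h *: 1) - u (x.1, x.2))).
Proof.
apply/funext => h /=; rewrite -surjective_pairing; congr (_ *: (u _ - _)).
by apply: injective_projections; rewrite /= ?scaler0 ?add0r.
Qed.

(** Partial derivatives are directional derivatives, which only see the
    restriction to a line. *)
Lemma is_derive_slice1 u x d :
  is_derive x ((1, 0) : plane) u d <-> is_derive x.1 1 (fun t => u (t, x.2)) d.
Proof.
split=> -[dv <-]; apply: DeriveDef; move: dv; rewrite /derivable /derive slice1 //.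
Qed.

Lemma is_derive_slice2 u x d :
  is_derive x ((0, 1) : plane) u d <-> is_derive x.2 1 (fun t => u (x.1, t)) d.
Proof.
split=> -[dv <-]; apply: DeriveDef; move: dv; rewrite /derivable /derive slice2 //.
Qed.

(** [C^k] functions, with the derivatives exhibited. *)
Lemma CkS k u u1 u2 : (forall x, is_derive x.1 1 (fun t => u (t, x.2)) (u1 x)) ->
  (forall x, is_derive x.2 1 (fun t => u (x.1, t)) (u2 x)) ->
  continuous u -> Ck k u1 -> Ck k u2 -> Ck k.+1 u.
Proof.
move=> h1 h2 cu c1 c2.
have e1 : pd1 u = u1.
  by apply/funext => x; have /is_derive_slice1[_] := h1 x.
have e2 : pd2 u = u2.
  by apply/funext => x; have /is_derive_slice2[_] := h2 x.
split=> //; rewrite ?e1 ?e2 //.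
- by move=> x; have /is_derive_slice1[] := h1 x.
- by move=> x; have /is_derive_slice2[] := h2 x.
Qed.

Lemma Ck_pd k u : Ck k.+1 u ->
  [/\ forall x, is_derive x.1 1 (fun t => u (t, x.2)) (pd1 u x),
      forall x, is_derive x.2 1 (fun t => u (x.1, t)) (pd2 u x),
      continuous u, Ck k (pd1 u) & Ck k (pd2 u)].
Proof.
move=> [d1 d2 cu c1 c2]; split=> // x.
- by apply/is_derive_slice1; apply: DeriveDef; [exact: d1|].
- by apply/is_derive_slice2; apply: DeriveDef; [exact: d2|].
Qed.

Lemma Ck_continuous k u : Ck k u -> continuous u.
Proof. by case: k => [//|k] []. Qed.

Lemma Ck_pred k u : Ck k.+1 u -> Ck k u.
Proof.
elim: k u => [|k IH] u; first by case.
by move=> [d1 d2 cu c1 c2]; split; [exact: d1|exact: d2|exact: cu|exact: (IH _ c1)|exact: (IH _ c2)].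
Qed.

Lemma Ck_cst k (c : R) : Ck k (fun=> c).
Proof.
elim: k c => [|k IH] c; first by move=> x; exact: cvg_cst.
apply: (CkS (u1 := fun=> 0) (u2 := fun=> 0)) => //; try by move=> x; exact: is_derive_cst.
by move=> x; exact: cvg_cst.
Qed.

Lemma Ck_fst k : Ck k (fun x : plane => x.1).
Proof.
have c : continuous (fun x : plane => x.1) by move=> x; exact: cvg_fst.
have h1 x : is_derive x.1 1 (fun t : R => ((t, x.2) : plane).1) 1 by exact: is_derive_id.
have h2 x : is_derive x.2 1 (fun t : R => ((x.1, t) : plane).1) 0 by exact: is_derive_cst.
by case: k => [//|k]; apply: (CkS h1 h2 c); exact: Ck_cst.
Qed.

Lemma Ck_snd k : Ck k (fun x : plane => x.2).
Proof.
have c : continuous (fun x : plane => x.2) by move=> x; exact: cvg_snd.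
have h1 x : is_derive x.1 1 (fun t : R => ((t, x.2) : plane).2) 0 by exact: is_derive_cst.
have h2 x : is_derive x.2 1 (fun t : R => ((x.1, t) : plane).2) 1 by exact: is_derive_id.
by case: k => [//|k]; apply: (CkS h1 h2 c); exact: Ck_cst.
Qed.

Lemma CkD k u v : Ck k u -> Ck k v -> Ck k (fun x => u x + v x).
Proof.
elim: k u v => [|k IH] u v.
  by move=> cu cv x; apply: cvgD; [exact: cu|exact: cv].
move=> /Ck_pd[u1 u2 cu Cu1 Cu2] /Ck_pd[v1 v2 cv Cv1 Cv2].
have h1 x := is_deriveD (u1 x) (v1 x); have h2 x := is_deriveD (u2 x) (v2 x).
apply: (CkS h1 h2); [|exact: IH|exact: IH].
by move=> x; apply: cvgD; [exact: cu|exact: cv].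
Qed.

Lemma CkM k u v : Ck k u -> Ck k v -> Ck k (fun x => u x * v x).
Proof.
elim: k u v => [|k IH] u v.
  by move=> cu cv x; apply: cvgM; [exact: cu|exact: cv].
move=> hu hv; have [u1 u2 cu Cu1 Cu2] := Ck_pd hu; have [v1 v2 cv Cv1 Cv2] := Ck_pd hv.
have Cu := Ck_pred hu; have Cv := Ck_pred hv.
have h1 x : is_derive x.1 1 (fun t => u (t, x.2) * v (t, x.2)) (u x * pd1 v x + v x * pd1 u x).
  by have := is_deriveM (u1 x) (v1 x); rewrite -!surjective_pairing.
have h2 x : is_derive x.2 1 (fun t => u (x.1, t) * v (x.1, t)) (u x * pd2 v x + v x * pd2 u x).
  by have := is_deriveM (u2 x) (v2 x); rewrite -!surjective_pairing.
apply: (CkS h1 h2).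
- by move=> x; apply: cvgM; [exact: cu|exact: cv].
- exact: (CkD (IH _ _ Cu Cv1) (IH _ _ Cv Cu1)).
- exact: (CkD (IH _ _ Cu Cv2) (IH _ _ Cv Cu2)).
Qed.

Lemma Ck_comp k f u : diffn k.+1 f -> Ck k u -> Ck k (fun x => f (u x)).
Proof.
elim: k f u => [|k IH] f u hf.
  by move=> cu x; apply: continuous_comp; [exact: cu|exact: diffn_continuous].
move=> hu; have [u1 u2 cu Cu1 Cu2] := Ck_pd hu; have Cu := Ck_pred hu.
have cf : continuous f by apply: diffn_continuous; case: hf => f' df [f'' _ _]; exists f'.
have [f' df sf] := hf.
have h1 x : is_derive x.1 1 (fun t => f (u (t, x.2))) (f' (u x) * pd1 u x).
  have dx := df (u x); rewrite [x in u x]surjective_pairing in dx.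
  by have := is_derive1_comp dx (u1 x); rewrite -surjective_pairing.
have h2 x : is_derive x.2 1 (fun t => f (u (x.1, t))) (f' (u x) * pd2 u x).
  have dx := df (u x); rewrite [x in u x]surjective_pairing in dx.
  by have := is_derive1_comp dx (u2 x); rewrite -surjective_pairing.
apply: (CkS h1 h2).
- by move=> x; apply: continuous_comp; [exact: cu|exact: cf].
- exact: (CkM (IH _ _ sf Cu) Cu1).
- exact: (CkM (IH _ _ sf Cu) Cu2).
Qed.

Lemma mean_value f (f' : R -> R) (x y : R) : (forall t : R, is_derive t 1 f (f' t)) ->
  exists2 c, `|c - x| <= `|y - x| & f y - f x = f' c * (y - x).
Proof.
move=> df; have cf A : {within A, continuous f}.
  apply: continuous_subspaceT => t; apply: differentiable_continuous.
  by apply/derivable1_diffP; case: (df t).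
have [xy|yx|->] := ltgtP x y.
- have [c] := MVT xy (fun t _ => df t) (cf _).
  rewrite in_itv/= => /andP[h1 h2] e; exists c => //.
  by rewrite !ger0_norm ?subr_ge0 ?ltW//; lra.
- have [c] := MVT yx (fun t _ => df t) (cf _).
  rewrite in_itv/= => /andP[h1 h2] e; exists c; last by lra.
  by rewrite !ler0_norm ?subr_le0 ?ltW//; lra.
- by exists y => //; rewrite !subrr mulr0.
Qed.

(** The increment is taken one variable at a time; the mean value theorem and
    the continuity of the partial derivatives control both parts. *)
Lemma is_derive_curve u (g1 g2 : R -> R) (t d1 d2 : R) : Ck 1 u ->
  is_derive t 1 g1 d1 -> is_derive t 1 g2 d2 ->
  is_derive t 1 (fun s => u (g1 s, g2 s))
    (pd1 u (g1 t, g2 t) * d1 + pd2 u (g1 t, g2 t) * d2).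
Proof.
move=> hu D1 D2; have [u1 u2 cu c1 c2] := Ck_pd hu.
set a := g1 t; set b := g2 t.
have cg1 : {for t, continuous g1}.
  by apply: differentiable_continuous; apply/derivable1_diffP; case: D1.
have cg2 : {for t, continuous g2}.
  by apply: differentiable_continuous; apply/derivable1_diffP; case: D2.
have sh0 (g : R -> R) : {for t, continuous g} -> g (h + t) @[h --> (0 : R)^'] --> g t.
  move=> cg; apply: cvg_trans (cvg_app _ (cvg_within _)) _.
  apply: (@cvg_comp _ _ _ (fun h => h + t) g _ (nbhs t)) => //.
  have : h + t @[h --> nbhs (0 : R)] --> 0 + t by apply: cvgD; [exact: cvg_id|exact: cvg_cst].
  by rewrite add0r.
pose q1 (h : R) := if g1 (h + t) == a then pd1 u (a, b) else
  (u (g1 (h + t), g2 (h + t)) - u (a, g2 (h + t))) / (g1 (h + t) - a).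
pose q2 (h : R) := if g2 (h + t) == b then pd2 u (a, b) else
  (u (a, g2 (h + t)) - u (a, b)) / (g2 (h + t) - b).
have cv1 : q1 h @[h --> 0^'] --> pd1 u (a, b).
  apply/cvgrPdist_lt => e e0.
  have := c1 (a, b); move=> /cvgrPdist_lt/(_ e e0)/nbhs_ballP[dl /= dl0 hd].
  near=> h; rewrite /q1; case: eqP => [_|/eqP ne]; first by rewrite subrr normr0.
  have [c hc ->] := @mean_value (fun s => u (s, g2 (h + t))) (fun s => pd1 u (s, g2 (h + t)))
    a (g1 (h + t)) (fun s => u1 (s, g2 (h + t))).
  rewrite mulfK ?subr_eq0//; apply: hd; split=> /=; rewrite /ball/= distrC.
    apply: le_lt_trans hc _; rewrite distrC; near: h.
    by have /cvgrPdist_lt := sh0 _ cg1; apply.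
  by rewrite distrC; near: h; have /cvgrPdist_lt := sh0 _ cg2; apply.
have cv2 : q2 h @[h --> 0^'] --> pd2 u (a, b).
  apply/cvgrPdist_lt => e e0.
  have := c2 (a, b); move=> /cvgrPdist_lt/(_ e e0)/nbhs_ballP[dl /= dl0 hd].
  near=> h; rewrite /q2; case: eqP => [_|/eqP ne]; first by rewrite subrr normr0.
  have [c hc ->] := @mean_value (fun s => u (a, s)) (fun s => pd2 u (a, s))
    b (g2 (h + t)) (fun s => u2 (a, s)).
  rewrite mulfK ?subr_eq0//; apply: hd; split=> /=; rewrite /ball/= distrC.
    by rewrite subrr normr0.
  apply: le_lt_trans hc _; rewrite distrC; near: h.
  by have /cvgrPdist_lt := sh0 _ cg2; apply.
have quo (g : R -> R) d : is_derive t 1 g d -> h^-1 * (g (h + t) - g t) @[h --> (0:R)^'] --> d.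
  move=> [dg <-].
  have -> : (fun h : R => h^-1 * (g (h + t) - g t)) =
      (fun h => h^-1 *: ((g \o shift t) (h *: 1) - g t)).
    by apply/funext => h /=; rewrite /GRing.scale/= mulr1.
  exact: dg.
have lim : h^-1 *: (u (g1 (h *: 1 + t), g2 (h *: 1 + t)) - u (a, b)) @[h --> (0:R)^'] -->
   pd1 u (a, b) * d1 + pd2 u (a, b) * d2.
  have -> : (fun h : R => h^-1 *: (u (g1 (h *: 1 + t), g2 (h *: 1 + t)) - u (a, b))) =
    (fun h => q1 h * (h^-1 * (g1 (h + t) - a)) + q2 h * (h^-1 * (g2 (h + t) - b))).
    apply/funext => h; rewrite /GRing.scale /= mulr1 /q1 /q2.
    case: eqP => [->|/eqP n1]; case: eqP => [->|/eqP n2]; rewrite ?subrr ?mulr0 ?addr0 ?add0r//.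
    + by move: (h^-1) => k; field; rewrite subr_eq0.
    + by move: (h^-1) => k; field; rewrite subr_eq0.
    + by move: (h^-1) => k; field; rewrite !subr_eq0 n1 n2.
  exact: (cvgD (cvgM cv1 (quo _ _ D1)) (cvgM cv2 (quo _ _ D2))).
apply: DeriveDef; first by apply/cvg_ex; exists (pd1 u (a, b) * d1 + pd2 u (a, b) * d2).
exact/cvg_lim.
Unshelve. all: by end_near. Qed.

End PlaneSmooth.

(** * The fundamental lemma of the calculus of variations *)

Section VanishingIntegrals.
Local Open Scope ereal_scope.
Context {d1 d2} {T1 : measurableType d1} {T2 : measurableType d2} {R : realType}.
Variable m : {measure set T2 -> \bar R}.

(** The sets over which the integral vanishes form a Dynkin system, so it is
    enough to test a generating family closed under intersection. *)
Lemma dynkin_integral (f : T2 -> \bar R) (p : T2 -> T1) (G : set (set T1)) :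
  m.-integrable setT f -> measurable_fun setT p ->
  @measurable _ T1 = <<s G >> -> setI_closed G ->
  \int[m]_x f x = 0 -> (forall A, G A -> \int[m]_(x in p @^-1` A) f x = 0) ->
  forall A, measurable A -> \int[m]_(x in p @^-1` A) f x = 0.
Proof.
move=> fi mp gen GI fT fG A mA.
have mpA B : measurable B -> measurable (p @^-1` B).
  by move=> mB; rewrite -[X in measurable X]setTI; exact: mp.
apply: (@dynkin_induction _ T1 G (fun A => \int[m]_(x in p @^-1` A) f x = 0)) => //.
- move=> B mB IB; have mB' := mpA _ mB.
  have := integral_setU m mB' (measurableC mB') (f := f).
  rewrite setUv fT IB add0e preimage_setC => /(_ _ _) /esym; apply.
    by have := measurable_int _ fi.
  by apply/disj_setPCl.
- move=> F mF tF IF; rewrite preimage_bigcup integral_bigcup//.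
  + by rewrite eseries0.
  + apply/trivIsetP => i j _ _ ij; rewrite -preimage_setI.
    by move/trivIsetP : tF => ->//; rewrite preimage_set0.
  + by move=> k; exact: mpA.
  + by apply: integrableS fi => //; apply: bigcup_measurable => k _; exact: mpA.
- by rewrite -gen.
Qed.

(** Dominated convergence against a fixed integrable [F]. *)
Lemma Rintegral_cvg (D : set T2) (F : T2 -> R) (phi : nat -> T2 -> R) (phi0 : T2 -> R) :
  measurable D -> m.-integrable D (EFin \o F) ->
  (forall n, measurable_fun D (phi n)) -> measurable_fun D phi0 ->
  (forall n x, D x -> `|phi n x| <= 1)%R ->
  (forall x, D x -> phi n x @[n --> \oo] --> phi0 x) ->
  (\int[m]_(x in D) (F x * phi n x))%R @[n --> \oo] --> (\int[m]_(x in D) (F x * phi0 x))%R.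
Proof.
move=> mD iF mphi mphi0 phi1 cphi.
have mF : measurable_fun D F by apply/measurable_EFinP; exact: measurable_int iF.
have c1 : {ae m, forall x, D x -> (fun n => (F x * phi n x)%:E) @ \oo --> (F x * phi0 x)%:E}.
  apply: aeW => x Dx; apply/fine_cvgP; split; first exact: nearW.
  by apply: cvgM; [exact: cvg_cst|exact: cphi].
have c2 : {ae m, forall x n, D x -> `|(F x * phi n x)%:E| <= `|F x|%:E}.
  by apply: aeW => x n Dx; rewrite /= lee_fin normrM ler_piMr// phi1.
have [ilim _ cv] := @dominated_convergence _ _ _ m D mD
  (fun n x => (F x * phi n x)%:E) (fun x => (F x * phi0 x)%:E) (fun x => `|F x|%:E)
  (fun n => (measurable_EFinP _ _).2 (measurable_funM mF (mphi n)))
  ((measurable_EFinP _ _).2 (measurable_funM mF mphi0)) c1 (integrable_norm iF) c2.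
rewrite /Rintegral; apply: fine_cvg; rewrite fineK//.
exact: integrable_fin_num.
Qed.

Lemma ae_zero_of_integrals (D : set T2) (f : T2 -> R) : measurable D ->
  m.-integrable D (EFin \o f) ->
  (forall A, measurable A -> A `<=` D -> \int[m]_(x in A) (f x)%:E = 0) ->
  {ae m, forall x, D x -> f x = 0%R}.
Proof.
move=> mD fi f0.
have := @integral_ae_eq _ _ _ m D mD (cst 0) (EFin \o f) fi (@measurable_cst _ _ _ _ _ _) _.
have h E : E `<=` D -> measurable E -> \int[m]_(x in E) (EFin \o f) x = \int[m]_(x in E) cst 0 x.
  by move=> ED mE; rewrite f0// integral0.
by move=> /(_ h); apply: filterS => x hx Dx; have [] := hx Dx.
Qed.

End VanishingIntegrals.

Section UniquenessOnIntervals.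
Context {R : realType}.
Notation mu := (@lebesgue_measure R).
Notation plane := (R * R)%type.

Lemma RGenOInfty_setI : setI_closed (@RGenOInfty.G R).
Proof.
move=> _ _ [x ->] [y ->]; exists (Num.max x y).
by apply/seteqP; split=> t /=; rewrite !in_itv/= !andbT gt_max; [by move=> [-> ->]|by move=> /andP[]].
Qed.

Lemma ae_zero_segment (b : R) (F : R -> R) : mu.-integrable `[0, b] (EFin \o F) ->
  \int[mu]_(x in `[0, b]) F x = 0 ->
  (forall a, 0 < a < b -> \int[mu]_(x in `[0, b]) (if a < x then F x else 0) = 0) ->
  {ae mu, forall x, `[0, b]%classic x -> F x = 0}.
Proof.
move=> iF F0 Fa.
have mD : measurable (`[0, b]%classic : set (measurableTypeR R)) by [].
have mF : measurable_fun `[0, b] F by apply/measurable_EFinP; exact: measurable_int iF.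
pose f := ((EFin \o F) \_ `[0%R, b])%E.
have fi := iF; rewrite integrable_mkcond// -/f in fi.
have key := @dynkin_integral _ _ (measurableTypeR R) (measurableTypeR R) R mu f idfun (@RGenOInfty.G R)
  fi (@measurable_id _ _ _) (@RGenOInfty.measurableE R) RGenOInfty_setI.
apply: ae_zero_of_integrals => // A mA AD.
have := key _ _ A mA; rewrite preimage_id => <-.
- rewrite /f integral_mkcond [RHS]integral_mkcond; apply: eq_integral => x _; rewrite !patchE.
  by case: ifPn => // /set_mem /AD /mem_set ->.
- rewrite /f -integral_mkcond; move: F0; rewrite /Rintegral => F0.
  rewrite -[LHS]fineK; first by rewrite [X in X%:E]F0.
  exact: integrable_fin_num.
- move=> _ [x ->]; rewrite preimage_id /f integral_mkcond.
  pose Fx y := if x < y then F y else 0.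
  have mFx : measurable_fun `[0, b] Fx.
    apply: measurable_fun_if => //.
      by apply: measurable_fun_ltr => //; exact: measurable_cst.
    by apply: measurable_funS mF.
  have iFx : mu.-integrable `[0, b] (EFin \o Fx).
    apply: le_integrable iF => //; first exact/measurable_EFinP.
    by move=> y _; rewrite /Fx /=; case: ifP => // _; rewrite normr0 lee_fin.
  transitivity (\int[mu]_(y in `[0%R, b]) (Fx y)%:E)%E.
    rewrite [RHS]integral_mkcond; apply: eq_integral => y _; rewrite !patchE /Fx !mem_setE !in_itv/= andbT.
    by case: ifP; case: ifP.
  rewrite -[LHS]fineK; last exact: integrable_fin_num.
  congr EFin; rewrite -[LHS]/(\int[mu]_(y in `[0, b]) Fx y).
  have [bx|xb] := leP b x.
    transitivity (\int[mu]_(y in `[0, b]) (0 : R)); last by rewrite Rintegral_cst ?mul0r.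
    apply: eq_Rintegral => y.
    by rewrite inE/= in_itv/= => /andP[_ yb]; rewrite /Fx ltNge (le_trans yb bx).
  have [x0|x0] := ltP 0 x; first by apply: Fa; rewrite x0.
  transitivity (\int[mu]_(y in `[0, b]) F y) => //; apply/esym; apply: Rintegral_eq_oo; first exact/measurable_oo_cc.
  by move=> y /andP[y0 yb]; rewrite /Fx (le_lt_trans x0 y0).
Qed.

(** The arc from [a] to [2 pi] is the set where the cosine centred at its
    midpoint exceeds its value at the ends; this is how an arc becomes a level
    set of a smooth periodic function. *)
Lemma cos_gt_arc (a t : R) : 0 < a < 2 * pi -> 0 <= t <= 2 * pi ->
  (cos ((2 * pi - a) / 2) < cos (t - (a + 2 * pi) / 2)) = (a < t < 2 * pi).
Proof.
move=> /andP[a0 a1] /andP[t0 t1]; have p0 := pi_gt0 R.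
set h := (2 * pi - a) / 2; set x := t - _.
have hI : h \in `[0, pi] by rewrite in_itv/= /h; apply/andP; split; lra.
rewrite -(cos_norm x); have xb : `|x| <= pi + a / 2.
  by rewrite ler_norml /x; apply/andP; split; lra.
have -> : (a < t < 2 * pi) = (`|x| < h).
  rewrite ltr_norml /x /h; apply/idP/idP => /andP[? ?]; apply/andP; split; lra.
have [xp|px] := leP `|x| pi.
  by rewrite ltr_cos// in_itv/= normr_ge0.
have -> : cos `|x| = cos (2 * pi - `|x|).
  by rewrite cosB mulr_natl cos2pi sin2pi mul1r mul0r addr0.
rewrite ltr_cos// ?in_itv/=; last by apply/andP; split; lra.
by rewrite /h; apply/idP/idP => ?; lra.
Qed.

Lemma measurable_comp_continuous d (T : measurableType d) (D : set T) (f : R -> R) (g : T -> R) :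
  continuous f -> measurable_fun D g -> measurable_fun D (fun x => f (g x)).
Proof. by move=> cf mg; apply: (measurableT_comp _ mg); exact: continuous_measurable_fun. Qed.

(** Smooth steps of cos (t - t0) approximate the indicators of arcs. Only
    these test functions occur, which keeps the uniqueness of traces and the
    regularity of functions on the circle elementary. *)
Lemma ae_zero_circle (F : R -> R) : L2 mu `[0, 2 * pi] F ->
  (forall (f : R -> R) t0, (forall n, diffn n f) ->
    \int[mu]_(t in `[0, 2 * pi]) (F t * f (cos (t - t0))) = 0) ->
  {ae mu, forall t, `[0, 2 * pi]%classic t -> F t = 0}.
Proof.
move=> LF H; have iF := L2_int LF.
apply: ae_zero_segment => //.
  rewrite -[RHS](H (fun=> 1) 0 (fun n => diffn_cst n 1)).
  by apply: eq_Rintegral => t _; rewrite mulr1.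
move=> a a02; set y0 := cos ((2 * pi - a) / 2); set t0 := (a + 2 * pi) / 2.
have mcos : measurable_fun `[0, 2 * pi] (fun t : R => cos (t - t0)).
  apply: measurable_comp_continuous; first exact: continuous_cos.
  exact: measurable_funB.
pose phi n (t : R) := smooth_step (n%:R * (cos (t - t0) - y0)).
pose phi0 (t : R) : R := if 0 < cos (t - t0) - y0 then 1 else 0.
have mphi n : measurable_fun `[0, 2 * pi] (phi n).
  apply: measurable_comp_continuous; first exact: continuous_smooth_step.
  by apply: measurable_funM => //; apply: measurable_funB.
have mphi0 : measurable_fun `[0, 2 * pi] phi0.
  apply: measurable_fun_if => //.
  by apply: measurable_fun_ltr; [exact: measurable_cst|exact: measurable_funB].
have p1 n t : `[0, 2 * pi]%classic t -> `|phi n t| <= 1.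
  by move=> _; rewrite ger0_norm ?smooth_step_le1 ?smooth_step_ge0.
have pc t : `[0, 2 * pi]%classic t -> phi n t @[n --> \oo] --> phi0 t.
  by move=> _; exact: smooth_step_cvg.
have := Rintegral_cvg _ iF mphi mphi0 p1 pc => /(_ _)/wrap[//|cv].
have e0 : (fun n => \int[mu]_(t in `[0, 2 * pi]) (F t * phi n t)) = cst 0.
  apply/funext => n; apply: (H (fun y => smooth_step (n%:R * (y - y0)))) => k.
  apply: diffn_comp; first exact: diffn_smooth_step.
  apply: diffnM; first exact: diffn_cst.
  by apply: diffnD; [exact: diffn_id|exact: diffn_cst].
rewrite e0 in cv.
transitivity (\int[mu]_(t in `[0, 2 * pi]) (F t * phi0 t)); last first.
  by apply: (cvg_unique _ cv) => //; exact: cvg_cst.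
apply/esym; apply: Rintegral_eq_oo.
  by apply/measurable_oo_cc; apply: measurable_funM => //; case: LF.
move=> t /andP[tt0 tt1]; rewrite /phi0 subr_gt0 cos_gt_arc//; last by rewrite !ltW.
by rewrite tt1 andbT; case: ifP; rewrite ?mulr1 ?mulr0.
Qed.

(** Vanishes near the unit circle and tends to 1 inside, so that products with
    it are test functions. *)
Definition cutoff (n : nat) (x : plane) : R :=
  smooth_step (n.+1%:R * (1 - (x.1 ^+ 2 + x.2 ^+ 2)) - 1).

Lemma Ck_sqnorm k : Ck k (fun x : plane => x.1 ^+ 2 + x.2 ^+ 2).
Proof.
rewrite (_ : (fun _ => _) = (fun x : plane => x.1 * x.1 + x.2 * x.2)).
  by apply: CkD; apply: CkM; (exact: Ck_fst || exact: Ck_snd).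
by apply/funext => x; rewrite !expr2.
Qed.

Lemma Ck_cutoff k n : Ck k (cutoff n).
Proof.
apply: (Ck_comp (f := fun s => smooth_step (n.+1%:R * (1 - s) - 1))); last exact: Ck_sqnorm.
apply: diffn_comp; first exact: diffn_smooth_step.
apply: diffnD; last exact: diffn_cst; apply: diffnM; first exact: diffn_cst.
rewrite (_ : (fun t : R => 1 - t) = (fun t => 1 + (-1) * t)); last first.
  by apply/funext => t; ring.
apply: diffnD; first exact: diffn_cst.
by apply: diffnM; [exact: diffn_cst|exact: diffn_id].
Qed.

Lemma cutoff_bound n x : 0 <= cutoff n x <= 1.
Proof. by rewrite smooth_step_ge0 smooth_step_le1. Qed.

Lemma sqr_sum_le1 (x y : R) : x ^+ 2 + y ^+ 2 <= 1 -> -1 <= x <= 1 /\ -1 <= y <= 1.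
Proof. by move=> h; split; apply/andP; split; nra. Qed.

Lemma test_fun_cutoff (u : plane -> R) n : (forall k, Ck k u) ->
  test_fun (fun x => u x * cutoff n x).
Proof.
move=> Cu; split; first by move=> k; apply: CkM; [exact: Cu|exact: Ck_cutoff].
have n0 : (0 : R) < n.+1%:R by rewrite ltr0n.
exists [set x : plane | x.1 ^+ 2 + x.2 ^+ 2 <= 1 - n.+1%:R^-1]; split.
- apply: (@subclosed_compact plane _ (`[-1, 1]%classic `*` `[-1, 1]%classic)).
  + have -> : [set x : plane | x.1 ^+ 2 + x.2 ^+ 2 <= 1 - n.+1%:R^-1] =
       (fun x : plane => x.1 ^+ 2 + x.2 ^+ 2) @^-1` [set s : R | s <= 1 - n.+1%:R^-1] by [].
    apply: closed_comp; last exact: closed_le.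
    by move=> x _; exact: (Ck_continuous (Ck_sqnorm 0)).
  + by apply: compact_setX; exact: segment_compact.
  + move=> [x y] /= h; have nn : 0 <= n.+1%:R^-1 :> R by rewrite invr_ge0 ltW.
    have h1 : (x : R) ^+ 2 + (y : R) ^+ 2 <= 1.
      by apply: le_trans h _; rewrite gerBl.
    by have [hx hy] := sqr_sum_le1 h1; split; rewrite /= in_itv/=.
- move=> x /= h; rewrite /ball1 /= enorm_lt1; apply: le_lt_trans h _.
  by rewrite ltrBlDr ltrDl invr_gt0.
- move=> x /= /negP; rewrite -ltNge => h; rewrite /cutoff smooth_step_le0 ?mulr0//.
  rewrite subr_le0 -ler_pdivlMl// mulr1.
  by rewrite lerBlDr -lerBlDl ltW.
Qed.

Lemma cutoff_cvg x : ball1 x -> cutoff n x @[n --> \oo] --> (1 : R).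
Proof.
rewrite /ball1 /= enorm_lt1 => x1; rewrite /cutoff.
set y := 1 - _; have y0 : 0 < y by rewrite subr_gt0.
have h := @smooth_step_cvg R (y / 2); rewrite divr_gt0// in h.
apply: (@squeeze_cvgr _ _ _ _ (fun n => smooth_step (n%:R * (y / 2))) (cst 1)) => //; last exact: cvg_cst.
near=> n; rewrite smooth_step_le1 andbT; apply: smooth_step_homo.
have : 2 / y <= n%:R by near: n; exact: nbhs_infty_ger.
rewrite ler_pdivrMr// -[n.+1%:R]natr1; clearbody y => hn; nra.
Unshelve. all: by end_near. Qed.

End UniquenessOnIntervals.

Section UniquenessInTheBall.
Context {R : realType}.
Notation mu := (@lebesgue_measure R).
Notation mu2 := (@lebesgue_measure R \x @lebesgue_measure R)%E.
Notation plane := (R * R)%type.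

Import HBSimple HBNNSimple.
(** Isomorphic measure spaces have the same integrals. The plane carries two
    syntactically different sigma-algebra structures, between which the
    identity is such an isomorphism. *)
Lemma integral_rename d1 d2 (T1 : measurableType d1) (T2 : measurableType d2)
  (i : T2 -> T1) (j : T1 -> T2) (m1 : set T1 -> \bar R) (m2 : set T2 -> \bar R) (D : set T2) (f : T2 -> \bar R) :
  cancel i j -> cancel j i -> measurable_fun [set: T2] i -> measurable_fun [set: T1] j ->
  (forall A, m1 A = m2 (i @^-1` A)) ->
  (\int[m1]_(x in j @^-1` D) f (j x) = \int[m2]_(x in D) f x)%E.
Proof.
move=> ij ji mi mj mE.
have key (g1 : T1 -> \bar R) (g : T2 -> \bar R) : (forall x, g1 x = g (j x)) ->
   [set sintegral m1 h | h in [set h : {nnsfun T1 >-> R} | forall x, ((h x)%:E <= g1 x)%E]] =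
   [set sintegral m2 h | h in [set h : {nnsfun T2 >-> R} | forall x, ((h x)%:E <= g x)%E]].
  move=> gj; apply/seteqP; split=> _ [h /= hg <-].
  - have mh : measurable_fun [set: T2] (h \o i) by exact: measurableT_comp.
    have fh : finite_set (range (h \o i)).
      by apply: sub_finite_set (@fimfunP _ _ h) => _ [x _ <-]; exists (i x).
    have ph x : 0 <= (h \o i) x by exact: fun_ge0.
    pose k := HB.pack_for {nnsfun T2 >-> R} (h \o i) (isMeasurableFun.Build _ _ _ _ _ mh)
      (FiniteImage.Build _ _ _ fh) (isNonNegFun.Build _ _ _ ph).
    exists k => [x /=|]; first by rewrite -{2}(ij x) -gj; exact: hg.
    rewrite /sintegral; apply: eq_fsbigr => x _; rewrite mE; congr (_ * m2 _)%E.
  - have mh : measurable_fun [set: T1] (h \o j) by exact: measurableT_comp.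
    have fh : finite_set (range (h \o j)).
      by apply: sub_finite_set (@fimfunP _ _ h) => _ [x _ <-]; exists (j x).
    have ph x : 0 <= (h \o j) x by exact: fun_ge0.
    pose k := HB.pack_for {nnsfun T1 >-> R} (h \o j) (isMeasurableFun.Build _ _ _ _ _ mh)
      (FiniteImage.Build _ _ _ fh) (isNonNegFun.Build _ _ _ ph).
    exists k => [x /=|]; first by rewrite gj; exact: hg.
    rewrite /sintegral; apply: eq_fsbigr => x _; rewrite mE; congr (_ * m2 _)%E.
    by apply/funext => y /=; rewrite ij.
have pE : (fun x => f (j x)) \_ (j @^-1` D) = (f \_ D)%E \o j.
  by apply/funext => x; rewrite /= !patchE; congr (if _ then _ else _); apply/idP/idP; rewrite !inE.
rewrite /integral pE; congr (ereal_sup _ - ereal_sup _)%E.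
  by apply: key => x; rewrite !funeposE.
by apply: key => x; rewrite !funenegE.
Qed.

Lemma integral_leb2 (D : set plane) (f : plane -> \bar R) : (\int[leb2]_(x in D) f x = \int[mu2]_(x in D) f x)%E.
Proof.
apply: (@integral_rename _ _ (R * R)%type (measurableTypeR R * measurableTypeR R)%type id id leb2 mu2 D f) => //.
Qed.
Lemma bintE (f : plane -> R) : bint f = \int[mu2]_(x in ball1) f x.
Proof. by rewrite /bint /Rintegral; congr fine; exact: integral_leb2. Qed.
Lemma L2_leb2 (D : set plane) (g : plane -> R) : L2 leb2 D g <-> L2 mu2 D g.
Proof. by split=> -[h1 h2]; (split; first exact: h1); move: h2; [rewrite (integral_leb2 D)|rewrite -(integral_leb2 D)]. Qed.

Lemma leb2_ball1_lty : (mu2 (ball1 : set plane) < +oo)%E.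
Proof.
have mb := @measurable_ball1 R.
apply: (@le_lt_trans _ _ (mu2 (`[(-1)%R, 1%R] `*` `[(-1)%R, 1%R])%classic)).
  apply: le_measure; rewrite ?inE//; first exact: measurableX.
  move=> [x y]; rewrite /ball1 /= enorm_lt1 /= => h.
  by have [hx hy] := sqr_sum_le1 (ltW h); split; rewrite /= in_itv/=.
rewrite product_measure1E//= !lebesgue_measure_itv/= lte_fin.
by case: ifP => // _; rewrite -?EFinD -?EFinM ltry.
Qed.

(** Products of smooth steps and the radial cutoff approximate the indicators
    of quadrants, which generate the Borel sets. *)
Lemma ae_zero_ball (g : plane -> R) : L2 leb2 ball1 g ->
  (forall phi, test_fun phi -> bint (fun x => g x * phi x) = 0) ->
  {ae mu2, forall x, ball1 x -> g x = 0}.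
Proof.
move=> Lg H; have mb := @measurable_ball1 R.
have ig : mu2.-integrable ball1 (EFin \o g).
  apply: (@L2_integrable _ _ R mu2 ball1 g mb).
    exact: leb2_ball1_lty.
  by apply/L2_leb2.
have mg : measurable_fun ball1 g by case: Lg.
have quad a c : \int[mu2]_(x in ball1) (g x * (if (a < x.1) && (c < x.2) then 1 else 0)) = 0.
  pose phi n (x : plane) := smooth_step (n%:R * (x.1 - a)) * smooth_step (n%:R * (x.2 - c)) * cutoff n x.
  have Cphi n k : Ck k (fun x : plane => smooth_step (n%:R * (x.1 - a)) * smooth_step (n%:R * (x.2 - c))).
    have sm (d : R) : forall k, diffn k (fun s : R => smooth_step (n%:R * (s - d))).
      move=> j; apply: diffn_comp; first exact: diffn_smooth_step.
      apply: diffnM; first exact: diffn_cst.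
      by apply: diffnD; [exact: diffn_id|exact: diffn_cst].
    apply: CkM.
      exact: (Ck_comp (sm a k.+1) (Ck_fst k)).
    exact: (Ck_comp (sm c k.+1) (Ck_snd k)).
  have mphi n : measurable_fun ball1 (phi n).
    apply: measurable_funTS; apply: measurable_funM; [apply: measurable_funM|];
      apply: measurable_comp_continuous; try exact: continuous_smooth_step.
    - by apply: measurable_funM => //; apply: measurable_funB.
    - by apply: measurable_funM => //; apply: measurable_funB.
    - apply: measurable_funB => //; apply: measurable_funM => //; apply: measurable_funB => //.
      by apply: measurable_funD; apply: measurable_funX.
  pose phi0 (x : plane) : R := if (a < x.1) && (c < x.2) then 1 else 0.
  have mphi0 : measurable_fun ball1 phi0.
    apply: measurable_funTS; apply: measurable_fun_ifT => //.
    by apply: measurable_and; apply: measurable_fun_ltr => //; exact: measurable_cst.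
  have p1 n x : ball1 x -> `|phi n x| <= 1.
    move=> _; have /andP[c0 c1] := cutoff_bound n x.
    have := smooth_step_ge0 (n%:R * (x.1 - a)); have := smooth_step_le1 (n%:R * (x.1 - a)).
    have := smooth_step_ge0 (n%:R * (x.2 - c)); have := smooth_step_le1 (n%:R * (x.2 - c)).
    rewrite /phi => h1 h2 h3 h4; rewrite ger0_norm ?mulr_ge0//.
    by rewrite mulr_ile1 ?mulr_ge0// mulr_ile1.
  have pc x : ball1 x -> phi n x @[n --> \oo] --> phi0 x.
    move=> bx; have -> : phi0 x = (if 0 < x.1 - a then 1 else 0) * (if 0 < x.2 - c then 1 else 0) * 1.
      by rewrite /phi0 !subr_gt0; case: ifP; case: ifP; case: ifP; rewrite ?mulr1 ?mulr0 ?mul0r//=;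
         move=> -> ->.
    apply: cvgM; last exact: cutoff_cvg.
    by apply: cvgM; exact: smooth_step_cvg.
  have cv := @Rintegral_cvg _ (measurableTypeR R * measurableTypeR R)%type R mu2 ball1 g phi phi0 mb ig mphi mphi0 p1 pc.
  have e0 : (fun n => \int[mu2]_(x in ball1) (g x * phi n x)) = cst 0.
    by apply/funext => n; apply: H; exact: test_fun_cutoff.
  rewrite e0 in cv.
  by apply/esym; apply: (cvg_unique _ _ cv) => //; exact: cvg_cst.
pose f (x : plane) : R := (g \_ ball1) x.
have if_ : mu2.-integrable setT (EFin \o f).
  by have := ig; rewrite integrable_mkcond// restrict_EFin.
have mf : measurable_fun [set: plane] f by apply/measurable_EFinP; exact: measurable_int if_.
have icond (P : plane -> bool) : measurable_fun setT P ->
    mu2.-integrable setT (fun x => (if P x then f x else 0)%:E).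
  move=> mP; apply: le_integrable if_ => //.
    by apply/measurable_EFinP; apply: measurable_fun_ifT.
  by move=> x _ /=; case: ifP => // _; rewrite normr0 lee_fin.
have quad' a c : (\int[mu2]_x (if (a < x.1)%R && (c < x.2)%R then f x else 0)%:E = 0)%E.
  have mP : measurable_fun [set: plane] (fun x : plane => (a < x.1) && (c < x.2)).
    by apply: measurable_and; apply: measurable_fun_ltr => //; exact: measurable_cst.
  rewrite -[LHS]fineK; last exact: (integrable_fin_num _ (icond _ mP)).
  rewrite -[RHS]/((0 : R)%:E) -(quad a c) [X in _ = X%:E]Rintegral_mkcond; congr EFin.
  apply: eq_Rintegral => x _; rewrite /f !patchE.
  by case: (x \in ball1); case: ifP; rewrite ?mulr1 ?mulr0.
have mray (c : R) : measurable_fun [set: plane] (fun x : plane => c < x.2).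
  by apply: measurable_fun_ltr => //; exact: measurable_cst.
have small (x : plane) : f x != 0 -> (-2 < x.1) && (-2 < x.2).
  rewrite /f patchE; case: ifPn => [|]; last by rewrite eqxx.
  rewrite inE /ball1 /= enorm_lt1 => h _; have := sqr_ge0 x.1; have := sqr_ge0 x.2.
  by move=> *; apply/andP; split; nra.
have stage1 c A : measurable A -> (\int[mu2]_(x in fst @^-1` A) (if (c < x.2)%R then f x else 0)%:E = 0)%E.
  move=> mA.
  apply: (@dynkin_integral _ _ (measurableTypeR R) _ R mu2 _ fst (@RGenOInfty.G R)) => //.
  - exact: icond (mray c).
  - exact: RGenOInfty.measurableE.
  - exact: RGenOInfty_setI.
  - rewrite -[RHS](quad' (-2) c); apply: eq_integral => x _.
    have [->|/small/andP[-> _]//] := eqVneq (f x) 0.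
    by rewrite !if_same.
  - move=> _ [a ->]; rewrite -[RHS](quad' a c) integral_mkcond; apply: eq_integral => x _.
    rewrite patchE; have -> : (x \in fst @^-1` `]a, +oo[) = (a < x.1).
      by apply/idP/idP; rewrite inE/= in_itv/= andbT.
    by case: (a < x.1); case: (c < x.2).
have stage2 A B : measurable A -> measurable B ->
   (\int[mu2]_(x in A `*` B) (f x)%:E = 0)%E.
  move=> mA mB.
  have mPA : measurable_fun [set: plane] (fun x : plane => x.1 \in A).
    apply: (measurable_fun_bool true); rewrite setTI.
    rewrite (_ : _ @^-1` _ = (fst : plane -> R) @^-1` (A : set R)); last by apply/seteqP; split=> x /= => [/set_mem|/mem_set].
    by rewrite -[X in measurable X]setTI; exact: measurable_fst.
  transitivity (\int[mu2]_(x in snd @^-1` B) (if x.1 \in A then f x else 0)%:E)%E.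
    rewrite integral_mkcond [RHS]integral_mkcond; apply: eq_integral => x _.
    rewrite !patchE in_setX; have -> : (x \in snd @^-1` B) = (x.2 \in B).
      by apply/idP/idP; rewrite !inE.
    by case: (x.1 \in A); case: (x.2 \in B).
  apply: (@dynkin_integral _ _ (measurableTypeR R) _ R mu2 _ snd (@RGenOInfty.G R)) => //.
  - exact: icond mPA.
  - exact: RGenOInfty.measurableE.
  - exact: RGenOInfty_setI.
  - rewrite -[RHS](stage1 (-2) A)// [RHS]integral_mkcond; apply: eq_integral => x _.
    rewrite patchE; have -> : (x \in fst @^-1` A) = (x.1 \in A) by apply/idP/idP; rewrite !inE.
    have [->|/small/andP[_ ->]] := eqVneq (f x) 0; last by case: (x.1 \in A).
    by rewrite !if_same.
  - move=> _ [c ->]; rewrite -[RHS](stage1 c A)// integral_mkcond [RHS]integral_mkcond.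
    apply: eq_integral => x _; rewrite !patchE.
    have -> : (x \in fst @^-1` A) = (x.1 \in A) by apply/idP/idP; rewrite !inE.
    have -> : (x \in snd @^-1` `]c, +oo[) = (c < x.2).
      by apply/idP/idP; rewrite inE/= in_itv/= andbT.
    by case: (x.1 \in A); case: (c < x.2).
apply: ae_zero_of_integrals => // A mA Ab.
transitivity (\int[mu2]_(x in idfun @^-1` A) (f x)%:E)%E.
  rewrite integral_mkcond [RHS]integral_mkcond; apply: eq_integral => x _.
  rewrite !patchE preimage_id /f patchE; case: ifPn => // /set_mem/Ab/mem_set -> //.
apply: (@dynkin_integral _ _ _ _ R mu2 _ idfun
  [set A `*` B | A in @measurable _ (measurableTypeR R) & B in @measurable _ (measurableTypeR R)]) => //.
- exact: measurable_id.
- exact: measurable_prod_measurableType.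
- move=> _ _ [A1 mA1 [B1 mB1 <-]] [A2 mA2 [B2 mB2 <-]].
  exists (A1 `&` A2); first exact: measurableI.
  exists (B1 `&` B2); first exact: measurableI.
  by rewrite setXI.
- by rewrite -setXTT; exact: stage2.
- by move=> _ [A1 mA1 [B1 mB1 <-]]; rewrite preimage_id; exact: stage2.
Qed.

End UniquenessInTheBall.

(** * Weak gradients on the disc *)

Section PlaneMeasurability.
Context {R : realType}.
Notation mu := (@lebesgue_measure R).
Notation mu2 := (@lebesgue_measure R \x @lebesgue_measure R)%E.
Notation plane := (R * R)%type.

Lemma open_measurable_plane (U : set plane) : open U -> measurable U.
Proof.
move=> oU.
pose box (q : rat * rat * nat) : set plane :=
  `]ratr q.1.1 - q.2.+1%:R^-1, ratr q.1.1 + q.2.+1%:R^-1[ `*` `]ratr q.1.2 - q.2.+1%:R^-1, ratr q.1.2 + q.2.+1%:R^-1[.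
have -> : U = \bigcup_(q in [set q | box q `<=` U]) box q.
  apply/seteqP; split=> [[x y] Uxy|z [q /= qU]]; last exact: qU.
  have /nbhs_ballP[e /= e0 eU] : nbhs (x, y) U by exact: open_nbhs_nbhs.
  have [k k2] : exists k : nat, 2 * k.+1%:R^-1 < e.
    exists (Num.truncn (2 / e)); rewrite ltr_pdivrMr ?ltr0n// mulrC -ltr_pdivrMr//.
    exact: truncnS_gt.
  have k0 : 0 < k.+1%:R^-1 :> R by rewrite invr_gt0 ltr0n.
  have near (s : R) : exists q : rat, s - k.+1%:R^-1 < ratr q < s + k.+1%:R^-1.
    have [|q] := @rat_in_itvoo R (s - k.+1%:R^-1) (s + k.+1%:R^-1).
      by move: k0; move: (k.+1%:R^-1) => u u0; lra.
    by rewrite in_itv/=; exists q.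
  have [q1 h1] := near x; have [q2 h2] := near y.
  exists (q1, q2, k); last first.
    rewrite /box /=; split; rewrite /= in_itv/=.
      by move: h1; move: (k.+1%:R^-1) => u /andP[? ?]; apply/andP; split; lra.
    by move: h2; move: (k.+1%:R^-1) => u /andP[? ?]; apply/andP; split; lra.
  move=> [s t] [/=]; rewrite !in_itv/= => hs ht; apply: eU; split=> /=.
    rewrite /ball/= ltr_norml; move: hs h1 k2; move: (k.+1%:R^-1) => u /andP[? ?] /andP[? ?] ?.
    by apply/andP; split; lra.
  rewrite /ball/= ltr_norml; move: ht h2 k2; move: (k.+1%:R^-1) => u /andP[? ?] /andP[? ?] ?.
  by apply/andP; split; lra.
rewrite bigcup_mkcond; apply: countable_bigcupT_measurable => [|q]; first exact: countableP.
by case: ifP => // _; exact: measurableX.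
Qed.

Lemma compact_measurable_plane (K : set plane) : compact K -> measurable K.
Proof.
move=> cK; rewrite -[K]setCK; apply: measurableC; apply: open_measurable_plane.
by apply: closed_openC; apply: compact_closed => //; exact: norm_hausdorff.
Qed.

Lemma continuous_measurable_plane (f : plane -> R) : continuous f -> measurable_fun setT f.
Proof.
move=> cf; apply: (@measurability _ _ plane R setT f (@RGenOInfty.G R) (RGenOInfty.measurableE R)).
move=> _ [_ [x ->] <-]; rewrite setTI; apply: open_measurable_plane.
by apply: open_comp => // t _; exact: cf.
Qed.

Lemma mball1 : measurable (ball1 : set (measurableTypeR R * measurableTypeR R)).
Proof. exact: measurable_ball1. Qed.

Lemma compact_cball1 : compact (cball1 : set plane).
Proof.
apply: (@subclosed_compact plane _ (`[-1, 1]%classic `*` `[-1, 1]%classic)).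
- have -> : (cball1 : set plane) =
     (fun x : plane => x.1 ^+ 2 + x.2 ^+ 2) @^-1` [set s : R | s <= 1].
    by apply/seteqP; split=> x /=; rewrite /cball1 /= enorm_le1.
  apply: closed_comp; last exact: closed_le.
  by move=> x _; exact: (Ck_continuous (Ck_sqnorm 0)).
- by apply: compact_setX; exact: segment_compact.
- move=> [x y] /=; rewrite /cball1 /= enorm_le1 => h.
  by have [hx hy] := sqr_sum_le1 h; split; rewrite /= in_itv/=.
Qed.

Lemma ball1_cball1 : ball1 `<=` (cball1 : set plane).
Proof. by move=> x; rewrite /ball1 /cball1 /=; exact: ltW. Qed.

Lemma bounded_cball1 (f : plane -> R) : {within cball1, continuous f} ->
  exists2 M, 0 <= M & forall x, cball1 x -> `|f x| <= M.
Proof.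
move=> cf; have := @continuous_compact _ _ f cball1 cf compact_cball1.
move=> /compact_bounded[M [_ hM]]; exists (`|M| + 1); first by rewrite addr_ge0.
move=> x cx; apply: (hM (`|M| + 1)); last by exists x.
by rewrite ltr_pwDr// ler_norm.
Qed.

Lemma bounded_ball1 (f : plane -> R) : continuous f ->
  exists2 M, 0 <= M & forall x, ball1 x -> `|f x| <= M.
Proof.
move=> cf; have [M M0 h] := bounded_cball1 (continuous_subspaceT cf).
by exists M => // x /ball1_cball1; exact: h.
Qed.

Lemma L2_continuous_mul (f v : plane -> R) : continuous f -> L2 mu2 ball1 v ->
  L2 mu2 ball1 (fun x => v x * f x).
Proof.
move=> cf Lv; have [M _ hM] := bounded_ball1 cf.
have h : L2 mu2 ball1 (fun x => f x * v x).
  apply: (L2_mulr_bounded (M := M)) => //; first exact: measurable_ball1.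
  by apply: measurable_funTS; exact: continuous_measurable_plane.
by apply: L2_eq h => x _; rewrite mulrC.
Qed.

Lemma L2_ball1_int (v : plane -> R) : L2 mu2 ball1 v -> mu2.-integrable ball1 (EFin \o v).
Proof. exact: (L2_integrable mball1 leb2_ball1_lty). Qed.

End PlaneMeasurability.

Section CauchySchwarz.
Context {d} {T : measurableType d} {R : realType}.
Variable m : {measure set T -> \bar R}.
Implicit Types (D : set T) (f g : T -> R).

Lemma cauchy_schwarz D f g : measurable D -> L2 m D f -> L2 m D g ->
  (\int[m]_(x in D) (f x * g x)) ^+ 2 <=
  \int[m]_(x in D) (f x ^+ 2) * \int[m]_(x in D) (g x ^+ 2).
Proof.
move=> mD Lf Lg.
have iff := L2_sqr_integrable mD Lf; have igg := L2_sqr_integrable mD Lg.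
have ifg := L2M mD Lf Lg.
set A := \int[m]_(x in D) (f x ^+ 2); set B := \int[m]_(x in D) (g x ^+ 2).
set C := \int[m]_(x in D) (f x * g x).
have A0 : 0 <= A by apply: Rintegral_ge0 => x _; exact: sqr_ge0.
have B0 : 0 <= B by apply: Rintegral_ge0 => x _; exact: sqr_ge0.
have q s t : 0 <= s ^+ 2 * A + 2 * (s * t) * C + t ^+ 2 * B.
  have -> : s ^+ 2 * A + 2 * (s * t) * C + t ^+ 2 * B =
      \int[m]_(x in D) (s * f x + t * g x) ^+ 2.
    rewrite /A /B /C -!RintegralZl// -?RintegralD//.
    - by apply: eq_Rintegral => x _; ring.
    - exact: (integrableD mD (integrableZl mD (s ^+ 2) iff) (integrableZl mD (2 * (s * t)) ifg)).
    - exact: (integrableZl mD (t ^+ 2) igg).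
    - exact: (integrableZl mD (s ^+ 2) iff).
    - exact: (integrableZl mD (2 * (s * t)) ifg).
  by apply: Rintegral_ge0 => x _; exact: sqr_ge0.
have := q B (- C); have := q C (- A); have := q 1 1; have := q 1 (-1).
move: (A) (B) (C) A0 B0 q => a b c a0 b0 q h1 h2 h3 h4.
have [a00|a1] := eqVneq a 0; last first.
  have ap : 0 < a by rewrite lt_def a1.
  rewrite -(ler_pM2l ap); nra.
have [b00|b1] := eqVneq b 0; last first.
  have bp : 0 < b by rewrite lt_def b1.
  rewrite -(ler_pM2l bp); nra.
by move: h1 h2; rewrite a00 b00; move=> ? ?; nra.
Qed.

(** Strong convergence in L2 implies convergence of integrals against a fixed
    function, by the Cauchy-Schwarz inequality. *)
Lemma L2_cvg_mulr D (f : nat -> T -> R) f0 g : measurable D ->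
  (forall n, L2 m D (f n)) -> L2 m D f0 -> L2 m D g ->
  \int[m]_(x in D) ((f n x - f0 x) ^+ 2) @[n --> \oo] --> (0 : R) ->
  \int[m]_(x in D) (f n x * g x) @[n --> \oo] --> \int[m]_(x in D) (f0 x * g x).
Proof.
move=> mD Lf L0 Lg cv.
have sub n : \int[m]_(x in D) ((f n x - f0 x) * g x) =
   \int[m]_(x in D) (f n x * g x) - \int[m]_(x in D) (f0 x * g x).
  rewrite -RintegralB//; [|exact: L2M|exact: L2M].
  by apply: eq_Rintegral => x _; rewrite mulrBl.
apply/cvgrPdist_le => e e0.
set B := \int[m]_(x in D) (g x ^+ 2).
have B0 : 0 <= B by apply: Rintegral_ge0 => x _; exact: sqr_ge0.
have e2 : 0 < e ^+ 2 / (B + 1) by rewrite divr_gt0 ?exprn_gt0//; lra.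
move/cvgrPdist_le : cv => /(_ _ e2); apply: filterS => n.
rewrite sub0r normrN ger0_norm; last by apply: Rintegral_ge0 => x _; exact: sqr_ge0.
move=> h; rewrite distrC -sub -ler_sqr ?nnegrE//; last exact: ltW.
rewrite real_normK ?num_real//.
apply: (le_trans (cauchy_schwarz mD (L2_subr mD (Lf n) L0) Lg)); rewrite -/B.
apply: (@le_trans _ _ (e ^+ 2 / (B + 1) * B)); first by rewrite ler_wpM2r.
rewrite -mulrA ler_piMr ?sqr_ge0// mulrC ler_pdivrMr; lra.
Qed.

End CauchySchwarz.

Section WeakGradientUniqueness.
Context {R : realType}.
Notation mu := (@lebesgue_measure R).
Notation mu2 := (@lebesgue_measure R \x @lebesgue_measure R)%E.
Notation plane := (R * R)%type.
Implicit Types (v : plane -> R) (g : plane -> plane).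

Lemma bintB f1 f2 : L2 mu2 ball1 f1 -> L2 mu2 ball1 f2 ->
  bint (fun x => f1 x - f2 x) = bint f1 - bint f2.
Proof.
move=> L1 L2; rewrite !bintE.
exact: (RintegralB mball1 (L2_ball1_int L1) (L2_ball1_int L2)).
Qed.

Lemma bintD f1 f2 : L2 mu2 ball1 f1 -> L2 mu2 ball1 f2 ->
  bint (fun x => f1 x + f2 x) = bint f1 + bint f2.
Proof.
move=> L1 L2; rewrite !bintE.
exact: (RintegralD mball1 (L2_ball1_int L1) (L2_ball1_int L2)).
Qed.

Lemma weak_gradient_unique v g g' : weak_gradient v g -> weak_gradient v g' ->
  {ae mu2, forall x, ball1 x -> g x = g' x}.
Proof.
move=> [/L2_leb2 g1 /L2_leb2 g2 wg] [/L2_leb2 g1' /L2_leb2 g2' wg'].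
have mb := @mball1 R.
have h1 : {ae mu2, forall x, ball1 x -> (g x).1 - (g' x).1 = 0}.
  apply: ae_zero_ball; first by apply/L2_leb2; exact: L2_subr mb g1 g1'.
  move=> phi tphi; have cphi := Ck_continuous (tphi.1 0).
  have [e _] := wg _ tphi; have [e' _] := wg' _ tphi.
  under [X in bint X]funext => x do rewrite mulrBl.
  rewrite bintB; [|exact: L2_continuous_mul|exact: L2_continuous_mul].
  by apply/eqP; rewrite subr_eq0 -eqr_opp -e -e'.
have h2 : {ae mu2, forall x, ball1 x -> (g x).2 - (g' x).2 = 0}.
  apply: ae_zero_ball; first by apply/L2_leb2; exact: L2_subr mb g2 g2'.
  move=> phi tphi; have cphi := Ck_continuous (tphi.1 0).
  have [_ e] := wg _ tphi; have [_ e'] := wg' _ tphi.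
  under [X in bint X]funext => x do rewrite mulrBl.
  rewrite bintB; [|exact: L2_continuous_mul|exact: L2_continuous_mul].
  by apply/eqP; rewrite subr_eq0 -eqr_opp -e -e'.
move: h1 h2; apply: (@filterS2 _ (almost_everywhere mu2)) => x e1 e2 bx; rewrite [g x]surjective_pairing [g' x]surjective_pairing.
by congr pair; apply/eqP; rewrite -subr_eq0 ?(e1 bx) ?(e2 bx).
Qed.

Lemma grad_weak v : H1 v -> weak_gradient v (grad v).
Proof. by move=> [_ [g wg]]; rewrite /grad; apply: xgetPex; exists g. Qed.

Lemma enorm_sqr (x : plane) : enorm x ^+ 2 = x.1 ^+ 2 + x.2 ^+ 2.
Proof. by rewrite /enorm sqr_sqrtr// addr_ge0// sqr_ge0. Qed.

Lemma L2_enorm_sqr g : L2 mu2 ball1 (fun x => (g x).1) -> L2 mu2 ball1 (fun x => (g x).2) ->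
  mu2.-integrable ball1 (EFin \o (fun x => enorm (g x) ^+ 2)).
Proof.
move=> g1 g2; have mb := @mball1 R.
have h := integrableD mb (L2_sqr_integrable mb g1) (L2_sqr_integrable mb g2).
by apply: eq_integrable h => // x _ /=; rewrite enorm_sqr.
Qed.

(** Any computed weak gradient may be used in place of the chosen one. *)
Lemma bint_grad v g : weak_gradient v g -> H1 v ->
  bint (fun x => enorm (grad v x) ^+ 2) = bint (fun x => enorm (g x) ^+ 2).
Proof.
move=> wg Hv; have wv := grad_weak Hv; have mb := @mball1 R.
have [/L2_leb2 g1 /L2_leb2 g2 _] := wg; have [/L2_leb2 v1 /L2_leb2 v2 _] := wv.
rewrite !bintE /Rintegral; congr fine; apply: ae_eq_integral => //.
- exact: (measurable_int _ (L2_enorm_sqr v1 v2)).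
- exact: (measurable_int _ (L2_enorm_sqr g1 g2)).
- have := weak_gradient_unique wv wg; apply: (@filterS _ (almost_everywhere mu2)) => x h bx.
  by rewrite h.
Qed.

End WeakGradientUniqueness.

(** * Integrals in distorted polar coordinates *)

Section Coordinates.
Context {R : realType}.
Notation mu := (@lebesgue_measure R).
Notation mu2 := (@lebesgue_measure R \x @lebesgue_measure R)%E.
Notation plane := (R * R)%type.

Lemma measurable_section_integral (A B : set R) (K : plane -> R) : measurable A -> measurable B ->
  mu2.-integrable (A `*` B) (EFin \o K) ->
  measurable_fun B (fun y => \int[mu]_(x in A) K (x, y)).
Proof.
move=> mA mB iK; have mAB : measurable (A `*` B) by exact: measurableX.
have := iK; rewrite integrable_mkcond// restrict_EFin => iK'.
have mG := measurable_fubini_G iK'; rewrite /fubini_G in mG.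
have mF : measurable_fun setT (fine \o (fun y => \int[mu]_x ((K \_ (A `*` B)) (x, y))%:E)%E).
  by apply: measurableT_comp.
apply: (@eq_measurable_fun _ _ _ _ _ (fine \o (fun y => \int[mu]_x ((K \_ (A `*` B)) (x, y))%:E)%E)).
  move=> y yB; rewrite /Rintegral [in RHS]integral_mkcond /=; congr fine.
  apply: eq_integral => x _; rewrite !patchE in_setX yB andbT.
  by case: ifP.
exact: measurable_funTS.
Qed.

Lemma integrable_rect_bounded (A B : set R) (K : plane -> R) (M : R) : measurable A -> measurable B ->
  (mu A < +oo)%E -> (mu B < +oo)%E -> measurable_fun (A `*` B) K ->
  (forall x y, A x -> B y -> `|K (x, y)| <= M) -> mu2.-integrable (A `*` B) (EFin \o K).
Proof.
move=> mA mB fA fB mK hM.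
have mA' : measurable (A : set (measurableTypeR R)) := mA.
have mB' : measurable (B : set (measurableTypeR R)) := mB.
apply: (integrable_rect_dominated (p := fun=> M) (q := fun=> 1)) => //.
- exact: (L2_integrable mA' fA (L2_cst M mA' fA)).
- exact: (L2_integrable mB' fB (L2_cst 1 mB' fB)).
- by move=> x y Ax By; rewrite normr1 mulr1 (le_trans (hM _ _ Ax By))// ler_norm.
Qed.

Section Twisted.
Variables (a : R) (psi rho : plane -> R) (delta : R).
Hypothesis delta_gt0 : 0 < delta.
Hypothesis mpsi : measurable_fun setT psi.
Hypothesis mrho : measurable_fun setT rho.
Hypothesis twist : forall r, 0 < r < 1 ->
    [/\ forall x y, x <= y -> prim x y (fun t => psi (r, t)) (fun t => rho (r, t)),
        forall x, delta <= rho (r, x), psi (r, a) = a & psi (r, a + 2 * pi) = a + 2 * pi].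
Let Q : set plane := `]0, 1[ `*` `[a, a + 2 * pi[.
Let P (q : plane) := polar (q.1, psi q).

Lemma measurable_twisted : measurable_fun setT P.
Proof.
apply: (measurableT_comp measurable_polar).
exact: (measurable_fun_pair (@measurable_fst _ _ _ _) mpsi).
Qed.

Lemma twisted_ball1 q : Q q -> ball1 (P q).
Proof.
move=> [/=]; rewrite in_itv/= => /andP[q0 q1] _.
by rewrite /ball1 /= /P (@enorm_polar _ (q.1, psi q))//= ltW.
Qed.

Lemma measurable_comp_twisted (F : plane -> R) : measurable_fun ball1 F ->
  measurable_fun Q (fun q => F (P q)).
Proof.
move=> mF; apply: (measurable_comp (F := ball1)) => //.
- exact: measurable_ball1.
- by move=> _ [q Qq <-]; exact: twisted_ball1.
- by apply: measurable_funTS; exact: measurable_twisted.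
Qed.

Lemma bint_coordinates (F K : plane -> R) : measurable_fun ball1 F ->
  (forall q, Q q -> K q = F (P q) * (q.1 * rho q)) ->
  mu2.-integrable Q (EFin \o K) ->
  bint F = \int[mu]_(x in `[a, a + 2 * pi[) \int[mu]_(r in `]0, 1[) K (r, x) /\
  bint F = \int[mu]_(r in `]0, 1[) \int[mu]_(x in `[a, a + 2 * pi[) K (r, x).
Proof.
move=> mF KE iK.
have e : bint F = \int[mu2]_(q in Q) K q.
  rewrite bintE /Rintegral; congr fine.
  have mF' : measurable_fun ball1 (EFin \o F) by apply/measurable_EFinP.
  rewrite (twisted_polar delta_gt0 mpsi mrho twist mF'); apply: eq_integral => q /set_mem Qq.
  by rewrite /= KE.
rewrite e; split; first exact: fubini_rect21.
exact: fubini_rect12.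
Qed.

Lemma L2_coordinates (F K : plane -> R) : measurable_fun ball1 F ->
  (forall q, Q q -> K q = F (P q) ^+ 2 * (q.1 * rho q)) ->
  mu2.-integrable Q (EFin \o K) -> L2 mu2 ball1 F.
Proof.
move=> mF KE iK; split => //.
have mF' : measurable_fun ball1 (EFin \o (fun x => F x ^+ 2)).
  by apply/measurable_EFinP; apply: measurable_funX.
rewrite (twisted_polar delta_gt0 mpsi mrho twist mF').
have mQ : measurable (Q : set (measurableTypeR R * measurableTypeR R)) by exact: measurableX.
rewrite (_ : (\int[_]_(q in _) _)%E = (\int[mu2]_(q in Q) (K q)%:E)%E).
  have := integrable_fin_num mQ iK; rewrite fin_numElt => /andP[_]; exact.
by apply: eq_integral => q /set_mem Qq; rewrite /= KE.
Qed.

End Twisted.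
End Coordinates.

(** * Traces on the circle *)

Section RadialConcentration.
Context {R : realType}.
Notation mu := (@lebesgue_measure R).
Notation mu2 := (@lebesgue_measure R \x @lebesgue_measure R)%E.
Notation plane := (R * R)%type.

Lemma bounded_segment (a b : R) (k : R -> R) : {within `[a, b], continuous k} ->
  exists2 M, 0 <= M & forall r, a <= r <= b -> `|k r| <= M.
Proof.
move=> ck; have := @continuous_compact _ _ k `[a, b]%classic ck (@segment_compact R a b).
move=> /compact_bounded[M [_ hM]]; exists (`|M| + 1); first by rewrite addr_ge0.
move=> x xab; apply: (hM (`|M| + 1)); first by rewrite ltr_pwDr// ler_norm.
by exists x => //=; rewrite in_itv.
Qed.

Definition radial_cutoff n (r : R) := smooth_step (n.+1%:R * (1 - r ^+ 2) - 1).
(** The derivative of [radial_cutoff], up to sign: a mass tending to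
    1 that concentrates at [r = 1]. *)
Definition radial_weight n (r : R) := 2 * n.+1%:R * r * flat 2 (n.+1%:R * (1 - r ^+ 2) - 1).

Lemma is_derive_smooth_step (y : R) : is_derive y 1 smooth_step (flat 2 y).
Proof.
have := @is_derive_flat R 0 y; rewrite mul0r subr0; exact.
Qed.

Lemma continuous_flat k : continuous (@flat R k).
Proof. by apply: diffn_continuous; exact: (diffn_flat 1 k). Qed.

Lemma flat_ge0 k (y : R) : 0 <= flat k y.
Proof.
rewrite /flat; case: ifP => // y0; rewrite mulr_ge0 ?expR_ge0//.
by rewrite exprn_ge0// invr_ge0 ltW.
Qed.

Lemma continuous_radial_weight n : continuous (radial_weight n).
Proof.
move=> r; rewrite /radial_weight; apply: cvgM.
  by apply: cvgM; [exact: cvg_cst|exact: cvg_id].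
apply: (@continuous_comp _ _ _ (fun x : R => n.+1%:R * (1 - x ^+ 2) - 1) (flat 2) r); last exact: continuous_flat.
apply: cvgB; last exact: cvg_cst; apply: cvgM; first exact: cvg_cst.
apply: cvgB; first exact: cvg_cst.
rewrite (_ : (fun x : R => x ^+ 2) = (fun x => x * x)); last by apply/funext => x; rewrite expr2.
by rewrite expr2; apply: cvgM; exact: cvg_id.
Qed.

Lemma prim_radial_cutoff n : prim 0 1 (radial_cutoff n) (fun r => - radial_weight n r).
Proof.
apply: prim_C1; last by move=> r; apply: cvgN; exact: continuous_radial_weight.
move=> r; rewrite /radial_cutoff /radial_weight.
have h1 : is_derive r 1 (fun r : R => n.+1%:R * (1 - r ^+ 2) - 1) (n.+1%:R * (- (2 * r))).
  apply: is_derive_eq; rewrite /GRing.scale/=; ring.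
have h2 := is_derive_smooth_step (n.+1%:R * (1 - r ^+ 2) - 1).
have h := @is_derive1_comp R smooth_step (fun r : R => n.+1%:R * (1 - r ^+ 2) - 1) r _ _ h2 h1.
apply: (is_derive_eq h); rewrite /GRing.scale/=; ring.
Qed.

Lemma prim_one_sub_sqr : prim (0 : R) 1 (fun r => 1 - r ^+ 2) (fun r => - (2 * r)).
Proof.
apply: prim_C1 => [r|].
  by apply: is_derive_eq; rewrite /GRing.scale/=; ring.
by move=> r; apply: cvgN; apply: cvgM; [exact: cvg_cst|exact: cvg_id].
Qed.

Lemma radial_cutoff_cutoff n r : radial_cutoff n r = cutoff n (r, 0).
Proof. by rewrite /radial_cutoff /cutoff /= expr0n /= addr0. Qed.

Lemma radial_mass_cvg :
  \int[mu]_(r in `[0, 1]) (2 * r * radial_cutoff n r) @[n --> \oo] --> (1 : R).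
Proof.
have c2 : continuous (fun r : R => 2 * r).
  by move=> r; apply: cvgM; [exact: cvg_cst|exact: cvg_id].
have i2 : mu.-integrable `[0, 1] (EFin \o (fun r : R => 2 * r)) by exact: continuous_integrable.
pose phi0 (r : R) : R := if r < 1 then 1 else 0.
have mphi0 : measurable_fun `[(0 : R), 1] phi0.
  by apply: measurable_funTS; apply: measurable_fun_ifT => //; apply: measurable_fun_ltr => //; exact: measurable_cst.
have := @Rintegral_cvg _ (measurableTypeR R) R mu `[0, 1]%classic (fun r : R => 2 * r) radial_cutoff phi0
  _ i2 _ mphi0 _ _.
have -> : \int[mu]_(x in `[0, 1]) (2 * x * phi0 x) = 1.
  transitivity (\int[mu]_(x in `[0, 1]) (2 * x : R)).
    apply: Rintegral_eq_oo => [|x /andP[x0 x1]]; last by rewrite /phi0 x1 mulr1.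
    by apply/measurable_oo_cc; apply: measurable_funM => //; apply: measurable_funM.
  have pr : prim (0 : R) 1 (fun r => r ^+ 2) (fun r => 2 * r).
    apply: prim_C1 => // r.
    by apply: is_derive_eq; rewrite /GRing.scale/=; ring.
  have := prim_diff pr (lexx 0) ler01 (lexx 1).
  by rewrite expr1n expr0n subr0.
apply => //.
- move=> n; have [_ _] := prim_L2 (prim_radial_cutoff n) => //.
  by have [] := prim_L2 (prim_radial_cutoff n).
- by move=> n r _; rewrite ger0_norm ?smooth_step_ge0 ?smooth_step_le1.
- move=> r /=; rewrite in_itv/= => /andP[r0 r1]; rewrite /phi0.
  have [r1'|r1'] := ltP r 1.
    under eq_fun do rewrite radial_cutoff_cutoff.
    apply: cutoff_cvg; rewrite /ball1 /= enorm_lt1 /= expr0n /= addr0.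
    by rewrite expr_lt1.
  rewrite (_ : (fun n => _) = cst 0); first exact: cvg_cst.
  apply/funext => n; rewrite /radial_cutoff.
  have -> : r = 1 by apply/eqP; rewrite eq_le r1.
  by rewrite expr1n subrr mulr0 sub0r smooth_step_le0// lerN10.
Qed.

Lemma smooth_step_nat_cvg : smooth_step n%:R @[n --> \oo] --> (1 : R).
Proof.
have := @smooth_step_cvg R 1; rewrite ltr01.
by under eq_fun do rewrite mulr1.
Qed.

Lemma radial_cutoff0 n : radial_cutoff n 0 = smooth_step n%:R.
Proof. by rewrite /radial_cutoff expr0n subr0 mulr1 -natr1 addrK. Qed.

Lemma radial_cutoff1 n : radial_cutoff n 1 = 0.
Proof. by rewrite /radial_cutoff expr1n subrr mulr0 sub0r smooth_step_le0// lerN10. Qed.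

Lemma integral_radial_weight n : \int[mu]_(r in `[0, 1]) radial_weight n r = smooth_step n%:R.
Proof.
have Lw : L2 mu `[0, 1] (radial_weight n).
  by apply: continuous_L2; apply: continuous_subspaceT; exact: continuous_radial_weight.
have := prim_diff (prim_radial_cutoff n) (lexx 0) ler01 (lexx 1).
rewrite radial_cutoff0 radial_cutoff1 sub0r -[X in _ = X -> _]opprK => /oppr_inj ->.
under [in RHS]eq_Rintegral => r _ do rewrite -mulN1r.
by rewrite RintegralZl//; [rewrite mulN1r opprK|exact: L2_int].
Qed.

(** A continuous function is within e of its value at 1 up to a multiple of
    1 - r^2, and the integral of 1 - r^2 against the weight tends to zero after
    integration by parts. *)
Lemma radial_concentration (k : R -> R) : {within `[0, 1], continuous k} ->
  \int[mu]_(r in `[0, 1]) (k r * radial_weight n r) @[n --> \oo] --> k 1.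
Proof.
move=> ck; have Lk := continuous_L2 ck.
have [M M0 hM] : exists2 M, 0 <= M & forall r, 0 <= r <= 1 -> `|k r| <= M.
  exact: bounded_segment ck.
have Lw n : L2 mu `[0, 1] (radial_weight n).
  by apply: continuous_L2; apply: continuous_subspaceT; exact: continuous_radial_weight.
have c0 := radial_cutoff0; have c1 := radial_cutoff1; have iw := integral_radial_weight.
have iw2 n : \int[mu]_(r in `[0, 1]) ((1 - r ^+ 2) * radial_weight n r) =
    smooth_step n%:R - \int[mu]_(r in `[0, 1]) (2 * r * radial_cutoff n r).
  have := prim_by_parts ler01 (prim_radial_cutoff n) prim_one_sub_sqr.
  rewrite c0 c1 mul0r expr0n subr0 mulr1 sub0r => h.
  have L1 : mu.-integrable `[0, 1] (EFin \o (fun r => (1 - r ^+ 2) * radial_weight n r)).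
    by apply: L2M => //; exact: prim_L2 prim_one_sub_sqr.
  have L2' : mu.-integrable `[0, 1] (EFin \o (fun r => 2 * r * radial_cutoff n r)).
    apply: L2M => //; last exact: prim_L2 (prim_radial_cutoff n).
    by apply: continuous_L2; apply: continuous_subspaceT => r; apply: cvgM; [exact: cvg_cst|exact: cvg_id].
  apply/eqP; rewrite eq_sym subr_eq -RintegralD//; apply/eqP.
  rewrite -[LHS]opprK -h -mulN1r -RintegralZl//.
    by apply: eq_Rintegral => r _; ring.
  have msk : measurable (`[0, 1]%classic : set (measurableTypeR R)) by [].
  have := integrableN (integrableD msk L1 L2').
  by apply: eq_integrable => // r _ /=; congr EFin; ring.
pose en n := smooth_step n%:R - \int[mu]_(r in `[0, 1]) (2 * r * radial_cutoff n r).
have en0 : en n @[n --> \oo] --> (0 : R).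
  by rewrite -(subrr (1 : R)); apply: cvgB; [exact: smooth_step_nat_cvg|exact: radial_mass_cvg].
apply/cvgrPdist_le => e e0; have e3 : 0 < e / 3 by lra.
have [C C0 hC] : exists2 C, 0 <= C & forall r, 0 <= r <= 1 -> `|k r - k 1| <= e / 3 + C * (1 - r ^+ 2).
  have [_ _ /cvgrPdist_le /(_ _ e3)] := (continuous_within_itvP k ltr01).1 ck.
  move=> /nbhs_ballP[d /= d0 hd]; exists (2 * M / d); first by rewrite divr_ge0 ?mulr_ge0// ltW.
  move=> r /andP[r0 r1]; have r2 : r ^+ 2 <= r by rewrite expr2 ler_piMl.
  have [rd|rd] := ltP (1 - d) r.
    have q : 0 <= 2 * M / d * (1 - r ^+ 2) by rewrite mulr_ge0 ?divr_ge0 ?mulr_ge0 ?(ltW d0)//; lra.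
    rewrite -[leLHS]addr0; apply: lerD => //.
    have [->|r1'] := eqVneq r 1; first by rewrite subrr normr0 ltW.
    rewrite distrC; apply: hd; last by rewrite lt_neqAle r1'.
    by rewrite /ball/= ger0_norm; lra.
  have : `|k r - k 1| <= 2 * M.
    rewrite (le_trans (ler_normB _ _))//.
    have := hM r; have := hM 1; rewrite r0 r1 ler01 lexx => /(_ isT) h1 /(_ isT) h2; lra.
  move/le_trans; apply; rewrite -[leLHS]add0r; apply: lerD; first exact: ltW.
  rewrite -[leLHS]mulr1 -!mulrA ler_wpM2l// ler_wpM2l// mulrC ler_pdivlMr//; lra.
have main n : `|\int[mu]_(r in `[0, 1]) (k r * radial_weight n r) - k 1 * smooth_step n%:R| <=
    e / 3 + C * en n.
  have i1 : mu.-integrable `[0, 1] (EFin \o (fun r => k r * radial_weight n r)) by exact: L2M.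
  have i2 : mu.-integrable `[0, 1] (EFin \o (fun r => (k r - k 1) * radial_weight n r)).
    by apply: L2M => //; apply: L2_subr => //; exact: L2_cst_segment.
  have i3 : mu.-integrable `[0, 1] (EFin \o (fun r => (e / 3 + C * (1 - r ^+ 2)) * radial_weight n r)).
    apply: L2M => //; apply: L2_addr => //; first exact: L2_cst_segment.
    by apply: L2_scale => //; exact: prim_L2 prim_one_sub_sqr.
  have -> : \int[mu]_(r in `[0, 1]) (k r * radial_weight n r) - k 1 * smooth_step n%:R =
      \int[mu]_(r in `[0, 1]) ((k r - k 1) * radial_weight n r).
    rewrite -iw -RintegralZl//; last exact: L2_int.
    rewrite -RintegralB//; first by apply: eq_Rintegral => r _; ring.
    exact: (integrableZl _ (k 1) (L2_int (Lw n))).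
  apply: (le_trans (le_normr_Rintegral _ i2)) => //.
  apply: (@le_trans _ _ (\int[mu]_(r in `[0, 1]) ((e / 3 + C * (1 - r ^+ 2)) * radial_weight n r))).
    apply: le_Rintegral => //; first by have := integrable_norm i2.
    move=> r /=; rewrite in_itv/= => r01; have /andP[r0 _] := r01.
    have w0 : 0 <= radial_weight n r by rewrite !mulr_ge0 ?flat_ge0 ?ler0n.
    by rewrite normrM (ger0_norm w0) ler_wpM2r// hC.
  have -> : \int[mu]_(r in `[0, 1]) ((e / 3 + C * (1 - r ^+ 2)) * radial_weight n r) =
     e / 3 * smooth_step n%:R + C * en n.
    have iq : mu.-integrable `[0, 1] (EFin \o (fun r => (1 - r ^+ 2) * radial_weight n r)).
      by apply: L2M => //; exact: prim_L2 prim_one_sub_sqr.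
    have iwn := L2_int (Lw n).
    have msk : measurable (`[0, 1]%classic : set (measurableTypeR R)) by [].
    rewrite -iw /en -iw2 -(RintegralZl (e / 3) msk iwn) -(RintegralZl C msk iq).
    rewrite -(RintegralD msk (integrableZl msk (e / 3) iwn) (integrableZl msk C iq)).
    by apply: eq_Rintegral => r _; ring.
  by rewrite lerD2r ler_piMr ?smooth_step_le1// ltW.
have h1 : \forall n \near \oo, C * en n <= e / 3.
  have : C * en n @[n --> \oo] --> (0 : R) by rewrite -(mulr0 C); apply: cvgM => //; exact: cvg_cst.
  move/cvgrPdist_le => /(_ _ e3); apply: filterS => n; rewrite sub0r normrN; apply: le_trans.
  exact: ler_norm.
have h2 : \forall n \near \oo, `|k 1 - k 1 * smooth_step n%:R| <= e / 3.
  have : k 1 * smooth_step n%:R @[n --> \oo] --> k 1.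
    by rewrite -[X in _ --> X]mulr1; apply: cvgM; [exact: cvg_cst|exact: smooth_step_nat_cvg].
  by move/cvgrPdist_le => /(_ _ e3).
apply: filterS2 h1 h2 => n e1 e2.
have := main n; rewrite distrC => e4.
have -> : k 1 - \int[mu]_(r in `[0, 1]) (k r * radial_weight n r) =
  (k 1 - k 1 * smooth_step n%:R) + (k 1 * smooth_step n%:R - \int[mu]_(r in `[0, 1]) (k r * radial_weight n r)) by ring.
apply: (le_trans (ler_normD _ _)); lra.
Qed.

End RadialConcentration.

Section TraceUniqueness.
Context {R : realType}.
Notation mu := (@lebesgue_measure R).
Notation mu2 := (@lebesgue_measure R \x @lebesgue_measure R)%E.
Notation plane := (R * R)%type.
Implicit Types (u v w tau : plane -> R).

Lemma within_comp (T1 T2 T3 : topologicalType) (A : set T2) (B : set T1) (f : T2 -> T3) (g : T1 -> T2) :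
  {within A, continuous f} -> continuous g -> (forall x, B x -> A (g x)) ->
  {within B, continuous (f \o g)}.
Proof.
move=> /subspace_continuousP cf cg gAB; apply/subspace_continuousP => x Bx.
apply: (@cvg_comp _ _ _ g f _ (within A (nbhs (g x)))); last exact: cf (gAB _ Bx).
move=> U; rewrite /within/= => hU.
have h : nbhs x (fun y => A (g y) -> U (g y)) by exact: (cg x _ hU).
by apply: filterS h => y h By; apply: h; exact: gAB.
Qed.

Lemma continuous_comp_within (T1 T2 T3 : topologicalType) (A : set T2) (f : T2 -> T3) (g : T1 -> T2) :
  {within A, continuous f} -> continuous g -> (forall x, A (g x)) -> continuous (fun x => f (g x)).
Proof.
move=> /subspace_continuousP cf cg gA x.
apply: (@cvg_comp _ _ _ g f _ (within A (nbhs (g x)))); last exact: cf (gA _).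
move=> U; rewrite /within/= => hU.
have h : nbhs x (fun y => A (g y) -> U (g y)) by exact: (cg x _ hU).
by apply: filterS h => y; apply; exact: gA.
Qed.

Lemma within_mul (T : topologicalType) (A : set T) (f g : T -> R) :
  {within A, continuous f} -> {within A, continuous g} -> {within A, continuous (fun x => f x * g x)}.
Proof. by move=> cf cg x; apply: cvgM; [exact: cf|exact: cg]. Qed.

Lemma continuous_pair (T1 T2 T3 : topologicalType) (f : T1 -> T2) (g : T1 -> T3) :
  continuous f -> continuous g -> continuous (fun x => (f x, g x)).
Proof.
move=> cf cg x; exact: (@cvg_pair _ _ _ (nbhs x) (nbhs (f x)) (nbhs (g x)) _ _ _ f g (cf x) (cg x)).
Qed.

Lemma continuous_fst_plane : continuous (fun q : plane => q.1).
Proof. by move=> q; exact: cvg_fst. Qed.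

Lemma continuous_snd_plane : continuous (fun q : plane => q.2).
Proof. by move=> q; exact: cvg_snd. Qed.

Lemma pd1E u (x : plane) (d : R) : is_derive x.1 (1 : R) (fun t : R => u (t, x.2)) d -> pd1 u x = d.
Proof. by move=> /is_derive_slice1 h; rewrite /pd1 derive_val. Qed.

Lemma pd2E u (x : plane) (d : R) : is_derive x.2 (1 : R) (fun t : R => u (x.1, t)) d -> pd2 u x = d.
Proof. by move=> /is_derive_slice2 h; rewrite /pd2 derive_val. Qed.

Lemma continuous_polar : continuous (@polar R).
Proof.
apply: continuous_pair => q.
  apply: cvgM; first exact: cvg_fst.
  by apply: (@continuous_comp _ _ _ (fun q : plane => q.2) (@cos R)); [exact: cvg_snd|exact: continuous_cos].
apply: cvgM; first exact: cvg_fst.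
by apply: (@continuous_comp _ _ _ (fun q : plane => q.2) (@sin R)); [exact: cvg_snd|exact: continuous_sin].
Qed.

Lemma continuous_ray (t : R) : continuous (fun r : R => polar (r, t)).
Proof.
move=> r; apply: (@continuous_comp _ _ _ (fun r : R => (r, t)) (@polar R) r); last exact: continuous_polar.
by apply: continuous_pair => s; [exact: cvg_id|exact: cvg_cst].
Qed.

Lemma continuous_circ : continuous (@circ R).
Proof. by apply: continuous_pair; [exact: continuous_cos|exact: continuous_sin]. Qed.

Lemma polar_cball1 (r t : R) : 0 <= r <= 1 -> cball1 (polar (r, t)).
Proof. by move=> /andP[r0 r1]; rewrite /cball1 /= enorm_polar. Qed.

Lemma cball1_circ (t : R) : cball1 (circ t).
Proof. by rewrite /cball1 /= enorm_le1 /circ /= cos2Dsin2. Qed.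

(** The divergence of the vector field [x u]. *)
Definition euler_div u (x : plane) := 2 * u x + (x.1 * pd1 u x + x.2 * pd2 u x).

Lemma pd1_radial u n x : Ck 1 u ->
  pd1 (fun x => x.1 * u x * cutoff n x) x =
  (u x + x.1 * pd1 u x) * cutoff n x -
  x.1 ^+ 2 * u x * (2 * n.+1%:R * flat 2 (n.+1%:R * (1 - (x.1 ^+ 2 + x.2 ^+ 2)) - 1)).
Proof.
move=> Cu; case: x => x1 x2; have [h _ _ _ _] := Ck_pd Cu; apply: pd1E => /=.
have hu := h (x1, x2); rewrite /= in hu; set y := n.+1%:R * _ - 1.
have h1 : is_derive x1 1 (fun t : R => n.+1%:R * (1 - (t ^+ 2 + x2 ^+ 2)) - 1) (n.+1%:R * (- (2 * x1))).
  apply: is_derive_eq; rewrite /GRing.scale/=; ring.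
have h3 := @is_derive1_comp R smooth_step (fun t : R => n.+1%:R * (1 - (t ^+ 2 + x2 ^+ 2)) - 1) x1 _ _
  (is_derive_smooth_step y) h1.
have h4 : is_derive x1 1 (fun t : R => t * u (t, x2) * cutoff n (t, x2))
    (x1 * u (x1, x2) * (flat 2 y * (n.+1%:R * (- (2 * x1)))) +
     cutoff n (x1, x2) * (x1 * pd1 u (x1, x2) + u (x1, x2) * 1)).
  exact: (is_deriveM (is_deriveM (is_derive_id x1 1) hu) h3).
apply: (is_derive_eq h4); ring.
Qed.

Lemma pd2_radial u n x : Ck 1 u ->
  pd2 (fun x => x.2 * u x * cutoff n x) x =
  (u x + x.2 * pd2 u x) * cutoff n x -
  x.2 ^+ 2 * u x * (2 * n.+1%:R * flat 2 (n.+1%:R * (1 - (x.1 ^+ 2 + x.2 ^+ 2)) - 1)).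
Proof.
move=> Cu; case: x => x1 x2; have [_ h _ _ _] := Ck_pd Cu; apply: pd2E => /=.
have hu := h (x1, x2); rewrite /= in hu; set y := n.+1%:R * _ - 1.
have h1 : is_derive x2 1 (fun t : R => n.+1%:R * (1 - (x1 ^+ 2 + t ^+ 2)) - 1) (n.+1%:R * (- (2 * x2))).
  apply: is_derive_eq; rewrite /GRing.scale/=; ring.
have h3 := @is_derive1_comp R smooth_step (fun t : R => n.+1%:R * (1 - (x1 ^+ 2 + t ^+ 2)) - 1) x2 _ _
  (is_derive_smooth_step y) h1.
have h4 : is_derive x2 1 (fun t : R => t * u (x1, t) * cutoff n (x1, t))
    (x2 * u (x1, x2) * (flat 2 y * (n.+1%:R * (- (2 * x2)))) +
     cutoff n (x1, x2) * (x2 * pd2 u (x1, x2) + u (x1, x2) * 1)).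
  exact: (is_deriveM (is_deriveM (is_derive_id x2 1) hu) h3).
apply: (is_derive_eq h4); ring.
Qed.

Lemma continuous_euler_div u : (forall k, Ck k u) -> continuous (euler_div u).
Proof.
move=> Cu; have [_ _ cu c1 c2] := Ck_pd (Cu 1%N).
have c0 : Ck 0 (euler_div u).
  apply: CkD; first by apply: CkM; [exact: (Ck_cst 0)|exact: Cu].
  by apply: CkD; apply: CkM => //; [exact: (Ck_fst 0)|exact: (Ck_snd 0)].
exact: c0.
Qed.

Lemma continuous_cutoff n : continuous (@cutoff R n).
Proof. exact: Ck_continuous (Ck_cutoff 0 n). Qed.

(** Test the weak gradient with [x u] times the cutoff: the derivative of the
    cutoff concentrates on the circle and yields the boundary integral. *)
Lemma green_radial w g u : weak_gradient w g -> L2 mu2 ball1 w -> {within cball1, continuous w} ->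
  (forall k, Ck k u) ->
  cint (fun x => w x * u x) =
  bint (fun x => w x * euler_div u x) + bint (fun x => ((g x).1 * x.1 + (g x).2 * x.2) * u x).
Proof.
move=> wg Lw cw Cu; have [/L2_leb2 g1 /L2_leb2 g2 wgt] := wg.
have mb := @mball1 R; have Cu1 := Cu 1%N; have cu := Ck_continuous (Cu 0%N).
have ced := continuous_euler_div Cu.
pose G (x : plane) := ((g x).1 * x.1 + (g x).2 * x.2) * u x.
have LG : L2 mu2 ball1 G.
  apply: (L2_continuous_mul cu); apply: (L2_addr mb).
    exact: (L2_continuous_mul continuous_fst_plane g1).
  exact: (L2_continuous_mul continuous_snd_plane g2).
pose rw n (x : plane) := 2 * n.+1%:R * (x.1 ^+ 2 + x.2 ^+ 2) * flat 2 (n.+1%:R * (1 - (x.1 ^+ 2 + x.2 ^+ 2)) - 1).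
pose M n := bint (fun x => w x * (u x * rw n x)).
have Crw k n : Ck k (rw n).
  rewrite /rw; apply: CkM; first by apply: CkM; [exact: Ck_cst|exact: Ck_sqnorm].
  apply: (Ck_comp (f := fun s => flat 2 (n.+1%:R * (1 - s) - 1))); last exact: Ck_sqnorm.
  apply: diffn_comp; first exact: diffn_flat.
  apply: diffnD; last exact: diffn_cst; apply: diffnM; first exact: diffn_cst.
  apply: (@diffn_ext _ _ (fun t => 1 + (-1) * t)); first by move=> t; ring.
  apply: diffnD; first exact: diffn_cst.
  by apply: diffnM; [exact: diffn_cst|exact: diffn_id].
have step1 n : M n = bint (fun x => w x * euler_div u x * cutoff n x) + bint (fun x => G x * cutoff n x).
  have Cx1 k : Ck k (fun x : plane => x.1 * u x) by apply: CkM; [exact: Ck_fst|exact: Cu].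
  have Cx2 k : Ck k (fun x : plane => x.2 * u x) by apply: CkM; [exact: Ck_snd|exact: Cu].
  have t1 := test_fun_cutoff n Cx1; have t2 := test_fun_cutoff n Cx2.
  have [e1 _] := wgt _ t1; have [_ e2] := wgt _ t2.
  have [_ _ _ cp1 _] := Ck_pd (t1.1 1%N); have [_ _ _ _ cp2] := Ck_pd (t2.1 1%N).
  have L1 := L2_continuous_mul (Ck_continuous cp1) Lw.
  have L2' := L2_continuous_mul (Ck_continuous cp2) Lw.
  have L3 := L2_continuous_mul (@continuous_cutoff n) (L2_continuous_mul ced Lw).
  have L4 := L2_continuous_mul (@continuous_cutoff n) LG.
  have L5 := L2_continuous_mul (Ck_continuous (CkM (Cu 0%N) (Crw 0%N n))) Lw.
  have L6 := L2_continuous_mul (Ck_continuous (t1.1 0%N)) g1.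
  have L7 := L2_continuous_mul (Ck_continuous (t2.1 0%N)) g2.
  have eA : bint (fun x => w x * euler_div u x * cutoff n x) - M n = - bint (fun x => G x * cutoff n x).
    rewrite /M -(bintB L3 L5).
    transitivity (bint (fun x => w x * pd1 (fun x => x.1 * u x * cutoff n x) x) +
                  bint (fun x => w x * pd2 (fun x => x.2 * u x * cutoff n x) x)).
      rewrite -(bintD L1 L2'); congr bint; apply/funext => x.
      rewrite pd1_radial// pd2_radial// /euler_div /rw; ring.
    rewrite e1 e2 -opprD -(bintD L6 L7); congr (- bint _); apply/funext => x.
    rewrite /G; ring.
  by move/eqP: eA; rewrite subr_eq => /eqP ->; ring.
have cv1 (v : plane -> R) : L2 mu2 ball1 v -> bint (fun x => v x * cutoff n x) @[n --> \oo] --> bint v.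
  move=> Lv; have iv := L2_ball1_int Lv.
  under eq_fun do rewrite bintE.
  have := @Rintegral_cvg _ (measurableTypeR R * measurableTypeR R)%type R mu2 ball1 v (@cutoff R) (fun=> 1) mb iv.
  rewrite bintE (_ : \int[mu2]_(x in ball1) (v x * 1) = \int[mu2]_(x in ball1) v x); last first.
    by apply: eq_Rintegral => x _; rewrite mulr1.
  apply.
  - by move=> n; apply: measurable_funTS; apply: continuous_measurable_plane; exact: continuous_cutoff.
  - exact: measurable_cst.
  - by move=> n x _; have /andP[? ?] := cutoff_bound n x; rewrite ger0_norm.
  - by move=> x bx; exact: cutoff_cvg.
have cvM : M n @[n --> \oo] --> bint (fun x => w x * euler_div u x) + bint G.
  under eq_fun do rewrite step1.
  by apply: cvgD; [exact: cv1 (L2_continuous_mul ced Lw)|exact: cv1].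
apply: (cvg_unique _ _ cvM) => //.
pose W (x : plane) := w x * u x.
have cW : {within cball1, continuous W} by apply: within_mul => //; exact: continuous_subspaceT.
have [B B0 hB] := bounded_cball1 cW.
pose k t (r : R) := W (polar (r, t)) * r ^+ 2.
have ck t : {within `[0, 1], continuous (k t)}.
  have c1 : {within `[(0 : R), 1], continuous (fun r : R => W (polar (r, t)))}.
    apply: (@within_comp _ _ _ cball1 _ W (fun r : R => polar (r, t)) cW (continuous_ray (t := t))).
    by move=> r /=; rewrite in_itv/=; exact: polar_cball1.
  have c2 : {within `[(0 : R), 1], continuous (fun r : R => r ^+ 2)}.
    by apply: continuous_subspaceT; exact: exprn_continuous.
  by move=> r; apply: cvgM; [exact: c1|exact: c2].
pose K n (q : plane) := k q.2 q.1 * radial_weight n q.1.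
have pmeas : measurable_fun [set: plane] (snd : plane -> R) by exact: measurable_snd.
have tw (r : R) : 0 < r < 1 -> [/\ forall x y : R, x <= y -> prim x y (fun t : R => snd (r, t)) (fun=> 1 : R),
    forall x : R, (1 : R) <= 1, snd (r, 0 : R) = 0 & snd (r, 0 + 2 * pi : R) = 0 + 2 * pi].
  move=> _; split => // x y xy; have idc : prim x y (fun t : R => t) (fun=> 1).
    by apply: prim_C1; exact: cst_continuous.
  exact: idc.
have mF n : measurable_fun (ball1 : set plane) (fun x => w x * (u x * rw n x)).
  have [] := L2_continuous_mul (Ck_continuous (CkM (Cu 0%N) (Crw 0%N n))) Lw; exact.
have KE n q : (`]0, 1[ `*` `[0, 0 + 2 * pi[)%classic q ->
    K n q = w (polar (q.1, q.2)) * (u (polar (q.1, q.2)) * rw n (polar (q.1, q.2))) * (q.1 * 1).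
  move=> _; rewrite /K /k /W /rw /radial_weight.
  have -> : (polar (q.1, q.2)).1 ^+ 2 + (polar (q.1, q.2)).2 ^+ 2 = q.1 ^+ 2.
    by rewrite /polar /= !exprMn -mulrDr cos2Dsin2 mulr1.
  ring.
have mQ : measurable (`]0, 1[ `*` `[0, 0 + 2 * pi[ : set (measurableTypeR R * measurableTypeR R)).
  exact: measurableX.
have mk : measurable_fun (`]0, 1[ `*` `[0, 0 + 2 * pi[ : set plane) (fun q : plane => k q.2 q.1).
  apply: measurable_funM; last first.
    by apply: measurable_funTS; apply: measurable_funX; exact: measurable_fst.
  have mWb : measurable_fun (ball1 : set plane) W by have [] := L2_continuous_mul cu Lw.
  have := measurable_comp_twisted pmeas (a := 0) mWb; apply: eq_measurable_fun => q _.
  by rewrite -surjective_pairing.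
have kb (t r : R) : 0 < r < 1 -> `|k t r| <= B.
  move=> /andP[r0 r1]; rewrite /k normrM -[leRHS]mulr1 ler_pM//.
    by apply: hB; apply: polar_cball1; rewrite !ltW.
  by rewrite normrX; apply: exprn_ile1 => //; rewrite ger0_norm ltW.
have iK n : mu2.-integrable (`]0, 1[ `*` `[0, 0 + 2 * pi[) (EFin \o K n).
  have [Cw Cw0 hCw] : exists2 C : R, 0 <= C & forall r : R, 0 <= r <= 1 -> `|radial_weight n r| <= C.
    have crw : {within `[0, 1], continuous (@radial_weight R n)}.
      by apply: continuous_subspaceT; exact: continuous_radial_weight.
    exact: bounded_segment crw.
  apply: (integrable_rect_bounded (M := B * Cw)) => //.
  - by rewrite lebesgue_measure_itv/=; case: ifP => _; rewrite -?EFinD ltry.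
  - by rewrite lebesgue_measure_itv/=; case: ifP => _; rewrite -?EFinD ltry.
  - apply: measurable_funM => //; apply: measurable_funTS.
    apply: (measurable_comp_continuous (f := @radial_weight R n)); first exact: continuous_radial_weight.
    exact: measurable_fst.
  - move=> r t; rewrite /= !in_itv/= => r01 _; rewrite normrM ler_pM//; first exact: kb.
    by apply: hCw; have /andP[? ?] := r01; rewrite !ltW.
pose T n t := \int[mu]_(r in `]0, 1[) K n (r, t).
have MT n : M n = \int[mu]_(t in `[0, 0 + 2 * pi[) T n t.
  have m1 : measurable_fun [set: plane] (fun=> 1 : R) by exact: measurable_cst.
  have [e _] := @bint_coordinates R 0 snd (fun=> 1) 1 ltr01 pmeas m1 tw
    (fun x => w x * (u x * rw n x)) (K n) (mF n) (KE n) (iK n).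
  exact: e.
have kw t n : mu.-integrable `[0, 1] (EFin \o (fun r => k t r * radial_weight n r)).
  apply: L2M => //; first exact: continuous_L2.
  by apply: continuous_L2; apply: continuous_subspaceT; exact: continuous_radial_weight.
have Tk n t : T n t = \int[mu]_(r in `[0, 1]) (k t r * radial_weight n r).
  have h := kw t n; rewrite /T Rintegral_itv_obnd_cbnd; last first.
    by apply: integrableS h => //; apply: subset_itv; rewrite bnd_simp.
  rewrite Rintegral_itv_bndo_bndc//.
  by apply: integrableS h => //; apply: subset_itv; rewrite bnd_simp.
have k1 t : k t 1 = W (circ t) by rewrite /k expr1n mulr1 /polar /circ /= !mul1r.
have Tcv t : T n t @[n --> \oo] --> W (circ t).
  by rewrite -k1; under eq_fun do rewrite Tk; exact: radial_concentration.
have Lrw n : L2 mu `[(0 : R), 1] (radial_weight n).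
  by apply: continuous_L2; apply: continuous_subspaceT; exact: continuous_radial_weight.
have Tb n t : `|T n t| <= B.
  rewrite Tk; apply: (le_trans (le_normr_Rintegral _ (kw t n))) => //.
  apply: (@le_trans _ _ (\int[mu]_(r in `[0, 1]) (B * radial_weight n r))).
    apply: le_Rintegral => //; first by have := integrable_norm (kw t n).
      by apply: L2_int; exact: L2_scale.
    move=> r /=; rewrite in_itv/= => r01; have /andP[r0 _] := r01.
    have w0 : 0 <= radial_weight n r by rewrite !mulr_ge0 ?flat_ge0 ?ler0n.
    rewrite normrM (ger0_norm w0) ler_wpM2r// /k normrM -[leRHS]mulr1 ler_pM//.
      by apply: hB; exact: polar_cball1.
    have /andP[_ r1] := r01.
    by rewrite normrX; apply: exprn_ile1 => //; rewrite ger0_norm.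
  have iw := L2_int (Lrw n); rewrite RintegralZl// -[leRHS]mulr1 ler_wpM2l//.
  by rewrite integral_radial_weight smooth_step_le1.
have mT n : measurable_fun `[0, 0 + 2 * pi[ (T n) by apply: measurable_section_integral (iK n).
have cWc : continuous (fun t => W (circ t)).
  by apply: (continuous_comp_within cW continuous_circ) => t; exact: cball1_circ.
pose B1 := B + 1; have B10 : 0 < B1 by rewrite /B1; lra.
have cvT : (\int[mu]_(t in `[0, 0 + 2 * pi[) (B1 * (T n t / B1))) @[n --> \oo] -->
    \int[mu]_(t in `[0, 0 + 2 * pi[) (B1 * (W (circ t) / B1)).
  have p0 : (0 : R) <= 0 + 2 * pi by rewrite add0r mulr_ge0// pi_ge0.
  apply: (@Rintegral_cvg _ (measurableTypeR R) R mu _ (fun=> B1) (fun n t => T n t / B1)) => //.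
  - have h : mu.-integrable `[0, 0 + 2 * pi] (EFin \o (fun=> B1 : R)) by exact: L2_int (L2_cst_segment _ _ _).
    by apply: integrableS h => //; apply: subset_itv; rewrite bnd_simp.
  - by move=> n; apply: measurable_funM; [exact: mT|exact: measurable_cst].
  - apply: measurable_funM; last exact: measurable_cst.
    by apply: measurable_funTS; exact: continuous_measurable_fun.
  - move=> n t _; rewrite normrM normfV (ger0_norm (ltW B10)) ler_pdivrMr// mul1r.
    by rewrite (le_trans (Tb n t))// /B1; lra.
  - by move=> t _; apply: cvgM; [exact: Tcv|exact: cvg_cst].
have B1E (s : R) : B1 * (s / B1) = s by rewrite mulrCA divff ?mulr1// gt_eqF.
rewrite (_ : cint _ = \int[mu]_(t in `[0, 0 + 2 * pi[) (B1 * (W (circ t) / B1))); last first.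
  have i : mu.-integrable `[0, 2 * pi] (EFin \o (fun t => W (circ t))) by exact: continuous_integrable.
  rewrite add0r; under [RHS]eq_Rintegral => t _ do rewrite B1E.
  rewrite Rintegral_itv_bndo_bndc//.
  by apply: integrableS i => //; apply: subset_itv; rewrite bnd_simp.
rewrite (_ : M = (fun n => \int[mu]_(t in `[0, 0 + 2 * pi[) (B1 * (T n t / B1)))) //.
apply/funext => n; rewrite MT; apply: eq_Rintegral => t _; by rewrite B1E.
Qed.

Lemma cintE (f : plane -> R) : cint f = \int[mu]_(t in `[0, 2 * pi]) f (circ t).
Proof. by []. Qed.

Lemma H1_dist2_cvg (w : nat -> plane -> R) v : (forall n, H1 (w n)) -> H1 v ->
  H1_dist2 (w n) v @[n --> \oo] --> (0 : R) ->
  [/\ bint (fun x => (w n x - v x) ^+ 2) @[n --> \oo] --> (0 : R),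
      bint (fun x => ((grad (w n) x).1 - (grad v x).1) ^+ 2) @[n --> \oo] --> (0 : R) &
      bint (fun x => ((grad (w n) x).2 - (grad v x).2) ^+ 2) @[n --> \oo] --> (0 : R)].
Proof.
move=> Hw Hv cv; have mb := @mball1 R.
have ge0 (f : plane -> R) : (forall x, 0 <= f x) -> 0 <= bint f.
  by move=> f0; rewrite bintE; apply: Rintegral_ge0 => x _.
have sq (f : plane -> R) : 0 <= bint (fun x => f x ^+ 2) by apply: ge0 => x; exact: sqr_ge0.
have sqz (f : nat -> plane -> R) : (forall n, bint (fun x => f n x ^+ 2) <= H1_dist2 (w n) v) ->
   bint (fun x => f n x ^+ 2) @[n --> \oo] --> (0 : R).
  move=> h; apply: (@squeeze_cvgr _ _ _ _ (cst 0) (fun n => H1_dist2 (w n) v)) => //; last exact: cvg_cst.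
  by apply: nearW => n; rewrite h andbT sq.
have [/L2_leb2 v1 /L2_leb2 v2 _] := grad_weak Hv.
have gL n : L2 mu2 ball1 (fun x => (grad (w n) x - grad v x).1) /\ L2 mu2 ball1 (fun x => (grad (w n) x - grad v x).2).
  have [/L2_leb2 w1 /L2_leb2 w2 _] := grad_weak (Hw n).
  by split; [exact: (L2_subr mb w1 v1)|exact: (L2_subr mb w2 v2)].
have ien n : mu2.-integrable ball1 (EFin \o (fun x => enorm (grad (w n) x - grad v x) ^+ 2)).
  by have [? ?] := gL n; exact: L2_enorm_sqr.
split; apply: sqz => n.
- by rewrite /H1_dist2 lerDl sq.
- apply: (@le_trans _ _ (bint (fun x => enorm (grad (w n) x - grad v x) ^+ 2))); last by rewrite /H1_dist2 lerDr sq.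
  rewrite !bintE; apply: (le_Rintegral mb (L2_sqr_integrable mb (gL n).1) (ien n)) => x _.
  by rewrite enorm_sqr /= lerDl sqr_ge0.
- apply: (@le_trans _ _ (bint (fun x => enorm (grad (w n) x - grad v x) ^+ 2))); last by rewrite /H1_dist2 lerDr sq.
  rewrite !bintE; apply: (le_Rintegral mb (L2_sqr_integrable mb (gL n).2) (ien n)) => x _.
  by rewrite enorm_sqr /= lerDr sqr_ge0.
Qed.

Lemma bint_cvg_mulr (f : nat -> plane -> R) (f0 h : plane -> R) : (forall n, L2 mu2 ball1 (f n)) ->
  L2 mu2 ball1 f0 -> continuous h -> bint (fun x => (f n x - f0 x) ^+ 2) @[n --> \oo] --> (0 : R) ->
  bint (fun x => f n x * h x) @[n --> \oo] --> bint (fun x => f0 x * h x).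
Proof.
move=> Lf L0 ch cv; have mb := @mball1 R.
have Lh : L2 mu2 ball1 h.
  have L1 : L2 mu2 ball1 (fun=> 1 : R) by apply: (L2_cst 1 mb leb2_ball1_lty).
  by apply: L2_eq (L2_continuous_mul ch L1) => x _; rewrite mul1r.
under eq_fun do rewrite bintE.
rewrite bintE; apply: (L2_cvg_mulr mb Lf L0 Lh).
by move: cv; under eq_fun do rewrite bintE.
Qed.

(** Both sides are continuous along the approximating sequence of the trace. *)
Lemma green_trace v tau u : has_trace v tau -> (forall k, Ck k u) ->
  cint (fun x => tau x * u x) =
  bint (fun x => v x * euler_div u x) +
  bint (fun x => ((grad v x).1 * x.1 + (grad v x).2 * x.2) * u x).
Proof.
move=> [Hv Ltau [w [wP cvH cvT]]] Cu; have mb := @mball1 R.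
have Hw n : H1 (w n) by case: (wP n).
have [c0 c1 c2] := H1_dist2_cvg Hw Hv cvH.
have cu := Ck_continuous (Cu 0%N); have ced := continuous_euler_div Cu.
have Lw n : L2 mu2 ball1 (w n) by have [/L2_leb2] := Hw n.
have Lv : L2 mu2 ball1 v by have [/L2_leb2] := Hv.
have [/L2_leb2 v1 /L2_leb2 v2 _] := grad_weak Hv.
have w12 n : L2 mu2 ball1 (fun x => (grad (w n) x).1) /\ L2 mu2 ball1 (fun x => (grad (w n) x).2).
  by have [/L2_leb2 ? /L2_leb2 ? _] := grad_weak (Hw n).
have cxu : continuous (fun x : plane => x.1 * u x).
  by move=> x; apply: cvgM; [exact: cvg_fst|exact: cu].
have cyu : continuous (fun x : plane => x.2 * u x).
  by move=> x; apply: cvgM; [exact: cvg_snd|exact: cu].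
have split_ (g : plane -> plane) : L2 mu2 ball1 (fun x => (g x).1) -> L2 mu2 ball1 (fun x => (g x).2) ->
   bint (fun x => ((g x).1 * x.1 + (g x).2 * x.2) * u x) =
   bint (fun x => (g x).1 * (x.1 * u x)) + bint (fun x => (g x).2 * (x.2 * u x)).
  move=> g1 g2; rewrite -(bintD (L2_continuous_mul cxu g1) (L2_continuous_mul cyu g2)).
  by congr bint; apply/funext => x; ring.
have wc n : L2 mu `[0, 2 * pi] (fun t => w n (circ t)).
  have [_ cw] := wP n; apply: continuous_L2; apply: continuous_subspaceT.
  by apply: (continuous_comp_within cw continuous_circ) => t; exact: cball1_circ.
have L1 : cint (fun x => w n x * u x) @[n --> \oo] --> cint (fun x => tau x * u x).
  have mc : measurable (`[0, 2 * pi]%classic : set (measurableTypeR R)) by [].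
  have Luc : L2 mu `[0, 2 * pi] (fun t => u (circ t)).
    apply: continuous_L2; apply: continuous_subspaceT => t.
    by apply: (@continuous_comp _ _ _ (@circ R) u); [exact: continuous_circ|exact: cu].
  exact: (L2_cvg_mulr mc wc Ltau Luc cvT).
have R1 := bint_cvg_mulr Lw Lv ced c0.
have R2 := bint_cvg_mulr (fun n => (w12 n).1) v1 cxu c1.
have R3 := bint_cvg_mulr (fun n => (w12 n).2) v2 cyu c2.
rewrite (split_ _ v1 v2); have RR := cvgD R1 (cvgD R2 R3).
apply: (cvg_unique _ L1) => //.
rewrite (_ : (fun n => _) = (fun n => bint (fun x => w n x * euler_div u x) +
  (bint (fun x => (grad (w n) x).1 * (x.1 * u x)) + bint (fun x => (grad (w n) x).2 * (x.2 * u x))))); first exact: RR.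
apply/funext => n; have [_ cw] := wP n; have [? ?] := w12 n.
by rewrite (green_radial (grad_weak (Hw n)) (Lw n) cw Cu) split_.
Qed.

(** The right-hand side of [green_trace] does not involve the trace. *)
Lemma trace_unique v tau tau' : has_trace v tau -> has_trace v tau' ->
  {ae mu, forall t, `[0, 2 * pi]%classic t -> tau (circ t) = tau' (circ t)}.
Proof.
move=> ht ht'; have [_ L _] := ht; have [_ L' _] := ht'.
have mc : measurable (`[0, 2 * pi]%classic : set (measurableTypeR R)) by [].
have := @ae_zero_circle _ (fun t => tau (circ t) - tau' (circ t)) (L2_subr mc L L') _.
move=> /(_ _)/wrap[|h].
  move=> f t0 sf; pose u (x : plane) := f (x.1 * cos t0 + x.2 * sin t0).
  have Cu k : Ck k u.
    apply: Ck_comp; first exact: sf.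
    by apply: CkD; apply: CkM; (exact: Ck_fst || exact: Ck_snd || exact: Ck_cst).
  have uE t : f (cos (t - t0)) = u (circ t) by rewrite /u /circ /= cosB.
  have cu := Ck_continuous (Cu 0%N).
  have Luc : L2 mu `[0, 2 * pi] (fun t => u (circ t)).
    apply: continuous_L2; apply: continuous_subspaceT => t.
    by apply: (@continuous_comp _ _ _ (@circ R) u); [exact: continuous_circ|exact: cu].
  transitivity (cint (fun x => tau x * u x) - cint (fun x => tau' x * u x)).
    rewrite !cintE -(RintegralB mc (L2M mc L Luc) (L2M mc L' Luc)).
    by apply: eq_Rintegral => t _; rewrite uE mulrBl.
  by rewrite (green_trace ht Cu) (green_trace ht' Cu) subrr.
by move: h; apply: (@filterS _ (almost_everywhere mu)) => t h tI; apply/eqP; rewrite -subr_eq0 h.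
Qed.

Lemma cint_trace v c : has_trace v c -> cint (fun x => trace v x ^+ 2) = cint (fun x => c x ^+ 2).
Proof.
move=> hc; have ht : has_trace v (trace v) by rewrite /trace; apply: xgetPex; exists c.
have [_ L _] := hc; have [_ L' _] := ht.
have mc : measurable (`[0, 2 * pi]%classic : set (measurableTypeR R)) by [].
rewrite !cintE /Rintegral; congr fine; apply: ae_eq_integral => //.
- exact: (measurable_int _ (L2_sqr_integrable mc L')).
- exact: (measurable_int _ (L2_sqr_integrable mc L)).
- by have := trace_unique ht hc; apply: (@filterS _ (almost_everywhere mu)) => t h tI; rewrite h.
Qed.

End TraceUniqueness.

(** * Sobolev functions on the circle *)

Section AntiderivativesAndShifts.
Context {R : realType}.
Notation mu := (@lebesgue_measure R).

Lemma Rintegral_cst_segment (a b k : R) : a <= b -> \int[mu]_(t in `[a, b]) k = k * (b - a).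
Proof. by move=> ab; rewrite Rintegral_cst//; congr (k * _); exact: (congr1 fine (mu_segment ab)). Qed.

Lemma prim_shift (a b T : R) u p : prim a b u p ->
  prim (a + T) (b + T) (fun t => u (t - T)) (fun t => p (t - T)).
Proof.
have ge0 (s e : R) (F : R -> \bar R) : measurable_fun setT F -> (forall y, 0 <= F y)%E ->
   (\int[mu]_(y in `[s, e]) F y = \int[mu]_(x in `[(s + T)%R, (e + T)%R]) (F (x - T)%R * 1%:E))%E.
  move=> mF F0; rewrite integral_mkcond [RHS]integral_mkcond.
  have mFr : measurable_fun setT (F \_ `[s, e])%E.
    by apply/(measurable_restrictT _ _).1 => //; exact: measurable_funTS.
  rewrite (@change_affine _ 1 (- T) (F \_ `[s, e])%E)//; last first.
    by move=> y; apply: erestrict_ge0.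
  apply: eq_integral => x _; rewrite !patchE mul1r.
  have -> : (x - T \in `[s, e]%classic) = (x \in `[(s + T)%R, (e + T)%R]%classic).
    by rewrite !mem_setE !in_itv/=; apply/idP/idP => /andP[? ?]; apply/andP; split; lra.
  by case: ifP => // _; rewrite mul0e.
have sub (s e : R) (F : R -> \bar R) : measurable_fun `[s, e] F ->
   (\int[mu]_(y in `[s, e]) F y = \int[mu]_(x in `[(s + T)%R, (e + T)%R]) (F (x - T)%R))%E.
  move=> mF; rewrite (@signed_substitution _ _ (measurableTypeR R) (measurableTypeR R) R mu mu
    `[s + T, e + T]%classic `[s, e]%classic (fun x => x - T) (fun=> 1))//.
  - by apply: eq_integral => x _; rewrite mule1.
  - by move=> x /=; rewrite !in_itv/= => /andP[? ?]; apply/andP; split; lra.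
  - exact: ge0.
move=> [[mp fp] up]; split; last first.
  move=> x /andP[ax xb]; rewrite up; last by apply/andP; split; lra.
  rewrite addrK; congr (_ + _); rewrite /Rintegral; congr fine.
  have mp' : measurable_fun `[a, x - T] (EFin \o p).
    by apply/measurable_EFinP; apply: measurable_funS mp => //; apply: subset_itvl; rewrite bnd_simp; lra.
  by rewrite (sub _ _ _ mp') subrK.
split.
  apply: (measurable_comp (F := `[a, b]%classic)) => //.
    have h (x : R) : a + T <= x <= b + T -> a <= x - T <= b by move=> /andP[? ?]; apply/andP; split; lra.
    by move=> _ [x + <-] /=; rewrite !in_itv/=; exact: h.
  exact: measurable_funB.
have mp2 : measurable_fun `[a, b] (EFin \o (fun t => p t ^+ 2)).
  by apply/measurable_EFinP; apply: measurable_funX.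
by rewrite -(sub _ _ _ mp2).
Qed.

Definition antiderivative (f : R -> R) (t : R) : R :=
  if 0 <= t then \int[mu]_(x in `[0, t]) f x else - \int[mu]_(x in `[t, 0]) f x.

Lemma antiderivativeE (f : R -> R) a t : continuous f -> a <= t ->
  antiderivative f t = antiderivative f a + \int[mu]_(x in `[a, t]) f x.
Proof.
move=> cf at_; have i u v : mu.-integrable `[u, v] (EFin \o f) by exact: continuous_integrable.
rewrite /antiderivative; case: (leP 0 a) => a0.
  by rewrite (le_trans a0 at_); exact: Rintegral_split.
case: (leP 0 t) => t0.
  by rewrite (Rintegral_split (ltW a0) t0 (i a t)); ring.
by rewrite (Rintegral_split at_ (ltW t0) (i a 0)); ring.
Qed.

Lemma is_derive_antiderivative (f : R -> R) (t : R) : continuous f ->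
  is_derive t 1 (antiderivative f) (f t).
Proof.
move=> cf; have h1 : t < t + 1 by lra.
have h2 : t - 1 < t by lra.
have [d e] := @continuous_FTC1_closed R f (t - 1) t (t + 1) h1 (continuous_integrable _ _ cf) h2 (cf t).
pose F x := antiderivative f (t - 1) + \int[mu]_(y in `[t - 1, x]) f y.
have dF : is_derive t 1 F (f t).
  have d1 : is_derive t 1 (fun x => \int[mu]_(y in `[t - 1, x]) f y) (f t).
    exact: (DeriveDef d (etrans (esym (derive1E _ _)) e)).
  have := is_deriveD (is_derive_cst (antiderivative f (t - 1)) t 1) d1.
  by rewrite add0r.
apply: is_derive_near dF; near=> x; rewrite /F -antiderivativeE//.
by apply: ltW; near: x; exact: lt_nbhsr.
Unshelve. all: by end_near. Qed.

Lemma antiderivative0 (f : R -> R) : antiderivative f 0 = 0.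
Proof. by rewrite /antiderivative lexx integral_point. Qed.

Lemma periodic_antiderivative (f : R -> R) (T : R) : continuous f -> (forall t, f (t + T) = f t) ->
  0 <= T -> \int[mu]_(t in `[0, T]) f t = 0 -> forall t, antiderivative f (t + T) = antiderivative f t.
Proof.
move=> cf fT T0 f0 t.
pose D s := antiderivative f (s + T) - antiderivative f s.
have dD (s : R) : is_derive s 1 D ((fun=> 0) s).
  have h1 := is_derive_antiderivative s cf.
  have h2 := is_derive_antiderivative (s + T) cf.
  have h3 : is_derive s 1 (fun s : R => s + T) 1.
    by apply: is_derive_eq; rewrite addr0.
  have h4 := @is_derive1_comp R (antiderivative f) (fun s : R => s + T) s _ _ h2 h3.
  have := is_deriveB h4 h1; rewrite mulr1 fT subrr; exact.
have [c _] := mean_value t 0 dD; rewrite mul0r => /eqP; rewrite subr_eq0 /D => /eqP e.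
apply/eqP; rewrite -subr_eq0 -e add0r antiderivative0 subr0.
by rewrite /antiderivative T0 f0.
Qed.

End AntiderivativesAndShifts.

Section DuBoisReymond.
Context {R : realType}.
Notation mu := (@lebesgue_measure R).
Notation plane := (R * R)%type.

Let twopi_ge0 : 0 <= 2 * pi :> R. Proof. by rewrite mulr_ge0// pi_ge0. Qed.
Let mc : measurable (`[0, 2 * pi]%classic : set (measurableTypeR R)). Proof. by []. Qed.

Lemma periodic_smooth_of_diffn (phi : R -> R) : (forall n, diffn n phi) ->
  (forall t, phi (t + 2 * pi) = phi t) -> periodic_smooth phi.
Proof. by move=> sphi pphi; split=> // n t; exact: smooth_derivable_derive1n. Qed.

(** Du Bois-Reymond: the difference of [c] and a primitive of its weak
    derivative is orthogonal to derivatives of periodic functions, so it is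
    constant. *)
Lemma H1_circle_prim (c : plane -> R) : H1_circle c -> exists C p : R -> R,
  [/\ prim 0 (2 * pi) C p, C 0 = C (2 * pi) &
      {ae mu, forall t, `[0, 2 * pi]%classic t -> c (circ t) = C t}].
Proof.
move=> [Lc [dc Ldc wd]]; pose f t := c (circ t).
have Lf : L2 mu `[0, 2 * pi] f by exact: Lc.
pose P t := \int[mu]_(s in `[0, t]) dc s.
have P0 : P 0 = 0 by exact: integral_point.
have pP : prim 0 (2 * pi) P dc by split=> // x _; rewrite P0 add0r.
have idc0 : P (2 * pi) = 0.
  have := wd (fun=> 1) (periodic_smooth_of_diffn (fun n => diffn_cst n 1) (fun=> erefl)).
  under eq_Rintegral => t _ do rewrite derive1_cst mulr0.
  rewrite Rintegral_cst// mul0r => /eqP; rewrite eq_sym oppr_eq0 => /eqP.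
  by under eq_Rintegral => t _ do rewrite mulr1.
have LF : L2 mu `[0, 2 * pi] (fun t => f t - P t) by apply: L2_subr => //; exact: prim_L2 pP.
pose m0 := (\int[mu]_(t in `[0, 2 * pi]) (f t - P t)) / (2 * pi).
have test phi phi' : (forall n, diffn n phi) -> (forall t, phi (t + 2 * pi) = phi t) ->
    (forall t : R, is_derive t 1 phi (phi' t)) -> continuous phi' ->
    \int[mu]_(t in `[0, 2 * pi]) ((f t - P t) * phi' t) = 0.
  move=> sphi pphi dphi cphi'.
  have := wd phi (periodic_smooth_of_diffn sphi pphi).
  have -> : derive1 phi = phi' by apply/funext => t; rewrite derive1E derive_val.
  have pphi2 : prim 0 (2 * pi) phi phi' by exact: prim_C1.
  have := prim_by_parts twopi_ge0 pP pphi2; rewrite idc0 P0 !mul0r subrr.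
  have Lphi := prim_L2 pphi2; have [Lphi' _] := pphi2; have LP := prim_L2 pP.
  rewrite (RintegralD mc (L2M mc Ldc Lphi) (L2M mc LP Lphi')) => e1 e2.
  transitivity (\int[mu]_(t in `[0, 2 * pi]) (f t * phi' t) - \int[mu]_(t in `[0, 2 * pi]) (P t * phi' t)).
    rewrite -(RintegralB mc (L2M mc Lf Lphi') (L2M mc LP Lphi')).
    by apply: eq_Rintegral => t _; rewrite mulrBl.
  rewrite [X in X - _](_ : _ = - \int[mu]_(t in `[0, 2 * pi]) (dc t * phi t)) //.
  by rewrite -opprD e1 oppr0.
have pi0 : 0 < 2 * pi :> R by rewrite mulr_gt0// pi_gt0.
have mean : \int[mu]_(t in `[0, 2 * pi]) (f t - P t - m0) = 0.
  rewrite (RintegralB mc (L2_int LF) (L2_int (L2_cst_segment _ _ _))).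
  rewrite (Rintegral_cst_segment _ twopi_ge0) subr0 /m0 divfK ?subrr//.
  by rewrite gt_eqF.
have key : {ae mu, forall t, `[0, 2 * pi]%classic t -> f t - P t - m0 = 0}.
  have LG : L2 mu `[0, 2 * pi] (fun t => f t - P t - m0).
    by apply: L2_subr => //; exact: L2_cst_segment.
  apply: ae_zero_circle => // g t0 sg.
  pose psi t := g (cos (t - t0)).
  have spsi n : diffn n psi.
    apply: diffn_comp => //; apply: (diffn_comp (diffn_sin_cos n).2).
    by apply: diffnD; [exact: diffn_id|exact: diffn_cst].
  pose pm := (\int[mu]_(t in `[0, 2 * pi]) psi t) / (2 * pi).
  pose psi0 t := psi t + - pm.
  have spsi0 n : diffn n psi0 by apply: diffnD => //; exact: diffn_cst.
  have cpsi0 : continuous psi0 by exact: diffn_continuous (spsi0 1%N).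
  have cpsi : continuous psi by exact: diffn_continuous (spsi 1%N).
  have Lpsi : L2 mu `[0, 2 * pi] psi by apply: continuous_L2; exact: continuous_subspaceT.
  have per t : psi0 (t + 2 * pi) = psi0 t.
    rewrite /psi0 /psi; congr (g _ - _).
    rewrite (_ : t + 2 * pi - t0 = (t - t0) + pi + pi); last by ring.
    by rewrite !cosDpi opprK.
  have i0 : \int[mu]_(t in `[0, 2 * pi]) psi0 t = 0.
    rewrite /psi0 (RintegralB mc (L2_int Lpsi) (L2_int (L2_cst_segment _ _ _))).
    rewrite (Rintegral_cst_segment _ twopi_ge0) subr0 /pm divfK ?subrr//.
    by rewrite gt_eqF.
  have sphi n : diffn n (antiderivative psi0).
    case: n => // n; exists psi0 => // t; exact: is_derive_antiderivative.
  have pphi := periodic_antiderivative cpsi0 per twopi_ge0 i0.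
  have e1 := test _ _ sphi pphi (fun t => is_derive_antiderivative t cpsi0) cpsi0.
  have Lpsi0 : L2 mu `[0, 2 * pi] psi0 by apply: continuous_L2; exact: continuous_subspaceT.
  transitivity (\int[mu]_(t in `[0, 2 * pi]) ((f t - P t) * psi0 t) +
     (\int[mu]_(t in `[0, 2 * pi]) (pm * (f t - P t - m0)) - \int[mu]_(t in `[0, 2 * pi]) (m0 * psi0 t))).
    have i1 := L2M mc LF Lpsi0; have i2 := L2_int (L2_scale pm mc LG); have i3 := L2_int (L2_scale m0 mc Lpsi0).
    rewrite -(RintegralB mc i2 i3) -(RintegralD mc i1); last by have := integrableB mc i2 i3; exact.
    by apply: eq_Rintegral => t _; rewrite /psi0 /psi; ring.
  rewrite e1 (RintegralZl pm mc (L2_int LG)) mean mulr0 (RintegralZl m0 mc (L2_int Lpsi0)) i0.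
  by rewrite mulr0 subrr addr0.
exists (fun t => P t + m0), dc; split.
- have := prim_addr pP (prim_cst 0 (2 * pi) m0).
  by apply: prim_eq_oo => // t _; rewrite addr0.
- by rewrite idc0 P0.
- move: key; apply: (@filterS _ (almost_everywhere mu)) => t h tI; apply/eqP.
  by rewrite -subr_eq0 -/(f t) opprD addrA h.
Qed.

(** Two periods, so that every window of length [2 pi] that starts in the first
    one is a segment of the same function. *)
Lemma H1_circle_periodic (c : plane -> R) : H1_circle c -> exists C p : R -> R,
  [/\ prim 0 (4 * pi) C p, forall t, 0 <= t <= 2 * pi -> C (t + 2 * pi) = C t &
      {ae mu, forall t, `[0, 2 * pi]%classic t -> c (circ t) = C t}].
Proof.
move=> /H1_circle_prim[C [p [Cp C0 cC]]].
have pi0 : 0 < 2 * pi :> R by rewrite mulr_gt0// pi_gt0.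
pose C' t := if t < 2 * pi then C t else C (t - 2 * pi).
pose p' t := if t < 2 * pi then p t else p (t - 2 * pi).
have C'E t : 0 <= t <= 2 * pi -> C' t = C t.
  move=> /andP[t0 t1]; rewrite /C'; case: ltP => // t2.
  have -> : t = 2 * pi by apply/eqP; rewrite eq_le t1.
  by rewrite subrr.
exists C', p'; split.
- have e : 4 * pi = 2 * pi + 2 * pi :> R by ring.
  apply: (@prim_glue _ 0 (2 * pi)) => //; first by rewrite e lerDl.
    by apply: prim_eq_oo Cp => t => [/C'E //|/andP[_ t1]]; rewrite /p' t1.
  have := prim_shift (2 * pi) Cp; rewrite add0r -e.
  apply: prim_eq_oo => t /andP[t0 t1].
    by rewrite /C' ltNge t0.
  by rewrite /p' ltNge (ltW t0).
- by move=> t /[dup] /C'E -> /andP[t0 t1]; rewrite /C' ltNge lerDr t0 /= addrK.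
- by move: cC; apply: (@filterS _ (almost_everywhere mu)) => t h tI; rewrite h// C'E.
Qed.

End DuBoisReymond.

(** * The distorted polar coordinates *)

Section Angles.
Context {R : realType}.
Notation mu := (@lebesgue_measure R).
Notation plane := (R * R)%type.

Lemma angle_unique (s t : R) : cos s = cos t -> sin s = sin t -> `|s - t| < 2 * pi -> s = t.
Proof.
move=> ec es st; apply/eqP; rewrite -subr_eq0; set x := s - t.
have c1 : cos x = 1 by rewrite /x cosB ec es -!expr2 cos2Dsin2.
have h : sin (`|x| / 2) = 0.
  apply/eqP; rewrite -sqrf_eq0; apply/eqP.
  have := cos_mulr2n (`|x| / 2); rewrite -[(`|x| / 2) *+ 2]mulr_natr divfK// cos_norm c1.
  by rewrite sin2cos2 => e; move: e; rewrite -mulr_natr => e; lra.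
apply/negPn/negP => x0; have xp : 0 < `|x| by rewrite normr_gt0.
have : 0 < sin (`|x| / 2) by apply: sin_gt0_pi; apply/andP; split; move: st; rewrite -/x; lra.
by rewrite h ltxx.
Qed.

Lemma angle_exists (z : plane) : enorm z != 0 ->
  exists2 t, 0 <= t < 2 * pi & z = polar (enorm z, t).
Proof.
case: z => x y; set r := enorm (x, y) => r0.
have rr : r ^+ 2 = x ^+ 2 + y ^+ 2 by rewrite enorm_sqr.
have rp : 0 < r by rewrite lt_def r0 sqrtr_ge0.
pose u := x / r; have u1 : u ^+ 2 <= 1.
  by rewrite expr_div_n ler_pdivrMr ?exprn_gt0// mul1r rr lerDl sqr_ge0.
have ub : -1 <= u <= 1 by rewrite -ler_norml -(@expr_le1 _ 2)// real_normK ?num_real.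
have uI : u \in `[-1, 1] by rewrite in_itv.
have a0 := acos_ge0 ub; have api := acos_lepi ub; have p0 := pi_gt0 R.
have xE : r * cos (acos u) = x by rewrite acosK// /u mulrC divfK.
have yE : r * sin (acos u) = `|y|.
  rewrite sin_acos// -(ger0_norm (ltW rp)) -sqrtr_sqr -sqrtrM ?sqr_ge0// mulrBr mulr1 -exprMn.
  by rewrite /u mulrC divfK// rr addrC addKr sqrtr_sqr.
have [y0|y0] := leP 0 y.
  exists (acos u); first by apply/andP; split => //; lra.
  by rewrite /polar /= xE yE ger0_norm.
have au0 : acos u != 0.
  apply/eqP => e; move: yE; rewrite e sin0 mulr0 => /esym/eqP; rewrite normr_eq0 => /eqP y00.
  by rewrite y00 ltxx in y0.
have au : 0 < acos u by rewrite lt_def au0.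
exists (2 * pi - acos u); first by apply/andP; split; lra.
rewrite /polar /= cosB sinB mulr_natl cos2pi sin2pi !mul1r !mul0r addr0 sub0r xE mulrN yE.
by rewrite ltr0_norm// opprK.
Qed.

Lemma polar_period (r t : R) : polar (r, t + 2 * pi) = polar (r, t).
Proof.
rewrite /polar /= (_ : t + 2 * pi = t + pi + pi); last by ring.
by rewrite !cosDpi !sinDpi !opprK.
Qed.

Lemma angle_exists_from (a : R) (z : plane) : 0 <= a <= 2 * pi -> enorm z != 0 ->
  exists2 t, a <= t < a + 2 * pi & z = polar (enorm z, t).
Proof.
move=> /andP[a0 a1] /angle_exists[t /andP[t0 t1] zE].
have [at_|ta] := leP a t; first by exists t => //; apply/andP; split; lra.
by exists (t + 2 * pi); [apply/andP; split; lra|rewrite polar_period].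
Qed.

Lemma prim_continuousT (u p : R -> R) : (forall x y, x <= y -> prim x y u p) -> continuous u.
Proof.
move=> h x; have x1 : x - 1 <= x + 1 by lra.
have /subspace_continuousP/(_ x) := prim_continuous (h _ _ x1).
have xI : `[x - 1, x + 1]%classic x by rewrite /= in_itv/=; apply/andP; split; lra.
move=> /(_ xI); rewrite within_interior//.
have xo : x \in `]x - 1, x + 1[ by rewrite in_itv/=; apply/andP; split; lra.
apply: filterS (near_in_itvoo xo) => y /=; rewrite !in_itv/= => /andP[? ?].
by apply/andP; split; exact: ltW.
Qed.

End Angles.

Section TwistedCoordinates.
Context {R : realType}.
Notation mu := (@lebesgue_measure R).
Notation mu2 := (@lebesgue_measure R \x @lebesgue_measure R)%E.
Notation plane := (R * R)%type.
Variables (a kappa : R) (m : R -> R).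
Hypothesis a02 : 0 <= a <= 2 * pi.
Hypothesis kappa_bound : 0 <= kappa <= 1 / 2.
Hypothesis mm : measurable_fun setT m.
Hypothesis m1 : forall x, `|m x| <= 1.
Hypothesis m_out : forall x, x < a -> m x = 0.
Hypothesis m_mean : \int[mu]_(x in `[a, a + 2 * pi]) m x = 0.

Let b := a + 2 * pi.
Let pi0 : 0 < 2 * pi :> R. Proof. by rewrite mulr_gt0// pi_gt0. Qed.
Let ab : a < b. Proof. by rewrite /b ltrDl. Qed.

(** The displacement of the point [x] of the circle, for the rate [m]. *)
Definition tw_shift (x : R) : R := \int[mu]_(t in `[a, x]) m t.
(** No displacement at [r = 1], so boundary values are kept; the displacement
    grows linearly towards the centre. *)
Definition tw_angle (q : plane) : R := q.2 + kappa * (1 - q.1) * tw_shift q.2.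
Definition tw_speed (q : plane) : R := 1 + kappa * (1 - q.1) * m q.2.
Definition tw (q : plane) : plane := polar (q.1, tw_angle q).

Let Lm x y : L2 mu `[x, y] m.
Proof. by apply: (L2_bounded (M := 1)) => //; [exact: mu_segment_lty|exact: measurable_funTS]. Qed.

Lemma prim_tw_shift x y : x <= y -> prim x y tw_shift m.
Proof.
move=> xy; split => // t /andP[xt ty]; rewrite /tw_shift.
have [ax|xa] := leP a x; first exact: Rintegral_split ax xt (L2_int (Lm _ _)).
rewrite [X in _ = X + _]Rintegral_empty// add0r.
have out (s : R) : \int[mu]_(u in `[x, a]) m u = 0.
  transitivity (\int[mu]_(u in `[x, a]) (0 : R)); last by rewrite Rintegral_cst// mul0r.
  apply: Rintegral_eq_oo => [|u /andP[_ ua]]; last exact: m_out.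
  exact: measurable_funTS.
have [at_|ta] := leP a t.
  by rewrite (Rintegral_split (ltW xa) at_ (L2_int (Lm _ _))) out// add0r.
rewrite Rintegral_empty//; transitivity (\int[mu]_(u in `[x, t]) (0 : R)).
  by rewrite Rintegral_cst// mul0r.
apply/esym; apply: Rintegral_eq_oo => [|u /andP[_ ut]]; first exact: measurable_funTS.
by apply: m_out; exact: lt_trans ut ta.
Qed.

Lemma tw_shift_left : tw_shift a = 0. Proof. exact: integral_point. Qed.
Lemma tw_shift_right : tw_shift b = 0. Proof. exact: m_mean. Qed.

Lemma continuous_tw_shift : continuous tw_shift.
Proof. exact: (prim_continuousT prim_tw_shift). Qed.

Lemma tw_angle_left r : tw_angle (r, a) = a.
Proof. by rewrite /tw_angle /= tw_shift_left mulr0 addr0. Qed.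

Lemma tw_angle_right r : tw_angle (r, b) = b.
Proof. by rewrite /tw_angle /= tw_shift_right mulr0 addr0. Qed.

Lemma tw_speed_bound r x : 0 <= r <= 1 -> 1 / 2 <= tw_speed (r, x) <= 3 / 2.
Proof.
move=> /andP[r0 r1]; rewrite /tw_speed /=; have /andP[k0 k1] := kappa_bound.
have := m1 x; rewrite ler_norml => /andP[h1 h2].
set t := kappa * (1 - r); have t0 : 0 <= t by rewrite mulr_ge0// subr_ge0.
have t1 : t <= 1 / 2 by rewrite -[leRHS]mulr1; apply: ler_pM => //; lra.
by apply/andP; split; nra.
Qed.

Lemma prim_tw_angle r x y : x <= y ->
  prim x y (fun t => tw_angle (r, t)) (fun t => tw_speed (r, t)).
Proof.
move=> xy; have idc : prim x y (fun t : R => t) (fun=> 1).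
  by apply: prim_C1; exact: cst_continuous.
exact: (prim_addr idc (prim_scale (kappa * (1 - r)) (prim_tw_shift xy))).
Qed.

Lemma tw_angle_lt r x y : 0 <= r <= 1 -> x < y -> tw_angle (r, x) < tw_angle (r, y).
Proof.
move=> r01 xy; rewrite -subr_gt0 (prim_diff (prim_tw_angle r (ltW xy)))//; last exact: ltW.
have [L _] := prim_tw_angle r (ltW xy).
apply: (@lt_le_trans _ _ (1 / 2 * (y - x))); first by rewrite mulr_gt0 ?subr_gt0//; lra.
rewrite -(Rintegral_cst_segment _ (ltW xy)); apply: le_Rintegral => //.
- exact: L2_int (L2_cst_segment _ _ _).
- exact: L2_int.
- by move=> t _; have /andP[] := tw_speed_bound t r01.
Qed.

Lemma tw_angle_le r x y : 0 <= r <= 1 -> x <= y -> tw_angle (r, x) <= tw_angle (r, y).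
Proof.
by move=> r01; rewrite le_eqVlt => /predU1P[->//|xy]; exact: ltW (tw_angle_lt r01 xy).
Qed.

Lemma tw_angle_inj r x y : 0 <= r <= 1 -> tw_angle (r, x) = tw_angle (r, y) -> x = y.
Proof.
move=> r01 e; case: (ltgtP x y) => // h.
  by have := tw_angle_lt r01 h; rewrite e ltxx.
by have := tw_angle_lt r01 h; rewrite e ltxx.
Qed.

Lemma continuous_tw_angle : continuous tw_angle.
Proof.
move=> q; rewrite /tw_angle; apply: cvgD; first exact: cvg_snd.
apply: cvgM; last first.
  by apply: (@continuous_comp _ _ _ (fun q : plane => q.2) tw_shift); [exact: cvg_snd|exact: continuous_tw_shift].
by apply: cvgM; [exact: cvg_cst|apply: cvgB; [exact: cvg_cst|exact: cvg_fst]].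
Qed.

Lemma continuous_tw : continuous tw.
Proof.
move=> q; apply: (@continuous_comp _ _ _ (fun q : plane => (q.1, tw_angle q)) (@polar R)).
  by apply: continuous_pair; [exact: continuous_fst_plane|exact: continuous_tw_angle].
exact: continuous_polar.
Qed.

Lemma enorm_tw r x : 0 <= r -> enorm (tw (r, x)) = r.
Proof. by move=> r0; rewrite /tw (@enorm_polar _ (r, tw_angle (r, x))). Qed.

Lemma tw_right r : tw (r, b) = tw (r, a).
Proof. by rewrite /tw tw_angle_left tw_angle_right /b polar_period. Qed.

Lemma tw_inj r x y : 0 < r <= 1 -> a <= x < b -> a <= y < b -> tw (r, x) = tw (r, y) -> x = y.
Proof.
move=> /andP[r0 r1] /andP[ax xb] /andP[ay yb].
have r01 : 0 <= r <= 1 by rewrite (ltW r0).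
rewrite /tw /polar /= => -[/(mulfI (lt0r_neq0 r0)) ec /(mulfI (lt0r_neq0 r0)) es].
apply: (tw_angle_inj r01); apply: angle_unique => //.
have h z : a <= z < b -> a <= tw_angle (r, z) < b.
  move=> /andP[az zb]; have := tw_angle_le r01 az; have := tw_angle_lt r01 zb.
  by rewrite tw_angle_left tw_angle_right => -> ->.
have xab : a <= x < b by rewrite ax xb.
have yab : a <= y < b by rewrite ay yb.
have dist (u v : R) : a <= u < b -> a <= v < b -> `|u - v| < 2 * pi.
  by rewrite /b => /andP[? ?] /andP[? ?]; rewrite ltr_norml; apply/andP; split; lra.
by apply: dist; exact: h.
Qed.

(** At fixed radius the angle increases continuously from [a] to [a + 2 pi]. *)
Lemma tw_surj z : cball1 z -> enorm z != 0 ->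
  exists2 x, a <= x < b & z = tw (enorm z, x).
Proof.
rewrite /cball1 /= => z1 z0; have [t /andP[at_ tb] zE] := angle_exists_from a02 z0.
have r0 : 0 <= enorm z by exact: sqrtr_ge0.
have r01 : 0 <= enorm z <= 1 by rewrite r0.
have ct : {within `[a, b], continuous (fun x => tw_angle (enorm z, x))}.
  apply: continuous_subspaceT; exact: (prim_continuousT (@prim_tw_angle (enorm z))).
have [|x xI xt] := @IVT R _ _ _ t (ltW ab) ct.
  rewrite tw_angle_left tw_angle_right (min_idPl (ltW ab)) (max_idPr (ltW ab)) at_ /=.
  exact: ltW.
move: xI; rewrite in_itv/= => /andP[ax xb]; exists x; last by rewrite /tw /= xt.
rewrite ax lt_neqAle xb andbT; apply/eqP => xb'; move: tb.
by rewrite -xt xb' tw_angle_right -/b ltxx.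
Qed.

(** The angular coordinate of [z]; at the centre it has the value [a]. *)
Definition tw_coord (z : plane) : R :=
  if enorm z == 0 then a else xget a [set x | a <= x < b /\ z = tw (enorm z, x)].

Lemma tw_coordP z : cball1 z -> a <= tw_coord z < b /\ z = tw (enorm z, tw_coord z).
Proof.
move=> bz; rewrite /tw_coord; have [e0|z0] := eqVneq (enorm z) 0.
  rewrite lexx ab e0 /tw /polar /= !mul0r; split=> //.
  move: e0 => /(congr1 (fun s => s ^+ 2)); rewrite enorm_sqr expr0n /= => /eqP.
  rewrite paddr_eq0 ?sqr_ge0// !sqrf_eq0 => /andP[/eqP h1 /eqP h2].
  by rewrite [z]surjective_pairing h1 h2.
have [x xab zE] := tw_surj bz z0.
by apply: (@xgetPex _ a [set x | a <= x < b /\ z = tw (enorm z, x)]); exists x.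
Qed.

Lemma tw_coord_tw r x : 0 < r <= 1 -> a <= x < b -> tw_coord (tw (r, x)) = x.
Proof.
move=> r01 xab; have /andP[r0 r1] := r01.
have bz : cball1 (tw (r, x)) by rewrite /cball1 /= enorm_tw// ltW.
have [h1 h2] := tw_coordP bz; rewrite (enorm_tw _ (ltW r0)) in h2.
by apply: (tw_inj r01) => //; rewrite -h2.
Qed.

(** The function on the disc that is given by [H] in the coordinates (r, x). *)
Definition tw_lift (H : plane -> R) (z : plane) : R := H (enorm z, tw_coord z).

Lemma tw_lift_tw H r x : 0 < r <= 1 -> a <= x < b -> tw_lift H (tw (r, x)) = H (r, x).
Proof.
by move=> r01 xab; rewrite /tw_lift enorm_tw ?tw_coord_tw//; case/andP: r01 => /ltW.
Qed.

(** Images of compact sets replace an explicit inverse of [tw]: closedness of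
    such images is what gives both the measurability and the continuity of the
    inverse coordinates. *)
Lemma compact_tw_box t (D : set R) : closed D -> forall V : plane -> R, continuous V ->
  compact (tw @` ((`[0, 1] `*` `[a, t]) `&` V @^-1` D)).
Proof.
move=> cD V cV; apply: continuous_compact; first exact: continuous_subspaceT continuous_tw.
apply: (@subclosed_compact plane _ (`[0, 1]%classic `*` `[a, t]%classic)).
- apply: closedI; last by apply: closed_comp => // x _; exact: cV.
  apply: compact_closed; first exact: norm_hausdorff.
  by apply: compact_setX; exact: segment_compact.
- by apply: compact_setX; exact: segment_compact.
- by move=> q [].
Qed.

Lemma measurable_tw_coord : measurable_fun ball1 tw_coord.
Proof.
have mb := @measurable_ball1 R.
apply: (@measurability _ _ plane R ball1 tw_coord (@RGenOInfty.G R) (RGenOInfty.measurableE R)).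
move=> _ [_ [t ->] <-].
have cE z : ball1 z -> a <= tw_coord z < b /\ z = tw (enorm z, tw_coord z).
  by move=> /ball1_cball1; exact: tw_coordP.
have [tlt|tge] := ltP t a.
  rewrite (_ : _ `&` _ = ball1)//; apply/seteqP; split=> [z []//|z bz]; split=> //=.
  by rewrite in_itv/= andbT (lt_le_trans tlt)//; have [/andP[]] := cE z bz.
have [tb|bt] := ltP t b; last first.
  rewrite (_ : _ `&` _ = set0); first exact: measurable0.
  apply/seteqP; split=> // z [bz /=]; rewrite in_itv/= andbT => h.
  by have [/andP[_ h2] _] := cE z bz; rewrite ltNge (le_trans (ltW h2) bt) in h.
(* The points of coordinate at most [t] form a compact set. *)
pose K : set plane := tw @` ((`[0, 1] `*` `[a, t]) `&` (fun=> 0 : R) @^-1` setT).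
have cK : compact K by apply: compact_tw_box; [exact: closedT|exact: cst_continuous].
rewrite (_ : _ `&` _ = ball1 `\` K); first by apply: measurableD => //; exact: compact_measurable_plane.
apply/seteqP; split=> z [bz zt]; split=> //.
- move=> [[r x] [[/=]]]; rewrite !in_itv/= => /andP[r0 r1] /andP[ax xt] _ zE.
  move: zt => /=; rewrite in_itv/= andbT -zE.
  move: r0; rewrite le_eqVlt => /predU1P[r0|r0].
    by rewrite /tw_coord enorm_tw -r0// eqxx ltNge tge.
  rewrite tw_coord_tw ?r0// ?ax ?(le_lt_trans xt tb)//.
  by rewrite ltNge xt.
- rewrite /= in_itv/= andbT ltNge; apply/negP => h; apply: zt.
  have [/andP[h1 h2] zE] := cE z bz.
  exists (enorm z, tw_coord z) => //; split => //; split; rewrite /= in_itv/=; last by rewrite h1.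
  by rewrite sqrtr_ge0; move: bz => /ltW.
Qed.

Lemma measurable_enorm : measurable_fun setT (@enorm R).
Proof.
rewrite /enorm; apply: measurable_comp_continuous; first exact: sqrt_continuous.
by apply: measurable_funD; apply: measurable_funX.
Qed.

Lemma measurable_tw_lift (H : plane -> R) : measurable_fun setT H -> measurable_fun ball1 (tw_lift H).
Proof.
move=> mH; have mb := @measurable_ball1 R; pose X := tw_coord \_ ball1.
have mX : measurable_fun [set: plane] X.
  exact: ((measurable_restrictT tw_coord mb).1 measurable_tw_coord).
apply: (@eq_measurable_fun _ _ _ _ _ (fun z : plane => H (enorm z, X z))).
  by move=> z zb; rewrite /X patchE zb.
apply: measurable_funTS; apply: (measurableT_comp mH).
exact: (measurable_fun_pair measurable_enorm mX).
Qed.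

(** [V] must be compatible with the identifications made by [tw], at the centre
    and across the ray of angle [a]. *)
Lemma continuous_tw_lift (V : plane -> R) : continuous V -> (forall x, V (0, x) = V (0, a)) ->
  (forall r, V (r, b) = V (r, a)) -> {within cball1, continuous (tw_lift V)}.
Proof.
move=> cV V0 Vb; apply/continuous_closedP => D cD; apply/closed_subspaceP.
exists (tw @` ((`[0, 1] `*` `[a, b]) `&` V @^-1` D)).
  by apply: compact_closed; [exact: norm_hausdorff|exact: compact_tw_box].
have VE r x : 0 <= r <= 1 -> a <= x <= b -> tw_lift V (tw (r, x)) = V (r, x).
  move=> /andP[r0 r1] /andP[ax xb]; move: r0; rewrite le_eqVlt => /predU1P[r0|r0].
    by rewrite /tw_lift enorm_tw -r0// V0 (V0 x).
  move: xb; rewrite le_eqVlt => /predU1P[->|xb].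
    by rewrite tw_right Vb tw_lift_tw ?r0 ?lexx.
  by rewrite tw_lift_tw ?r0 ?ax.
apply/seteqP; split=> z [h bz]; split=> //.
- move: h => [[r x] [[/= rI xI] Dx] zE]; suff : D (tw_lift V z) by []. rewrite -zE VE//.
- have [/andP[h1 h2] zE] := tw_coordP bz.
  have rI : 0 <= enorm z <= 1 by rewrite sqrtr_ge0.
  exists (enorm z, tw_coord z) => //; split; last exact: h.
  by split; rewrite /= in_itv/= ?rI// h1 ltW.
Qed.

End TwistedCoordinates.

(** * Iterated integrals of dominated functions *)

Section Tame.
Context {R : realType}.
Notation mu := (@lebesgue_measure R).
Notation mu2 := (@lebesgue_measure R \x @lebesgue_measure R)%E.
Notation plane := (R * R)%type.
Variables (a b : R) (g : R -> R).
Hypothesis ab : a < b.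
Hypothesis mg : measurable_fun setT g.
Hypothesis g1 : forall x, 1 <= g x.
Hypothesis Lg : L2 mu `[a, b] g.
Implicit Types (K : plane -> R) (k l : nat).

(** [k] counts the factors that are only square integrable in [x]; they are all
    dominated by [g], so that [tame 2] implies integrability and products add
    the exponents. *)
Definition tame k K := measurable_fun setT K /\
  exists2 M, 0 <= M & forall r x, 0 <= r <= 1 -> a <= x <= b -> `|K (r, x)| <= M * g x ^+ k.

Let g0 x k : 0 <= g x ^+ k. Proof. by rewrite exprn_ge0// (le_trans ler01). Qed.

Lemma tameM k l K L : tame k K -> tame l L -> tame (k + l) (fun q => K q * L q).
Proof.
move=> [mK [M M0 hM]] [mL [N N0 hN]]; split; first exact: measurable_funM.
exists (M * N); first exact: mulr_ge0.
move=> r x rI xI; rewrite normrM exprD mulrACA; apply: ler_pM => //; [exact: hM|exact: hN].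
Qed.

Lemma tameD k K L : tame k K -> tame k L -> tame k (fun q => K q + L q).
Proof.
move=> [mK [M M0 hM]] [mL [N N0 hN]]; split; first exact: measurable_funD.
exists (M + N); first exact: addr_ge0.
move=> r x rI xI; rewrite (le_trans (ler_normD _ _))// mulrDl.
by apply: lerD; [exact: hM|exact: hN].
Qed.

Lemma tameW k l K : (k <= l)%N -> tame k K -> tame l K.
Proof.
move=> kl [mK [M M0 hM]]; split=> //; exists M => // r x rI xI.
by rewrite (le_trans (hM r x rI xI))// ler_wpM2l// ler_weXn2l.
Qed.

Lemma tame_continuous K : continuous K -> tame 0 K.
Proof.
move=> cK; split; first exact: continuous_measurable_plane.
have cbox : compact (`[0, 1]%classic `*` `[a, b]%classic : set plane).
  by apply: compact_setX; exact: segment_compact.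
have := continuous_compact (continuous_subspaceT cK) cbox.
move=> /compact_bounded[M [_ hM]]; exists (`|M| + 1); first by rewrite addr_ge0.
move=> r x rI xI; rewrite expr0 mulr1; apply: (hM (`|M| + 1)); first by rewrite ltr_pwDr// ler_norm.
by exists (r, x) => //; split; rewrite /= in_itv.
Qed.

Lemma tame_bounded K (M : R) : measurable_fun setT K -> 0 <= M ->
  (forall r x, 0 <= r <= 1 -> a <= x <= b -> `|K (r, x)| <= M) -> tame 0 K.
Proof. by move=> mK M0 h; split=> //; exists M => // r x rI xI; rewrite mulr1; exact: h. Qed.

Lemma tame_cst (c : R) : tame 0 (fun=> c).
Proof. by apply: tame_continuous; exact: cst_continuous. Qed.

Lemma tame_scale k K c : tame k K -> tame k (fun q => c * K q).
Proof. exact: (tameM (tame_cst c)). Qed.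

Lemma tameN k K : tame k K -> tame k (fun q => - K q).
Proof.
move=> /(tame_scale (-1)) h; congr (tame k _) : h; by apply/funext => q; rewrite mulN1r.
Qed.

Lemma tameB k K L : tame k K -> tame k L -> tame k (fun q => K q - L q).
Proof. by move=> hK hL; apply: tameD => //; exact: tameN. Qed.

Lemma tame_fst : tame 0 (fun q => q.1).
Proof. by apply: tame_continuous; exact: continuous_fst_plane. Qed.

Lemma tame_of_snd (u : R -> R) : continuous u -> tame 0 (fun q => u q.2).
Proof.
move=> cu; apply: tame_continuous => q.
by apply: (@continuous_comp _ _ _ (fun q : plane => q.2) u); [exact: cvg_snd|exact: cu].
Qed.

Lemma tame_dominated (u : R -> R) : measurable_fun setT u -> (forall x, `|u x| <= g x) ->
  tame 1 (fun q => u q.2).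
Proof.
move=> mu_ hu; split; first exact: (measurableT_comp mu_).
by exists 1 => // r x _ _; rewrite mul1r expr1 hu.
Qed.

Let Q : set plane := `]0, 1[ `*` `[a, b[.
Let mQ : measurable (Q : set (measurableTypeR R * measurableTypeR R)).
Proof. exact: measurableX. Qed.

Let ig k : (k <= 2)%N -> mu.-integrable `[a, b] (EFin \o (fun x => g x ^+ k)).
Proof.
case: k => [|[|[|//]]] _.
- exact: (L2_int (L2_cst_segment a b 1)).
- exact: (L2_int Lg).
- exact: L2_sqr_integrable.
Qed.

Lemma tame_integrable K : tame 2 K -> mu2.-integrable Q (EFin \o K).
Proof.
move=> [mK [M M0 hM]].
have iM : mu.-integrable `[(0 : R), 1] (EFin \o (fun=> M)) by exact: L2_int (L2_cst_segment _ _ _).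
apply: (integrable_rect_dominated (p := fun=> M) (q := fun x => g x ^+ 2)) => //.
- exact: measurable_funTS.
- by apply: integrableS iM => //; apply: subset_itv; rewrite bnd_simp.
- by apply: integrableS (ig _) => //; apply: subset_itv; rewrite bnd_simp.
- move=> r x /=; rewrite !in_itv/= => /andP[? ?] /andP[? ?].
  by rewrite (ger0_norm M0) (ger0_norm (g0 _ _)); apply: hM; apply/andP; split=> //; exact: ltW.
Qed.

Lemma tame_r_section k K x : tame k K -> a <= x <= b -> L2 mu `[0, 1] (fun r => K (r, x)).
Proof.
move=> [mK [M M0 hM]] xI; apply: (L2_bounded (M := M * g x ^+ k)) => //.
- exact: mu_segment_lty.
- apply: measurable_funTS; apply: (measurableT_comp mK).
  by apply: measurable_fun_pair => //; exact: measurable_cst.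
- by move=> r /=; rewrite in_itv/= => rI; exact: hM.
Qed.

Lemma tame_x_section K r : tame 2 K -> 0 <= r <= 1 ->
  mu.-integrable `[a, b] (EFin \o (fun x => K (r, x))).
Proof.
move=> [mK [M M0 hM]] rI; have iMg := integrableZl _ M (ig (leqnn 2)).
apply: (le_integrable _ _ _ (iMg _)) => //.
- apply/measurable_EFinP; apply: measurable_funTS; apply: (measurableT_comp mK).
  by apply: measurable_fun_pair => //; exact: measurable_cst.
- move=> x /=; rewrite in_itv/= => xI; rewrite lee_fin (ger0_norm (mulr_ge0 M0 (g0 _ _))).
  exact: hM.
Qed.

Let mA : measurable (`]0, 1[%classic : set (measurableTypeR R)). Proof. by []. Qed.
Let mB : measurable (`[a, b[%classic : set (measurableTypeR R)). Proof. by []. Qed.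

(** The integral over the coordinate rectangle, without the Jacobian. *)
Definition rect_integral K := \int[mu2]_(q in Q) K q.

Lemma dblD K L : tame 2 K -> tame 2 L -> rect_integral (fun q => K q + L q) = rect_integral K + rect_integral L.
Proof. by move=> hK hL; exact: (RintegralD mQ (tame_integrable hK) (tame_integrable hL)). Qed.

Lemma dblB K L : tame 2 K -> tame 2 L -> rect_integral (fun q => K q - L q) = rect_integral K - rect_integral L.
Proof. by move=> hK hL; exact: (RintegralB mQ (tame_integrable hK) (tame_integrable hL)). Qed.

Lemma dbl_rx K : tame 2 K -> rect_integral K = \int[mu]_(r in `]0, 1[) \int[mu]_(x in `[a, b]) K (r, x).
Proof.
move=> hK; rewrite /rect_integral (@fubini_rect12 R `]0, 1[ `[a, b[ K mA mB (tame_integrable hK)).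
apply: eq_Rintegral => r /set_mem/=; rewrite in_itv/= => /andP[r0 r1].
rewrite Rintegral_itv_bndo_bndc//.
have i : mu.-integrable `[a, b] (EFin \o (fun x => K (r, x))) by apply: tame_x_section => //; rewrite !ltW.
by apply: integrableS i => //; apply: subset_itv; rewrite bnd_simp.
Qed.

Lemma dbl_xr K : tame 2 K -> rect_integral K = \int[mu]_(x in `[a, b[) \int[mu]_(r in `[0, 1]) K (r, x).
Proof.
move=> hK; rewrite /rect_integral (@fubini_rect21 R `]0, 1[ `[a, b[ K mA mB (tame_integrable hK)).
apply: eq_Rintegral => x /set_mem/=; rewrite in_itv/= => /andP[ax xb].
have i : mu.-integrable `[0, 1] (EFin \o (fun r => K (r, x))).
  by apply: L2_int; apply: (tame_r_section hK); rewrite ax ltW.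
rewrite Rintegral_itv_obnd_cbnd; last first.
  by apply: integrableS i => //; apply: subset_itv; rewrite bnd_simp.
by rewrite Rintegral_itv_bndo_bndc//; apply: integrableS i => //; apply: subset_itv; rewrite bnd_simp.
Qed.

Lemma dbl_derive_r (A A' : plane -> R) : tame 2 A' ->
  (forall x, a <= x <= b -> prim 0 1 (fun r => A (r, x)) (fun r => A' (r, x))) ->
  rect_integral A' = \int[mu]_(x in `[a, b[) (A (1, x) - A (0, x)).
Proof.
move=> hA h; rewrite dbl_xr//; apply: eq_Rintegral => x /set_mem/=; rewrite in_itv/= => /andP[ax xb].
by rewrite (prim_diff (h x _))// ax ltW.
Qed.

Lemma dbl_derive_x (A A' : plane -> R) : tame 2 A' ->
  (forall r, 0 <= r <= 1 -> prim a b (fun x => A (r, x)) (fun x => A' (r, x))) ->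
  (forall r, 0 <= r <= 1 -> A (r, a) = A (r, b)) -> rect_integral A' = 0.
Proof.
move=> hA h e; rewrite dbl_rx//; transitivity (\int[mu]_(r in `]0, 1[) (0 : R)).
  apply: eq_Rintegral => r /set_mem/=; rewrite in_itv/= => /andP[r0 r1].
  have rI : 0 <= r <= 1 by rewrite !ltW.
  by rewrite -(prim_diff (h r rI) (lexx a) (ltW ab) (lexx b)) (e r rI) subrr.
by rewrite Rintegral_cst ?mul0r.
Qed.

End Tame.

Section ChainRule.
Context {R : realType}.
Notation mu := (@lebesgue_measure R).

(** Chain rule for a smooth function of an increasing absolutely continuous one. *)
Lemma prim_comp (psi rho F F' : R -> R) (delta a b : R) : 0 < delta -> a <= b ->
  (forall x y, x <= y -> prim x y psi rho) -> (forall x, delta <= rho x) -> measurable_fun setT rho ->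
  (forall t : R, is_derive t 1 F (F' t)) -> continuous F' ->
  prim a b (fun x => F (psi x)) (fun x => F' (psi x) * rho x).
Proof.
move=> d0 ab pp dr mr dF cF'; have cpsi := prim_continuousT pp.
have incr x y : (x < y) -> psi x < psi y.
  move=> xy; rewrite -subr_gt0 (prim_diff (pp _ _ (ltW xy)))//; last exact: ltW.
  have [L _] := pp _ _ (ltW xy).
  apply: (@lt_le_trans _ _ (delta * (y - x))); first by rewrite mulr_gt0 ?subr_gt0.
  rewrite -(Rintegral_cst_segment _ (ltW xy)); apply: le_Rintegral => //.
  - exact: L2_int (L2_cst_segment _ _ _).
  - exact: L2_int.
have incrE x y : (psi x <= psi y) = (x <= y).
  by case: (leP x y) => [|/incr h]; [rewrite le_eqVlt => /predU1P[->|/incr/ltW]//; rewrite lexx|rewrite leNgt h].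
have cF'psi : continuous (fun x => F' (psi x)).
  by move=> x; apply: (@continuous_comp _ _ _ psi F'); [exact: cpsi|exact: cF'].
have mab : measurable (`[a, b]%classic : set (measurableTypeR R)) by [].
split.
  have [L _] := pp _ _ ab.
  have [M _ hM] := bounded_segment (a := a) (b := b) (continuous_subspaceT cF'psi).
  apply: (L2_mulr_bounded (M := M) mab) => //.
  by apply: measurable_funTS; exact: continuous_measurable_fun.
move=> x /andP[ax xb].
have pF : prim (psi a) (psi x) F F' by exact: prim_C1.
have pax : psi a <= psi x by rewrite incrE.
apply/eqP; rewrite addrC -subr_eq; apply/eqP; rewrite (prim_diff pF)// /Rintegral; congr fine.
have mF' : measurable_fun `[psi a, psi x] (EFin \o F').
  by apply/measurable_EFinP; apply: measurable_funTS; exact: continuous_measurable_fun.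
rewrite (@signed_substitution _ _ (measurableTypeR R) (measurableTypeR R) R mu mu
    `[a, x]%classic `[psi a, psi x]%classic psi rho _ _ _ _ _ mF')//.
- by move=> t /=; rewrite !in_itv/= !incrE.
- by move=> t _; rewrite (le_trans (ltW d0)).
- move=> G mG G0; rewrite integral_mkcond [RHS]integral_mkcond.
  have mGr : measurable_fun setT (G \_ `[psi a, psi x])%E.
    by apply/(measurable_restrictT _ _).1 => //; exact: measurable_funTS.
  rewrite (increasing_substitution d0 pp dr mr mGr); last by move=> y; apply: erestrict_ge0.
  apply: eq_integral => t _; rewrite !patchE.
  have -> : (psi t \in `[psi a, psi x]%classic) = (t \in `[a, x]%classic).
    by rewrite !mem_setE !in_itv/= !incrE.
  by case: ifP => // _; rewrite mul0e.
Qed.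

End ChainRule.

Section Slices.
Context {R : realType}.
Notation mu := (@lebesgue_measure R).
Notation mu2 := (@lebesgue_measure R \x @lebesgue_measure R)%E.
Notation plane := (R * R)%type.
Variables (a b : R) (g : R -> R).
Hypothesis g1 : forall x, 1 <= g x.
Hypothesis Lg : L2 mu `[a, b] g.

Lemma measurable_slice (K : plane -> R) (A B : set R) : measurable A -> measurable B ->
  mu2.-integrable (A `*` B) (EFin \o K) ->
  measurable_fun A (fun r => \int[mu]_(x in B) K (r, x)).
Proof.
move=> mA mB iK; have mAB : measurable (A `*` B) by exact: measurableX.
have := iK; rewrite integrable_mkcond// restrict_EFin => iK'.
have mG := measurable_fubini_F iK'; rewrite /fubini_F in mG.
have mF : measurable_fun setT (fine \o (fun x => \int[mu]_y ((K \_ (A `*` B)) (x, y))%:E)%E).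
  by apply: measurableT_comp.
apply: (@eq_measurable_fun _ _ _ _ _ (fine \o (fun x => \int[mu]_y ((K \_ (A `*` B)) (x, y))%:E)%E)).
  move=> x xA; rewrite /Rintegral [in RHS]integral_mkcond /=; congr fine.
  apply: eq_integral => y _; rewrite !patchE in_setX xA /=.
  by case: ifP.
exact: measurable_funTS.
Qed.

Lemma integrable_slice (K : plane -> R) : tame a b g 2 K ->
  mu.-integrable `]0, 1[ (EFin \o (fun r => \int[mu]_(x in `[a, b]) K (r, x))).
Proof.
move=> tK; have mA : measurable (`]0, 1[%classic : set (measurableTypeR R)) by [].
have mB : measurable (`[a, b[%classic : set (measurableTypeR R)) by [].
have mab : measurable (`[a, b]%classic : set (measurableTypeR R)) by [].
have iK := tame_integrable g1 Lg tK.
have mS := measurable_slice mA mB iK.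
have E (r : R) : `]0, 1[%classic r ->
    \int[mu]_(x in `[a, b[) K (r, x) = \int[mu]_(x in `[a, b]) K (r, x).
  rewrite /= in_itv/= => /andP[r0 r1]; apply: Rintegral_itv_bndo_bndc.
  have i : mu.-integrable `[a, b] (EFin \o (fun x => K (r, x))) by apply: (tame_x_section g1 Lg tK); rewrite !ltW.
  by apply: integrableS i => //; apply: subset_itv; rewrite bnd_simp.
have mS' : measurable_fun (`]0, 1[%classic : set (measurableTypeR R)) (fun r => \int[mu]_(x in `[a, b]) K (r, x)).
  by apply: eq_measurable_fun mS => r /set_mem/E.
have lty : (mu (`]0%R, 1%R[%classic) < +oo)%E by rewrite lebesgue_measure_itv/= lte_fin ltr01 -EFinD ltry.
have [_ [M M0 KM]] := tK; have ig := L2_sqr_integrable mab Lg.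
apply: (L2_integrable mA lty).
apply: (@L2_bounded _ _ _ mu _ _ (M * \int[mu]_(x in `[a, b]) (g x ^+ 2))) => // r.
rewrite /= in_itv/= => /andP[r0 r1].
have rI : 0 <= r <= 1 by rewrite !ltW.
have i := tame_x_section g1 Lg tK rI.
apply: (le_trans (le_normr_Rintegral mab i)).
rewrite -RintegralZl//; apply: le_Rintegral => //; last first.
- by move=> x; rewrite /= in_itv/= => xab; exact: KM.
- by have := integrableZl mab M ig.
- by have := integrable_norm i.
Qed.

Lemma int_open_unit (G : R -> R) : continuous G ->
  mu.-integrable `]0, 1[ (EFin \o G) /\
  \int[mu]_(r in `]0, 1[) G r = \int[mu]_(r in `[0, 1]) G r.
Proof.
move=> cG; have sub : `]0, 1[%classic `<=` (`[0, 1]%classic : set R).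
  by move=> x /=; rewrite !in_itv/= => /andP[/ltW -> /ltW ->].
have mA : measurable (`]0, 1[%classic : set (measurableTypeR R)) by [].
have mB : measurable (`[0, 1]%classic : set (measurableTypeR R)) by [].
have i := integrableS mB mA sub (continuous_integrable 0 1 cG).
split => //; rewrite /Rintegral; congr fine.
by apply/esym/(@integral_itv_bndoo R 0 1 (EFin \o G) true false); exact: measurable_int i.
Qed.

Lemma dbl_le (K : plane -> R) (G : R -> R) : tame a b g 2 K -> continuous G ->
  (forall r : R, 0 < r < 1 -> \int[mu]_(x in `[a, b]) K (r, x) <= G r) ->
  rect_integral a b K <= \int[mu]_(r in `[0, 1]) G r.
Proof.
move=> tK cG KG; rewrite (dbl_rx g1 Lg tK); have [iG <-] := int_open_unit cG.
have mA : measurable (`]0, 1[%classic : set (measurableTypeR R)) by [].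
apply: (le_Rintegral mA (integrable_slice tK) iG) => r /=.
by rewrite in_itv/=; exact: KG.
Qed.

Lemma dbl_eq (K : plane -> R) (G : R -> R) : tame a b g 2 K -> continuous G ->
  (forall r : R, 0 < r < 1 -> \int[mu]_(x in `[a, b]) K (r, x) = G r) ->
  rect_integral a b K = \int[mu]_(r in `[0, 1]) G r.
Proof.
move=> tK cG KG; rewrite (dbl_rx g1 Lg tK); have [iG <-] := int_open_unit cG.
by apply: eq_Rintegral => r /set_mem/=; rewrite in_itv/=; exact: KG.
Qed.

End Slices.

(** * The competitor, its gradient and its energy *)

Section Competitor.
Context {R : realType}.
Notation mu := (@lebesgue_measure R).
Notation mu2 := (@lebesgue_measure R \x @lebesgue_measure R)%E.
Notation plane := (R * R)%type.
Variables (a kappa N : R) (m C p w w' : R -> R).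
Hypothesis a02 : 0 <= a <= 2 * pi.
Hypothesis kappa_bound : 0 <= kappa <= 1 / 2.
Hypothesis mm : measurable_fun setT m.
Hypothesis m1 : forall x, `|m x| <= 1.
Hypothesis m_out : forall x, x < a -> m x = 0.
Hypothesis m_mean : \int[mu]_(x in `[a, a + 2 * pi]) m x = 0.
Let b := a + 2 * pi.
Hypothesis pC : prim a b C p.
Hypothesis pw : prim a b w w'.
Hypothesis cC : continuous C.
Hypothesis cw : continuous w.
Hypothesis mp : measurable_fun setT p.
Hypothesis mw' : measurable_fun setT w'.
Hypothesis Cab : C a = C b.
Hypothesis wab : w a = w b.

Let pi0 : 0 < 2 * pi :> R. Proof. by rewrite mulr_gt0// pi_gt0. Qed.
Let ab : a < b. Proof. by rewrite /b ltrDl. Qed.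

Notation ang := (tw_angle a kappa m).
Notation rho := (tw_speed kappa m).
Notation tw := (tw a kappa m).
Notation lift := (tw_lift a kappa m).
Notation eta := (tw_shift a m).

Let f x := C x - w x.
Let f' x := p x - w' x.
(** The competitor divided by [r]; it equals [C] at [r = 1]. *)
Definition comp_val (q : plane) := C q.2 - N * (kappa * (1 - q.1)) * f q.2.
Definition comp_dx (q : plane) := p q.2 - N * (kappa * (1 - q.1)) * f' q.2.
(** The derivative of [comp_val] along the ray, at fixed angle instead of fixed
    [x]; it is of order [kappa]. *)
Definition comp_transport (q : plane) :=
  N * kappa * f q.2 + kappa * eta q.2 / rho q * comp_dx q.
Local Notation U := comp_val.
Local Notation Ux := comp_dx.
Local Notation D := comp_transport.
Definition comp_dr (q : plane) := U q + q.1 * D q.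
Definition comp_dt (q : plane) := Ux q / rho q.
(** The component of the gradient in the direction of angle [t0]; the
    Cartesian components are those for [t0 = 0] and [t0 = pi / 2]. *)
Definition comp_grad t0 (q : plane) := cos (ang q - t0) * comp_dr q - sin (ang q - t0) * comp_dt q.
Definition competitor : plane -> R := lift (fun q => q.1 * U q).
Definition competitor_grad (z : plane) : plane :=
  (lift (comp_grad 0) z, lift (comp_grad (pi / 2)) z).
(** The energy density, after the part that integrates to the boundary term has
    been removed. *)
Definition comp_energy (q : plane) :=
  q.1 * (Ux q ^+ 2 / rho q - U q ^+ 2 * rho q) + q.1 ^+ 3 * (D q ^+ 2 * rho q).

Let g x := 1 + (`|p x| + `|w' x|).
Let g1 x : 1 <= g x. Proof. by rewrite /g lerDl addr_ge0. Qed.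
Let mg : measurable_fun setT g.
Proof. by apply: measurable_funD => //; apply: measurable_funD; exact: measurableT_comp. Qed.
Let Lg : L2 mu `[a, b] g.
Proof.
have mab : measurable (`[a, b]%classic : set (measurableTypeR R)) by [].
have [Lp _] := pC; have [Lw _] := pw.
have nrm (u : R -> R) : L2 mu `[a, b] u -> L2 mu `[a, b] (fun x => `|u x|).
  move=> Lu; apply: (L2_le mab _ Lu); last by move=> x _; rewrite normr_id.
  by have [mu_ _] := Lu; exact: measurableT_comp.
by apply: (L2_addr mab (L2_cst_segment _ _ _)); apply: (L2_addr mab); exact: nrm.
Qed.

Notation tm := (tame a b g).
Let tM := (@tameM R a b g).
Let tcst := tame_cst a b g.
Let tcont := (@tame_continuous R a b g).

Let cf : continuous f. Proof. by move=> x; apply: cvgB; [exact: cC|exact: cw]. Qed.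
Let ceta : continuous eta. Proof. exact: continuous_tw_shift. Qed.
Let cang : continuous ang. Proof. exact: continuous_tw_angle. Qed.

Let tr : tm 0 (fun q => q.1). Proof. exact: tame_fst. Qed.
Let teta : tm 0 (fun q => eta q.2). Proof. exact: tame_of_snd. Qed.
Let tfs : tm 0 (fun q => f q.2). Proof. exact: tame_of_snd. Qed.
Let tCs : tm 0 (fun q => C q.2). Proof. exact: tame_of_snd. Qed.
Let ts : tm 0 (fun q => N * (kappa * (1 - q.1))).
Proof. exact: (tame_scale N (tame_scale kappa (tameB (tcst 1) tr))). Qed.

Let tU : tm 0 U. Proof. by apply: tameB => //; exact: (tM ts tfs). Qed.
Let tp : tm 1 (fun q => p q.2).
Proof. by apply: tame_dominated => // x; rewrite /g; have := normr_ge0 (w' x); lra. Qed.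
Let tw' : tm 1 (fun q => w' q.2).
Proof. by apply: tame_dominated => // x; rewrite /g; have := normr_ge0 (p x); lra. Qed.
Let tf' : tm 1 (fun q => f' q.2). Proof. exact: tameB. Qed.
Let tUx : tm 1 Ux. Proof. by apply: tameB => //; exact: (tM ts tf'). Qed.
Let tm_m : tm 0 (fun q => m q.2).
Proof.
apply: (@tame_bounded R a b g _ 1) => //.
exact: (measurableT_comp mm).
Qed.
Let trho : tm 0 rho.
Proof.
exact: (tameD (tcst 1) (tM (tame_scale kappa (tameB (tcst 1) tr)) tm_m)).
Qed.
Let rho_bound r x : 0 <= r <= 1 -> 1 / 2 <= rho (r, x) <= 3 / 2.
Proof. exact: tw_speed_bound. Qed.
Let mrho : measurable_fun setT rho. Proof. by have [] := trho. Qed.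
Let tirho : tm 0 (fun q => (rho q)^-1).
Proof.
apply: (@tame_bounded R a b g _ 2) => // [|r x rI _]; first exact: (measurableT_comp measurable_invr mrho).
have /andP[h1 h2] := rho_bound x rI.
have h0 : 0 < rho (r, x) by apply: lt_le_trans h1.
rewrite ger0_norm ?invr_ge0 ?(ltW h0)// -[leLHS]mul1r ler_pdivrMr//; lra.
Qed.
Let tD : tm 1 D.
Proof.
apply: (tameD (K := fun q => N * kappa * f q.2)).
  by apply: (tameW g1 (k := 0)) => //; exact: tame_scale.
exact: (tM (tM (tame_scale kappa teta) tirho) tUx).
Qed.
Let tdr : tm 1 comp_dr. Proof. by apply: tameD; [exact: (tameW g1 (k := 0))|exact: (tM tr tD)]. Qed.
Let tdt : tm 1 comp_dt. Proof. exact: (tM tUx tirho). Qed.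
Let ctrig (F : R -> R) t0 : continuous F -> tm 0 (fun q => F (ang q - t0)).
Proof.
move=> cF; apply: tcont => q.
apply: (@continuous_comp _ _ _ (fun q : plane => ang q - t0) F); last exact: cF.
by apply: cvgB; [exact: cang|exact: cvg_cst].
Qed.
Let tcos t0 : tm 0 (fun q => cos (ang q - t0)). Proof. exact/ctrig/continuous_cos. Qed.
Let tsin t0 : tm 0 (fun q => sin (ang q - t0)). Proof. exact/ctrig/continuous_sin. Qed.
Let tgrad t0 : tm 1 (comp_grad t0).
Proof. by apply: tameB; [exact: (tM (tcos t0) tdr)|exact: (tM (tsin t0) tdt)]. Qed.

Notation dbl := (@rect_integral R a b).
Notation Q := (`]0, 1[ `*` `[a, a + 2 * pi[ : set plane).

Let twist r : 0 < r < 1 ->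
    [/\ forall x y, x <= y -> prim x y (fun t => ang (r, t)) (fun t => rho (r, t)),
        forall x, 1 / 2 <= rho (r, x), ang (r, a) = a & ang (r, a + 2 * pi) = a + 2 * pi].
Proof.
move=> /andP[r0 r1]; have rI : 0 <= r <= 1 by rewrite !ltW.
split=> [x y xy|x||].
- exact: prim_tw_angle.
- by have /andP[] := rho_bound x rI.
- exact: tw_angle_left.
- exact: tw_angle_right.
Qed.
Let mang : measurable_fun setT ang. Proof. exact: continuous_measurable_plane. Qed.
Let half0 : 0 < 1 / 2 :> R. Proof. lra. Qed.

Let liftQ H q : Q q -> lift H (tw q) = H q.
Proof.
case: q => r x [/=]; rewrite !in_itv/= => /andP[r0 r1] xab.
by apply: tw_lift_tw => //; rewrite r0 ltW.
Qed.

(** Integrals over the disc in the coordinates [tw]. *)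
Lemma bint_dbl (F K : plane -> R) : measurable_fun ball1 F ->
  (forall q, Q q -> K q = F (tw q) * (q.1 * rho q)) -> tm 2 K -> bint F = dbl K.
Proof.
have mA : measurable (`]0, 1[%classic : set (measurableTypeR R)) by [].
have mB : measurable (`[a, b[%classic : set (measurableTypeR R)) by [].
move=> mF KE tK; have iK := tame_integrable g1 Lg tK.
have [_ ->] := bint_coordinates half0 mang mrho twist mF KE iK.
by rewrite /Defs.bint /rect_integral -fubini_rect12.
Qed.

Lemma L2_lift H : tm 1 H -> L2 mu2 ball1 (lift H).
Proof.
move=> tH; have [mH _] := tH; pose K q := H q * H q * (q.1 * rho q).
have tK : tm 2 K by apply: (tM (tM tH tH)); exact: (tM tr trho).
apply: (L2_coordinates half0 mang mrho twist (K := K)).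
- exact: measurable_tw_lift.
- by move=> q Qq; rewrite liftQ// expr2.
- exact: tame_integrable.
Qed.

Let tV : tm 0 (fun q => q.1 * U q). Proof. exact: (tM tr tU). Qed.

Section TestFunction.
Variables (phi : plane -> R) (t0 : R).
Hypothesis tphi : test_fun phi.
Let Phi q := phi (tw q).
Let ph1 q := pd1 phi (tw q).
Let ph2 q := pd2 phi (tw q).
Let Dt q := q.1 * (- sin (ang q) * ph1 q + cos (ang q) * ph2 q).
Let Pr q := cos (ang q) * ph1 q + sin (ang q) * ph2 q - kappa * eta q.2 * Dt q.

Let ctw : continuous tw. Proof. exact: continuous_tw. Qed.
Let comp_tw (u : plane -> R) : continuous u -> continuous (fun q => u (tw q)).
Proof. by move=> cu q; apply: (@continuous_comp _ _ _ tw u); [exact: ctw|exact: cu]. Qed.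
Let C1 : Ck 1 phi. Proof. exact: tphi.1. Qed.
Let cphi : continuous phi. Proof. exact: (Ck_continuous C1). Qed.
Let cph1 : continuous (pd1 phi). Proof. by have [_ _ _ /Ck_continuous] := Ck_pd C1. Qed.
Let cph2 : continuous (pd2 phi). Proof. by have [_ _ _ _ /Ck_continuous] := Ck_pd C1. Qed.

Let phi_circle z : enorm z = 1 -> phi z = 0.
Proof.
move=> z1; have [_ [K [_ KB K0]]] := tphi; apply: K0 => /KB.
by rewrite /ball1 /= z1 ltxx.
Qed.

Lemma prim_test_r x : prim 0 1 (fun r => Phi (r, x)) (fun r => Pr (r, x)).
Proof.
have cr : continuous (fun r : R => (r, x)).
  by apply: continuous_pair => r; [exact: cvg_id|exact: cvg_cst].
have ca : continuous (fun r : R => ang (r, x)).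
  by move=> r; apply: (@continuous_comp _ _ _ (fun r : R => (r, x)) ang); [exact: cr|exact: cang].
apply: prim_C1 => [r|]; last first.
  have cc (u : plane -> R) : continuous u -> continuous (fun r : R => u (tw (r, x))).
    by move=> cu r; apply: (@continuous_comp _ _ _ (fun r : R => (r, x)) (fun q => u (tw q))); [exact: cr|exact: comp_tw].
  have ct (F : R -> R) : continuous F -> continuous (fun r : R => F (ang (r, x))).
    by move=> cF r; apply: (@continuous_comp _ _ _ (fun r : R => ang (r, x)) F); [exact: ca|exact: cF].
  have c1 := cc _ cph1; have c2 := cc _ cph2.
  have c3 := ct _ (@continuous_cos R); have c4 := ct _ (@continuous_sin R).
  move=> r; rewrite /Pr /Dt /ph1 /ph2 /=; apply: cvgB.
    by apply: cvgD; apply: cvgM; [exact: c3|exact: c1|exact: c4|exact: c2].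
  apply: cvgM; first exact: cvg_cst.
  apply: cvgM; first exact: cvg_id.
  apply: cvgD; apply: cvgM; [|exact: c1|exact: c3|exact: c2].
  by apply: cvgN; exact: c4.
have da : is_derive r 1 (fun r : R => ang (r, x)) (- (kappa * eta x)).
  rewrite /tw_angle /=.
  by apply: is_derive_eq; rewrite /GRing.scale/=; ring.
have dc := @is_derive1_comp R cos (fun r : R => ang (r, x)) r _ _ (is_derive_cos _) da.
have ds := @is_derive1_comp R sin (fun r : R => ang (r, x)) r _ _ (is_derive_sin _) da.
have d1 := is_deriveM (is_derive_id r 1) dc.
have d2 := is_deriveM (is_derive_id r 1) ds.
have h := is_derive_curve C1 d1 d2.
apply: (is_derive_eq h); rewrite /GRing.scale/= /Pr /Dt /ph1 /ph2 /tw /polar /=; ring.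
Qed.

Lemma prim_test_x r : 0 <= r <= 1 ->
  prim a b (fun x => Phi (r, x)) (fun x => Dt (r, x) * rho (r, x)).
Proof.
move=> rI; pose F t := phi (polar (r, t)).
pose F' t := r * (- sin t * pd1 phi (polar (r, t)) + cos t * pd2 phi (polar (r, t))).
have ct : continuous (fun t : R => polar (r, t)).
  move=> t; apply: (@continuous_comp _ _ _ (fun t : R => (r, t)) (@polar R)); last exact: continuous_polar.
  by apply: continuous_pair => s; [exact: cvg_cst|exact: cvg_id].
have dF (t : R) : is_derive t 1 F (F' t).
  have d1 : is_derive t 1 (fun t => r * cos t) (r * - sin t).
    by apply: is_derive_eq; rewrite /GRing.scale/=; ring.
  have d2 : is_derive t 1 (fun t => r * sin t) (r * cos t).
    by apply: is_derive_eq; rewrite /GRing.scale/=; ring.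
  apply: (is_derive_eq (is_derive_curve C1 d1 d2)).
  rewrite /F' /polar /=; ring.
have cF' : continuous F'.
  move=> t; rewrite /F'; apply: cvgM; first exact: cvg_cst.
  apply: cvgD; apply: cvgM.
  - by apply: cvgN; exact: continuous_sin.
  - by apply: (@continuous_comp _ _ _ (fun t : R => polar (r, t)) (pd1 phi)); [exact: ct|exact: cph1].
  - exact: continuous_cos.
  - by apply: (@continuous_comp _ _ _ (fun t : R => polar (r, t)) (pd2 phi)); [exact: ct|exact: cph2].
have mr : measurable_fun setT (fun x => rho (r, x)).
  by apply: (measurableT_comp mrho); apply: measurable_fun_pair => //; exact: measurable_cst.
have pa x y : x <= y -> prim x y (fun t => ang (r, t)) (fun t => rho (r, t)) by exact: prim_tw_angle.
have rl x : 1 / 2 <= rho (r, x) by have /andP[] := rho_bound x rI.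
exact: (prim_comp half0 (ltW ab) pa rl mr dF cF').
Qed.

Let Cs q := cos (ang q - t0).
Let Sn q := sin (ang q - t0).

Let tPhi : tm 0 Phi. Proof. by apply: tcont; exact: comp_tw. Qed.
Let tph1 : tm 0 ph1. Proof. by apply: tcont; exact: comp_tw. Qed.
Let tph2 : tm 0 ph2. Proof. by apply: tcont; exact: comp_tw. Qed.
Let tcos0 : tm 0 (fun q => cos (ang q)).
Proof. by apply: tcont => q; apply: (@continuous_comp _ _ _ ang (@cos R)); [exact: cang|exact: continuous_cos]. Qed.
Let tsin0 : tm 0 (fun q => sin (ang q)).
Proof. by apply: tcont => q; apply: (@continuous_comp _ _ _ ang (@sin R)); [exact: cang|exact: continuous_sin]. Qed.
Let tDt : tm 0 Dt.
Proof. exact: (tM tr (tameD (tM (tameN tsin0) tph1) (tM tcos0 tph2))). Qed.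
Let tPr : tm 0 Pr.
Proof. exact: (tameB (tameD (tM tcos0 tph1) (tM tsin0 tph2)) (tM (tame_scale kappa teta) tDt)). Qed.

Let prim_trig_r (F F' : R -> R) x : (forall t : R, is_derive t 1 F (F' t)) -> continuous F' ->
  prim 0 1 (fun r => F (ang (r, x) - t0)) (fun r => F' (ang (r, x) - t0) * - (kappa * eta x)).
Proof.
move=> dF cF'.
have da (r : R) : is_derive r 1 (fun r : R => ang (r, x) - t0) (- (kappa * eta x)).
  rewrite /tw_angle /=.
  by apply: is_derive_eq; rewrite /GRing.scale/=; ring.
apply: prim_C1 => r.
apply: cvgM; last exact: cvg_cst.
apply: (@continuous_comp _ _ _ (fun r : R => ang (r, x) - t0) F'); last exact: cF'.
have [da1 _] := da r; apply: differentiable_continuous; exact/derivable1_diffP.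
Qed.

Let prim_trig_x (F F' : R -> R) r : 0 <= r <= 1 ->
  (forall t : R, is_derive t 1 F (F' t)) -> continuous F' ->
  prim a b (fun x => F (ang (r, x) - t0)) (fun x => F' (ang (r, x) - t0) * rho (r, x)).
Proof.
move=> rI dF cF'.
have mr : measurable_fun setT (fun x => rho (r, x)).
  by apply: (measurableT_comp mrho); apply: measurable_fun_pair => //; exact: measurable_cst.
have pa x y : x <= y -> prim x y (fun t => ang (r, t)) (fun t => rho (r, t)) by exact: prim_tw_angle.
have rl x : 1 / 2 <= rho (r, x) by have /andP[] := rho_bound x rI.
have dS (t : R) : is_derive t 1 (fun t : R => t - t0) 1.
  by apply: is_derive_eq; rewrite subr0.
apply: (prim_comp half0 (ltW ab) pa rl mr (F := fun t => F (t - t0)) (F' := fun t => F' (t - t0))).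
- move=> t; have := @is_derive1_comp R F (fun t : R => t - t0) t _ _ (dF _) (dS t).
  by rewrite mulr1.
- move=> t; apply: (@continuous_comp _ _ _ (fun t : R => t - t0) F'); last exact: cF'.
  by apply: cvgB; [exact: cvg_id|exact: cvg_cst].
Qed.

Let prim_U_r x : prim 0 1 (fun r => U (r, x)) (fun=> N * kappa * f x).
Proof.
apply: prim_C1; last exact: cst_continuous.
move=> r; rewrite /comp_val /=; apply: is_derive_eq; rewrite /GRing.scale/=; ring.
Qed.

Let prim_U_x r : prim a b (fun x => U (r, x)) (fun x => Ux (r, x)).
Proof. exact: (prim_subr pC (prim_scale (N * (kappa * (1 - r))) (prim_subr pC pw))). Qed.

Let prim_rho_r x : prim 0 1 (fun r => rho (r, x)) (fun=> - (kappa * m x)).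
Proof.
apply: prim_C1; last exact: cst_continuous.
move=> r; rewrite /tw_speed /=; apply: is_derive_eq; rewrite /GRing.scale/=; ring.
Qed.

Let prim_rr : prim (0 : R) 1 (fun r => r * r) (fun r => 2 * r).
Proof.
apply: prim_C1; last by move=> r; apply: cvgM; [exact: cvg_cst|exact: cvg_id].
move=> r; apply: is_derive_eq; rewrite /GRing.scale/=; ring.
Qed.

Let U_ab r : U (r, a) = U (r, b).
Proof. by rewrite /comp_val /f /= Cab wab. Qed.

(** The derivative of a test function in a fixed direction is, up to the
    Jacobian, a derivative in [r] plus a derivative in [x] of products, with the
    boundary terms vanishing because the test function does at [r = 1], the
    Jacobian does at [r = 0], and everything is periodic in [x]. *)
Lemma competitor_by_parts :
  bint (fun z => competitor z * (cos t0 * pd1 phi z + sin t0 * pd2 phi z)) +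
  bint (fun z => lift (comp_grad t0) z * phi z) = 0.
Proof.
have cns : continuous (fun t : R => - sin t) by move=> t; apply: cvgN; exact: continuous_sin.
(* A prime denotes the derivative: in r for the letters a and A, in x for the
   letters b, c and B. *)
pose a0 (q : plane) := q.1 * q.1; pose a0' (q : plane) := 2 * q.1.
pose a1 q := a0 q * U q; pose a1' q := a0' q * U q + a0 q * (N * kappa * f q.2).
pose a2 q := a1 q * rho q; pose a2' q := a1' q * rho q + a1 q * - (kappa * m q.2).
pose a3 q := a2 q * Cs q; pose a3' q := a2' q * Cs q + a2 q * (- Sn q * - (kappa * eta q.2)).
pose A q := a3 q * Phi q; pose A' q := a3' q * Phi q + a3 q * Pr q.
pose b0 q := q.1 * U q; pose b0' q := q.1 * Ux q.
pose c0 (q : plane) := q.1 * kappa * eta q.2; pose c0' (q : plane) := q.1 * kappa * m q.2.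
pose c1 q := c0 q * Cs q; pose c1' q := c0' q * Cs q + c0 q * (- Sn q * rho q).
pose c2 q := Sn q - c1 q; pose c2' q := Cs q * rho q - c1' q.
pose b1 q := b0 q * c2 q; pose b1' q := b0' q * c2 q + b0 q * c2' q.
pose B q := b1 q * Phi q; pose B' q := b1' q * Phi q + b1 q * (Dt q * rho q).
have tCs_ : tm 0 Cs by exact: tcos.
have tSn_ : tm 0 Sn by exact: tsin.
have ta0 : tm 0 a0 := tM tr tr; have ta0' : tm 0 a0' := tame_scale 2 tr.
have ta1 : tm 0 a1 := tM ta0 tU.
have ta1' : tm 0 a1' := tameD (tM ta0' tU) (tM ta0 (tame_scale (N * kappa) tfs)).
have ta2 : tm 0 a2 := tM ta1 trho.
have ta2' : tm 0 a2' := tameD (tM ta1' trho) (tM ta1 (tameN (tame_scale kappa tm_m))).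
have ta3 : tm 0 a3 := tM ta2 tCs_.
have ta3' : tm 0 a3' := tameD (tM ta2' tCs_) (tM ta2 (tM (tameN tSn_) (tameN (tame_scale kappa teta)))).
have tA' : tm 0 A' := tameD (tM ta3' tPhi) (tM ta3 tPr).
have tb0 : tm 0 b0 := tM tr tU; have tb0' : tm 1 b0' := tM tr tUx.
have tc0 : tm 0 c0 := tM (tM tr (tcst kappa)) teta; have tc0' : tm 0 c0' := tM (tM tr (tcst kappa)) tm_m.
have tc1 : tm 0 c1 := tM tc0 tCs_.
have tc1' : tm 0 c1' := tameD (tM tc0' tCs_) (tM tc0 (tM (tameN tSn_) trho)).
have tc2 : tm 0 c2 := tameB tSn_ tc1; have tc2' : tm 0 c2' := tameB (tM tCs_ trho) tc1'.
have tb1 : tm 0 b1 := tM tb0 tc2.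
have W01 K0 : tm 0 K0 -> tm 1 K0 by exact: (tameW g1).
have tb1' : tm 1 b1' := tameD (tM tb0' tc2) (W01 _ (tM tb0 tc2')).
have tB' : tm 1 B' := tameD (tM tb1' tPhi) (W01 _ (tM tb1 (tM tDt trho))).
have dA : dbl A' = 0.
  rewrite (dbl_derive_r g1 Lg (A := A) (tameW g1 (leq0n 2) tA')).
    transitivity (\int[mu]_(x in `[a, b[) (0 : R)); last by rewrite Rintegral_cst ?mul0r.
    apply: eq_Rintegral => x _; rewrite /A /a3 /a2 /a1 /a0 /= !mul0r subr0.
    by rewrite /Phi phi_circle ?mulr0// enorm_tw.
  move=> x _; have h0 := prim_mulr prim_rr (prim_U_r x).
  have h1 := prim_mulr h0 (prim_rho_r x).
  have h2 := prim_mulr h1 (prim_trig_r x (fun t => is_derive_cos t) cns).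
  exact: (prim_mulr h2 (prim_test_r x)).
have dB : dbl B' = 0.
  apply: (dbl_derive_x ab g1 Lg (A := B)); first exact: (tameW g1 (isT : (1 <= 2)%N) tB').
    move=> r rI.
    have hc := prim_mulr (prim_scale (r * kappa) (prim_tw_shift mm m1 m_out (ltW ab)))
       (prim_trig_x rI (fun t => is_derive_cos t) cns).
    have hs := prim_subr (prim_trig_x rI (fun t => is_derive_sin t) (@continuous_cos R)) hc.
    have h1 := prim_mulr (prim_scale r (prim_U_x r)) hs.
    exact: (prim_mulr h1 (prim_test_x rI)).
  move=> r rI; rewrite /B /b1 /b0 /c2 /c1 /c0 /Sn /Phi /= -U_ab tw_shift_left.
  have -> : eta b = 0 by exact: tw_shift_right.
  have -> : tw (r, b) = tw (r, a) by exact: tw_right.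
  rewrite !mulr0 !mul0r !subr0; congr (_ * _ * _).
  have -> : ang (r, b) = b by exact: tw_angle_right.
  rewrite tw_angle_left /b (_ : a + 2 * pi - t0 = a - t0 + pi + pi); last by ring.
  by rewrite !sinDpi opprK.
pose K q := q.1 * U q * (cos t0 * ph1 q + sin t0 * ph2 q) * (q.1 * rho q).
pose L q := comp_grad t0 q * Phi q * (q.1 * rho q).
have tK : tm 0 K.
  exact: (tM (tM tV (tameD (tame_scale (cos t0) tph1) (tame_scale (sin t0) tph2))) (tM tr trho)).
have tL : tm 1 L := tM (tM (tgrad t0) tPhi) (tM tr trho).
have mphi (u : plane -> R) : continuous u -> measurable_fun ball1 u.
  by move=> cu; apply: measurable_funTS; exact: continuous_measurable_plane.
have eK : bint (fun z => competitor z * (cos t0 * pd1 phi z + sin t0 * pd2 phi z)) = dbl K.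
  apply: bint_dbl; last exact: (tameW g1 (leq0n 2) tK).
    apply: measurable_funM; first by apply: measurable_tw_lift => //; have [] := tV.
    by apply: measurable_funD; apply: measurable_funM => //; exact: mphi.
  by move=> q Qq; rewrite /competitor liftQ.
have eL : bint (fun z => lift (comp_grad t0) z * phi z) = dbl L.
  apply: bint_dbl; last exact: (tameW g1 (isT : (1 <= 2)%N) tL).
    by apply: measurable_funM; [apply: measurable_tw_lift => //; have [] := tgrad t0|exact: mphi].
  by move=> q Qq; rewrite liftQ.
have T2 j K0 : (j <= 2)%N -> tm j K0 -> tm 2 K0 by exact: (tameW g1).
rewrite eK eL -(dblD g1 Lg (T2 0%N _ isT tK) (T2 1%N _ isT tL)) -(subrr (0 : R)) -{1}dA -dB.
rewrite -(dblB g1 Lg (T2 0%N _ isT tA') (T2 1%N _ isT tB')).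
apply: eq_Rintegral => q /set_mem; case: q => r x [/=]; rewrite !in_itv/= => /andP[r0 r1] _.
have rI : 0 <= r <= 1 by rewrite !ltW.
have rho0 : rho (r, x) != 0.
  have /andP[h _] := rho_bound x rI; apply: lt0r_neq0; exact: lt_le_trans half0 h.
have ec : cos t0 = Cs (r, x) * cos (ang (r, x)) + Sn (r, x) * sin (ang (r, x)).
  have e := cosB (ang (r, x)) (ang (r, x) - t0); rewrite subKr in e.
  by rewrite e /Cs /Sn mulrC [sin _ * _]mulrC.
have es : sin t0 = Cs (r, x) * sin (ang (r, x)) - Sn (r, x) * cos (ang (r, x)).
  have e := sinB (ang (r, x)) (ang (r, x) - t0); rewrite subKr in e.
  by rewrite e /Cs /Sn mulrC [cos (ang _) * _]mulrC.
rewrite /K /L ec es /comp_grad -/(Cs (r, x)) -/(Sn (r, x)) /A' /B' /b1' /b1 /c2' /c2 /c1' /c1 /c0' /c0 /b0' /b0.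
rewrite /a3' /a3 /a2' /a2 /a1' /a1 /a0' /a0 /comp_dr /comp_dt /comp_transport /Pr /Dt /=.
move: rho0; move: (rho (r, x)) (Cs (r, x)) (Sn (r, x)) (cos (ang (r, x))) (sin (ang (r, x))).
move: (U (r, x)) (Ux (r, x)) (ph1 (r, x)) (ph2 (r, x)) (Phi (r, x)) (eta x) (m x) (f x).
move=> v1 v2 v3 v4 v5 v6 v7 v8 v9 v10 v11 v12 v13 v90; by field.
Qed.

End TestFunction.

Let T2 j K0 : (j <= 2)%N -> tm j K0 -> tm 2 K0. Proof. exact: (tameW g1). Qed.

Lemma L2_competitor : L2 mu2 ball1 competitor.
Proof. by apply: L2_lift; exact: (tameW g1 (leq0n 1) tV). Qed.

Lemma competitor_weak_gradient : weak_gradient competitor competitor_grad.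
Proof.
split; [by apply/L2_leb2; exact: L2_lift|by apply/L2_leb2; exact: L2_lift|].
move=> phi tphi; split.
  have := competitor_by_parts 0 tphi => /eqP; rewrite addr_eq0 => /eqP <-.
  by congr bint; apply/funext => z; rewrite cos0 sin0 mul1r mul0r addr0.
have := competitor_by_parts (pi / 2) tphi => /eqP; rewrite addr_eq0 => /eqP <-.
by congr bint; apply/funext => z; rewrite cos_pihalf sin_pihalf mul1r mul0r add0r.
Qed.

Lemma H1_competitor : H1 competitor.
Proof.
split; first by apply/L2_leb2; exact: L2_competitor.
by exists competitor_grad; exact: competitor_weak_gradient.
Qed.

Lemma continuous_competitor : {within cball1, continuous competitor}.
Proof.
apply: continuous_tw_lift => //.
- move=> q; apply: cvgM; first exact: cvg_fst.
  have cs (u : R -> R) : continuous u -> continuous (fun q : plane => u q.2).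
    by move=> cu z; apply: (@continuous_comp _ _ _ (fun q : plane => q.2) u); [exact: cvg_snd|exact: cu].
  apply: cvgB; first exact: (cs _ cC).
  apply: cvgM; last exact: (cs _ cf).
  apply: cvgM; first exact: cvg_cst; apply: cvgM; first exact: cvg_cst.
  by apply: cvgB; [exact: cvg_cst|exact: cvg_fst].
- by move=> x; rewrite !mul0r.
- by move=> r; rewrite /comp_val /f /= Cab wab.
Qed.

Lemma competitor_circle x : a <= x <= b -> competitor (circ x) = C x.
Proof.
have cE y : circ y = tw (1, y) by rewrite /tw /polar /tw_angle /= subrr mulr0 mul0r addr0 !mul1r.
have h y : a <= y < b -> competitor (circ y) = C y.
  move=> yI; rewrite cE /competitor tw_lift_tw ?ltr01 ?lexx// /comp_val /= subrr !mulr0 mul0r subr0.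
  by rewrite mul1r.
move=> /andP[ax]; rewrite le_eqVlt => /predU1P[->|xb]; last by apply: h; rewrite ax.
by rewrite cE [tw _]tw_right// -cE h ?lexx.
Qed.

Let tE : tm 2 comp_energy.
Proof.
have t2 K0 : tm 1 K0 -> tm 2 (fun q => K0 q ^+ 2) by move=> h; exact: (tM h h).
apply: tameD.
  apply: (tM tr); apply: tameB; first exact: (tM (t2 _ tUx) tirho).
  by apply: (T2 (leq0n 2)); exact: (tM (tM tU tU) trho).
have t3 : tm 0 (fun q => q.1 ^+ 3) := tM tr (tM tr tr).
exact: (tM t3 (tM (t2 _ tD) trho)).
Qed.

(** The cross term 2 r U U_r of the expanded square is a total derivative: with
    the square of [U] it is the [r]-derivative of r^2 U^2 rho, up to an
    [x]-derivative that integrates to zero. It produces the integral of C^2,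
    which cancels the boundary term of the functional. *)
Lemma competitor_energy :
  bint (fun z => enorm (competitor_grad z) ^+ 2) = dbl comp_energy + \int[mu]_(x in `[a, b[) (C x ^+ 2).
Proof.
pose K q := (comp_dr q * comp_dr q + comp_dt q * comp_dt q) * (q.1 * rho q).
have tK : tm 2 K := tM (tameD (tM tdr tdr) (tM tdt tdt)) (tM tr trho).
(* [A'] is the derivative of [A] in r and [B'] that of [B] in x. *)
pose e0 (q : plane) := q.1 * q.1; pose e0' (q : plane) := 2 * q.1.
pose e1 q := U q * U q; pose e1' q := N * kappa * f q.2 * U q + U q * (N * kappa * f q.2).
pose e2 q := e0 q * e1 q; pose e2' q := e0' q * e1 q + e0 q * e1' q.
pose A q := e2 q * rho q; pose A' q := e2' q * rho q + e2 q * - (kappa * m q.2).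
pose d1' q := q.1 * q.1 * (Ux q * U q + U q * Ux q).
pose B q := e2 q * (- kappa * eta q.2); pose B' q := d1' q * (- kappa * eta q.2) + e2 q * (- kappa * m q.2).
have te0 : tm 0 e0 := tM tr tr; have te0' : tm 0 e0' := tame_scale 2 tr.
have te1 : tm 0 e1 := tM tU tU.
have te1' : tm 0 e1' := tameD (tM (tame_scale (N * kappa) tfs) tU) (tM tU (tame_scale (N * kappa) tfs)).
have te2 : tm 0 e2 := tM te0 te1; have te2' : tm 0 e2' := tameD (tM te0' te1) (tM te0 te1').
have tA' : tm 0 A' := tameD (tM te2' trho) (tM te2 (tameN (tame_scale kappa tm_m))).
have td1' : tm 1 d1' := tM te0 (tameD (tM tUx tU) (tM tU tUx)).
have tB' : tm 1 B'.
  apply: tameD; first exact: (tM td1' (tame_scale (- kappa) teta)).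
  exact: (tameW g1 (leq0n 1) (tM te2 (tame_scale (- kappa) tm_m))).
have prrr : prim (0 : R) 1 (fun r => r * r) (fun r => 2 * r).
  apply: prim_C1; last by move=> r; apply: cvgM; [exact: cvg_cst|exact: cvg_id].
  move=> r; apply: is_derive_eq; rewrite /GRing.scale/=; ring.
have prU x : prim 0 1 (fun r => U (r, x)) (fun=> N * kappa * f x).
  apply: prim_C1; last exact: cst_continuous.
  move=> r; rewrite /comp_val /=; apply: is_derive_eq; rewrite /GRing.scale/=; ring.
have prrho x : prim 0 1 (fun r => rho (r, x)) (fun=> - (kappa * m x)).
  apply: prim_C1; last exact: cst_continuous.
  move=> r; rewrite /tw_speed /=; apply: is_derive_eq; rewrite /GRing.scale/=; ring.
have dA : dbl A' = \int[mu]_(x in `[a, b[) (C x ^+ 2).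
  rewrite (dbl_derive_r g1 Lg (A := A) (T2 (leq0n 2) tA')).
    apply: eq_Rintegral => x _; rewrite /A /e2 /e1 /e0 /comp_val /tw_speed /=; ring.
  by move=> x _; exact: (prim_mulr (prim_mulr prrr (prim_mulr (prU x) (prU x))) (prrho x)).
have dB : dbl B' = 0.
  apply: (dbl_derive_x ab g1 Lg (A := B)); first exact: (T2 (isT : (1 <= 2)%N) tB').
    move=> r rI.
    have pU := prim_subr pC (prim_scale (N * (kappa * (1 - r))) (prim_subr pC pw)).
    exact: (prim_mulr (prim_scale (r * r) (prim_mulr pU pU)) (prim_scale (- kappa) (prim_tw_shift mm m1 m_out (ltW ab)))).
  move=> r rI; rewrite /B /= tw_shift_left.
  have -> : eta b = 0 by exact: tw_shift_right.
  by rewrite !mulr0.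
have -> : bint (fun z => enorm (competitor_grad z) ^+ 2) = dbl K.
  apply: bint_dbl => //.
    under eq_fun do rewrite enorm_sqr.
    apply: measurable_funD; apply: measurable_funX; apply: measurable_tw_lift => //.
      by have [] := tgrad 0.
    by have [] := tgrad (pi / 2).
  move=> q Qq; rewrite enorm_sqr /competitor_grad /= !liftQ// /K /comp_grad subr0 cosBpihalf sinBpihalf.
  congr (_ * _); have := cos2Dsin2 (ang q); move: (cos _) (sin _) (comp_dr q) (comp_dt q).
  move=> c s x y cs; transitivity ((x * x + y * y) * (c ^+ 2 + s ^+ 2)); first by rewrite cs mulr1.
  ring.
have tA2 := T2 (leq0n 2) tA'; have tB2 := T2 (isT : (1 <= 2)%N) tB'.
rewrite -dA -[RHS]subr0 -dB -(dblD g1 Lg tE tA2) -(dblB g1 Lg (tameD tE tA2) tB2).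
apply: eq_Rintegral => q /set_mem; case: q => r x [/=]; rewrite !in_itv/= => /andP[r0 r1] _.
have rI : 0 <= r <= 1 by rewrite !ltW.
have rho0 : rho (r, x) != 0.
  have /andP[h _] := rho_bound x rI; apply: lt0r_neq0; exact: lt_le_trans half0 h.
rewrite /K /comp_energy /A' /B' /d1' /e2' /e2 /e1' /e1 /e0' /e0 /comp_dr /comp_dt /comp_transport /=.
move: rho0; move: (rho (r, x)) (U (r, x)) (Ux (r, x)) (eta x) (m x) (f x).
by move=> v1 v2 v3 v4 v5 v6 v10; field.
Qed.

Lemma fine_leb2_set (S : plane -> bool) : measurable_fun ball1 S ->
  fine (leb2 ([set z | S z] `&` ball1)) = bint (fun z => if S z then 1 else 0).
Proof.
move=> mS; have mb := @mball1 R.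
have mE : measurable ([set z | S z] `&` ball1).
  have := mS measurable_ball1 [set true] I.
  rewrite setIC (_ : S @^-1` [set true] = [set z | S z]) //.
rewrite bintE /Rintegral; congr fine.
rewrite (_ : leb2 _ = mu2 ([set z | S z] `&` ball1 `&` ball1)); last by rewrite -setIA setIid.
rewrite -(integral_indic mu2 mb mE); apply: eq_integral => z zb.
rewrite indicE; have -> : (z \in [set z | S z] `&` ball1) = S z.
  by rewrite in_setI zb andbT; apply/idP/idP => [/set_mem|/mem_set].
by case: (S z).
Qed.

(** The level sets are measured in the coordinates, where the sign only depends
    on [x]. *)
Lemma competitor_measure (S : R -> bool) : measurable_fun setT S ->
  (forall r x, 0 < r -> r < 1 -> a <= x < b -> S (r * U (r, x)) = S (C x)) ->
  fine (leb2 ([set z | S (competitor z)] `&` ball1)) =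
  dbl (fun q => (if S (C q.2) then 1 else 0) * (q.1 * rho q)).
Proof.
move=> mS hS; have [mV _] := tV.
have mSc : measurable_fun ball1 (fun z => S (competitor z)).
  by apply: (measurableT_comp mS); exact: measurable_tw_lift.
rewrite fine_leb2_set//; apply: bint_dbl.
- by apply: (measurableT_comp (f := fun s : bool => if s then 1 else 0 : R)).
- move=> q Qq; rewrite /competitor liftQ//; case: q Qq => r x [/=].
  by rewrite !in_itv/= => /andP[r0 r1] xI; rewrite hS.
- have tS : tm 0 (fun q => if S (C q.2) then 1 else 0).
    apply: (@tame_bounded R a b g _ 1) => // [|r x _ _]; last by case: ifP; rewrite ?normr1 ?normr0.
    apply: measurable_fun_ifT => //; apply: (measurableT_comp mS).
    apply: (measurableT_comp (f := C)); [exact: continuous_measurable_fun|exact: measurable_snd].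
  exact: (T2 (leq0n 2) (tM tS (tM tr trho))).
Qed.

Definition comp_total (lam : R -> R) (q : plane) := comp_energy q + lam q.2 * (q.1 * rho q).

Let ttotal (lam : R -> R) Lam : measurable_fun setT lam -> (forall x, 0 <= lam x <= Lam) ->
  tm 2 (comp_total lam).
Proof.
move=> mlam blam; apply: tameD => //; apply: (T2 (leq0n 2)).
apply: (tM (k := 0)); last exact: (tM tr trho).
have /andP[l0 l1] := blam 0.
apply: (@tame_bounded R a b g _ Lam); first exact: (measurableT_comp mlam measurable_snd).
  exact: le_trans l1.
by move=> r x _ _; have /andP[h1 h2] := blam x; rewrite ger0_norm.
Qed.

Lemma integrable_comp_total (lam : R -> R) Lam (r : R) : measurable_fun setT lam ->
  (forall x, 0 <= lam x <= Lam) -> 0 <= r <= 1 ->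
  mu.-integrable `[a, b] (EFin \o (fun x => comp_total lam (r, x))).
Proof. by move=> mlam blam; apply: (tame_x_section g1 Lg); exact: ttotal mlam blam. Qed.

Lemma comp_total_le (lam : R -> R) Lam (G : R -> R) : measurable_fun setT lam ->
  (forall x, 0 <= lam x <= Lam) -> continuous G ->
  (forall r : R, 0 < r < 1 -> \int[mu]_(x in `[a, b]) comp_total lam (r, x) <= G r) ->
  dbl (comp_total lam) <= \int[mu]_(r in `[0, 1]) G r.
Proof. by move=> mlam blam; apply: (dbl_le g1 Lg); exact: ttotal mlam blam. Qed.

Lemma comp_total_eq (lam : R -> R) Lam (G : R -> R) : measurable_fun setT lam ->
  (forall x, 0 <= lam x <= Lam) -> continuous G ->
  (forall r : R, 0 < r < 1 -> \int[mu]_(x in `[a, b]) comp_total lam (r, x) = G r) ->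
  dbl (comp_total lam) = \int[mu]_(r in `[0, 1]) G r.
Proof. by move=> mlam blam; apply: (dbl_eq g1 Lg); exact: ttotal mlam blam. Qed.

Lemma competitor_phases (l1 l2 : R) : 0 <= l1 -> 0 <= l2 ->
  (forall r x, 0 < r -> r < 1 -> a <= x < b ->
    (0 < r * U (r, x)) = (0 < C x) /\ (r * U (r, x) < 0) = (C x < 0)) ->
  dbl comp_energy + l1 * fine (leb2 ([set z | 0 < competitor z] `&` ball1)) +
    l2 * fine (leb2 ([set z | competitor z < 0] `&` ball1)) =
  dbl (comp_total (fun x => if 0 < C x then l1 else if C x < 0 then l2 else 0)).
Proof.
move=> l10 l20 sg.
have mlt (S : R -> bool) : measurable_fun setT S -> tm 2 (fun q => (if S (C q.2) then 1 else 0) * (q.1 * rho q)).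
  move=> mS; have tS : tm 0 (fun q => if S (C q.2) then 1 else 0).
    apply: (@tame_bounded R a b g _ 1) => // [|r x _ _]; last by case: ifP; rewrite ?normr1 ?normr0.
    apply: measurable_fun_ifT => //; apply: (measurableT_comp mS).
    apply: (measurableT_comp (f := C)); [exact: continuous_measurable_fun|exact: measurable_snd].
  exact: (T2 (leq0n 2) (tM tS (tM tr trho))).
have m1' : measurable_fun setT (fun t : R => 0 < t) by exact: measurable_fun_ltr.
have m2' : measurable_fun setT (fun t : R => t < 0) by exact: measurable_fun_ltr.
rewrite (@competitor_measure (fun t => 0 < t) m1'); last by move=> r x r0 r1 xI; have [] := sg r x r0 r1 xI.
rewrite (@competitor_measure (fun t => t < 0) m2'); last by move=> r x r0 r1 xI; have [] := sg r x r0 r1 xI.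
have scl (k : R) K : tm 2 K -> k * dbl K = dbl (fun q => k * K q).
  move=> tK; rewrite /rect_integral RintegralZl//; last exact: (tame_integrable g1 Lg).
  by apply: measurableX.
have t1 := mlt _ m1'; have t2 := mlt _ m2'.
rewrite (scl l1 _ t1) (scl l2 _ t2) -(dblD g1 Lg tE (tame_scale l1 t1)).
rewrite -(dblD g1 Lg (tameD tE (tame_scale l1 t1)) (tame_scale l2 t2)).
apply: eq_Rintegral => q _; rewrite /comp_total -addrA; congr (_ + _).
by case: ltgtP => _; rewrite ?mul0r ?mulr0 ?addr0 ?add0r ?mul1r.
Qed.

(** A null set of angles sweeps out a null set of the disc. *)
Lemma lift_ae_eq (F F' : R -> R) : measurable_fun setT F -> measurable_fun setT F' ->
  {ae mu, forall x, `[a, b]%classic x -> F x = F' x} ->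
  {ae mu2, forall z, ball1 z -> lift (fun q => q.1 * F q.2) z = lift (fun q => q.1 * F' q.2) z}.
Proof.
move=> mF mF' FF; pose S x := F x != F' x.
have mS : measurable_fun setT S.
  have mD : measurable_fun setT (fun x => F x - F' x) by exact: measurable_funB.
  have -> : S = fun x => ~~ (F x - F' x == 0) by apply/funext => x; rewrite subr_eq0.
  by apply: measurable_neg; apply: (measurable_fun_eqr mD).
pose H (q : plane) : R := if S q.2 then 1 else 0.
have tH : tm 0 H.
  apply: (@tame_bounded R a b g _ 1) => // [|r x _ _]; last by rewrite /H; case: ifP; rewrite ?normr1 ?normr0.
  by apply: measurable_fun_ifT => //; exact: (measurableT_comp mS measurable_snd).
have mH := measurable_tw_lift a02 kappa_bound mm m1 m_out m_mean tH.1.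
have z0 : bint (lift H) = 0.
  rewrite (@bint_dbl (lift H) (fun q => H q * (q.1 * rho q)))//; first last.
  - exact: (T2 (leq0n 2) (tM tH (tM tr trho))).
  - by move=> q Qq; rewrite liftQ.
  rewrite (dbl_rx g1 Lg (T2 (leq0n 2) (tM tH (tM tr trho)))).
  transitivity (\int[mu]_(r in `]0, 1[) (0 : R)); last by rewrite /Rintegral integral0.
  apply: eq_Rintegral => r /set_mem/=; rewrite in_itv/= => /andP[r0 r1]; rewrite /Rintegral.
  have rI : 0 <= r <= 1 by rewrite !ltW.
  have iS := tame_x_section g1 Lg (T2 (leq0n 2) (tM tH (tM tr trho))) rI.
  rewrite (_ : (\int[mu]_(x in `[a, b]) _)%E = (\int[mu]_(x in `[a, b]) (0 : R)%:E)%E); first by rewrite integral0.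
  apply: ae_eq_integral => //; first exact: measurable_int iS.
  by move: FF; apply: (@filterS _ (almost_everywhere mu)) => x h xab; rewrite /H /S /= h// eqxx mul0r.
have mb := @mball1 R.
have L1 := L2_lift (tameW g1 (leq0n 1) tH); have i1 := L2_ball1_int L1.
have mL := measurable_int _ i1.
have int0 : (\int[mu2]_(z in ball1) `|(EFin \o lift H) z| = 0)%E.
  rewrite -[RHS]/(0%:E) -z0 bintE fineK; last by have := integrable_fin_num mb i1.
  apply: eq_integral => z _; rewrite /= ger0_norm// /tw_lift /H; case: ifP => //.
have := (ae_eq_integral_abs mu2 mb mL).1 int0.
apply: (@filterS _ (almost_everywhere mu2)) => z h bz; move: (h bz) => /= [].
rewrite /tw_lift /H /S /=; case: eqP => [-> //|_ /eqP]; by rewrite oner_eq0.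
Qed.

End Competitor.

(** * Poincare inequalities on arcs *)

Section Poincare.
Context {R : realType}.
Notation mu := (@lebesgue_measure R).
Implicit Types (u v l r x k : R) (C p : R -> R).

Lemma prim_C1_segment (a b : R) (u p : R -> R) :
  (forall x : R, a <= x <= b -> is_derive x 1 u (p x)) -> {within `[a, b], continuous p} ->
  prim a b u p.
Proof.
move=> du cp; split; first exact: continuous_L2.
move=> x /andP[ax xb]; move: ax; rewrite le_eqVlt => /predU1P[<-|ax].
  by rewrite integral_point addr0.
have cu (y : R) : a <= y <= b -> {for y, continuous u}.
  move=> /du [d _]; apply: differentiable_continuous; exact/derivable1_diffP.
have cp' : {within `[a, x], continuous p}.
  by apply: continuous_subspaceW cp; apply: subset_itvl; rewrite bnd_simp.
have h := @continuous_FTC2 R p u a x ax cp'.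
have h1 : derivable_oo_LRcontinuous u a x.
  split.
  + move=> y; rewrite in_itv/= => /andP[ay yx]; have yI : a <= y <= b by rewrite (ltW ay) (le_trans (ltW yx)).
    by have [] := du y yI.
  + by apply: cvg_at_right_filter; apply: cu; rewrite lexx (le_trans (ltW ax)).
  + by apply: cvg_at_left_filter; apply: cu; rewrite (ltW ax).
have h2 : {in `]a, x[, derive1 u =1 p}.
  move=> y; rewrite in_itv/= => /andP[ay yx]; have yI : a <= y <= b by rewrite (ltW ay) (le_trans (ltW yx)).
  by have hd := du y yI; rewrite derive1E derive_val.
by rewrite /Rintegral (h h1 h2) /= subrKC.
Qed.

Lemma limit_of_squares (A B K : R) : 0 <= A -> 0 < K -> (forall k, 0 < k < K -> k ^+ 2 * B <= A) ->
  K ^+ 2 * B <= A.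
Proof.
move=> A0 K0 h; rewrite leNgt; apply/negP => lt.
set S := K ^+ 2 * B in lt; have S0 : 0 < S by apply: le_lt_trans lt.
pose e := (S - A) / (4 * S).
have e0 : 0 < e by rewrite divr_gt0 ?subr_gt0// mulr_gt0.
have eS : e * S = (S - A) / 4 by rewrite /e; field; rewrite gt_eqF.
have e1 : e <= 1 / 4.
  by rewrite -(ler_pM2r S0) eS; clearbody e; clearbody S; lra.
have := h (K * (1 - e)) _; rewrite exprMn mulrAC -/S => /(_ _)/wrap[|].
  by apply/andP; split; nra.
have -> : S * (1 - e) ^+ 2 = S - 2 * (e * S) + e ^+ 2 * S by ring.
have q : 0 <= e ^+ 2 * S by rewrite mulr_ge0 ?sqr_ge0// ltW.
have fin (s A' x : R) : A' < s -> 0 <= x -> s - 2 * ((s - A') / 4) + x <= A' -> False by move=> *; lra.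
by rewrite eS; exact: fin lt q.
Qed.

(** For [k < pi / T] the function k tan (k (x - c)), with [c] the midpoint, is
    smooth on the whole segment, and completing the square in
    (C' + k tan(.) C)^2 gives the inequality with [k] in place of [pi / T]. *)
Lemma poincare (a b T : R) C p : a <= b -> 0 < T -> b - a <= T -> prim a b C p -> C a = 0 -> C b = 0 ->
  (pi / T) ^+ 2 * \int[mu]_(x in `[a, b]) (C x ^+ 2) <= \int[mu]_(x in `[a, b]) (p x ^+ 2).
Proof.
move=> ab T0 bT pC Ca Cb; have mab : measurable (`[a, b]%classic : set (measurableTypeR R)) by [].
apply: limit_of_squares.
- by apply: Rintegral_ge0 => x _; exact: sqr_ge0.
- by rewrite divr_gt0// pi_gt0.
move=> k /andP[k0 kT]; pose c := (a + b) / 2.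
have cosk x : a <= x <= b -> 0 < cos (k * (x - c)).
  move=> /andP[ax xb]; apply: cos_gt0_pihalf.
  have kT2 : k * T < pi by rewrite -ltr_pdivlMr.
  have h1 : - (T / 2) <= x - c by rewrite /c; lra.
  have h2 : x - c <= T / 2 by rewrite /c; lra.
  by apply/andP; split; nra.
pose W x := k * tan (k * (x - c)).
have pW : prim a b W (fun x => k ^+ 2 * (1 + tan (k * (x - c)) ^+ 2)).
  have dk x : is_derive x 1 (fun x : R => k * (x - c)) k.
    by apply: is_derive_eq; rewrite /GRing.scale/=; ring.
  have dW x : a <= x <= b -> is_derive x 1 W (k ^+ 2 * (1 + tan (k * (x - c)) ^+ 2)).
    move=> /cosk/lt0r_neq0 h; have ht := is_derive_tan h; rewrite cos2_tan2// in ht.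
    have h1 := @is_derive1_comp R tan (fun x : R => k * (x - c)) x _ _ ht (dk x).
    have h2 := is_deriveZ k h1.
    by apply: (is_derive_eq h2); rewrite /GRing.scale/=; ring.
  apply: prim_C1_segment => //.
  apply: continuous_in_subspaceT => x; rewrite inE /= in_itv/= => xI.
  have ct : {for x, continuous (fun x : R => tan (k * (x - c)))}.
    have h := cosk x xI; have ht := is_derive_tan (lt0r_neq0 h).
    have [d _] := @is_derive1_comp R tan (fun x : R => k * (x - c)) x _ _ ht (dk x).
    by apply: differentiable_continuous; exact/derivable1_diffP.
  apply: cvgM; first exact: cvg_cst.
  apply: cvgD; first exact: cvg_cst.
  by under eq_fun do rewrite expr2; rewrite expr2; apply: cvgM; exact: ct.
have LC := prim_L2 pC; have [Lp _] := pC; have LW := prim_bounded_L2 pW LC.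
have by_parts := prim_by_parts ab (prim_mulr pC pC) pW.
rewrite Ca Cb !mul0r subrr in by_parts.
have i1 := L2_sqr_integrable mab Lp.
have i2 := L2M mab Lp LW; have i3 := L2_sqr_integrable mab LW; have i4 := L2_sqr_integrable mab LC.
have e1 : \int[mu]_(x in `[a, b]) (2 * (p x * (W x * C x))) +
    \int[mu]_(x in `[a, b]) (k ^+ 2 * (C x ^+ 2)) + \int[mu]_(x in `[a, b]) ((W x * C x) ^+ 2) = 0.
  rewrite -by_parts -(RintegralD mab (integrableZl mab 2 i2) (integrableZl mab (k ^+ 2) i4)).
  have i24 := integrableD mab (integrableZl mab 2 i2) (integrableZl mab (k ^+ 2) i4).
  rewrite -(RintegralD mab i24 i3); apply: eq_Rintegral => x _; rewrite /W; ring.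
have e2 : 0 <= \int[mu]_(x in `[a, b]) ((p x + W x * C x) ^+ 2).
  by apply: Rintegral_ge0 => x _; exact: sqr_ge0.
have e3 : \int[mu]_(x in `[a, b]) ((p x + W x * C x) ^+ 2) =
   \int[mu]_(x in `[a, b]) (p x ^+ 2) + (\int[mu]_(x in `[a, b]) (2 * (p x * (W x * C x))) +
    \int[mu]_(x in `[a, b]) ((W x * C x) ^+ 2)).
  rewrite -(RintegralD mab (integrableZl mab 2 i2) i3) -(RintegralD mab i1 (integrableD mab (integrableZl mab 2 i2) i3)).
  by apply: eq_Rintegral => x _; ring.
have e4 : k ^+ 2 * \int[mu]_(x in `[a, b]) (C x ^+ 2) = \int[mu]_(x in `[a, b]) (k ^+ 2 * (C x ^+ 2)).
  exact/esym/(RintegralZl _ mab i4).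
have fin : forall I0 J1 J2 J3 J4 J5 : R, J2 + J4 + J3 = 0 -> 0 <= I0 -> I0 = J1 + (J2 + J3) ->
    J5 = J4 -> J5 <= J1 by clear; move=> *; lra.
exact: fin e1 e2 e3 e4.
Qed.

Lemma sup_zero C (S : set R) : continuous C -> S !=set0 -> has_ubound S -> (forall x, S x -> C x = 0) ->
  C (sup S) = 0.
Proof.
move=> cC S0 Sb SC; have cl : closed [set x | C x = 0].
  rewrite (_ : [set x | C x = 0] = C @^-1` [set 0])//.
  by apply: closed_comp => [x _|]; [exact: cC|exact: closed_eq].
have := closure_sup S0 Sb; move=> /(closure_subset (B := [set x | C x = 0]) SC).
by rewrite -(closure_id _).1.
Qed.

Lemma last_zero C l x : continuous C -> l <= x -> C l = 0 -> C x != 0 ->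
  exists u, [/\ l <= u, u < x, C u = 0 & forall t, u < t <= x -> C t != 0].
Proof.
move=> cC lx Cl Cx; pose S := [set t | l <= t <= x /\ C t = 0].
have Sl : S l by split=> //; rewrite lexx.
have Sb : has_ubound S by exists x => t [/andP[]].
have Cu : C (sup S) = 0 by apply: sup_zero => //; [by exists l|move=> t []].
have lu : l <= sup S by exact: ub_le_sup.
exists (sup S); split=> //.
- rewrite lt_neqAle; apply/andP; split; last by apply: ge_sup; [exists l|move=> t [/andP[]]].
  by apply/eqP => e; rewrite -e Cu eqxx in Cx.
- move=> t /andP[ut tx]; apply/eqP => Ct; move: ut; rewrite ltNge => /negP; apply.
  rewrite leNgt; apply/negP => ut; move: (ut); rewrite ltNge => /negP; apply.
  by apply: ub_le_sup => //; split=> //; rewrite tx (le_trans lu (ltW ut)).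
Qed.

Lemma next_zero C x r : continuous C -> x <= r -> C r = 0 -> C x != 0 ->
  exists v, [/\ v <= r, x < v, C v = 0 & forall t, x <= t < v -> C t != 0].
Proof.
move=> cC xr Cr Cx.
have cN : continuous (fun t : R => C (- t)).
  by move=> t; apply: (@continuous_comp _ _ _ (fun t : R => - t) C); [exact: opp_continuous|exact: cC].
have [u [h1 h2 h3 h4]] : exists u, [/\ - r <= u, u < - x, C (- u) = 0 & forall t, u < t <= - x -> C (- t) != 0].
  by apply: (last_zero cN); rewrite ?lerN2 ?opprK.
exists (- u); split=> //; [by rewrite lerNl|by rewrite ltrNr|].
move=> t /andP[xt tu]; have := h4 (- t); rewrite opprK; apply.
by rewrite ltrNr tu lerN2.
Qed.

(** Continuous induction on the zeros up to which the inequality holds: from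
    the last of them the next zero within distance [L] can be reached, and on a
    segment no longer than [L] between zeros [poincare] applies. Infinitely many
    components need no separate treatment. *)
Lemma gap_poincare l r L C p : continuous C -> l <= r -> 0 < L -> prim l r C p -> C l = 0 -> C r = 0 ->
  (forall u v, l <= u -> u < v -> v <= r -> C u = 0 -> C v = 0 -> (forall t, u < t < v -> C t != 0) -> v - u <= L) ->
  (pi / L) ^+ 2 * \int[mu]_(x in `[l, r]) (C x ^+ 2) <= \int[mu]_(x in `[l, r]) (p x ^+ 2).
Proof.
move=> cC lr L0 pC Cl Cr gap.
pose I u v := (pi / L) ^+ 2 * \int[mu]_(x in `[u, v]) (C x ^+ 2) <= \int[mu]_(x in `[u, v]) (p x ^+ 2).
have mab u v : measurable (`[u, v]%classic : set (measurableTypeR R)) by [].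
have Icat u v y : l <= u -> u <= v -> v <= y -> y <= r -> I u v -> I v y -> I u y.
  move=> lu uv vy yr; rewrite /I.
  have h : prim u y C p by apply: prim_sub pC.
  have [Lp _] := h; have LC := prim_L2 h.
  rewrite (Rintegral_split uv vy (L2_sqr_integrable (mab _ _) LC)).
  rewrite (Rintegral_split uv vy (L2_sqr_integrable (mab _ _) Lp)).
  by rewrite mulrDr; exact: lerD.
have Ishort u v : l <= u -> u <= v -> v <= r -> C u = 0 -> C v = 0 -> v - u <= L -> I u v.
  move=> lu uv vr Cu Cv uvL; apply: poincare => //.
  exact: prim_sub pC.
pose S := [set x | [/\ l <= x <= r, C x = 0 & I l x]].
have Sl : S l.
  by split=> //; [rewrite lexx|rewrite /I !integral_point mulr0].
have Sb : has_ubound S by exists r => t [/andP[]].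
have S0 : S !=set0 by exists l.
set x := sup S; have Cx : C x = 0 by apply: sup_zero => // t [].
have lx : l <= x by exact: ub_le_sup.
have xr : x <= r by apply: ge_sup => // t [/andP[]].
have Ix : I l x.
  have [s [/andP[ls sr] Cs Is] xs] := sup_adherent L0 (conj S0 Sb).
  have sx : s <= x by apply: ub_le_sup => //; split=> //; rewrite ls sr.
  apply: (Icat _ s) => //; apply: Ishort => //.
  by move: xs; rewrite -/x; lra.
move: xr; rewrite le_eqVlt => /predU1P[<-//|xr]; exfalso.
suff [z [xz zr zL Cz]] : exists z, [/\ x < z, z <= r, z - x <= L & C z = 0].
  have : z <= x.
    apply: ub_le_sup => //; split=> //; first by rewrite zr (le_trans lx (ltW xz)).
    by apply: (Icat _ x) => //; [exact: ltW|apply: Ishort => //; exact: ltW].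
  by rewrite leNgt xz.
have [rL|Lr] := leP (r - x) L; first by exists r.
set y := x + L; have xy : x < y by rewrite /y ltrDl.
have yr : y <= r by rewrite /y; lra.
have [Cy|Cy] := eqVneq (C y) 0; first by exists y; split=> //; rewrite /y; lra.
have [u [xu uy Cu hu]] := last_zero cC (ltW xy) Cx Cy.
move: xu; rewrite le_eqVlt => /predU1P[xu|xu]; last first.
  by exists u; split=> //; [rewrite (le_trans (ltW uy))|move: uy; rewrite /y; lra].
have [v [vr yv Cv hv]] := next_zero cC yr Cr Cy.
have := gap x v lx (lt_trans xy yv) vr Cx Cv; move=> /(_ _)/wrap[|h].
  move=> t /andP[xt tv]; have [ty|yt] := leP t y; first by apply: hu; rewrite -xu xt.
  by apply: hv; rewrite (ltW yt).
by move: h yv; rewrite /y; lra.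
Qed.

End Poincare.

(** * Estimates on an arc and their concatenation *)

Section PieceEnergies.
Context {R : realType}.
Notation mu := (@lebesgue_measure R).
Implicit Types (l r x s e d : R).

Lemma int_pieces (F F1 F2 : R -> R) l y r : l <= y -> y <= r ->
  mu.-integrable `[l, r] (EFin \o F) ->
  (forall x, l < x < y -> F x = F1 x) -> (forall x, y < x < r -> F x = F2 x) ->
  \int[mu]_(x in `[l, r]) F x = \int[mu]_(x in `[l, y]) F1 x + \int[mu]_(x in `[y, r]) F2 x.
Proof.
move=> ly yr iF h1 h2; rewrite (Rintegral_split ly yr iF).
congr (_ + _); apply: Rintegral_eq_oo => //; apply/measurable_oo_cc/measurable_EFinP.
  exact: (measurable_int _ (integrable_sub (lexx l) yr iF)).
exact: (measurable_int _ (integrable_sub ly (lexx r) iF)).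
Qed.

Lemma integrable_eqfun (D : set R) (F G : R -> R) : (forall x, F x = G x) ->
  mu.-integrable D (EFin \o F) -> mu.-integrable D (EFin \o G).
Proof. by move=> /funext ->. Qed.

Lemma int_lin l r a b (F G : R -> R) : mu.-integrable `[l, r] (EFin \o F) ->
  mu.-integrable `[l, r] (EFin \o G) ->
  mu.-integrable `[l, r] (EFin \o (fun x => a * F x + b * G x)) /\
  \int[mu]_(x in `[l, r]) (a * F x + b * G x) =
  a * \int[mu]_(x in `[l, r]) F x + b * \int[mu]_(x in `[l, r]) G x.
Proof.
have mab : measurable (`[l, r]%classic : set (measurableTypeR R)) by [].
move=> iF iG.
have iaF := integrableZl mab a iF.
have ibG := integrableZl mab b iG.
split; first by have := integrableD mab iaF ibG.
by rewrite RintegralD// !RintegralZl.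
Qed.

Lemma quad_int l r k u v : L2 mu `[l, r] u -> L2 mu `[l, r] v ->
  mu.-integrable `[l, r] (EFin \o (fun x => (u x + k * v x) ^+ 2)) /\
  \int[mu]_(x in `[l, r]) ((u x + k * v x) ^+ 2) =
  \int[mu]_(x in `[l, r]) (u x ^+ 2) + 2 * k * \int[mu]_(x in `[l, r]) (u x * v x) +
  k ^+ 2 * \int[mu]_(x in `[l, r]) (v x ^+ 2).
Proof.
have mab : measurable (`[l, r]%classic : set (measurableTypeR R)) by [].
move=> Lu Lv.
have iu := L2_sqr_integrable mab Lu; have iv := L2_sqr_integrable mab Lv.
have iuv := L2M mab Lu Lv.
have [i1 e1] := int_lin 1 (2 * k) iu iuv.
have [i2 e2] := int_lin 1 (k ^+ 2) i1 iv.
have E : (fun x => (u x + k * v x) ^+ 2) =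
  (fun x => 1 * (1 * u x ^+ 2 + 2 * k * (u x * v x)) + k ^+ 2 * v x ^+ 2).
  by apply/funext => x; ring.
by rewrite E; split => //; rewrite e2 e1; ring.
Qed.

Lemma le_Rintegral_oo l r (F G : R -> R) : mu.-integrable `[l, r] (EFin \o F) ->
  mu.-integrable `[l, r] (EFin \o G) -> (forall x, l < x < r -> F x <= G x) ->
  \int[mu]_(x in `[l, r]) F x <= \int[mu]_(x in `[l, r]) G x.
Proof.
have moo : measurable (`]l, r[%classic : set (measurableTypeR R)) by [].
have mcc : measurable (`[l, r]%classic : set (measurableTypeR R)) by [].
have sub : `]l, r[%classic `<=` (`[l, r]%classic : set R).
  by move=> x /=; rewrite !in_itv/= => /andP[/ltW -> /ltW ->].
have cc (f : R -> R) : mu.-integrable `[l, r] (EFin \o f) ->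
    mu.-integrable `]l, r[ (EFin \o f) /\
    \int[mu]_(x in `[l, r]) f x = \int[mu]_(x in `]l, r[) f x.
  move=> fi; have fi' : mu.-integrable `]l, r[ (EFin \o f) by exact: (integrableS mcc moo sub fi).
  split => //; rewrite /Rintegral; congr fine.
  apply: (@integral_itv_bndoo R l r (EFin \o f) true false).
  exact: measurable_int fi'.
move=> /cc[iF ->] /cc[iG ->] FG; apply: (le_Rintegral moo iF iG) => x /=.
by rewrite in_itv/= => /FG.
Qed.

(** The circle part of the energy density on the circle of parameter [s], where
    the values have moved by the fraction [N s] towards [w] and lengths have
    been multiplied by [1 + s m]. *)
Definition stretched_energy (N s : R) (C p w w' m : R -> R) (x : R) : R :=
  (p x - N * s * (p x - w' x)) ^+ 2 / (1 + s * m x) -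
  (C x - N * s * (C x - w x)) ^+ 2 * (1 + s * m x).

Lemma stretch_bound (m s : R) : `|m| <= 1 -> 0 <= s <= 1 / 2 -> 1 / 2 <= 1 + s * m <= 3 / 2.
Proof. by rewrite ler_norml => /andP[h1 h2] /andP[h3 h4]; apply/andP; split; nra. Qed.

Lemma L2_prim_deriv l r u p : prim l r u p -> L2 mu `[l, r] p.
Proof. by case. Qed.

Lemma stretched_energy_integrable (N s l r : R) (C p w w' m : R -> R) : prim l r C p -> prim l r w w' ->
  measurable_fun setT m -> (forall x, `|m x| <= 1) -> 0 <= s <= 1 / 2 ->
  mu.-integrable `[l, r] (EFin \o stretched_energy N s C p w w' m).
Proof.
move=> pC pw mm m1 s01.
have mab : measurable (`[l, r]%classic : set (measurableTypeR R)) by [].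
have mm' : measurable_fun `[l, r] m by exact: measurable_funS mm.
have mq : measurable_fun `[l, r] (fun x => 1 + s * m x).
  by apply: measurable_funD => //; apply: measurable_funM.
have q0 x : 1 / 2 <= 1 + s * m x <= 3 / 2 by exact: stretch_bound.
have L1 : L2 mu `[l, r] (fun x => p x - N * s * (p x - w' x)).
  apply: L2_subr => //; first exact: L2_prim_deriv pC.
  by apply: L2_scale => //; apply: L2_subr => //; [exact: L2_prim_deriv pC|exact: L2_prim_deriv pw].
have L0 : L2 mu `[l, r] (fun x => C x - N * s * (C x - w x)).
  apply: L2_subr => //; first exact: prim_L2 pC.
  by apply: L2_scale => //; apply: L2_subr => //; [exact: prim_L2 pC|exact: prim_L2 pw].
have mqV : measurable_fun `[l, r] (fun x => (1 + s * m x)^-1).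
  exact: (measurableT_comp measurable_invr mq).
have La : L2 mu `[l, r] (fun x => (1 + s * m x)^-1 * (p x - N * s * (p x - w' x))).
  apply: (L2_mulr_bounded (M := 2) mab mqV _ L1) => x _; have /andP[h _] := q0 x.
  have h0 : 0 < 1 + s * m x by lra.
  rewrite (@ger0_norm R); last by rewrite invr_ge0 ltW.
  by rewrite -[leLHS]mul1r ler_pdivrMr//; lra.
have Lb : L2 mu `[l, r] (fun x => (1 + s * m x) * (C x - N * s * (C x - w x))).
  apply: (L2_mulr_bounded (M := 2) mab mq _ L0) => x _; have /andP[h h'] := q0 x.
  by rewrite ger0_norm; lra.
have [] := int_lin 1 (-1) (L2M mab L1 La) (L2M mab L0 Lb).
by move=> + _; apply: integrable_eqfun => x; rewrite /stretched_energy; ring.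
Qed.

(** The remainder C - w, of energies F1 and F0, shrinks by the factor 1 - N s,
    which is stronger than the distortion [1 + s m] since N >= 8. The surplus
    N - 1 over the mandatory rate 1 is the gain. *)
Lemma stretch_inequality (N s m F0 F1 : R) : 8 <= N -> 0 <= s <= 1 / (2 * N) -> `|m| <= 1 ->
  0 <= F0 -> 16 / 9 * F0 <= F1 ->
  (1 - N * s) ^+ 2 * (F1 / (1 + s * m) - F0 * (1 + s * m)) <=
  (1 - s) * (F1 - F0) - s * ((N - 1) * (F1 - F0)).
Proof.
move=> N8 /andP[s0 sN] m1 F00 F10.
have N0 : 0 < 2 * N by rewrite mulr_gt0// (lt_le_trans _ N8).
have Ns : N * s <= 1 / 2 by move: sN; rewrite ler_pdivlMr//; lra.
have s16 : s <= 1 / 16 by nra.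
have /andP[q1 q2] : 1 - s <= 1 + s * m <= 1 + s by move: m1; rewrite ler_norml => /andP[h1 h2]; apply/andP; split; nra.
set q := 1 + s * m in q1 q2 *; clearbody q.
have q0 : 0 < q by lra.
(* The slope 9/8 exceeds 1 by enough to absorb the term in s^2, as s <= 1/16. *)
have FV : F1 / q <= F1 * (1 + 9 / 8 * s).
  rewrite ler_pdivrMr// -(mulrA F1); apply: ler_peMr; first by lra.
  apply: (@le_trans _ _ ((1 + 9 / 8 * s) * (1 - s))); first by nra.
  by rewrite ler_wpM2l//; lra.
set G := F1 / q in FV *; clearbody G.
have E : 0 <= 1 - N * s by lra.
have h1 : (1 - N * s) * (G - F0 * q) <= F1 - F0.
  have b1 : G - F0 * q <= F1 * (1 + 9 / 8 * s) - F0 * (1 - s) by nra.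
  apply: (@le_trans _ _ ((1 - N * s) * (F1 * (1 + 9 / 8 * s) - F0 * (1 - s)))).
    by rewrite ler_wpM2l.
  have b2 : 0 <= F1 * (1 + 9 / 8 * s) - F0 * (1 - s) by nra.
  apply: (@le_trans _ _ ((1 - 8 * s) * (F1 * (1 + 9 / 8 * s) - F0 * (1 - s)))).
    by rewrite ler_wpM2r//; nra.
  have F1p : 0 <= F1 by lra.
  have ss : 0 <= s * s by rewrite mulr_ge0.
  have : 0 <= s * (F1 - 16 / 9 * F0) by apply: mulr_ge0; lra.
  have : 0 <= s * F0 by rewrite mulr_ge0.
  have : 0 <= s * s * F1 by rewrite mulr_ge0.
  have : 0 <= s * s * F0 by rewrite mulr_ge0.
  by move=> *; lra.
rewrite expr2 -mulrA.
apply: (@le_trans _ _ ((1 - N * s) * (F1 - F0))); first by rewrite ler_wpM2l.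
by lra.
Qed.

(** The gain dominates the full H1 norm of the remainder. *)
Lemma mass_le_gap (N F0 F1 : R) : 16 / 9 * F0 <= F1 -> 8 <= N -> 0 <= F0 ->
  F0 + F1 <= (N - 1) * (F1 - F0).
Proof. by move=> *; nra. Qed.

End PieceEnergies.

Section Pieces.
Context {R : realType}.
Notation mu := (@lebesgue_measure R).
Variables (N : R) (C p lam : R -> R).
Implicit Types (l r x s e d : R).

(** On [l, r], there are a profile [w] with the values of [C] at the ends and
    the same sign, and a rate [m] with total stretch [d], that gain [Delta] in
    energy at unit speed. [H] bounds the coefficient of kappa^2, where [e] is
    the displacement accumulated before [l], and [Q] bounds the cost of the
    phases at [s = 1]. *)
Definition piece_estimate (l r e d Delta H Q : R) := exists w w' m : R -> R,
  [/\ prim l r w w' /\ w l = C l /\ w r = C r,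
      measurable_fun setT m /\ (forall x, `|m x| <= 1) /\ \int[mu]_(x in `[l, r]) m x = d,
      forall x, l <= x <= r -> (C x = 0 -> w x = 0) /\ 0 <= C x * w x,
      forall s, 0 <= s <= 1 / (2 * N) ->
        \int[mu]_(x in `[l, r]) stretched_energy N s C p w w' m x <=
        (1 - s) * \int[mu]_(x in `[l, r]) (p x ^+ 2 - C x ^+ 2) - s * Delta &
      \int[mu]_(x in `[l, r]) ((C x - w x) ^+ 2 + (p x - w' x) ^+ 2 +
         (e + \int[mu]_(t in `[l, x]) m t) ^+ 2 * w' x ^+ 2) <= H /\
      \int[mu]_(x in `[l, r]) (lam x * (1 + m x)) <= Q].

Hypothesis N8 : 8 <= N.
Variable Lam : R.
Hypothesis (mlam : measurable_fun setT lam) (lam_bound : forall x, 0 <= lam x <= Lam).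

Lemma piece_le l r e d D D' H H' Q Q' : piece_estimate l r e d D H Q -> D' <= D -> H <= H' -> Q <= Q' ->
  piece_estimate l r e d D' H' Q'.
Proof.
move=> [w [w' [m [h1 h2 h3 h4 [h5 h6]]]]] dD hH hQ; exists w, w', m; split => //; last first.
  by split; [exact: le_trans hH|exact: le_trans hQ].
move=> s s01; apply: (le_trans (h4 s s01)); rewrite lerD2l lerN2 ler_wpM2l//.
by case/andP: s01.
Qed.

Lemma half_bound s : 0 <= s <= 1 / (2 * N) -> 0 <= s <= 1 / 2.
Proof.
move=> /andP[s0 sN]; rewrite s0/=; apply: (le_trans sN).
have N0 : 0 < 2 * N by rewrite mulr_gt0// (lt_le_trans _ N8).
rewrite ler_pdivrMr// mul1r mulrA mulVf// ?mul1r ?(le_trans _ N8)//; lra.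
Qed.

Lemma integrable_transport l r e (w w' m : R -> R) : prim l r C p -> prim l r w w' ->
  measurable_fun setT m -> (forall x, `|m x| <= 1) ->
  mu.-integrable `[l, r] (EFin \o (fun x => (C x - w x) ^+ 2 + (p x - w' x) ^+ 2 +
         (e + \int[mu]_(t in `[l, x]) m t) ^+ 2 * w' x ^+ 2)).
Proof.
have mab : measurable (`[l, r]%classic : set (measurableTypeR R)) by [].
move=> pC pw mm m1.
have mm' : measurable_fun `[l, r] m by exact: measurable_funS mm.
have Lm : L2 mu `[l, r] m.
  by apply: (@L2_bounded _ _ _ mu _ m 1) => //; exact: mu_segment_lty.
have pm : prim l r (fun x => e + \int[mu]_(t in `[l, x]) m t) m.
  by split => // x _; rewrite integral_point; ring.
have [M _ bM] := prim_bounded pm.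
have Le := prim_L2 pm.
have Lw := L2_prim_deriv pw.
have L3 := @L2_mulr_bounded _ _ _ mu _ _ _ M mab Le.1 bM Lw.
have pf := prim_subr pC pw.
have [i1 _] := int_lin 1 1 (L2_sqr_integrable mab (prim_L2 pf)) (L2_sqr_integrable mab pf.1).
have [i2 _] := int_lin 1 1 i1 (L2_sqr_integrable mab L3).
by move: i2; apply: integrable_eqfun => x; ring.
Qed.

Lemma integrable_lam l r (m : R -> R) : measurable_fun setT m -> (forall x, `|m x| <= 1) ->
  mu.-integrable `[l, r] (EFin \o (fun x => lam x * (1 + m x))).
Proof.
move=> mm m1.
have mab : measurable (`[l, r]%classic : set (measurableTypeR R)) by [].
apply: L2_int; apply: (@L2_bounded _ _ _ mu _ _ (Lam * 2)) => //; first exact: mu_segment_lty.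
  apply: (@measurable_funS _ _ _ _ setT) => //.
  by apply: measurable_funM => //; apply: measurable_funD.
move=> x _; have := m1 x; have /andP[h1 h2] := lam_bound x; rewrite ler_norml => /andP[h3 h4].
by rewrite ger0_norm; nra.
Qed.

(** Everything is additive, and the displacement at the cut is the initial one
    of the second piece. *)
Lemma piece_concat l y r e d1 d2 D1 D2 H1 H2 Q1 Q2 : l <= y -> y <= r -> prim l r C p ->
  piece_estimate l y e d1 D1 H1 Q1 -> piece_estimate y r (e + d1) d2 D2 H2 Q2 ->
  piece_estimate l r e (d1 + d2) (D1 + D2) (H1 + H2) (Q1 + Q2).
Proof.
move=> ly yr pC [w1 [w1' [m1 [[pw1 [w1l w1r]] [mm1 [m11 im1]] z1 E1 [T1 S1]]]]].
move=> [w2 [w2' [m2 [[pw2 [w2l w2r]] [mm2 [m21 im2]] z2 E2 [T2 S2]]]]].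
pose glue (f g : R -> R) x := if x <= y then f x else g x.
have gl f g x : x <= y -> glue f g x = f x by rewrite /glue => ->.
have gr f g x : y < x -> glue f g x = g x by rewrite /glue ltNge => /negbTE ->.
have gr' f g x : f y = g y -> y <= x -> glue f g x = g x.
  by move=> fg; rewrite le_eqVlt => /orP[/eqP <-|/gr//]; rewrite gl.
have w12 : w1 y = w2 y by rewrite w1r w2l.
have pw : prim l r (glue w1 w2) (glue w1' w2').
  apply: (prim_glue ly yr).
    by apply: (prim_eq_oo _ _ pw1) => x /andP[h1 h2]; rewrite gl// ltW.
  apply: (prim_eq_oo _ _ pw2) => x /andP[h1 h2]; last by rewrite gr.
  by rewrite gr'.
have mm : measurable_fun setT (glue m1 m2).
  apply: measurable_fun_if => //; last 2 first.
  - exact: measurable_funS mm1.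
  - exact: measurable_funS mm2.
  - by apply: measurable_fun_ler.
have m1b x : `|glue m1 m2 x| <= 1 by rewrite /glue; case: ifP.
have im : mu.-integrable `[l, r] (EFin \o glue m1 m2).
  apply: L2_int; apply: (@L2_bounded _ _ _ mu _ _ 1) => //; first exact: mu_segment_lty.
  exact: measurable_funS mm.
have ieta x : y <= x -> x <= r -> \int[mu]_(t in `[l, x]) glue m1 m2 t = d1 + \int[mu]_(t in `[y, x]) m2 t.
  move=> yx xr; rewrite -im1; apply: int_pieces => //.
  - exact: (integrable_sub (lexx l) xr im).
  - by move=> t /andP[_ h]; rewrite gl// ltW.
  - by move=> t /andP[h _]; rewrite gr.
have ietal x : l <= x -> x <= y -> \int[mu]_(t in `[l, x]) glue m1 m2 t = \int[mu]_(t in `[l, x]) m1 t.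
  move=> lx xy; apply: Rintegral_eq_oo => [|t /andP[_ h]]; first exact: measurable_funS mm.
  by rewrite gl// ltW// (lt_le_trans h).
exists (glue w1 w2), (glue w1' w2'), (glue m1 m2); split.
- by rewrite gl// gr'//.
- by split => //; split => //; rewrite ieta// im2.
- move=> x /andP[lx xr]; have [xy|xy] := leP x y.
    by rewrite gl//; apply: z1; rewrite lx.
  by rewrite gr//; apply: z2; rewrite xr ltW.
- move=> s s01; have s2 := half_bound s01.
  rewrite (@int_pieces R _ (stretched_energy N s C p w1 w1' m1) (stretched_energy N s C p w2 w2' m2) l y r)//.
  + have mab : measurable (`[l, r]%classic : set (measurableTypeR R)) by [].
    rewrite (@int_pieces R (fun x => p x ^+ 2 - C x ^+ 2) (fun x => p x ^+ 2 - C x ^+ 2) (fun x => p x ^+ 2 - C x ^+ 2) l y r)//.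
      by have h1 := E1 s s01; have h2 := E2 s s01; lra.
    have [+ _] := int_lin 1 (-1) (L2_sqr_integrable mab pC.1) (L2_sqr_integrable mab (prim_L2 pC)).
    by apply: integrable_eqfun => x; ring.
  + exact: stretched_energy_integrable.
  + by move=> x /andP[_ /ltW h]; rewrite /stretched_energy !gl.
  + by move=> x /andP[h _]; rewrite /stretched_energy !gr.
- split.
  + apply: (le_trans _ (lerD T1 T2)).
    rewrite (@int_pieces R _ (fun x => (C x - w1 x) ^+ 2 + (p x - w1' x) ^+ 2 +
         (e + \int[mu]_(t in `[l, x]) m1 t) ^+ 2 * w1' x ^+ 2) (fun x => (C x - w2 x) ^+ 2 + (p x - w2' x) ^+ 2 +
         (e + d1 + \int[mu]_(t in `[y, x]) m2 t) ^+ 2 * w2' x ^+ 2) l y r)//.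
    * exact: integrable_transport.
    * by move=> x /andP[lx xy]; rewrite !gl ?ltW// ietal// ltW.
    * by move=> x /andP[yx xr]; rewrite !gr// ieta ?ltW// addrA.
  + apply: (le_trans _ (lerD S1 S2)).
    rewrite (@int_pieces R _ (fun x => lam x * (1 + m1 x)) (fun x => lam x * (1 + m2 x)) l y r)//.
    * exact: integrable_lam.
    * by move=> x /andP[_ /ltW h]; rewrite !gl.
    * by move=> x /andP[h _]; rewrite !gr.
Qed.

Lemma stretched_energy_cst s l r (w w' : R -> R) m : prim l r C p -> prim l r w w' -> 0 < 1 + s * m ->
  \int[mu]_(x in `[l, r]) stretched_energy N s C p w w' (fun=> m) x =
  (\int[mu]_(x in `[l, r]) (w' x ^+ 2) + 2 * (1 - N * s) * \int[mu]_(x in `[l, r]) (w' x * (p x - w' x)) +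
    (1 - N * s) ^+ 2 * \int[mu]_(x in `[l, r]) ((p x - w' x) ^+ 2)) / (1 + s * m) -
  (\int[mu]_(x in `[l, r]) (w x ^+ 2) + 2 * (1 - N * s) * \int[mu]_(x in `[l, r]) (w x * (C x - w x)) +
    (1 - N * s) ^+ 2 * \int[mu]_(x in `[l, r]) ((C x - w x) ^+ 2)) * (1 + s * m).
Proof.
move=> pC pw q0; have pf := prim_subr pC pw.
have [i1 <-] := quad_int (1 - N * s) pw.1 pf.1.
have [i0 <-] := quad_int (1 - N * s) (prim_L2 pw) (prim_L2 pf).
have [_ E] := int_lin ((1 + s * m)^-1) (- (1 + s * m)) i1 i0.
have comb (A B V q : R) : A * V - B * q = V * A + - q * B by ring.
rewrite comb -E; congr (Rintegral _ _ _); apply/funext => x; rewrite /stretched_energy; ring.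
Qed.

(** With a constant rate the quadratic forms decouple into the part of [w],
    which gains [delta], and the part of C - w, to which [stretch_inequality]
    applies, provided that the cross terms cancel for every [s]. *)
Lemma piece_const l r e m (w w' : R -> R) delta E Lm : l <= r -> prim l r C p -> prim l r w w' ->
  w l = C l -> w r = C r ->
  (forall x, l <= x <= r -> (C x = 0 -> w x = 0) /\ 0 <= C x * w x) -> `|m| <= 1 ->
  let F1 := \int[mu]_(x in `[l, r]) ((p x - w' x) ^+ 2) in
  let F0 := \int[mu]_(x in `[l, r]) ((C x - w x) ^+ 2) in
  let W1 := \int[mu]_(x in `[l, r]) (w' x ^+ 2) in
  let W0 := \int[mu]_(x in `[l, r]) (w x ^+ 2) in
  16 / 9 * F0 <= F1 ->
  (forall s, 0 <= s <= 1 / (2 * N) -> (1 + s * m)^-1 * \int[mu]_(x in `[l, r]) (w' x * (p x - w' x)) =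
     (1 + s * m) * \int[mu]_(x in `[l, r]) (w x * (C x - w x))) ->
  (forall s, 0 <= s <= 1 / (2 * N) ->
     W1 / (1 + s * m) - W0 * (1 + s * m) <= (1 - s) * (W1 - W0) - s * delta) ->
  (forall x, l <= x <= r -> `|e + m * (x - l)| <= E) ->
  (forall x, l < x < r -> lam x <= Lm) ->
  piece_estimate l r e (m * (r - l)) (delta + (N - 1) * (F1 - F0)) ((N - 1) * (F1 - F0) + E ^+ 2 * W1)
    (Lm * (1 + m) * (r - l)).
Proof.
move=> lr pC pw wl wr sgn m1 F1 F0 W1 W0 FF XX WW eE lL.
have pf := prim_subr pC pw.
have mab : measurable (`[l, r]%classic : set (measurableTypeR R)) by [].
have F00 : 0 <= F0 by apply: Rintegral_ge0 => x _; exact: sqr_ge0.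
have im x : l <= x -> \int[mu]_(t in `[l, x]) m = m * (x - l) by exact: Rintegral_cst_segment.
have qpos s : 0 <= s <= 1 / (2 * N) -> 0 < 1 + s * m.
  move=> /half_bound/(stretch_bound m1)/andP[h _]; apply: lt_le_trans h; lra.
exists w, w', (fun=> m); split => //.
- by split => //; split => //; rewrite im.
- move=> s s01; rewrite stretched_energy_cst ?qpos//.
  have T := stretch_inequality N8 s01 m1 F00 FF.
  have Ws := WW s s01; have Xs := XX s s01.
  have X0 := XX 0; rewrite mul0r addr0 invr1 !mul1r in X0.
  have {}X0 : \int[mu]_(x in `[l, r]) (w' x * (p x - w' x)) =
    \int[mu]_(x in `[l, r]) (w x * (C x - w x)).
    by apply: X0; rewrite lexx/= invr_ge0 mulr_ge0// (le_trans _ N8).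
  have -> : \int[mu]_(x in `[l, r]) (p x ^+ 2 - C x ^+ 2) = W1 - W0 + (F1 - F0).
    have [i1 e1] := quad_int 1 pw.1 pf.1.
    have [i0 e0] := quad_int 1 (prim_L2 pw) (prim_L2 pf).
    have [_ e2] := int_lin 1 (-1) i1 i0.
    transitivity (\int[mu]_(x in `[l, r]) (1 * (w' x + 1 * (p x - w' x)) ^+ 2 + -1 * (w x + 1 * (C x - w x)) ^+ 2)).
      by congr (Rintegral _ _ _); apply/funext => x; ring.
    rewrite e2 e1 e0 X0 /W1 /W0 /F1 /F0; ring.
  rewrite -/W1 -/W0 -/F1 -/F0 in Xs *.
  have fin (w1 w0 f1 f0 x1 x0 V q a dd D os : R) : w1 * V - w0 * q <= os * (w1 - w0) - s * dd ->
      V * x1 = q * x0 -> a ^+ 2 * (f1 * V - f0 * q) <= os * (f1 - f0) - s * D ->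
      (w1 + 2 * a * x1 + a ^+ 2 * f1) * V - (w0 + 2 * a * x0 + a ^+ 2 * f0) * q <=
      os * (w1 - w0 + (f1 - f0)) - s * (dd + D).
    move=> h1 h2 h3; have -> : (w1 + 2 * a * x1 + a ^+ 2 * f1) * V - (w0 + 2 * a * x0 + a ^+ 2 * f0) * q =
      (w1 * V - w0 * q) + 2 * a * (V * x1 - q * x0) + a ^+ 2 * (f1 * V - f0 * q) by ring.
    rewrite h2 subrr mulr0 addr0; apply: (le_trans (lerD h1 h3)).
    by rewrite le_eqVlt; apply/orP; left; apply/eqP; ring.
  exact: fin.
- have W10 : 0 <= W1 by apply: Rintegral_ge0 => x _; exact: sqr_ge0.
  have mm : measurable_fun setT (fun _ : R => m) by [].
  split; last first.
    rewrite -Rintegral_cst_segment//; apply: le_Rintegral_oo.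
    - exact: integrable_lam.
    - by apply: continuous_integrable => x; exact: cvg_cst.
    - move=> x lxr; rewrite ler_wpM2r ?lL//.
      by move: m1; rewrite ler_norml => /andP[h _]; rewrite -lerBlDl sub0r.
  have [i1 e1] := int_lin 1 1 (L2_sqr_integrable mab (prim_L2 pf)) (L2_sqr_integrable mab pf.1).
  have [i2 e2] := int_lin 1 (E ^+ 2) i1 (L2_sqr_integrable mab pw.1).
  apply: (@le_trans _ _ (F0 + F1 + E ^+ 2 * W1)).
    have -> : F0 + F1 + E ^+ 2 * W1 =
      1 * (1 * \int[mu]_(x in `[l, r]) ((C x - w x) ^+ 2) + 1 * \int[mu]_(x in `[l, r]) ((p x - w' x) ^+ 2)) +
      E ^+ 2 * \int[mu]_(x in `[l, r]) (w' x ^+ 2) by rewrite !mul1r.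
    rewrite -e1 -e2; apply: le_Rintegral_oo => //; first exact: integrable_transport.
    move=> x /andP[lx xr]; rewrite !mul1r lerD2l ler_wpM2r ?sqr_ge0// (im _ (ltW lx)).
    rewrite -(real_normK (num_real (e + _))) lerXn2r ?nnegrE//.
      by apply: le_trans (eE l _); rewrite // lexx.
    by apply: eE; rewrite !ltW.
  by rewrite lerD2r; exact: mass_le_gap.
Qed.

Lemma piece_const_values l r e m (w w' : R -> R) delta E Lm F1 F0 W1 W0 X1 X0 : l <= r ->
  prim l r C p -> prim l r w w' ->
  \int[mu]_(x in `[l, r]) ((p x - w' x) ^+ 2) = F1 ->
  \int[mu]_(x in `[l, r]) ((C x - w x) ^+ 2) = F0 ->
  \int[mu]_(x in `[l, r]) (w' x ^+ 2) = W1 -> \int[mu]_(x in `[l, r]) (w x ^+ 2) = W0 ->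
  \int[mu]_(x in `[l, r]) (w' x * (p x - w' x)) = X1 ->
  \int[mu]_(x in `[l, r]) (w x * (C x - w x)) = X0 ->
  w l = C l -> w r = C r ->
  (forall x, l <= x <= r -> (C x = 0 -> w x = 0) /\ 0 <= C x * w x) -> `|m| <= 1 ->
  16 / 9 * F0 <= F1 ->
  (forall s, 0 <= s <= 1 / (2 * N) -> (1 + s * m)^-1 * X1 = (1 + s * m) * X0) ->
  (forall s, 0 <= s <= 1 / (2 * N) ->
     W1 / (1 + s * m) - W0 * (1 + s * m) <= (1 - s) * (W1 - W0) - s * delta) ->
  (forall x, l <= x <= r -> `|e + m * (x - l)| <= E) ->
  (forall x, l < x < r -> lam x <= Lm) ->
  piece_estimate l r e (m * (r - l)) (delta + (N - 1) * (F1 - F0)) ((N - 1) * (F1 - F0) + E ^+ 2 * W1)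
    (Lm * (1 + m) * (r - l)).
Proof.
move=> lr pC pw <- <- <- <- <- <- wl wr sgn m1 FF XX WW eE lL.
exact: (piece_const lr pC pw wl wr sgn m1 FF XX WW eE lL).
Qed.

End Pieces.

(** * Gaps, long arcs and wide arcs *)

Section Eigenfunctions.
Context {R : realType}.
Notation mu := (@lebesgue_measure R).
Implicit Types (a b k c : R).

Lemma prim_sine a b k c :
  prim a b (fun x => sin (k * (x - c))) (fun x => k * cos (k * (x - c))) /\
  prim a b (fun x => k * cos (k * (x - c))) (fun x => - k ^+ 2 * sin (k * (x - c))).
Proof.
have dk (x : R) : is_derive x 1 (fun x : R => k * (x - c)) k.
  by apply: is_derive_eq; rewrite /GRing.scale/=; ring.
have ck : continuous (fun x : R => k * (x - c)).
  by move=> x; apply: cvgM; [exact: cvg_cst|apply: cvgB; [exact: cvg_id|exact: cvg_cst]].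
have cs : continuous (fun x : R => sin (k * (x - c))).
  by move=> x; apply: (@continuous_comp _ _ _ (fun x : R => k * (x - c)) sin); [exact: ck|exact: continuous_sin].
have cc : continuous (fun x : R => cos (k * (x - c))).
  by move=> x; apply: (@continuous_comp _ _ _ (fun x : R => k * (x - c)) cos); [exact: ck|exact: continuous_cos].
split; apply: prim_C1.
- move=> x; have h := @is_derive1_comp R sin (fun x : R => k * (x - c)) x _ _ (is_derive_sin _) (dk x).
  by apply: (is_derive_eq h); rewrite /GRing.scale/=; ring.
- by move=> x; apply: cvgM; [exact: cvg_cst|exact: cc].
- move=> x; have h := is_deriveZ k (@is_derive1_comp R cos (fun x : R => k * (x - c)) x _ _ (is_derive_cos _) (dk x)).
  by apply: (is_derive_eq h); rewrite /GRing.scale/=; ring.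
- by move=> x; apply: cvgM; [exact: cvg_cst|exact: cs].
Qed.

(** For a solution of u'' = - k u. It evaluates both the energy of [u] and its
    cross terms with a function that vanishes at the ends. *)
Lemma eigen_by_parts a b k (u u' f f' : R -> R) : a <= b -> prim a b u u' ->
  prim a b u' (fun x => - k * u x) -> prim a b f f' ->
  \int[mu]_(x in `[a, b]) (u' x * f' x) =
  k * \int[mu]_(x in `[a, b]) (u x * f x) + (u' b * f b - u' a * f a).
Proof.
move=> ab pu pu' pf; have mab : measurable (`[a, b]%classic : set (measurableTypeR R)) by [].
rewrite -(prim_by_parts ab pu' pf).
have i1 := L2M mab (prim_L2 pu) (prim_L2 pf).
have i2 := L2M mab pu.1 pf.1.
have [i3 e3] := int_lin (- k) 1 i1 i2; have [_ e4] := int_lin k 1 i1 i3.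
have -> : \int[mu]_(x in `[a, b]) (- k * u x * f x + u' x * f' x) =
  \int[mu]_(x in `[a, b]) (- k * (u x * f x) + 1 * (u' x * f' x)).
  by congr (Rintegral _ _ _); apply/funext => x; ring.
rewrite e3; ring.
Qed.

Definition arc_sine (l r x : R) := sin (pi / (r - l) * (x - l)).
Definition arc_cosine (l r x : R) := pi / (r - l) * cos (pi / (r - l) * (x - l)).

Lemma prim_arc_sine a b l r : prim a b (arc_sine l r) (arc_cosine l r).
Proof. exact: (prim_sine a b _ _).1. Qed.

Lemma prim_arc_cosine a b l r :
  prim a b (arc_cosine l r) (fun x => - (pi / (r - l)) ^+ 2 * arc_sine l r x).
Proof. exact: (prim_sine a b _ _).2. Qed.

Lemma arc_sine_continuous l r : continuous (arc_sine l r).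
Proof.
move=> x; apply: (@continuous_comp _ _ _ (fun x : R => pi / (r - l) * (x - l)) sin).
  by apply: cvgM; [exact: cvg_cst|apply: cvgB; [exact: cvg_id|exact: cvg_cst]].
exact: continuous_sin.
Qed.

Lemma arc_sine_ends l r : l < r ->
  [/\ arc_sine l r l = 0, arc_sine l r r = 0 & arc_sine l r ((l + r) / 2) = 1].
Proof.
move=> lr; rewrite /arc_sine subrr mulr0 sin0; split => //.
  rewrite divfK ?subr_eq0 ?gt_eqF//; exact: sinpi.
have -> : pi / (r - l) * ((l + r) / 2 - l) = pi / 2 by field; rewrite subr_eq0 gt_eqF.
exact: sin_pihalf.
Qed.

Lemma arc_sine_ge0 l r x : l < r -> l <= x <= r -> 0 <= arc_sine l r x.
Proof.
move=> lr /andP[lx xr]; apply: sin_ge0_pi; have lr0 : 0 < r - l by rewrite subr_gt0.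
apply/andP; split; first by rewrite mulr_ge0 ?subr_ge0// divr_ge0 ?pi_ge0// ltW.
by rewrite mulrAC ler_pdivrMr// ler_wpM2l ?pi_ge0// lerB.
Qed.

Lemma arc_sine_sqr_int l r : l < r ->
  \int[mu]_(x in `[l, r]) (arc_sine l r x * arc_sine l r x) = (r - l) / 2.
Proof.
move=> lr; have lr' := ltW lr; have lr0 : r - l != 0 by rewrite subr_eq0 gt_eqF.
have mab : measurable (`[l, r]%classic : set (measurableTypeR R)) by [].
have ps := prim_arc_sine l r l r; have pc := prim_arc_cosine l r l r.
have := eigen_by_parts lr' ps pc ps.
have [-> -> _] := arc_sine_ends lr; rewrite !mulr0 subrr addr0 => e1.
have [_ e2] := int_lin ((pi / (r - l)) ^+ 2) 1 (L2M mab (prim_L2 ps) (prim_L2 ps)) (L2M mab ps.1 ps.1).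
have e3 : \int[mu]_(x in `[l, r]) ((pi / (r - l)) ^+ 2 * (arc_sine l r x * arc_sine l r x) + 1 * (arc_cosine l r x * arc_cosine l r x)) =
  (pi / (r - l)) ^+ 2 * (r - l).
  rewrite -Rintegral_cst_segment//; congr (Rintegral _ _ _); apply/funext => x.
  rewrite /arc_sine /arc_cosine; have := cos2Dsin2 (pi / (r - l) * (x - l)).
  move: (pi / (r - l)) => k; move: (sin _) (cos _) => S Co h.
  by transitivity (k ^+ 2 * (Co ^+ 2 + S ^+ 2)); [ring|rewrite h mulr1].
rewrite e3 e1 mul1r -mulrDr in e2.
have /mulfI : (pi / (r - l)) ^+ 2 != 0 :> R.
  by rewrite expf_neq0// mulf_neq0 ?invr_neq0// gt_eqF// pi_gt0.
move=> /(_ _ _ e2); clear => h; lra.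
Qed.

(** Subtract the multiple of the sine that makes the function vanish at the
    midpoint, and apply [poincare] on both halves; orthogonality makes the
    correction contribute with a favourable sign. *)
Lemma half_poincare l r (f f' : R -> R) : l < r -> prim l r f f' -> f l = 0 -> f r = 0 ->
  \int[mu]_(x in `[l, r]) (arc_sine l r x * f x) = 0 ->
  4 * (pi / (r - l)) ^+ 2 * \int[mu]_(x in `[l, r]) (f x ^+ 2) <= \int[mu]_(x in `[l, r]) (f' x ^+ 2).
Proof.
move=> lr pf fl fr orth; have lr' := ltW lr; have lr0 : r - l != 0 by rewrite subr_eq0 gt_eqF.
have mab : measurable (`[l, r]%classic : set (measurableTypeR R)) by [].
have ps := prim_arc_sine l r l r; have pc := prim_arc_cosine l r l r.
have [sl sr sm] := arc_sine_ends lr.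
have orth' := eigen_by_parts lr' ps pc pf.
rewrite orth fl fr !mulr0 subrr addr0 in orth'.
have nrm' := eigen_by_parts lr' ps pc ps.
rewrite sl sr !mulr0 subrr addr0 arc_sine_sqr_int// in nrm'.
(* The sine equals 1 at the midpoint [y]. *)
pose y := (l + r) / 2; pose b := - f y.
have ly : l <= y by rewrite /y; lra.
have yr : y <= r by rewrite /y; lra.
have pg := prim_addr pf (prim_scale b ps).
have gl : f l + b * arc_sine l r l = 0 by rewrite fl sl mulr0 addr0.
have gr : f r + b * arc_sine l r r = 0 by rewrite fr sr mulr0 addr0.
have gm : f y + b * arc_sine l r y = 0 by rewrite sm mulr1 /b subrr.
have T0 : 0 < (r - l) / 2 by rewrite divr_gt0// subr_gt0.
have T1 : y - l <= (r - l) / 2 by rewrite /y; lra.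
have T2 : r - y <= (r - l) / 2 by rewrite /y; lra.
have P1 := poincare ly T0 T1 (prim_sub (lexx l) yr pg) gl gm.
have P2 := poincare yr T0 T2 (prim_sub ly (lexx r) pg) gm gr.
have ig := L2_sqr_integrable mab (prim_L2 pg); have ig' := L2_sqr_integrable mab pg.1.
have := lerD P1 P2; rewrite -mulrDr -(Rintegral_split ly yr ig) -(Rintegral_split ly yr ig').
have [_ ->] := quad_int b (prim_L2 pf) (prim_L2 ps).
have [_ ->] := quad_int b pf.1 ps.1.
have sq (h : R -> R) : \int[mu]_(x in `[l, r]) (h x ^+ 2) = \int[mu]_(x in `[l, r]) (h x * h x).
  by congr (Rintegral _ _ _); apply/funext => x; rewrite expr2.
have cm (h g : R -> R) : \int[mu]_(x in `[l, r]) (h x * g x) = \int[mu]_(x in `[l, r]) (g x * h x).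
  by congr (Rintegral _ _ _); apply/funext => x; rewrite mulrC.
rewrite (cm f (arc_sine l r)) orth (cm f' (arc_cosine l r)) orth' (sq (arc_sine l r)) (sq (arc_cosine l r)) nrm' arc_sine_sqr_int// !mulr0 !addr0.
have -> : pi / ((r - l) / 2) = 2 * (pi / (r - l)) :> R by field.
move: (pi / (r - l)) (\int[mu]_(x in `[l, r]) (f x ^+ 2)) (\int[mu]_(x in `[l, r]) (f' x ^+ 2)) => k F0 F1.
have : 0 <= b ^+ 2 * ((r - l) / 2) * k ^+ 2 by apply: mulr_ge0; [apply: mulr_ge0; [exact: sqr_ge0|exact: ltW]|exact: sqr_ge0].
clear => h1 h2.
have E : (2 * k) ^+ 2 * (F0 + b ^+ 2 * ((r - l) / 2)) - b ^+ 2 * (k ^+ 2 * ((r - l) / 2)) =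
  4 * k ^+ 2 * F0 + 3 * (b ^+ 2 * ((r - l) / 2) * k ^+ 2) by ring.
lra.
Qed.

(** The energy of the sine on an arc of length theta_s = (1 - s) theta + s pi is
    proportional to pi^2 / theta_s - theta_s. This is strictly convex in [s] and
    vanishes at [s = 1], and the convexity is worth a multiple of
    (pi - theta)^2. *)
Lemma arc_energy_gain (s theta W q P : R) : 2 <= P -> P <= 4 -> q = 1 + s * ((P - theta) / theta) -> 2 * P / 3 <= theta -> theta <= 3 * P / 2 -> 0 <= W -> 0 <= s <= 1 / 2 ->
  (P / theta) ^+ 2 * W / q - W * q <=
  (1 - s) * ((P / theta) ^+ 2 * W - W) - s * (W * (P - theta) ^+ 2 / 108).
Proof.
move=> PII PIH qE t1 t2 W0 /andP[s0 s1].
have t0 : 0 < theta by lra.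
have qt : q = (theta + s * (P - theta)) / theta by rewrite qE; field; lra.
set th := theta + s * (P - theta) in qt; have th0 : 0 < th by rewrite /th; nra.
have th2 : th <= 3 * P / 2 by rewrite /th; nra.
have key : (1 - s) * ((P / theta) ^+ 2 * W - W) - s * (W * (P - theta) ^+ 2 / 108) -
  ((P / theta) ^+ 2 * W / q - W * q) =
  s * (W * (P - theta) ^+ 2) * ((1 - s) * P / (theta ^+ 2 * th) - 1 / 108).
  rewrite qt /th; field.
  by rewrite -/th; apply/andP; split; lra.
rewrite -subr_ge0 key; apply: mulr_ge0; first by rewrite mulr_ge0// mulr_ge0// sqr_ge0.
rewrite subr_ge0 ler_pdivlMr; last by rewrite mulr_gt0// exprn_gt0.
have h1 : theta ^+ 2 <= (3 * P / 2) ^+ 2 by rewrite lerXn2r// nnegrE; lra.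
have h2 : theta ^+ 2 * th <= (3 * P / 2) ^+ 2 * (3 * P / 2).
  by apply: ler_pM => //; [exact: sqr_ge0|exact: ltW].
have h3 : P ^+ 2 <= 16 :> R by have : P ^+ 2 <= 4 ^+ 2 :> R; [rewrite lerXn2r// nnegrE; lra|lra].
have h4 : P ^+ 2 * P <= 16 * P :> R by rewrite ler_wpM2r//; lra.
have h5 : 1 / 2 * P <= (1 - s) * P :> R by rewrite ler_wpM2r//; lra.
have h6 : (3 * P / 2) ^+ 2 * (3 * P / 2) = 27 / 8 * (P ^+ 2 * P) :> R by field.
lra.
Qed.

Lemma third_ratio (P : R) : 0 < P -> 16 / 9 <= (P / (2 * P / 3)) ^+ 2.
Proof.
move=> P0; have -> : P / (2 * P / 3) = 3 / 2 by field; rewrite gt_eqF.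
lra.
Qed.

Lemma twothird_le (P : R) : 2 <= P -> 2 * P / 3 <= P.
Proof. by move=> P2; lra. Qed.

Lemma strain_bound (P theta : R) : 2 * P / 3 <= theta -> theta <= 3 * P / 2 -> 0 < theta ->
  `|(P - theta) / theta| <= 1.
Proof.
by move=> *; rewrite ler_norml ler_pdivlMr// ler_pdivrMr//; apply/andP; split; lra.
Qed.

Lemma four_sqr_ge k : 2 / 3 <= k -> 16 / 9 <= 4 * k ^+ 2.
Proof. by move=> k2; nra. Qed.

Lemma sqr_le_94 k : 2 / 3 <= k -> k <= 3 / 2 -> k ^+ 2 <= 9 / 4.
Proof. by move=> k2; nra. Qed.

End Eigenfunctions.

Section ArcPieces.
Context {R : realType}.
Notation mu := (@lebesgue_measure R).
Variables (N : R) (C p lam : R -> R).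
Hypothesis N8 : 8 <= N.
Variable Lam : R.
Hypothesis (mlam : measurable_fun setT lam) (lam_bound : forall x, 0 <= lam x <= Lam).
Implicit Types (l r x s e d m : R).

(** The profile is zero: all of [C] counts as remainder. *)
Lemma piece_gap l r e m : l <= r -> prim l r C p -> C l = 0 -> C r = 0 -> `|m| <= 1 ->
  16 / 9 * \int[mu]_(x in `[l, r]) (C x ^+ 2) <= \int[mu]_(x in `[l, r]) (p x ^+ 2) ->
  let D := (N - 1) * (\int[mu]_(x in `[l, r]) (p x ^+ 2) - \int[mu]_(x in `[l, r]) (C x ^+ 2)) in
  piece_estimate N C p lam l r e (m * (r - l)) D D (Lam * (1 + m) * (r - l)).
Proof.
move=> lr pC Cl Cr m1 FF D.
have z0 : \int[mu]_(x in `[l, r]) (0 ^+ 2) = 0 :> R by rewrite Rintegral_cst_segment// expr0n mul0r.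
have e1 (f : R -> R) : (fun x => (f x - 0) ^+ 2) = (fun x => f x ^+ 2).
  by apply/funext => x; rewrite subr0.
have zl (f : R -> R) : \int[mu]_(x in `[l, r]) (0 * f x) = 0.
  rewrite -[RHS](mul0r (r - l)) -Rintegral_cst_segment//.
  by congr (Rintegral _ _ _); apply/funext => x; rewrite mul0r.
have := @piece_const_values R N C p lam N8 Lam mlam lam_bound l r e m (fun=> 0) (fun=> 0) 0 (`|e| + (r - l)) Lam
  _ _ 0 0 0 0 lr pC (prim_cst l r 0) erefl erefl z0 z0 (zl _) (zl _).
rewrite !e1 => H; apply: piece_le; [apply: H => //| | |] => //.
- by move=> x _; rewrite mulr0.
- by move=> s _; rewrite !mulr0.
- by move=> s _; rewrite !mul0r subrr !mulr0 subr0.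
- move=> x /andP[lx xr]; apply: (le_trans (ler_normD _ _)); rewrite lerD2l normrM.
  rewrite (ger0_norm (_ : 0 <= x - l)) ?subr_ge0//.
  apply: (@le_trans _ _ (1 * (x - l))); first by rewrite ler_wpM2r// subr_ge0.
  by rewrite mul1r lerD2r.
- by move=> x _; case/andP: (lam_bound x).
- by rewrite add0r.
- by rewrite mulr0 addr0.
Qed.

(** The squared L2 norm of the projection of [C] on the half wave sine. *)
Definition arc_mass (l r : R) := (\int[mu]_(x in `[l, r]) (C x * arc_sine l r x)) ^+ 2 * (2 / (r - l)).

(** The profile is the projection on the half wave sine. The cross terms vanish
    by orthogonality, the remainder has the Poincare constant 4 (pi / theta)^2,
    at least 16/9 as theta <= 3 pi / 2, and the rate brings the length to pi. *)
Lemma piece_arc l r Lm : 2 * pi / 3 <= r - l -> r - l <= 3 * pi / 2 -> prim l r C p -> C l = 0 -> C r = 0 ->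
  (forall x, l < x < r -> C x != 0) ->
  (forall x y, l <= x <= r -> l <= y <= r -> 0 <= C x * C y) ->
  (forall x, l < x < r -> lam x <= Lm) ->
  exists2 D, 0 <= D & forall e, piece_estimate N C p lam l r e (pi - (r - l))
    (arc_mass l r * (pi - (r - l)) ^+ 2 / 108 + D)
    (D + (`|e| + `|pi - (r - l)|) ^+ 2 * (9 / 4 * arc_mass l r)) (Lm * pi).
Proof.
move=> t1 t2 pC Cl Cr Cn0 CC lL; have pi2 := pi_ge2 R; have pih := pihalf_lt2 R.
have lr : l < r by lra. have lr' := ltW lr; have lr0 : 0 < r - l by lra.
have mab : measurable (`[l, r]%classic : set (measurableTypeR R)) by [].
have ps := prim_arc_sine l r l r; have pc := prim_arc_cosine l r l r.
have [sl sr _] := arc_sine_ends lr.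
pose I := \int[mu]_(x in `[l, r]) (C x * arc_sine l r x); pose A := I * (2 / (r - l)).
pose w x := A * arc_sine l r x; pose w' x := A * arc_cosine l r x.
have pw : prim l r w w' := prim_scale A ps.
have pw' : prim l r w' (fun x => - (pi / (r - l)) ^+ 2 * w x).
  by apply: prim_eq_oo (prim_scale A pc) => // x _; rewrite /w; ring.
have wl : w l = 0 by rewrite /w sl mulr0. have wr : w r = 0 by rewrite /w sr mulr0.
have pf := prim_subr pC pw.
have sI := arc_sine_sqr_int lr.
have iCs := L2M mab (prim_L2 pC) (prim_L2 ps).
have iss := L2M mab (prim_L2 ps) (prim_L2 ps).
have scal (h : R -> R) k : mu.-integrable `[l, r] (EFin \o h) ->
    \int[mu]_(x in `[l, r]) (k * h x) = k * \int[mu]_(x in `[l, r]) h x by exact: RintegralZl.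
have orth : \int[mu]_(x in `[l, r]) (arc_sine l r x * (C x - w x)) = 0.
  have [_ h] := int_lin 1 (- A) iCs iss; rewrite sI -/I in h.
  transitivity (1 * I + - A * ((r - l) / 2)); last by rewrite /A; field; rewrite gt_eqF.
  by rewrite -h; congr (Rintegral _ _ _); apply/funext => x; rewrite /w; ring.
have X0 : \int[mu]_(x in `[l, r]) (w x * (C x - w x)) = 0.
  rewrite -(mulr0 A) -orth -scal; last exact: (L2M mab (prim_L2 ps) (prim_L2 pf)).
  by congr (Rintegral _ _ _); apply/funext => x; rewrite /w; ring.
have X1 : \int[mu]_(x in `[l, r]) (w' x * (p x - w' x)) = 0.
  rewrite (eigen_by_parts lr' pw pw' pf) X0 Cl Cr wl wr; ring.
have sq (h : R -> R) : \int[mu]_(x in `[l, r]) (h x ^+ 2) = \int[mu]_(x in `[l, r]) (h x * h x).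
  by congr (Rintegral _ _ _); apply/funext => x; rewrite expr2.
have W0 : \int[mu]_(x in `[l, r]) (w x ^+ 2) = arc_mass l r.
  transitivity (A ^+ 2 * ((r - l) / 2)); last by rewrite /arc_mass -/I /A; field; rewrite gt_eqF.
  by rewrite -sI -scal//; congr (Rintegral _ _ _); apply/funext => x; rewrite /w; ring.
have W1 : \int[mu]_(x in `[l, r]) (w' x ^+ 2) = (pi / (r - l)) ^+ 2 * arc_mass l r.
  by rewrite sq (eigen_by_parts lr' pw pw' pw) -sq W0 wl wr !mulr0 subrr addr0.
have M0 : 0 <= arc_mass l r by rewrite -W0; apply: Rintegral_ge0 => x _; exact: sqr_ge0.
have k1 : pi / (r - l) <= 3 / 2 by rewrite ler_pdivrMr//; lra.
have k2 : 2 / 3 <= pi / (r - l) by rewrite ler_pdivlMr//; lra.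
have fl : C l - w l = 0 by rewrite Cl wl subrr.
have fr : C r - w r = 0 by rewrite Cr wr subrr.
have FF0 := half_poincare lr pf fl fr orth.
have F00 : 0 <= \int[mu]_(x in `[l, r]) ((C x - w x) ^+ 2) by apply: Rintegral_ge0 => x _; exact: sqr_ge0.
have FF : 16 / 9 * \int[mu]_(x in `[l, r]) ((C x - w x) ^+ 2) <= \int[mu]_(x in `[l, r]) ((p x - w' x) ^+ 2).
  apply: le_trans FF0; rewrite ler_wpM2r//.
  exact: four_sqr_ge.
exists ((N - 1) * (\int[mu]_(x in `[l, r]) ((p x - w' x) ^+ 2) - \int[mu]_(x in `[l, r]) ((C x - w x) ^+ 2))).
  by apply: le_trans (mass_le_gap FF N8 F00); rewrite addr_ge0// (le_trans _ FF)// mulr_ge0.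
move=> e; set m := (pi - (r - l)) / (r - l).
have mE : m * (r - l) = pi - (r - l) by rewrite /m divfK// gt_eqF.
have m1 : `|m| <= 1.
  exact: strain_bound.
have := @piece_const_values R N C p lam N8 Lam mlam lam_bound l r e m w w' (arc_mass l r * (pi - (r - l)) ^+ 2 / 108)
  (`|e| + `|pi - (r - l)|) Lm _ _ _ _ _ _ lr' pC pw erefl erefl W1 W0 X1 X0.
rewrite mE => H; apply: piece_le; [apply: H => //| | |] => //.
- by rewrite wl Cl. - by rewrite wr Cr.
- move=> x lxr; split.
    have [->|xl] := eqVneq x l; first by rewrite wl.
    have [->|xr] := eqVneq x r; first by rewrite wr.
    move=> Cx0; have : C x != 0; last by rewrite Cx0 eqxx.
    by apply: Cn0; case/andP: lxr => h1 h2; rewrite !lt_neqAle h1 h2 eq_sym xl xr.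
  have -> : C x * w x = 2 / (r - l) * (C x * I) * arc_sine l r x by rewrite /w /A; ring.
  apply: mulr_ge0; last exact: arc_sine_ge0.
  apply: mulr_ge0; first by rewrite divr_ge0// ltW.
  rewrite -scal//; apply: Rintegral_ge0 => y; rewrite /= in_itv/= => ly.
  by rewrite mulrA mulr_ge0 ?CC// arc_sine_ge0.
- by move=> s _; rewrite !mulr0.
- by move=> s s01; apply: (arc_energy_gain _ _ _ t1 t2) => //; first lra; exact: half_bound N8 _ s01.
- move=> x /andP[lx xr]; apply: (le_trans (ler_normD _ _)); rewrite lerD2l normrM.
  rewrite -mE [leRHS]normrM ler_wpM2l// !ger0_norm ?subr_ge0//; first by rewrite lerD2r.
- by rewrite lerD2l ler_wpM2l ?sqr_ge0// ler_wpM2r// sqr_le_94.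
- by rewrite -mulrA mulrDl mul1r mE; rewrite addrC subrK.
Qed.

(** The solution of w'' = - w with the values of [C] at the ends has the energy
    ((C_l^2 + C_r^2) cos h - 2 C_l C_r) / sin h. It is nonpositive for a length
    h >= pi / 2 and values of the same sign, so a profile of this energy can
    only gain. *)
Lemma piece_third l r Lm : pi / 2 <= r - l -> r - l <= 2 * pi / 3 -> prim l r C p ->
  (forall x, l < x < r -> C x != 0) ->
  (forall x y, l <= x <= r -> l <= y <= r -> 0 <= C x * C y) ->
  (forall x, l < x < r -> lam x <= Lm) ->
  exists2 D, 0 <= D & piece_estimate N C p lam l r 0 0 D D (Lm * (r - l)).
Proof.
move=> t1 t2 pC Cn0 CC lL; have pi2 := pi_ge2 R; have pih := pihalf_lt2 R.
have lr : l < r by lra. have lr' := ltW lr; have lr0 : 0 < r - l by lra.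
have mab : measurable (`[l, r]%classic : set (measurableTypeR R)) by [].
pose h := r - l; have sh : 0 < sin h by apply: sin_gt0_pi; rewrite /h; apply/andP; split; lra.
have ch : cos h <= 0.
  have -> : h = (h - pi / 2) + pi / 2 by rewrite subrK.
  by rewrite cosDpihalf oppr_le0; apply: sin_ge0_pi; rewrite /h; apply/andP; split; lra.
pose w x := C r / sin h * sin (1 * (x - l)) + (- C l / sin h) * sin (1 * (x - r)).
pose w' x := C r / sin h * (1 * cos (1 * (x - l))) + (- C l / sin h) * (1 * cos (1 * (x - r))).
have pw : prim l r w w' := prim_addr (prim_scale _ (prim_sine l r 1 l).1) (prim_scale _ (prim_sine l r 1 r).1).
have pw' : prim l r w' (fun x => - 1 * w x).
  apply: prim_eq_oo (prim_addr (prim_scale (C r / sin h) (prim_sine l r 1 l).2) (prim_scale (- C l / sin h) (prim_sine l r 1 r).2)) => // x _.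
  by rewrite /w; ring.
have snh : sin h != 0 by rewrite gt_eqF.
have lrh : l - r = - h by rewrite opprB.
have wl : w l = C l by rewrite /w subrr lrh mulr0 sin0 mul1r sinN; field.
have wr : w r = C r by rewrite /w subrr mulr0 sin0 mul1r -/h; field.
have pf := prim_subr pC pw.
have fl : C l - w l = 0 by rewrite wl subrr.
have fr : C r - w r = 0 by rewrite wr subrr.
have X1 : \int[mu]_(x in `[l, r]) (w' x * (p x - w' x)) = \int[mu]_(x in `[l, r]) (w x * (C x - w x)).
  by rewrite (eigen_by_parts lr' pw pw' pf) fl fr !mulr0 subrr addr0 mul1r.
have sq (g : R -> R) : \int[mu]_(x in `[l, r]) (g x ^+ 2) = \int[mu]_(x in `[l, r]) (g x * g x).
  by congr (Rintegral _ _ _); apply/funext => x; rewrite expr2.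
have W1 : \int[mu]_(x in `[l, r]) (w' x ^+ 2) <= \int[mu]_(x in `[l, r]) (w x ^+ 2).
  rewrite sq (eigen_by_parts lr' pw pw' pw) -sq mul1r gerDl wl wr.
  have -> : w' r * C r - w' l * C l = ((C r ^+ 2 + C l ^+ 2) * cos h - 2 * (C l * C r)) / sin h.
    by rewrite /w' !subrr lrh !mul1r cos0 cosN -/h; field.
  rewrite ler_pdivrMr// mul0r subr_le0; apply: (@le_trans _ _ 0).
    by rewrite mulr_ge0_le0// addr_ge0// sqr_ge0.
  by rewrite mulr_ge0// CC// lexx lr'.
have T0 : 0 < 2 * pi / 3 :> R by lra.
have F00 : 0 <= \int[mu]_(x in `[l, r]) ((C x - w x) ^+ 2) by apply: Rintegral_ge0 => x _; exact: sqr_ge0.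
have FF : 16 / 9 * \int[mu]_(x in `[l, r]) ((C x - w x) ^+ 2) <= \int[mu]_(x in `[l, r]) ((p x - w' x) ^+ 2).
  apply: le_trans (poincare lr' T0 t2 pf fl fr); rewrite ler_wpM2r//.
  exact: third_ratio (pi_gt0 R).
exists ((N - 1) * (\int[mu]_(x in `[l, r]) ((p x - w' x) ^+ 2) - \int[mu]_(x in `[l, r]) ((C x - w x) ^+ 2))).
  by apply: le_trans (mass_le_gap FF N8 F00); rewrite addr_ge0// (le_trans _ FF)// mulr_ge0.
have := @piece_const_values R N C p lam N8 Lam mlam lam_bound l r 0 0 w w' 0 0 Lm _ _ _ _ _ _
  lr' pC pw erefl erefl erefl erefl X1 erefl.
rewrite expr0n !mul0r !addr0 add0r mulr1 => H; apply: H => //.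
- move=> x lxr; split.
    have [->|xl] := eqVneq x l; first by rewrite wl.
    have [->|xr] := eqVneq x r; first by rewrite wr.
    move=> Cx0; have : C x != 0; last by rewrite Cx0 eqxx.
    by apply: Cn0; case/andP: lxr => h1 h2; rewrite !lt_neqAle h1 h2 eq_sym xl xr.
  case/andP: (lxr) => lx xr.
  have -> : C x * w x = (C x * C r * sin (x - l) + C x * C l * sin (r - x)) / sin h.
    by rewrite /w !mul1r -(opprB r x) sinN; field.
  have CCl : 0 <= C x * C l by rewrite CC// lexx lr'.
  have CCr : 0 <= C x * C r by rewrite CC// lexx lr'.
  have s1 : 0 <= sin (x - l) by apply: sin_ge0_pi; rewrite subr_ge0 lx/= (le_trans (lerB xr (lexx l)))// (le_trans t2)// twothird_le.
  have s2 : 0 <= sin (r - x) by apply: sin_ge0_pi; rewrite subr_ge0 xr/= (le_trans (lerB (lexx r) lx))// (le_trans t2)// twothird_le.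
  by rewrite divr_ge0 ?(ltW sh)// addr_ge0// mulr_ge0.
- by rewrite normr0.
- by move=> s _; rewrite mulr0 addr0 invr1.
- move=> s /andP[s0 _]; rewrite mulr0 addr0 divr1 mulr1 subr0.
  move: W1; move: (\int[mu]_(x in `[l, r]) (w x ^+ 2)) (\int[mu]_(x in `[l, r]) (w' x ^+ 2)) => a b ba.
  by rewrite mulrBl mul1r lerDl oppr_ge0 mulr_ge0_le0// subr_le0.
- by move=> x _; rewrite mul0r addr0 normr0.
Qed.

End ArcPieces.

(** * Decomposition of the circle *)

Section Selection.
Context {R : realType}.
Notation mu := (@lebesgue_measure R).
Variables (C p : R -> R) (l1 l2 : R).
Hypotheses (cC : continuous C) (pC : prim 0 (4 * pi) C p).
Hypothesis perC : forall t, 0 <= t <= 2 * pi -> C (t + 2 * pi) = C t.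
Hypotheses (l1_gt0 : 0 < l1) (l2_gt0 : 0 < l2).
Implicit Types (u v x t e m : R) (b : bool).

(** Read off from [prim_shift] for a primitive of [f]. *)
Lemma int_shift (f : R -> R) l r T : l <= r -> continuous f ->
  \int[mu]_(x in `[l + T, r + T]) f x = \int[mu]_(x in `[l, r]) f (x + T).
Proof.
move=> lr cf; have lr' : l + T <= r + T by rewrite lerD2r.
have pF : prim (l + T) (r + T) (fun x => \int[mu]_(t in `[l + T, x]) f t) f.
  split; first exact/continuous_L2/continuous_subspaceT.
  by move=> x _; rewrite integral_point add0r.
have [_ /(_ r)] := prim_shift (- T) pF.
rewrite !addrK !opprK lr lexx => /(_ isT) ->.
by rewrite integral_point add0r; congr (Rintegral _ _ _); apply/funext => x; rewrite opprK.
Qed.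

Lemma int_period (f : R -> R) a : continuous f -> (forall t, 0 <= t <= 2 * pi -> f (t + 2 * pi) = f t) ->
  0 <= a <= 2 * pi ->
  \int[mu]_(x in `[a, a + 2 * pi]) f x = \int[mu]_(x in `[0, 2 * pi]) f x.
Proof.
move=> cf pf /andP[a0 a2]; have h1 : 2 * pi <= a + 2 * pi by lra.
rewrite (Rintegral_split a2 h1 (continuous_integrable _ _ cf)).
rewrite (Rintegral_split a0 a2 (continuous_integrable _ _ cf)) addrC; congr (_ + _).
have := int_shift (2 * pi) a0 cf; rewrite add0r => ->.
apply: eq_Rintegral => x; rewrite inE/= in_itv/= => /andP[x0 xa].
by rewrite pf// x0 (le_trans xa a2).
Qed.

Definition weight x := if 0 < C x then l1 else if C x < 0 then l2 else 0.
Definition signed b y : R := if b then y else - y.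
Definition phase b : R := if b then l1 else l2.
(** The positive part of [C] or of [- C], in a form that is visibly continuous. *)
Definition signed_part b x := (`|C x| + signed b (C x)) / 2.

Lemma measurable_weight : measurable_fun setT weight.
Proof.
have mC : measurable_fun setT C := continuous_measurable_fun cC.
apply: measurable_fun_if => //; first exact: measurable_fun_ltr.
apply: (@measurable_funS _ _ _ _ setT) => //.
by apply: measurable_fun_if => //; exact: measurable_fun_ltr.
Qed.

Lemma weight_bound x : 0 <= weight x <= l1 + l2.
Proof. move: l1_gt0 l2_gt0 => h1 h2; rewrite /weight; case: ifP => _; [|case: ifP => _]; apply/andP; split; lra. Qed.

Lemma continuous_signed_part b : continuous (signed_part b).
Proof.
move=> x; apply: cvgM; last exact: cvg_cst.
apply: cvgD; first by apply: cvg_norm; exact: cC.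
by case: b; [exact: cC|apply: cvgN; exact: cC].
Qed.

Lemma signed_part_ge0 b x : 0 <= signed_part b x.
Proof.
rewrite /signed_part /signed divr_ge0//; case: b; first by have := ler_norm (- C x); rewrite normrN; lra.
by have := ler_norm (C x); lra.
Qed.

Definition long_arc u v :=
  [/\ C u = 0, C v = 0, 2 * pi / 3 < v - u & forall t, u < t < v -> C t != 0].

Lemma one_signed u v : (forall t, u < t < v -> C t != 0) ->
  exists b, forall t, u < t < v -> 0 < signed b (C t).
Proof.
move=> C0; have [[x [xuv Cx]]|no] := pselect (exists x, u < x < v /\ 0 < C x); last first.
  exists false => t tuv; rewrite /signed oppr_gt0 lt_neqAle C0//= leNgt.
  by apply/negP => h; apply: no; exists t.
exists true => t tuv; rewrite /signed ltNge; apply/negP => Ct.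
have sub a c : u < a -> a <= c -> c < v -> Num.min (C a) (C c) <= 0 <= Num.max (C a) (C c) -> False.
  move=> ua ac cv h; have [y] := IVT ac (continuous_subspaceT cC) h.
  rewrite in_itv/= => /andP[ay yc] Cy; have : C y != 0; last by rewrite Cy eqxx.
  by apply: C0; rewrite (lt_le_trans ua ay) (le_lt_trans yc cv).
case/andP: xuv => ux xv; case/andP: tuv => ut tv.
have [xt|/ltW tx] := leP x t.
  by apply: (sub x t) => //; rewrite ge_min le_max Ct (ltW Cx) orbT.
by apply: (sub t x) => //; rewrite ge_min le_max Ct (ltW Cx) orbT.
Qed.

Lemma signed_part_opposite b u v : C u = 0 -> C v = 0 -> (forall t, u < t < v -> 0 < signed b (C t)) ->
  \int[mu]_(x in `[u, v]) signed_part (~~ b) x = 0.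
Proof.
move=> Cu Cv sg.
have -> : \int[mu]_(x in `[u, v]) signed_part (~~ b) x = \int[mu]_(x in `[u, v]) (0 : R).
  apply: Rintegral_eq_oo => [|x /sg].
    exact: measurable_funS (continuous_measurable_fun (@continuous_signed_part _)).
  rewrite /signed_part /signed; case: b {sg} => /= h.
    by rewrite gtr0_norm// subrr mul0r.
  by rewrite ltr0_norm -?oppr_gt0// addNr mul0r.
by rewrite /Rintegral integral0.
Qed.

Lemma long_shift u v : 0 <= u -> v <= 2 * pi -> long_arc (u + 2 * pi) (v + 2 * pi) <-> long_arc u v.
Proof.
move=> u0 v2; have pi0 := pi_gt0 R; have T : 2 * pi = 2 * pi :> R by [].
have E t : u <= t <= v -> C (t + 2 * pi) = C t.
  by move=> /andP[h1 h2]; apply: perC; rewrite (le_trans u0 h1) (le_trans h2 v2).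
have uv (w : R) : 2 * pi / 3 < w -> 0 < w by lra.
split=> -[h1 h2 h3 h4].
  have l : u <= v by have := uv _ h3; lra.
  rewrite /long_arc -(E u) ?lexx// -(E v) ?lexx ?l//; split => //; first lra.
  move=> t /andP[t1 t2]; rewrite -E ?(ltW t1) ?(ltW t2)//.
  by apply: h4; rewrite !ltrD2r t1.
have l : u <= v by have := uv _ h3; lra.
rewrite /long_arc !E ?lexx ?l//; split => //; first lra.
move=> t /andP[t1 t2]; have t3 : u < t - 2 * pi < v by apply/andP; split; lra.
rewrite -(subrK (2 * pi) t) E; first exact: h4.
by case/andP: t3 => *; rewrite !ltW.
Qed.

Lemma arc_mass_shift u v : 0 <= u -> u <= v -> v <= 2 * pi ->
  arc_mass C (u + 2 * pi) (v + 2 * pi) = arc_mass C u v.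
Proof.
move=> u0 uv v2; have dE : v + 2 * pi - (u + 2 * pi) = v - u by ring.
rewrite /arc_mass dE int_shift//; last first.
  by move=> x; apply: cvgM; [exact: cC|exact: arc_sine_continuous].
congr (_ ^+ 2 * _); apply: eq_Rintegral => x; rewrite inE/= in_itv/= => /andP[ux xv].
by rewrite perC ?(le_trans u0 ux) ?(le_trans xv v2)// /arc_sine dE; congr (_ * sin (_ * _)); ring.
Qed.

Lemma signed_part_period b a : 0 <= a <= 2 * pi ->
  \int[mu]_(x in `[a, a + 2 * pi]) signed_part b x = \int[mu]_(x in `[0, 2 * pi]) signed_part b x.
Proof.
move=> a2; apply: int_period => //; first exact: continuous_signed_part.
by move=> t t2; rewrite /signed_part perC.
Qed.

Lemma long_lam u v b : (forall t, u < t < v -> 0 < signed b (C t)) ->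
  forall x, u < x < v -> weight x <= phase b.
Proof.
move=> sg x /sg; rewrite /weight /phase /signed; case: b {sg} => h; first by rewrite h.
by rewrite -oppr_gt0 h ltNge -oppr_ge0 (ltW h).
Qed.

Lemma long_same_sign u v b : C u = 0 -> C v = 0 -> (forall t, u < t < v -> 0 < signed b (C t)) ->
  forall x y, u <= x <= v -> u <= y <= v -> 0 <= C x * C y.
Proof.
move=> Cu Cv sg.
have sg' t : u <= t <= v -> 0 <= signed b (C t).
  have s0 : signed b 0 = 0 by rewrite /signed oppr0; case: (b).
  move=> /andP[ut tv]; have [->|tu] := eqVneq t u; first by rewrite Cu s0.
  have [->|tv'] := eqVneq t v; first by rewrite Cv s0.
  by apply/ltW/sg; rewrite !lt_neqAle ut tv eq_sym tu tv'.
move=> x y /sg' hx /sg' hy; have := mulr_ge0 hx hy.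
by rewrite /signed; case: (b); rewrite ?mulrNN.
Qed.

Variable N : R.
Hypothesis N8 : 8 <= N.
Local Notation Lam := (l1 + l2).
Local Notation piece := (piece_estimate N C p weight).

Lemma prim_window u v : 0 <= u -> v <= 4 * pi -> prim u v C p.
Proof. by move=> u0 v4; exact: prim_sub u0 v4 pC. Qed.

Lemma piece_cat l y r e e' d d1 d2 D1 D2 H1 H2 Q1 Q2 : l <= y -> y <= r -> 0 <= l -> r <= 4 * pi ->
  piece l y e d1 D1 H1 Q1 -> piece y r e' d2 D2 H2 Q2 -> e' = e + d1 -> d = d1 + d2 ->
  piece l r e d (D1 + D2) (H1 + H2) (Q1 + Q2).
Proof.
move=> ly yr l0 r4 g1 + eE ->; rewrite eE => g2.
exact: (piece_concat N8 measurable_weight weight_bound ly yr (prim_window l0 r4) g1 g2).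
Qed.

Lemma sqr_ge_signed_part b t x : 2 * t * signed_part b x - t ^+ 2 <= C x ^+ 2.
Proof.
have h : signed_part b x ^+ 2 <= C x ^+ 2.
  rewrite -(real_normK (num_real (C x))) lerXn2r ?nnegrE ?signed_part_ge0//.
  rewrite /signed_part /signed; case: (b); first by have := ler_norm (C x); lra.
  by have := ler_norm (- C x); rewrite normrN; lra.
by apply: le_trans h; have := sqr_ge0 (signed_part b x - t); move: (signed_part b x) => y; lra.
Qed.

(** The lower bound is 2 t y - t^2 <= y^2 integrated; the free [t] plays the
    part of the Cauchy-Schwarz inequality while staying additive over gaps. *)
Lemma gap_gain v w m : 0 <= v -> v <= w -> w <= 4 * pi -> C v = 0 -> C w = 0 -> `|m| <= 1 ->
  (forall u1 v1, v <= u1 -> v1 <= w -> ~ long_arc u1 v1) ->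
  exists D, [/\ 0 <= D,
    forall b t, (N - 1) * (2 * t * \int[mu]_(x in `[v, w]) signed_part b x - t ^+ 2 * (w - v)) <= D &
    forall e, piece v w e (m * (w - v)) D D (Lam * (1 + m) * (w - v))].
Proof.
move=> v0 vw w4 Cv Cw m1 nolong; have pG := prim_window v0 w4.
have mab : measurable (`[v, w]%classic : set (measurableTypeR R)) by [].
have L0 : 0 < 2 * pi / 3 :> R by have := pi_gt0 R; lra.
have gp : (pi / (2 * pi / 3)) ^+ 2 * \int[mu]_(x in `[v, w]) (C x ^+ 2) <= \int[mu]_(x in `[v, w]) (p x ^+ 2).
  apply: (gap_poincare cC vw L0 pG Cv Cw) => u1 v1 vu1 uv1 vw1 Cu Cv1 n0.
  by rewrite leNgt; apply/negP => h; apply: (nolong u1 v1 vu1 vw1); split.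
have I0 : 0 <= \int[mu]_(x in `[v, w]) (C x ^+ 2) by apply: Rintegral_ge0 => x _; exact: sqr_ge0.
have gp' : 9 / 4 * \int[mu]_(x in `[v, w]) (C x ^+ 2) <= \int[mu]_(x in `[v, w]) (p x ^+ 2).
  apply: le_trans gp; rewrite ler_wpM2r//; have pi0 := pi_gt0 R.
  have -> : pi / (2 * pi / 3) = 3 / 2 :> R by move: pi0; move: (pi : R) => P P0; field; rewrite gt_eqF.
  lra.
have FF : 16 / 9 * \int[mu]_(x in `[v, w]) (C x ^+ 2) <= \int[mu]_(x in `[v, w]) (p x ^+ 2).
  by apply: le_trans gp'; rewrite ler_wpM2r//; lra.
have N1 : 0 <= N - 1 by move: N8; lra.
exists ((N - 1) * (\int[mu]_(x in `[v, w]) (p x ^+ 2) - \int[mu]_(x in `[v, w]) (C x ^+ 2))).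
have low b t : 2 * t * \int[mu]_(x in `[v, w]) signed_part b x - t ^+ 2 * (w - v) <= \int[mu]_(x in `[v, w]) (C x ^+ 2).
  have i1 := continuous_integrable v w (@continuous_signed_part b).
  have i2 : mu.-integrable `[v, w] (EFin \o (fun=> 1 : R)).
    by apply: continuous_integrable => x; exact: cvg_cst.
  have [i3 e3] := int_lin (2 * t) (- t ^+ 2) i1 i2.
  rewrite Rintegral_cst_segment// mul1r in e3.
  rewrite -mulNr -e3; apply: le_Rintegral => //; first exact: (L2_sqr_integrable mab (prim_L2 pG)).
  by move=> x _; rewrite mulr1; exact: sqr_ge_signed_part.
have gapI : \int[mu]_(x in `[v, w]) (C x ^+ 2) <= \int[mu]_(x in `[v, w]) (p x ^+ 2) - \int[mu]_(x in `[v, w]) (C x ^+ 2).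
  by move: gp' I0; move: (\int[mu]_(x in `[v, w]) (p x ^+ 2)) (\int[mu]_(x in `[v, w]) (C x ^+ 2)) => a c; lra.
split.
- by rewrite mulr_ge0// (le_trans I0).
- by move=> b t; rewrite ler_wpM2l// (le_trans (low b t)).
- by move=> e; apply: piece_gap => //; [exact: measurable_weight|exact: weight_bound].
Qed.

Lemma arc_gain u v b : 0 <= u -> v <= 4 * pi -> long_arc u v -> v - u <= 3 * pi / 2 ->
  (forall t, u < t < v -> 0 < signed b (C t)) ->
  exists2 D, 0 <= D & forall e, piece u v e (pi - (v - u))
    (arc_mass C u v * (pi - (v - u)) ^+ 2 / 108 + D)
    (D + (`|e| + `|pi - (v - u)|) ^+ 2 * (9 / 4 * arc_mass C u v)) (phase b * pi).
Proof.
move=> u0 v4 [Cu Cv L n0] uv2 sg.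
apply: (piece_arc N8 measurable_weight weight_bound (ltW L) uv2 (prim_window u0 v4) Cu Cv n0).
  exact: (long_same_sign Cu Cv sg).
exact: long_lam sg.
Qed.

(** Thirds have length between pi / 2 and 2 pi / 3, as [piece_third] requires. *)
Lemma wide_arc_gain u v b : 0 <= u -> v <= 4 * pi -> long_arc u v -> 3 * pi / 2 < v - u -> v - u <= 2 * pi ->
  (forall t, u < t < v -> 0 < signed b (C t)) ->
  exists2 D, 0 <= D & piece u v 0 0 D D (phase b * (v - u)).
Proof.
move=> u0 v4 [Cu Cv _ n0] uv2 uv3 sg; have ss := long_same_sign Cu Cv sg.
have pi0 := pi_gt0 R; pose h := (v - u) / 3.
have third y z : u <= y -> z <= v -> z - y = h -> exists2 D, 0 <= D & piece y z 0 0 D D (phase b * h).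
  move=> uy zv zy; have yz : y <= z by rewrite -subr_ge0 zy /h; lra.
  rewrite -zy; apply: (piece_third N8 measurable_weight weight_bound).
  - by rewrite zy /h; lra.
  - by rewrite zy /h; lra.
  - exact: prim_window (le_trans u0 uy) (le_trans zv v4).
  - by move=> x /andP[h1 h2]; apply: n0; rewrite (le_lt_trans uy h1) (lt_le_trans h2 zv).
  - move=> x x' /andP[h1 h2] /andP[h3 h4]; apply: ss.
      by rewrite (le_trans uy h1) (le_trans h2 zv).
    by rewrite (le_trans uy h3) (le_trans h4 zv).
  - by move=> x /andP[h1 h2]; apply: (long_lam sg); rewrite (le_lt_trans uy h1) (lt_le_trans h2 zv).
have [] := third u (u + h); [by []|by rewrite /h; lra|by rewrite addrC addKr|] => D1 D10 g1.
have [] := third (u + h) (u + 2 * h); [by rewrite /h; lra|by rewrite /h; lra|by ring|] => D2 D20 g2.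
have [] := third (u + 2 * h) v; [by rewrite /h; lra|by []|by rewrite /h; lra|] => D3 D30 g3.
have a1 : u <= u + h by rewrite /h; lra.
have a2 : u + h <= u + 2 * h by rewrite /h; lra.
have a3 : u + 2 * h <= v by rewrite /h; lra.
have g12 := piece_cat a1 a2 u0 (le_trans a3 v4) g1 g2 (esym (addr0 0)) (esym (addr0 0)).
have g123 := piece_cat (le_trans a1 a2) a3 u0 v4 g12 g3 (esym (addr0 0)) (esym (addr0 0)).
exists (D1 + D2 + D3); first by rewrite !addr_ge0.
rewrite -!mulrDr in g123; move: g123; congr (piece _ _ _ _ _ _ (_ * _)).
by rewrite /h; field.
Qed.

Variable alpha : R.
Hypotheses (alpha_gt0 : 0 < alpha) (N_large : 64 * Lam <= (N - 1) * alpha ^+ 2).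
Hypothesis both_phases : forall b, alpha <= \int[mu]_(x in `[0, 2 * pi]) signed_part b x.

(** The constant 2500 only has to exceed the ratio of the kappa^2 costs to the
    gains in all cases below. *)
Definition improvable a := exists D H Q,
  [/\ piece a (a + 2 * pi) 0 0 D H Q, H <= 2500 * D & Q - Lam * pi <= D / 2].

(** If the gaps contain all of one phase, their gain exceeds the possible
    excess of the phase cost. The value t = alpha / 8 nearly optimises
    [gap_gain] as the total length is less than 8. *)
Lemma gaps_dominate D S W : alpha <= S -> W <= 2 * pi ->
  (N - 1) * (2 * (alpha / 8) * S - (alpha / 8) ^+ 2 * W) <= D -> Lam * pi <= D / 2.
Proof.
move=> aS W8 hD; have pih := pihalf_lt2 R.
have N1 : 0 <= N - 1 by move: N8; lra.
have h1 : alpha ^+ 2 / 8 <= 2 * (alpha / 8) * S - (alpha / 8) ^+ 2 * W.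
  have a1 : alpha * alpha <= alpha * S by rewrite ler_wpM2l// ltW.
  have a2 : (alpha * alpha) * W <= (alpha * alpha) * 8 by rewrite ler_wpM2l ?mulr_ge0 ?ltW//; lra.
  have -> : 2 * (alpha / 8) * S - (alpha / 8) ^+ 2 * W = (alpha * S) / 4 - (alpha * alpha * W) / 64 by field.
  have -> : alpha ^+ 2 / 8 = (alpha * alpha) / 8 by rewrite expr2.
  by move: a1 a2; move: (alpha * alpha) (alpha * S) => *; lra.
have h2 := ler_wpM2l N1 h1.
have h3 : (N - 1) * (alpha ^+ 2 / 8) = (N - 1) * alpha ^+ 2 / 8 by rewrite mulrA.
have L0 : 0 <= Lam by move: l1_gt0 l2_gt0; lra.
have h4 : Lam * pi <= Lam * 4 by rewrite ler_wpM2l//; lra.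
by move: N_large h2 h3 h4 hD; lra.
Qed.

Lemma both_phases_window b a : 0 <= a <= 2 * pi ->
  alpha <= \int[mu]_(x in `[a, a + 2 * pi]) signed_part b x.
Proof. by move=> a2; rewrite signed_part_period. Qed.

Lemma signed_part_split b u v w : u <= v -> v <= w ->
  \int[mu]_(x in `[u, w]) signed_part b x =
  \int[mu]_(x in `[u, v]) signed_part b x + \int[mu]_(x in `[v, w]) signed_part b x.
Proof. by move=> uv vw; exact: (Rintegral_split uv vw (continuous_integrable _ _ (@continuous_signed_part b))). Qed.

Lemma phase_bound b : 0 <= phase b <= Lam.
Proof. by move: l1_gt0 l2_gt0 => h1 h2; rewrite /phase; case: b; apply/andP; split; lra. Qed.

Lemma improvable_no_long_arc z : 0 <= z <= 2 * pi -> C z = 0 ->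
  (forall u v, z <= u -> v <= z + 2 * pi -> ~ long_arc u v) -> improvable z.
Proof.
move=> z2 Cz nolong; have pi0 := pi_gt0 R; case/andP: (z2) => z0 z2'.
have z4 : z + 2 * pi <= 4 * pi by lra.
have zz : z <= z + 2 * pi by lra.
have Cz' : C (z + 2 * pi) = 0 by rewrite perC.
have [] := @gap_gain z (z + 2 * pi) 0 z0 zz z4 Cz Cz' _ nolong; first by rewrite normr0.
move=> D [D0 gain g]; have := g 0; rewrite mul0r addr0 mulr1 => {}g.
exists D, D, (Lam * (z + 2 * pi - z)); split => //.
  by rewrite ler_peMl//; lra.
have W : z + 2 * pi - z <= 2 * pi by lra.
have := gaps_dominate (both_phases_window true z2) W (gain true (alpha / 8)).
have -> : Lam * (z + 2 * pi - z) - Lam * pi = Lam * pi by ring.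
by [].
Qed.

Lemma arc_cost (M tau D DG : R) : 0 <= M -> 0 <= D -> 0 <= DG ->
  D + `|tau| ^+ 2 * (9 / 4 * M) + DG <= 2500 * (M * tau ^+ 2 / 108 + D + DG).
Proof.
move=> M0 D0 DG0; rewrite (real_normK (num_real tau)).
have : 0 <= M * tau ^+ 2 by rewrite mulr_ge0// sqr_ge0.
have -> : tau ^+ 2 * (9 / 4 * M) = 9 / 4 * (M * tau ^+ 2) by ring.
by move: (M * tau ^+ 2) => X; lra.
Qed.

Lemma arc_mass_ge0 u v : u < v -> 0 <= arc_mass C u v.
Proof. by move=> uv; rewrite mulr_ge0 ?sqr_ge0// divr_ge0// subr_ge0 ltW. Qed.

(** The gap absorbs the stretch: its rate is (theta - pi) / (2 pi - theta), at
    most 1 in absolute value exactly when theta <= 3 pi / 2. A wider arc is left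
    unstretched. The phase opposite to the arc lies in the gap. *)
Lemma improvable_one_long_arc u v : 0 <= u <= 2 * pi -> v <= u + 2 * pi -> long_arc u v ->
  (forall u1 v1, v <= u1 -> v1 <= u + 2 * pi -> ~ long_arc u1 v1) -> improvable u.
Proof.
move=> u02 vu L nolong; have pi0 := pi_gt0 R; case/andP: (u02) => u0 u2.
have [Cu Cv Luv n0] := L; have [b sg] := one_signed n0.
have u4 : u + 2 * pi <= 4 * pi by lra.
have v4 := le_trans vu u4.
have uv : u < v by lra.
have v0 : 0 <= v by lra.
have Cu' : C (u + 2 * pi) = 0 by rewrite perC.
have big : alpha <= \int[mu]_(x in `[v, u + 2 * pi]) signed_part (~~ b) x.
  have := both_phases_window (~~ b) u02.
  by rewrite (signed_part_split _ (ltW uv) vu) (signed_part_opposite Cu Cv sg) add0r.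
have W : u + 2 * pi - v <= 2 * pi by lra.
have /andP[ph0 ph1] := phase_bound b.
have dom D : (forall b t, (N - 1) * (2 * t * \int[mu]_(x in `[v, u + 2 * pi]) signed_part b x - t ^+ 2 * (u + 2 * pi - v)) <= D) ->
    Lam * pi <= D / 2 by move=> /(_ (~~ b) (alpha / 8)); exact: gaps_dominate.
have [narrow|wide] := leP (v - u) (3 * pi / 2).
  have [D1 D10 /(_ 0) g1] := arc_gain u0 v4 L narrow sg.
  have G0 : 0 < u + 2 * pi - v by lra.
  (* The rate at which the gap compensates the stretch pi - (v - u) of the arc. *)
  pose m := (v - u - pi) / (u + 2 * pi - v).
  have mE : m * (u + 2 * pi - v) = v - u - pi by rewrite /m divfK// gt_eqF.
  have m1 : `|m| <= 1.
    by rewrite ler_norml ler_pdivlMr// ler_pdivrMr//; apply/andP; split; lra.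
  have [D2 [D20 gain /(_ (pi - (v - u))) g2]] := gap_gain v0 vu u4 Cv Cu' m1 nolong.
  rewrite mE in g2.
  exists (arc_mass C u v * (pi - (v - u)) ^+ 2 / 108 + D1 + D2), (D1 + (`|0 : R| + `|pi - (v - u)|) ^+ 2 * (9 / 4 * arc_mass C u v) + D2), (phase b * pi + Lam * (1 + m) * (u + 2 * pi - v)).
  split.
  - by apply: (piece_cat (ltW uv) vu u0 u4 g1 g2); ring.
  - by rewrite normr0 add0r; apply: arc_cost => //; exact: arc_mass_ge0.
  - have -> : Lam * (1 + m) * (u + 2 * pi - v) = Lam * (m * (u + 2 * pi - v) + (u + 2 * pi - v)) by ring.
    rewrite mE; have -> : phase b * pi + Lam * (v - u - pi + (u + 2 * pi - v)) - Lam * pi = phase b * pi by ring.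
    apply: (@le_trans _ _ (Lam * pi)); first by rewrite ler_wpM2r// ltW.
    apply: (le_trans (dom D2 gain)); rewrite ler_wpM2r//.
    by rewrite lerDr addr_ge0// mulr_ge0// mulr_ge0 ?sqr_ge0// arc_mass_ge0.
have v2 : v - u <= 2 * pi by lra.
have [D1 D10 g1] := wide_arc_gain u0 v4 L wide v2 sg.
have [] := @gap_gain v (u + 2 * pi) 0 v0 vu u4 Cv Cu' _ nolong; first by rewrite normr0.
move=> D2 [D20 gain g]; have := g 0; rewrite mul0r addr0 mulr1 => {}g.
exists (D1 + D2), (D1 + D2), (phase b * (v - u) + Lam * (u + 2 * pi - v)); split.
- by apply: (piece_cat (ltW uv) vu u0 u4 g1 g); rewrite addr0.
- by rewrite ler_peMl ?addr_ge0//; lra.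
- have h1 : phase b * (v - u) <= Lam * (v - u) by rewrite ler_wpM2r// subr_ge0 ltW.
  have h2 := dom D2 gain.
  have h3 : Lam * (v - u) + Lam * (u + 2 * pi - v) - Lam * pi = Lam * pi by ring.
  apply: (@le_trans _ _ (D2 / 2)); last by rewrite ler_wpM2r// lerDr.
  apply: le_trans h2; rewrite -[leRHS]h3 lerD2r lerD2r//.
Qed.

(** The displacement of the second arc is caused by the first one as well, so
    its cost is only controlled if the first arc has the larger mass. *)
Lemma two_arc_cost (M1 M2 t1 t2 e : R) : 0 <= M2 -> M2 <= M1 -> `|e| <= 2 * `|t1| + `|t2| ->
  (`|e| + `|t2|) ^+ 2 * (9 / 4 * M2) <= 18 * (M1 * t1 ^+ 2) + 18 * (M2 * t2 ^+ 2).
Proof.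
move=> M20 M21 he.
have h1 : (`|e| + `|t2|) ^+ 2 <= 8 * t1 ^+ 2 + 8 * t2 ^+ 2.
  rewrite -(real_normK (num_real t1)) -(real_normK (num_real t2)).
  move: he (normr_ge0 e) (normr_ge0 t1) (normr_ge0 t2); move: `|e| `|t1| `|t2| => x y z *.
  have : 0 <= (y - z) ^+ 2 by exact: sqr_ge0.
  have : (x + z) ^+ 2 <= (2 * y + 2 * z) ^+ 2 by rewrite lerXn2r// ?nnegrE; lra.
  by lra.
have c0 : 0 <= 9 / 4 * M2 by rewrite mulr_ge0.
apply: (le_trans (ler_wpM2r c0 h1)).
have h2 : M2 * t1 ^+ 2 <= M1 * t1 ^+ 2 by rewrite ler_wpM2r// sqr_ge0.
have -> : (8 * t1 ^+ 2 + 8 * t2 ^+ 2) * (9 / 4 * M2) = 18 * (M2 * t1 ^+ 2) + 18 * (M2 * t2 ^+ 2) by field.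
by rewrite lerD2r ler_wpM2l.
Qed.

Lemma drift_bound (t1 t2 g : R) : 0 <= g -> g <= t1 + t2 -> `|t1 - g| <= 2 * `|t1| + `|t2|.
Proof.
move=> g0 gt; have := ler_norm t1; have := ler_norm t2; have := ler_norm (- t1); rewrite normrN.
by move: `|t1| `|t2| => *; rewrite ler_norml; apply/andP; split; lra.
Qed.

(** The gaps are contracted with rate -1. The base point is put at the arc of
    larger mass, see [two_arc_cost]. For arcs of opposite signs the phase costs
    add up to (l1 + l2) pi; for equal signs the other phase lies in the gaps. *)
Lemma improvable_two_long_arcs u v u' v' : 0 <= u <= 2 * pi -> v <= u' -> v' <= u + 2 * pi ->
  long_arc u v -> long_arc u' v' -> arc_mass C u' v' <= arc_mass C u v -> improvable u.
Proof.
move=> u02 vu' vu L L' MM; have pi0 := pi_gt0 R; case/andP: (u02) => u0 u2.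
have [Cu Cv Luv n0] := L; have [Cu' Cv' Luv' n0'] := L'.
have [b sg] := one_signed n0; have [b' sg'] := one_signed n0'.
have u4 : u + 2 * pi <= 4 * pi by lra.
have uv : u < v by lra.
have uv' : u' < v' by lra.
have v0 : 0 <= v by lra.
have u0' : 0 <= u' by lra.
have v0' : 0 <= v' by lra.
have v4' : v' <= 4 * pi by lra.
have u4' : u' <= 4 * pi by lra.
have v4 : v <= 4 * pi by lra.
have th : v - u <= 3 * pi / 2 by lra.
have th' : v' - u' <= 3 * pi / 2 by lra.
have CE : C (u + 2 * pi) = 0 by rewrite perC.
have nl1 u1 v1 : v <= u1 -> v1 <= u' -> ~ long_arc u1 v1 by move=> h1 h2 [_ _ h3 _]; lra.
have nl2 u1 v1 : v' <= u1 -> v1 <= u + 2 * pi -> ~ long_arc u1 v1 by move=> h1 h2 [_ _ h3 _]; lra.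
have n1 : `|-1 : R| <= 1 by rewrite normrN normr1.
(* The stretches of the two arcs; the gaps give back their whole lengths. *)
set t1 := pi - (v - u); set t2 := pi - (v' - u').
have [D1 D10 /(_ 0) g1] := arc_gain u0 v4 L th sg.
have [G1 [G10 gain1 /(_ t1) g2]] := gap_gain v0 vu' u4' Cv Cu' n1 nl1.
have [D2 D20 /(_ (t1 - (u' - v))) g3] := arc_gain u0' v4' L' th' sg'.
have [G2 [G20 gain2 /(_ (t1 - (u' - v) + t2)) g4]] := gap_gain v0' vu u4 Cv' CE n1 nl2.
have c1 := piece_cat (ltW uv) vu' u0 u4' g1 g2 (esym (add0r _)) erefl.
have E1 : t1 - (u' - v) = 0 + (pi - (v - u) + -1 * (u' - v)) by rewrite /t1; ring.
have c2 := piece_cat (le_trans (ltW uv) vu') (ltW uv') u0 v4' c1 g3 E1 erefl.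
have E2 : t1 - (u' - v) + t2 = 0 + (pi - (v - u) + -1 * (u' - v) + (pi - (v' - u'))) by rewrite /t1 /t2; ring.
have c3 := piece_cat (le_trans (le_trans (ltW uv) vu') (ltW uv')) vu u0 u4 c2 g4 E2.
set M1 := arc_mass C u v in c3 MM; set M2 := arc_mass C u' v' in c3 MM.
have M10 : 0 <= M1 by exact: arc_mass_ge0.
have M20 : 0 <= M2 by exact: arc_mass_ge0.
exists (M1 * t1 ^+ 2 / 108 + D1 + G1 + (M2 * t2 ^+ 2 / 108 + D2) + G2),
  (D1 + (`|0 : R| + `|t1|) ^+ 2 * (9 / 4 * M1) + G1 +
   (D2 + (`|t1 - (u' - v)| + `|t2|) ^+ 2 * (9 / 4 * M2)) + G2), (phase b * pi + Lam * (1 + -1) * (u' - v) + phase b' * pi + Lam * (1 + -1) * (u + 2 * pi - v')).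
split.
- by apply: c3; rewrite /t1 /t2; ring.
- have e1 : `|t1 - (u' - v)| <= 2 * `|t1| + `|t2|.
    have g0 : 0 <= u' - v by rewrite subr_ge0.
    have g1' : u' - v <= t1 + t2 by rewrite /t1 /t2; lra.
    exact: drift_bound.
  have := two_arc_cost M20 MM e1; rewrite normr0 add0r (real_normK (num_real t1)).
  have : 0 <= M1 * t1 ^+ 2 by rewrite mulr_ge0// sqr_ge0.
  have : 0 <= M2 * t2 ^+ 2 by rewrite mulr_ge0// sqr_ge0.
  have -> : t1 ^+ 2 * (9 / 4 * M1) = 9 / 4 * (M1 * t1 ^+ 2) by ring.
  move: ((`|t1 - (u' - v)| + `|t2|) ^+ 2 * (9 / 4 * M2)) (M1 * t1 ^+ 2) (M2 * t2 ^+ 2) D10 D20 G10 G20.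
  by clear; move=> *; lra.
- rewrite subrr !mulr0 !mul0r !addr0.
  have Dpos : 0 <= M1 * t1 ^+ 2 / 108 + D1 + (M2 * t2 ^+ 2 / 108 + D2).
    by rewrite !addr_ge0// mulr_ge0// mulr_ge0// sqr_ge0.
  have [bb|bb] := eqVneq b b'; last first.
    have -> : phase b * pi + phase b' * pi = Lam * pi.
      by rewrite -mulrDl /phase; case: (b) (b') bb => -[]//= _; congr (_ * _); rewrite addrC.
    rewrite subrr divr_ge0//; move: Dpos G10 G20; clear; move=> *; lra.
  have S : alpha <= \int[mu]_(x in `[v, u']) signed_part (~~ b) x + \int[mu]_(x in `[v', u + 2 * pi]) signed_part (~~ b) x.
    have := both_phases_window (~~ b) u02.
    rewrite (signed_part_split _ (ltW uv) (le_trans (le_trans vu' (ltW uv')) vu)) (signed_part_opposite Cu Cv sg) add0r.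
    rewrite (signed_part_split _ vu' (le_trans (ltW uv') vu)) (signed_part_split _ (ltW uv') vu).
    by rewrite {2}bb (signed_part_opposite Cu' Cv' sg') add0r.
  have W : u' - v + (u + 2 * pi - v') <= 2 * pi by lra.
  have gg : (N - 1) * (2 * (alpha / 8) * (\int[mu]_(x in `[v, u']) signed_part (~~ b) x + \int[mu]_(x in `[v', u + 2 * pi]) signed_part (~~ b) x) - (alpha / 8) ^+ 2 * (u' - v + (u + 2 * pi - v'))) <= G1 + G2.
    apply: le_trans (lerD (gain1 (~~ b) (alpha / 8)) (gain2 (~~ b) (alpha / 8))).
    by rewrite le_eqVlt; apply/orP; left; apply/eqP; ring.
  have dom := gaps_dominate S W gg.
  have /andP[_ pb] := phase_bound b.
  rewrite -bb -mulrDl; have h1 : (phase b + phase b) * pi <= (Lam + Lam) * pi.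
    by rewrite ler_wpM2r ?lerD// ltW.
  apply: (@le_trans _ _ (Lam * pi)); first by rewrite lerBlDr -mulrDl.
  apply: (le_trans dom); rewrite ler_wpM2r//.
  by move: Dpos; clear; move=> *; lra.
Qed.

Lemma exists_zero : exists2 z, 0 <= z <= 2 * pi & C z = 0.
Proof.
have pi0 := pi_gt0 R.
have ex b : exists2 x, 0 <= x <= 2 * pi & 0 < signed b (C x).
  apply: contrapT => no; have := both_phases b; rewrite leNgt => /negP; apply.
  have -> : \int[mu]_(x in `[0, 2 * pi]) signed_part b x = 0 => //.
  transitivity (\int[mu]_(x in `[0, 2 * pi]) (0 : R)); last by rewrite /Rintegral integral0.
  apply: eq_Rintegral => x; rewrite inE/= in_itv/= => x2.
  have : signed b (C x) <= 0 by rewrite leNgt; apply/negP => h; apply: no; exists x.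
  rewrite /signed_part /signed; case: (b) => h; first by rewrite ler0_norm// addNr mul0r.
  by rewrite ger0_norm -?oppr_le0// subrr mul0r.
have [x x2 /= Cx] := ex true; have [y y2 /=] := ex false; rewrite oppr_gt0 => Cy.
have zero a c : 0 <= a -> a <= c -> c <= 2 * pi -> Num.min (C a) (C c) <= 0 <= Num.max (C a) (C c) ->
    exists2 z, 0 <= z <= 2 * pi & C z = 0.
  move=> a0 ac c2 h; have [z] := IVT ac (continuous_subspaceT cC) h.
  rewrite in_itv/= => /andP[az zc] Cz; exists z => //.
  by rewrite (le_trans a0 az) (le_trans zc c2).
case/andP: x2 => x0 x2; case/andP: y2 => y0 y2.
have [xy|/ltW yx] := leP x y.
  by apply: (zero x y) => //; rewrite ge_min le_max (ltW Cx) (ltW Cy) orbT.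
by apply: (zero y x) => //; rewrite ge_min le_max (ltW Cx) (ltW Cy) orbT.
Qed.

(** Start at a zero of [C] and rotate the base point to the left end of a long
    arc, if there is one; with two long arcs, to the one of larger mass. Windows
    are brought back to the first period. *)
Lemma exists_improvable : exists2 a, 0 <= a <= 2 * pi & improvable a.
Proof.
have pi0 := pi_gt0 R; have [z z02 Cz] := exists_zero; case/andP: (z02) => z0 z2.
have [ex|no] := pselect (exists u v, [/\ z <= u, v <= z + 2 * pi & long_arc u v]); last first.
  by exists z => //; apply: improvable_no_long_arc => // u v zu vz L; apply: no; exists u, v.
have {ex} [u [v [u02 vu L]]] : exists u v, [/\ 0 <= u <= 2 * pi, v <= u + 2 * pi & long_arc u v].
  have [u [v [zu vz L]]] := ex; have [_ _ uv _] := L.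
  have [u2|u2] := leP u (2 * pi).
    by exists u, v; rewrite (le_trans z0 zu) u2; split => //; lra.
  exists (u - 2 * pi), (v - 2 * pi); split; first by apply/andP; split; lra.
    by lra.
  by apply/(long_shift _ _); rewrite ?subrK//; lra.
case/andP: (u02) => u0 u2.
have [ex|no] := pselect (exists u' v', [/\ v <= u', v' <= u + 2 * pi & long_arc u' v']); last first.
  by exists u => //; apply: (improvable_one_long_arc u02 vu L) => u' v' h1 h2 L'; apply: no; exists u', v'.
have [u' [v' [vu' vu2 L']]] := ex; have [_ _ uv _] := L; have [_ _ uv' _] := L'.
have [MM|/ltW MM] := leP (arc_mass C u' v') (arc_mass C u v).
  by exists u => //; exact: (improvable_two_long_arcs u02 vu' vu2 L L').
have uv0 : u <= v by lra.
have [u2'|u2'] := leP u' (2 * pi).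
  have v2 := le_trans vu' u2'.
  exists u'; first by rewrite u2' andbT; lra.
  apply: (@improvable_two_long_arcs u' v' (u + 2 * pi) (v + 2 * pi)) => //.
  - by rewrite u2' andbT; lra.
  - by rewrite lerD2r.
  - exact/(long_shift u0 v2).
  - by rewrite arc_mass_shift.
have h0 : 0 <= u' - 2 * pi by lra.
have h2 : v' - 2 * pi <= 2 * pi by lra.
have huv : u' - 2 * pi <= v' - 2 * pi by lra.
exists (u' - 2 * pi); first by apply/andP; split; lra.
apply: (@improvable_two_long_arcs (u' - 2 * pi) (v' - 2 * pi) u v) => //.
- by apply/andP; split; lra.
- by lra.
- by lra.
- by apply/(long_shift h0 h2); rewrite !subrK.
- by rewrite -(arc_mass_shift h0 huv h2) !subrK.
Qed.

End Selection.

(** * Modification on null sets *)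

Section AlmostEverywhere.
Context {R : realType}.
Notation mu := (@lebesgue_measure R).
Notation mu2 := (@lebesgue_measure R \x @lebesgue_measure R)%E.
Notation plane := (R * R)%type.
Implicit Types (u v c : plane -> R).

Lemma bint_ae_eq (F G : plane -> R) : measurable_fun ball1 F -> measurable_fun ball1 G ->
  {ae mu2, forall z, ball1 z -> F z = G z} -> bint F = bint G.
Proof.
move=> mF mG FG; rewrite !bintE /Rintegral; congr fine; apply: ae_eq_integral => //.
- exact: mball1.
- exact/measurable_EFinP.
- exact/measurable_EFinP.
- by move: FG; apply: (@filterS _ (almost_everywhere mu2)) => z h bz /=; rewrite h.
Qed.

Lemma weak_gradient_ae u v g : L2 mu2 ball1 u -> L2 mu2 ball1 v ->
  {ae mu2, forall z, ball1 z -> u z = v z} -> weak_gradient u g -> weak_gradient v g.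
Proof.
move=> Lu Lv uv [g1 g2 gphi]; split => // phi tphi; have [h1 h2] := gphi phi tphi.
have [Cphi _] := tphi; have [_ _ _ c1 c2] := Cphi 1%N.
have sub (k : plane -> R) : continuous k -> bint (fun x => v x * k x) = bint (fun x => u x * k x).
  move=> ck; apply: bint_ae_eq.
  - exact: (L2_continuous_mul ck Lv).1.
  - exact: (L2_continuous_mul ck Lu).1.
  - by move: uv; apply: (@filterS _ (almost_everywhere mu2)) => z h bz; rewrite h.
by rewrite !sub.
Qed.

Lemma ae_sym u v : {ae mu2, forall z, ball1 z -> u z = v z} -> {ae mu2, forall z, ball1 z -> v z = u z}.
Proof. by apply: (@filterS _ (almost_everywhere mu2)) => z h bz; rewrite h. Qed.

Lemma grad_ae u v : L2 mu2 ball1 u -> L2 mu2 ball1 v ->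
  {ae mu2, forall z, ball1 z -> u z = v z} -> grad u = grad v.
Proof.
move=> Lu Lv uv; rewrite /grad; congr (xget _ _); apply/seteqP; split => g /= wg.
  exact: (weak_gradient_ae Lu Lv uv).
exact: (weak_gradient_ae Lv Lu (ae_sym uv)).
Qed.

Lemma H1_ae u v : H1 u -> L2 mu2 ball1 v ->
  {ae mu2, forall z, ball1 z -> u z = v z} -> H1 v.
Proof.
move=> [/L2_leb2 Lu [g wg]] Lv uv; split; first exact/L2_leb2.
by exists g; exact: (weak_gradient_ae Lu Lv uv).
Qed.

(** A function that is continuous up to the boundary approximates, as a constant
    sequence, everything that agrees with it almost everywhere. *)
Lemma has_trace_ae u v c : H1 u -> {within cball1, continuous u} -> L2 mu2 ball1 v ->
  {ae mu2, forall z, ball1 z -> u z = v z} -> L2 mu `[0, 2 * pi] (c \o circ) ->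
  {ae mu, forall t, `[0, 2 * pi]%classic t -> u (circ t) = c (circ t)} -> has_trace v c.
Proof.
move=> Hu cu Lv uv Lc uc; have Lu : L2 mu2 ball1 u by apply/L2_leb2; case: Hu.
split; [exact: (H1_ae Hu Lv uv)|exact: Lc|exists (fun=> u)].
have d0 : H1_dist2 u v = 0.
  rewrite /H1_dist2 (grad_ae Lu Lv uv).
  have -> : bint (fun x => enorm (grad v x - grad v x) ^+ 2) = 0.
    rewrite bintE -[RHS](_ : \int[mu2]_(x in ball1) (0 : R) = 0); last by rewrite /Rintegral integral0.
    by congr (Rintegral _ _ _); apply/funext => x; rewrite subrr enorm_sqr /= expr0n addr0.
  rewrite addr0; transitivity (bint (fun=> 0 : R)); last by rewrite bintE /Rintegral integral0.
  have [mu_ _] := Lu; have [mv _] := Lv.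
  apply: bint_ae_eq => //; first by apply: measurable_funX; exact: measurable_funB.
  by move: uv; apply: (@filterS _ (almost_everywhere mu2)) => z h bz; rewrite h// subrr expr0n.
have e0 : cint (fun x => (u x - c x) ^+ 2) = 0.
  rewrite cintE; transitivity (\int[mu]_(t in `[0, 2 * pi]) (0 : R)); last by rewrite /Rintegral integral0.
  have ccu : continuous (fun t : R => u (circ t)).
    exact: (continuous_comp_within cu (@continuous_circ R) (@cball1_circ R)).
  have mcu : measurable_fun `[0, 2 * pi] (fun t : R => u (circ t)).
    exact: (measurable_funS _ _ (continuous_measurable_fun ccu)).
  have [mc _] := Lc.
  rewrite /Rintegral; congr fine; apply: ae_eq_integral => //.
    apply/measurable_EFinP; apply: measurable_funX.
    exact: (measurable_funB mcu mc).
  by move: uc; apply: (@filterS _ (almost_everywhere mu)) => t h tI /=; rewrite h// subrr expr0n.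
split => //.
- by rewrite d0; exact: cvg_cst.
- by rewrite e0; exact: cvg_cst.
Qed.

Lemma WDP_weak_gradient l1 l2 v g c : weak_gradient v g -> H1 v -> has_trace v c ->
  WDP l1 l2 v = bint (fun x => enorm (g x) ^+ 2) - cint (fun x => c x ^+ 2)
    + l1 * fine (leb2 ([set x | 0 < v x] `&` ball1))
    + l2 * fine (leb2 ([set x | v x < 0] `&` ball1)).
Proof. by move=> wg Hv tv; rewrite /WDP (bint_grad wg Hv) (cint_trace tv). Qed.

Lemma level_ae (S : R -> bool) u v : measurable_fun setT S -> L2 mu2 ball1 u -> L2 mu2 ball1 v ->
  {ae mu2, forall z, ball1 z -> u z = v z} ->
  fine (leb2 ([set z | S (u z)] `&` ball1)) = fine (leb2 ([set z | S (v z)] `&` ball1)).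
Proof.
move=> mS [mu_ _] [mv _] uv.
have mSu : measurable_fun ball1 (fun z => S (u z)) := measurableT_comp mS mu_.
have mSv : measurable_fun ball1 (fun z => S (v z)) := measurableT_comp mS mv.
rewrite (fine_leb2_set (S := fun z => S (u z)) mSu) (fine_leb2_set (S := fun z => S (v z)) mSv).
have mi : measurable_fun setT (fun s : bool => if s then 1 else 0 : R) by [].
apply: bint_ae_eq.
- exact: (measurableT_comp mi mSu).
- exact: (measurableT_comp mi mSv).
- by move: uv; apply: (@filterS _ (almost_everywhere mu2)) => z h bz; rewrite h.
Qed.

Lemma WDP_ae l1 l2 u v c : H1 u -> {within cball1, continuous u} -> L2 mu2 ball1 v ->
  {ae mu2, forall z, ball1 z -> u z = v z} -> L2 mu `[0, 2 * pi] (c \o circ) ->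
  {ae mu, forall t, `[0, 2 * pi]%classic t -> u (circ t) = c (circ t)} ->
  WDP l1 l2 v = WDP l1 l2 u.
Proof.
move=> Hu cu Lv uv Lc uc; have Lu : L2 mu2 ball1 u by apply/L2_leb2; case: Hu.
have tv := has_trace_ae Hu cu Lv uv Lc uc.
have uu : {ae mu2, forall z, ball1 z -> u z = u z}.
  by move: uv; apply: (@filterS _ (almost_everywhere mu2)).
have tu := has_trace_ae Hu cu Lu uu Lc uc.
have m1 : measurable_fun setT (fun t : R => 0 < t) by exact: measurable_fun_ltr.
have m2 : measurable_fun setT (fun t : R => t < 0) by exact: measurable_fun_ltr.
have e1 : bint (fun x => enorm (grad v x) ^+ 2) = bint (fun x => enorm (grad u x) ^+ 2).
  by rewrite (grad_ae Lu Lv uv).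
have e2 := etrans (cint_trace tv) (esym (cint_trace tu)).
have e3 := esym (level_ae m1 Lu Lv uv); have e4 := esym (level_ae m2 Lu Lv uv).
have comb (A A' B B' P P' Q Q' : R) : A = A' -> B = B' -> P = P' -> Q = Q' ->
  A - B + l1 * P + l2 * Q = A' - B' + l1 * P' + l2 * Q' by move=> -> -> -> ->.
exact: (comb _ _ _ _ _ _ _ _ e1 e2 e3 e4).
Qed.

End AlmostEverywhere.

(** * The energy gain of the competitor *)

Section CompetitorEstimate.
Context {R : realType}.
Notation mu := (@lebesgue_measure R).
Notation plane := (R * R)%type.

Lemma int_radial_poly (k F X Y : R) :
  \int[mu]_(r in `[0, 1]) (r * ((1 - k * (1 - r)) * F + k * (1 - r) * X) + r ^+ 3 * Y) =
  (1 / 2 - k / 6) * F + k / 6 * X + Y / 4.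
Proof.
pose A (r : R) := (1 - k) * F * (r ^+ 2 / 2) + k * F * (r ^+ 3 / 3) + k * X * (r ^+ 2 / 2 - r ^+ 3 / 3) + Y * (r ^+ 4 / 4).
have pA : prim 0 1 A (fun r => r * ((1 - k * (1 - r)) * F + k * (1 - r) * X) + r ^+ 3 * Y).
  apply: prim_C1.
    by move=> r; rewrite /A; apply: is_derive_eq; rewrite /GRing.scale/=; field.
  have c1 : continuous (fun r : R => (1 - k * (1 - r))).
    by move=> r; apply: cvgB; [exact: cvg_cst|apply: cvgM; [exact: cvg_cst|apply: cvgB; [exact: cvg_cst|exact: cvg_id]]].
  have c2 : continuous (fun r : R => k * (1 - r)).
    by move=> r; apply: cvgM; [exact: cvg_cst|apply: cvgB; [exact: cvg_cst|exact: cvg_id]].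
  move=> r; apply: cvgD; apply: cvgM; [exact: cvg_id| |exact: exprn_continuous|exact: cvg_cst].
  apply: cvgD; apply: cvgM; [exact: c1|exact: cvg_cst|exact: c2|exact: cvg_cst].
have [_ /(_ 1)] := pA; rewrite ler01 lexx => /(_ isT) h.
transitivity (A 1 - A 0); first by rewrite h; ring.
by rewrite /A; field.
Qed.

(** Three terms are separated by Cauchy-Schwarz; rho and its inverse are at most
    2, and the displacement is at most 2 pi < 8. *)
Lemma transport_bound (N kappa f f' w1 eta rho t : R) : 1 / 2 <= rho -> rho <= 3 / 2 ->
  0 <= t -> t <= 1 -> eta ^+ 2 <= 64 ->
  (N * kappa * f + kappa * eta / rho * (w1 + t * f')) ^+ 2 * rho <=
  kappa ^+ 2 * (5 * N ^+ 2 + 400) * (f ^+ 2 + f' ^+ 2 + eta ^+ 2 * w1 ^+ 2).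
Proof.
move=> r1 r2 t0 t1 e64; have r0 : 0 < rho by lra.
pose v := rho^-1; have vr : v * rho = 1 by rewrite /v mulVf// gt_eqF.
have v0 : 0 < v by rewrite invr_gt0.
have v2 : v <= 2 by rewrite -[leLHS]mul1r ler_pdivrMr//; lra.
pose X := N * f; pose Y := eta * w1; pose Z := eta * t * f'.
have -> : (N * kappa * f + kappa * eta / rho * (w1 + t * f')) ^+ 2 * rho =
  kappa ^+ 2 * ((X + v * (Y + Z)) ^+ 2 * rho) by rewrite /X /Y /Z -/v; ring.
rewrite -mulrA ler_wpM2l ?sqr_ge0//.
have h1 : (X + v * (Y + Z)) ^+ 2 * rho <= 3 * (X ^+ 2 * rho + v * Y ^+ 2 + v * Z ^+ 2).
  have -> : 3 * (X ^+ 2 * rho + v * Y ^+ 2 + v * Z ^+ 2) =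
     3 * (X ^+ 2 + v ^+ 2 * Y ^+ 2 + v ^+ 2 * Z ^+ 2) * rho.
    have -> : 3 * (X ^+ 2 + v ^+ 2 * Y ^+ 2 + v ^+ 2 * Z ^+ 2) * rho = 3 * (X ^+ 2 * rho + (v * rho) * v * Y ^+ 2 + (v * rho) * v * Z ^+ 2) by ring.
    by rewrite vr !mul1r.
  rewrite ler_wpM2r ?(ltW r0)//.
  have := sqr_ge0 (X - v * Y); have := sqr_ge0 (X - v * Z); have := sqr_ge0 (v * Y - v * Z).
  have -> : v ^+ 2 * Y ^+ 2 = (v * Y) ^+ 2 by ring.
  have -> : v ^+ 2 * Z ^+ 2 = (v * Z) ^+ 2 by ring.
  have -> : (X + v * (Y + Z)) ^+ 2 = (X + v * Y + v * Z) ^+ 2 by ring.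
  by move: (v * Y) (v * Z) X => *; lra.
apply: (le_trans h1).
have X0 : X ^+ 2 * rho <= N ^+ 2 * f ^+ 2 * (3 / 2).
  by rewrite /X exprMn ler_wpM2l// mulr_ge0 ?sqr_ge0.
have Y0 : v * Y ^+ 2 <= 2 * (eta ^+ 2 * w1 ^+ 2) by rewrite /Y exprMn ler_wpM2r// mulr_ge0 ?sqr_ge0.
have Z0 : v * Z ^+ 2 <= 2 * (64 * f' ^+ 2).
  apply: ler_pM; [exact: ltW|exact: sqr_ge0|exact: v2|].
  rewrite /Z !exprMn ler_wpM2r ?sqr_ge0//.
  have t2 : t ^+ 2 <= 1 by rewrite -(expr1n R 2) lerXn2r// nnegrE.
  by rewrite -[leRHS]mulr1 ler_pM ?sqr_ge0.
have p1 := sqr_ge0 f; have p2 := sqr_ge0 f'; have p3 : 0 <= eta ^+ 2 * w1 ^+ 2 by rewrite mulr_ge0 ?sqr_ge0.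
have p4 : 0 <= N ^+ 2 * f ^+ 2 by rewrite mulr_ge0 ?sqr_ge0.
have p5 : 0 <= N ^+ 2 * f' ^+ 2 by rewrite mulr_ge0 ?sqr_ge0.
have p6 : 0 <= N ^+ 2 * (eta ^+ 2 * w1 ^+ 2) by rewrite mulr_ge0 ?sqr_ge0.
have -> : (5 * N ^+ 2 + 400) * (f ^+ 2 + f' ^+ 2 + eta ^+ 2 * w1 ^+ 2) =
  5 * (N ^+ 2 * f ^+ 2) + 5 * (N ^+ 2 * f' ^+ 2) + 5 * (N ^+ 2 * (eta ^+ 2 * w1 ^+ 2)) +
  400 * f ^+ 2 + 400 * f' ^+ 2 + 400 * (eta ^+ 2 * w1 ^+ 2) by ring.
move: X0 Y0 Z0 p1 p2 p3 p4 p5 p6; clear; lra.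
Qed.

Lemma transport_factor_ge0 (kappa N : R) : 0 <= kappa ^+ 2 * (5 * N ^+ 2 + 400).
Proof.
apply: mulr_ge0; first exact: sqr_ge0.
apply: addr_ge0; last exact: ler0n.
by apply: mulr_ge0; [exact: ler0n|exact: sqr_ge0].
Qed.

Variables (a N : R) (m C p w w' lam : R -> R) (Lam Delta H Q : R).
Hypothesis a02 : 0 <= a <= 2 * pi.
Hypothesis mm : measurable_fun setT m.
Hypothesis m1 : forall x, `|m x| <= 1.
Hypothesis m_out : forall x, x < a -> m x = 0.
Hypothesis m_mean : \int[mu]_(x in `[a, a + 2 * pi]) m x = 0.
Let b := a + 2 * pi.
Hypothesis pC : prim a b C p.
Hypothesis pw : prim a b w w'.
Hypothesis cC : continuous C.
Hypothesis cw : continuous w.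
Hypothesis mp : measurable_fun setT p.
Hypothesis mw' : measurable_fun setT w'.
Hypothesis Cab : C a = C b.
Hypothesis wab : w a = w b.
Hypotheses (mlam : measurable_fun setT lam) (lam_bound : forall x, 0 <= lam x <= Lam).
Hypothesis N8 : 8 <= N.
Hypothesis energy_gain : forall s, 0 <= s <= 1 / (2 * N) ->
  \int[mu]_(x in `[a, b]) stretched_energy N s C p w w' m x <=
  (1 - s) * \int[mu]_(x in `[a, b]) (p x ^+ 2 - C x ^+ 2) - s * Delta.
Hypothesis transport_cost : \int[mu]_(x in `[a, b]) ((C x - w x) ^+ 2 + (p x - w' x) ^+ 2 +
  (0 + \int[mu]_(t in `[a, x]) m t) ^+ 2 * w' x ^+ 2) <= H.
Hypothesis phase_gain : \int[mu]_(x in `[a, b]) (lam x * (1 + m x)) <= Q.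

Let F := \int[mu]_(x in `[a, b]) (p x ^+ 2 - C x ^+ 2) + \int[mu]_(x in `[a, b]) lam x.
Let ab : a <= b. Proof. by rewrite /b lerDl mulr_ge0// pi_ge0. Qed.

Lemma shift_sqr_bound x : a <= x <= b -> (\int[mu]_(t in `[a, x]) m t) ^+ 2 <= 64.
Proof.
move=> /andP[ax xb]; have pih := pihalf_lt2 R.
have Lm : L2 mu `[a, x] m.
  apply: (@L2_bounded _ _ _ mu _ m 1) => //; first exact: mu_segment_lty.
  exact: measurable_funS mm.
have i := L2_int Lm; have mab : measurable (`[a, x]%classic : set (measurableTypeR R)) by [].
have h : `|\int[mu]_(t in `[a, x]) m t| <= 8.
  apply: (le_trans (le_normr_Rintegral mab i)).
  apply: (@le_trans _ _ (\int[mu]_(t in `[a, x]) (1 : R))).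
    apply: le_Rintegral => //; first by have := integrable_norm i.
    by apply: continuous_integrable => y; exact: cvg_cst.
  by rewrite Rintegral_cst_segment// mul1r; move: xb; rewrite /b; lra.
rewrite -(real_normK (num_real _)); move: h (normr_ge0 (\int[mu]_(t in `[a, x]) m t)).
by move: `|_| => y h1 h2; nra.
Qed.

(** On the circle of radius [r] the phase cost interpolates linearly between its
    value for [C] and [Q], as the energy does by hypothesis. *)
Lemma slice_bound kappa r : 0 <= kappa <= 1 / 2 -> kappa <= 1 / (2 * N) -> 0 < r < 1 ->
  \int[mu]_(x in `[a, b]) comp_total a kappa N m C p w w' lam (r, x) <=
  r * ((1 - kappa * (1 - r)) * F + kappa * (1 - r) * (Q - Delta)) +
  r ^+ 3 * (kappa ^+ 2 * (5 * N ^+ 2 + 400) * H).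
Proof.
move=> k12 kN /andP[r0 r1]; set s := kappa * (1 - r); have /andP[k0 k2] := k12.
have mab : measurable (`[a, b]%classic : set (measurableTypeR R)) by [].
have rI : 0 <= r <= 1 by rewrite !ltW.
have s0 : 0 <= s by rewrite mulr_ge0// subr_ge0 ltW.
have sk : s <= kappa by rewrite ler_piMr// lerBlDr lerDl ltW.
have sN : 0 <= s <= 1 / (2 * N) by rewrite s0 (le_trans sk).
have s12 : 0 <= s <= 1 / 2 by rewrite s0 (le_trans sk).
have N0 : 0 < 2 * N by rewrite mulr_gt0// (lt_le_trans _ N8).
have Ns : N * s <= 1 by case/andP: sN => _; rewrite ler_pdivlMr// => h; move: s0; nra.
have Ns0 : 0 <= N * s by rewrite mulr_ge0// (le_trans _ N8).
pose T x := (C x - w x) ^+ 2 + (p x - w' x) ^+ 2 + (0 + \int[mu]_(t in `[a, x]) m t) ^+ 2 * w' x ^+ 2.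
have iT : mu.-integrable `[a, b] (EFin \o T) by exact: (integrable_transport 0 pC pw mm m1).
have iS := stretched_energy_integrable N pC pw mm m1 s12.
have iL := integrable_lam mlam lam_bound a b mm m1.
have Lty := mu_segment_lty a b.
have iL0 : mu.-integrable `[a, b] (EFin \o lam).
  apply: L2_int; apply: (@L2_bounded _ _ _ mu _ _ Lam) => //; first exact: measurable_funS mlam.
  by move=> x _; have /andP[h1 h2] := lam_bound x; rewrite ger0_norm.
have [iA eA] := int_lin (1 - s) s iL0 iL.
have [iB eB] := int_lin r r iS iA.
have [iD eD] := int_lin 1 (r ^+ 3 * (kappa ^+ 2 * (5 * N ^+ 2 + 400))) iB iT.
have iK := integrable_comp_total N k12 mm m1 m_out pC pw cC cw mp mw' mlam lam_bound rI.
apply: (@le_trans _ _ (1 * (r * \int[mu]_(x in `[a, b]) stretched_energy N s C p w w' m x +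
   r * ((1 - s) * \int[mu]_(x in `[a, b]) lam x + s * \int[mu]_(x in `[a, b]) (lam x * (1 + m x)))) +
   r ^+ 3 * (kappa ^+ 2 * (5 * N ^+ 2 + 400)) * \int[mu]_(x in `[a, b]) T x)).
  rewrite -eA -eB -eD; apply: (le_Rintegral mab iK iD) => x; rewrite /= in_itv/= => xab.
  have /andP[q1 q2] := stretch_bound (m1 x) s12.
  rewrite /comp_total /comp_energy /comp_dx /comp_val /comp_transport /tw_speed /= -/s.
  rewrite mul1r /stretched_energy /T add0r.
  have := @transport_bound N kappa (C x - w x) (p x - w' x) (w' x) (\int[mu]_(t in `[a, x]) m t)
    (1 + s * m x) (1 - N * s) q1 q2 _ _ (shift_sqr_bound xab).
  rewrite subr_ge0 gerBl => /(_ Ns Ns0) tb.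
  have dE : p x - N * s * (p x - w' x) = w' x + (1 - N * s) * (p x - w' x) by ring.
  rewrite /comp_dx /= -/s -dE in tb *.
  have r3 : 0 <= r ^+ 3 by rewrite exprn_ge0// ltW.
  have := ler_wpM2l r3 tb; rewrite /tw_shift => tb'.
  rewrite [X in X <= _](_ : _ = r * ((p x - N * s * (p x - w' x)) ^+ 2 / (1 + s * m x) -
      (C x - N * s * (C x - w x)) ^+ 2 * (1 + s * m x)) +
      r * ((1 - s) * lam x + s * (lam x * (1 + m x))) +
      r ^+ 3 * ((N * kappa * (C x - w x) + kappa * (\int[mu]_(t in `[a, x]) m t) / (1 + s * m x) *
       (p x - N * s * (p x - w' x))) ^+ 2 * (1 + s * m x))); last by ring.
  by rewrite lerD2l -[leRHS]mulrA.
have e1 := energy_gain sN.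
have e2 : s * \int[mu]_(x in `[a, b]) (lam x * (1 + m x)) <= s * Q by rewrite ler_wpM2l.
have c3 : 0 <= r ^+ 3 * (kappa ^+ 2 * (5 * N ^+ 2 + 400)).
  exact: mulr_ge0 (exprn_ge0 3 (ltW r0)) (transport_factor_ge0 kappa N).
have e3 := ler_wpM2l c3 transport_cost.
rewrite mul1r -mulrDr [leRHS]addrC [leLHS]addrC; apply: lerD.
  by rewrite [leRHS]mulrA.
rewrite ler_wpM2l ?(ltW r0)// /F.
rewrite (_ : (1 - s) * _ + s * (Q - Delta) = (1 - s) * \int[mu]_(x in `[a, b]) (p x ^+ 2 - C x ^+ 2) - s * Delta + ((1 - s) * \int[mu]_(x in `[a, b]) lam x + s * Q)); last by ring.
by rewrite lerD// lerD2l.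
Qed.

Lemma comp_total_bound kappa : 0 <= kappa <= 1 / 2 -> kappa <= 1 / (2 * N) ->
  rect_integral a b (comp_total a kappa N m C p w w' lam) <=
  (1 / 2 - kappa / 6) * F + kappa / 6 * (Q - Delta) + (kappa ^+ 2 * (5 * N ^+ 2 + 400) * H) / 4.
Proof.
move=> k12 kN; rewrite -int_radial_poly.
apply: (comp_total_le k12 mm m1 m_out pC pw cC cw mp mw' mlam lam_bound); last first.
  by move=> r rI; exact: slice_bound.
have c1 : continuous (fun r : R => (1 - kappa * (1 - r))).
  by move=> r; apply: cvgB; [exact: cvg_cst|apply: cvgM; [exact: cvg_cst|apply: cvgB; [exact: cvg_cst|exact: cvg_id]]].
have c2 : continuous (fun r : R => kappa * (1 - r)).
  by move=> r; apply: cvgM; [exact: cvg_cst|apply: cvgB; [exact: cvg_cst|exact: cvg_id]].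
move=> r; apply: cvgD; apply: cvgM; [exact: cvg_id| |exact: exprn_continuous|exact: cvg_cst].
by apply: cvgD; apply: cvgM; [exact: c1|exact: cvg_cst|exact: c2|exact: cvg_cst].
Qed.

End CompetitorEstimate.

(** * The homogeneous extension *)

Section Regularisation.
Context {R : realType}.
Notation mu := (@lebesgue_measure R).
Implicit Types (l r x : R).

(** The nearest point of [l, r], written so that continuity is immediate. *)
Definition clamp l r x := l + (`|x - l| - `|x - r| + (r - l)) / 2.

Lemma clamp_id l r x : l <= x <= r -> clamp l r x = x.
Proof.
move=> /andP[lx xr]; rewrite /clamp ger0_norm ?subr_ge0// ler0_norm ?subr_le0//.
by rewrite opprB; field.
Qed.

Lemma clamp_in l r x : l <= r -> l <= clamp l r x <= r.
Proof.
move=> lr; have [lx|xl] := leP l x; last first.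
  rewrite /clamp ltr0_norm ?subr_lt0// ltr0_norm ?subr_lt0 ?(lt_le_trans xl)//.
  by apply/andP; split; lra.
have [xr|rx] := leP x r; first by rewrite clamp_id ?lx ?xr.
rewrite /clamp ger0_norm ?subr_ge0// gtr0_norm ?subr_gt0//.
by apply/andP; split; lra.
Qed.

Lemma continuous_clamp l r : continuous (clamp l r).
Proof.
have cn (k : R) : continuous (fun x : R => `|x - k|).
  by move=> x; apply: cvg_norm; apply: cvgB; [exact: cvg_id|exact: cvg_cst].
move=> x; apply: cvgD; first exact: cvg_cst.
apply: cvgM; last exact: cvg_cst.
by apply: cvgD; [apply: cvgB; exact: cn|exact: cvg_cst].
Qed.

(** Extension by constants and by zero, so that global continuity and
    measurability can be assumed. *)
Lemma prim_regular l r u p : l <= r -> prim l r u p -> exists u' p',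
  [/\ continuous u', measurable_fun setT p', prim l r u' p' &
      forall x, l <= x <= r -> u' x = u x /\ p' x = p x].
Proof.
move=> lr pu; have mab : measurable (`[l, r]%classic : set (measurableTypeR R)) by [].
exists (fun x => u (clamp l r x)), (p \_ `[l, r]).
have E x : l <= x <= r -> u (clamp l r x) = u x /\ (p \_ `[l, r]) x = p x.
  by move=> xlr; rewrite clamp_id// patchE mem_set.
split => //.
- apply: (continuous_comp_within (prim_continuous pu) (@continuous_clamp l r)) => x /=.
  by rewrite in_itv/= clamp_in.
- by apply/(measurable_restrictT p mab); case: pu => -[].
- apply: prim_eq_oo pu => x xlr; first by have [] := E x xlr.
  by have [] // := E x; case/andP: xlr => h1 h2; rewrite !ltW.
Qed.

End Regularisation.

Section HomogeneousExtension.
Context {R : realType}.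
Notation mu := (@lebesgue_measure R).
Notation mu2 := (@lebesgue_measure R \x @lebesgue_measure R)%E.
Notation plane := (R * R)%type.
Variables (c : plane -> R) (C p : R -> R).
Hypothesis Hc : H1_circle c.
Hypotheses (cC : continuous C) (mp : measurable_fun setT p) (pC : prim 0 (4 * pi) C p).
Hypothesis perC : forall t, 0 <= t <= 2 * pi -> C (t + 2 * pi) = C t.
Hypothesis cCE : {ae mu, forall t, `[0, 2 * pi]%classic t -> c (circ t) = C t}.
Variable a : R.
Hypothesis a02 : 0 <= a <= 2 * pi.
Let b := a + 2 * pi.

Let pi0 : 0 < pi :> R. Proof. exact: pi_gt0. Qed.
Let Lc : L2 mu `[0, 2 * pi] (c \o circ). Proof. by case: Hc. Qed.

Lemma cC_period : C a = C b.
Proof. by rewrite /b perC. Qed.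

Lemma prim_period : prim a b C p.
Proof. by case/andP: a02 => h1 h2; apply: prim_sub pC => //; rewrite /b; lra. Qed.

Lemma circ_period (t : R) : circ (t + 2 * pi) = circ t.
Proof. by rewrite /circ mulr_natl cosD2pi sinD2pi. Qed.

Lemma cint_ae (h : R -> R) : measurable_fun setT h ->
  cint (fun x => h (c x)) = \int[mu]_(t in `[0, 2 * pi]) h (C t).
Proof.
move=> mh; rewrite cintE /Rintegral; congr fine; apply: ae_eq_integral => //.
- apply/measurable_EFinP; have [mc _] := Lc.
  exact: (measurableT_comp mh mc).
- apply/measurable_EFinP; apply: (@measurable_funS _ _ _ _ setT) => //.
  exact: (measurableT_comp mh (continuous_measurable_fun cC)).
- by move: cCE; apply: (@filterS _ (almost_everywhere mu)) => t h' tI /=; rewrite h'.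
Qed.

Lemma cint_sqr : cint (fun x => c x ^+ 2) = \int[mu]_(x in `[a, b[) (C x ^+ 2).
Proof.
have cC2 : continuous (fun t : R => C t ^+ 2).
  have -> : (fun t : R => C t ^+ 2) = (fun t : R => C t * C t) by apply/funext => t; rewrite expr2.
  by move=> x; apply: cvgM; exact: cC.
rewrite (@cint_ae (fun y => y ^+ 2)); last exact: measurable_funX.
rewrite -(int_period cC2 _ a02); last by move=> t t2; rewrite perC.
rewrite -Rintegral_itv_bndo_bndc//.
apply: integrableS (continuous_integrable a b cC2) => //.
by apply: subset_itv; rewrite bnd_simp.
Qed.

Lemma circle_values (h : plane -> R) : (forall x, a <= x <= b -> h (circ x) = C x) ->
  {ae mu, forall t, `[0, 2 * pi]%classic t -> h (circ t) = c (circ t)}.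
Proof.
move=> hC; move: cCE; apply: (@filterS _ (almost_everywhere mu)) => t ct tI; rewrite ct//.
move: tI; rewrite /= in_itv/= => /andP[t0 t2]; have [at_|ta] := leP a t.
  by rewrite hC// at_ /b (le_trans t2)// lerDr; case/andP: a02.
rewrite -circ_period hC ?perC ?t0//; case/andP: a02 => h1 h2.
by rewrite /b lerD2r (ltW ta) andbT; lra.
Qed.

Let zero (x : R) : R := 0.
Let mz : measurable_fun setT zero. Proof. exact: measurable_cst. Qed.
Let z1 (x : R) : `|zero x| <= 1. Proof. by rewrite normr0. Qed.
Let zo (s x : R) : x < s -> zero x = 0. Proof. by []. Qed.
Let zm (s : R) : \int[mu]_(x in `[s, s + 2 * pi]) zero x = 0.
Proof. by rewrite /Rintegral integral0. Qed.
Let k0 : 0 <= (0 : R) <= 1 / 2. Proof. by rewrite lexx/=; lra. Qed.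
Let o02 : 0 <= (0 : R) <= 2 * pi. Proof. by rewrite lexx/= mulr_ge0// ltW. Qed.

Notation radial := (competitor a 0 0 zero C C).

Lemma untwisted s (z : plane) : 0 <= s <= 2 * pi -> cball1 z ->
  s <= tw_coord s 0 zero z < s + 2 * pi /\
  z = (enorm z * cos (tw_coord s 0 zero z), enorm z * sin (tw_coord s 0 zero z)).
Proof.
move=> s02 bz; have [h1 h2] := @tw_coordP R s 0 zero s02 mz z1 (@zo s) (zm s) z bz; split=> //.
by rewrite {1}h2 /tw /polar /tw_angle /= !mul0r addr0.
Qed.

Lemma radial_value z : radial z = enorm z * C (tw_coord a 0 zero z).
Proof. by rewrite /competitor /tw_lift /comp_val /=; ring. Qed.

(** Independence of the ray at which the circle is cut; this makes the energy of
    the homogeneous extension available on the window of the competitor. *)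
Lemma radial_base z : ball1 z -> radial z = enorm z * C (tw_coord 0 0 zero z).
Proof.
move=> /ball1_cball1 bz; rewrite radial_value.
have [] := untwisted a02 bz; have [] := untwisted o02 bz.
move: (tw_coord a 0 zero z) (tw_coord 0 0 zero z) => x y.
rewrite add0r => /andP[y0 y2] zy /andP[ax xb] zx.
have [e0|e0] := eqVneq (enorm z) 0; first by rewrite e0 !mul0r.
congr (_ * _); have cE : cos x = cos y.
  by have := congr1 fst zy; rewrite {1}zx /= => /(mulfI e0).
have sE : sin x = sin y.
  by have := congr1 snd zy; rewrite {1}zx /= => /(mulfI e0).
have [x2|x2] := leP (2 * pi) x; last first.
  rewrite (angle_unique cE sE)// ltr_norml; case/andP: a02 => h1 h2.
  by apply/andP; split; lra.
have xE : x = (x - 2 * pi) + 2 * pi by ring.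
rewrite [in LHS]xE perC; last first.
  by case/andP: a02 => h1 h2; apply/andP; split; lra.
have cE' : cos (x - 2 * pi) = cos y by rewrite -cE [in RHS]xE mulr_natl cosD2pi.
have sE' : sin (x - 2 * pi) = sin y by rewrite -sE [in RHS]xE mulr_natl sinD2pi.
rewrite (angle_unique cE' sE')// ltr_norml; case/andP: a02 => h1 h2.
by apply/andP; split; lra.
Qed.

Let cc : R -> R := (c \o circ) \_ `[0, 2 * pi].

Lemma extension_value z : ball1 z ->
  one_homogeneous_extension c z = tw_lift 0 0 zero (fun q => q.1 * cc q.2) z.
Proof.
move=> /ball1_cball1 bz; rewrite /one_homogeneous_extension /tw_lift /=.
have [] := untwisted o02 bz; move: (tw_coord 0 0 zero z) => y; rewrite add0r => /andP[y0 y2] zy.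
have [e0|e0] := eqVneq (enorm z) 0; first by rewrite e0 !mul0r.
congr (_ * _); rewrite /cc patchE mem_set /=; last by rewrite in_itv/= y0 ltW.
have e1 : z.1 / enorm z = cos y by rewrite {1}zy /= mulrAC divff// mul1r.
have e2 : z.2 / enorm z = sin y by rewrite {1}zy /= mulrAC divff// mul1r.
by rewrite e1 e2.
Qed.

Let mcc : measurable_fun setT cc.
Proof.
have mab : measurable (`[0, 2 * pi]%classic : set (measurableTypeR R)) by [].
by apply/(measurable_restrictT _ mab); case: Lc.
Qed.

(** [c] agrees with [C] for almost every angle only, and the two extensions on
    almost every ray. *)
Lemma extension_ae : {ae mu2, forall z, ball1 z -> radial z = one_homogeneous_extension c z}.
Proof.
have pC2 : prim 0 (0 + 2 * pi) C p.
  by apply: prim_sub pC => //; rewrite add0r; move: pi0; lra.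
have mC := continuous_measurable_fun cC.
have FF : {ae mu, forall x, `[0, 0 + 2 * pi]%classic x -> C x = cc x}.
  move: cCE; apply: (@filterS _ (almost_everywhere mu)) => x h; rewrite add0r => xI.
  by rewrite /cc patchE mem_set//= h.
have := lift_ae_eq o02 k0 mz z1 (@zo 0) (zm 0) pC2 pC2 mC mcc FF.
apply: (@filterS _ (almost_everywhere mu2)) => z h bz.
by rewrite extension_value// -h// radial_base.
Qed.

Let HR := prim_period.
Let H1R : H1 radial := H1_competitor 0 a02 k0 mz z1 (@zo a) (zm a) HR HR cC cC mp mp cC_period cC_period.
Let cR : {within cball1, continuous radial} :=
  continuous_competitor a02 k0 mz z1 (@zo a) (zm a) cC cC cC_period cC_period.

Lemma L2_extension : L2 mu2 ball1 (one_homogeneous_extension c).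
Proof.
have LR : L2 mu2 ball1 radial by apply/L2_leb2; case: H1R.
have mE : measurable_fun ball1 (one_homogeneous_extension c).
  apply: (@eq_measurable_fun _ _ _ _ _ (tw_lift 0 0 zero (fun q => q.1 * cc q.2))).
    by move=> z /set_mem/extension_value.
  apply: (measurable_tw_lift o02 k0 mz z1 (@zo 0) (zm 0)).
  apply: measurable_funM; first exact: measurable_fst.
  exact: (measurableT_comp mcc measurable_snd).
split => //; have [mR] := LR; rewrite (_ : (\int[mu2]_(x in ball1) (radial x ^+ 2)%:E =
   \int[mu2]_(x in ball1) (one_homogeneous_extension c x ^+ 2)%:E)%E) //.
apply: ae_eq_integral => //.
- exact: mball1.
- by apply/measurable_EFinP; exact: measurable_funX.
- by apply/measurable_EFinP; exact: measurable_funX.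
- by move: extension_ae; apply: (@filterS _ (almost_everywhere mu2)) => z h bz; rewrite h.
Qed.

Lemma H1_extension : H1 (one_homogeneous_extension c).
Proof. exact: (H1_ae H1R L2_extension extension_ae). Qed.

(** The homogeneous extension is the competitor for kappa = 0, up to a null set. *)
Lemma WDP_extension (l1 l2 : R) : 0 <= l1 -> 0 <= l2 ->
  WDP l1 l2 (one_homogeneous_extension c) =
  (\int[mu]_(x in `[a, b]) (p x ^+ 2 - C x ^+ 2) + \int[mu]_(x in `[a, b]) weight C l1 l2 x) / 2.
Proof.
move=> l10 l20.
have circR x : a <= x <= b -> radial (circ x) = C x by exact: (competitor_circle 0 C a02 k0 mz z1 (@zo a) (zm a) cC_period).
have uc := circle_values circR.
rewrite (WDP_ae l1 l2 H1R cR L2_extension extension_ae Lc uc).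
have LR : L2 mu2 ball1 radial by apply/L2_leb2; case: H1R.
have uu : {ae mu2, forall z, ball1 z -> radial z = radial z}.
  by move: extension_ae; apply: (@filterS _ (almost_everywhere mu2)).
have tR := has_trace_ae H1R cR LR uu Lc uc.
have wg := competitor_weak_gradient 0 a02 k0 mz z1 (@zo a) (zm a) HR HR cC cC mp mp cC_period cC_period.
rewrite (WDP_weak_gradient l1 l2 wg H1R tR) cint_sqr.
rewrite (competitor_energy 0 a02 k0 mz z1 (@zo a) (zm a) HR HR cC cC mp mp) addrK.
rewrite (competitor_phases a02 k0 mz z1 (@zo a) (zm a) HR HR cC cC mp mp l10 l20); last first.
  move=> r x r0 r1 _; rewrite /comp_val /= subrr mulr0 subr0.
  by rewrite pmulr_rgt0// pmulr_rlt0.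
set F := \int[mu]_(x in `[a, b]) (p x ^+ 2 - C x ^+ 2) + \int[mu]_(x in `[a, b]) weight C l1 l2 x.
have -> : F / 2 = \int[mu]_(r in `[0, 1]) (r * ((1 - 0 * (1 - r)) * F + 0 * (1 - r) * 0) + r ^+ 3 * 0).
  by rewrite int_radial_poly; field.
have mab : measurable (`[a, b]%classic : set (measurableTypeR R)) by [].
have mw := measurable_weight l1 l2 cC.
have bw x : 0 <= weight C l1 l2 x <= l1 + l2.
  by rewrite /weight; case: ifP => _; [|case: ifP => _]; rewrite ?l10 ?l20 ?lexx ?lerDl ?lerDr ?addr_ge0.
apply: (comp_total_eq k0 mz z1 (@zo a) HR HR cC cC mp mp mw bw).
  have -> : (fun r : R => r * ((1 - 0 * (1 - r)) * F + 0 * (1 - r) * 0) + r ^+ 3 * 0) = (fun r : R => r * F).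
    by apply/funext => r; ring.
  by move=> r; apply: cvgM; [exact: cvg_id|exact: cvg_cst].
move=> r _; transitivity (\int[mu]_(x in `[a, b]) (r * (1 * (p x ^+ 2) + -1 * (C x ^+ 2)) + r * weight C l1 l2 x)).
  congr (Rintegral _ _ _); apply/funext => x.
  rewrite /comp_total /comp_energy /comp_dx /comp_val /comp_transport /tw_speed /zero /=.
  have e1 : 1 + 0 * (1 - r) * 0 = 1 :> R by ring.
  by rewrite e1 invr1; ring.
have i1 := L2_sqr_integrable mab HR.1; have i2 := L2_sqr_integrable mab (prim_L2 HR).
have [i3 e3] := int_lin 1 (-1) i1 i2.
have i4 : mu.-integrable `[a, b] (EFin \o weight C l1 l2).
  apply: L2_int; apply: (@L2_bounded _ _ _ mu _ _ (l1 + l2)) => //.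
  - exact: mu_segment_lty.
  - exact: measurable_funS mw.
  - by move=> x _; have /andP[h1 h2] := bw x; rewrite ger0_norm.
have [_ ->] := int_lin r r i3 i4.
have -> : \int[mu]_(x in `[a, b]) (1 * p x ^+ 2 + -1 * C x ^+ 2) = \int[mu]_(x in `[a, b]) (p x ^+ 2 - C x ^+ 2).
  by congr (Rintegral _ _ _); apply/funext => x; rewrite mul1r mulN1r.
rewrite /F; ring.
Qed.

End HomogeneousExtension.

(** * The improvement *)

Section Improvement.
Context {R : realType}.
Notation mu := (@lebesgue_measure R).
Notation mu2 := (@lebesgue_measure R \x @lebesgue_measure R)%E.
Notation plane := (R * R)%type.

(** The factor 7500 is 3 times the constant of [improvable]. *)
Lemma improvement_arithmetic (kappa A F D H Q L P : R) : 0 <= kappa -> 0 <= A ->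
  7500 * (kappa * A) <= 1 -> 0 <= H -> H <= 2500 * D -> Q - L * P <= D / 2 ->
  (1 / 2 - kappa / 6) * F + kappa / 6 * (Q - D) + (kappa ^+ 2 * A * H) / 4 - L * (P / 2) <=
  (1 - kappa / 3) * (F / 2 - L * (P / 2)).
Proof.
move=> k0 A0 kA H0 HD QD; have D0 : 0 <= D by lra.
have e1 : kappa * A * H <= D / 3.
  apply: (@le_trans _ _ (kappa * A * (2500 * D))); first by rewrite ler_wpM2l// mulr_ge0.
  have : 7500 * (kappa * A) * D <= 1 * D by rewrite ler_wpM2r.
  by move: (kappa * A) => *; lra.
have e2 := ler_wpM2l k0 e1; have e3 := ler_wpM2l k0 QD.
have -> : kappa ^+ 2 * A * H = kappa * (kappa * A * H) by ring.
by move: (kappa * (kappa * A * H)) e2 e3 => *; lra.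
Qed.

(** Moving towards a profile of the same sign, by less than the whole way, does
    not change the sign. *)
Lemma convex_sign (C w t : R) : 0 <= t -> t < 1 -> (C = 0 -> w = 0) -> 0 <= C * w ->
  (0 < C - t * (C - w)) = (0 < C) /\ (C - t * (C - w) < 0) = (C < 0).
Proof.
move=> t0 t1 Cw0 Cw; have E : C - t * (C - w) = (1 - t) * C + t * w by ring.
rewrite E; have t1' : 0 < 1 - t by rewrite subr_gt0.
have [C0|C0|C0] := ltgtP C 0.
- have w0 : w <= 0 by rewrite nmulr_rge0 in Cw.
  have h : (1 - t) * C + t * w < 0.
    by rewrite ltr_wnDr ?pmulr_rlt0// mulr_ge0_le0.
  by rewrite h ltNge (ltW h).
- have w0 : 0 <= w by rewrite pmulr_rge0 in Cw.
  have h : 0 < (1 - t) * C + t * w by rewrite ltr_wpDr ?mulr_gt0// mulr_ge0.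
  by rewrite h ltNge (ltW h).
- by rewrite C0 Cw0// !mulr0 addr0 ltxx.
Qed.

Lemma step_lt1 (N s : R) : 0 < 2 * N -> s <= 1 / (2 * N) -> N * s < 1.
Proof. by move=> N0; rewrite ler_pdivlMr// => h; lra. Qed.

Variables (c : plane -> R) (C p : R -> R) (l1 l2 N kappa a : R).
Hypothesis Hc : H1_circle c.
Hypotheses (cC : continuous C) (mp : measurable_fun setT p) (pC : prim 0 (4 * pi) C p).
Hypothesis perC : forall t, 0 <= t <= 2 * pi -> C (t + 2 * pi) = C t.
Hypothesis cCE : {ae mu, forall t, `[0, 2 * pi]%classic t -> c (circ t) = C t}.
Hypothesis a02 : 0 <= a <= 2 * pi.
Hypotheses (l1_ge0 : 0 <= l1) (l2_ge0 : 0 <= l2) (N8 : 8 <= N).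
Hypotheses (k0 : 0 <= kappa) (kA : 7500 * (kappa * (5 * N ^+ 2 + 400)) <= 1).
Let b := a + 2 * pi.
Let ab : a <= b. Proof. by rewrite /b lerDl mulr_ge0// pi_ge0. Qed.

Lemma small_kappa : kappa <= 1 / (2 * N).
Proof.
have N0 : 0 < 2 * N by rewrite mulr_gt0// (lt_le_trans _ N8).
rewrite ler_pdivlMr//; apply: le_trans kA.
move: k0 N8 => k N8'; have : 2 * N <= 7500 * (5 * N ^+ 2 + 400) by nra.
by move=> h; rewrite [leRHS]mulrCA; exact: ler_wpM2l.
Qed.

Lemma improved_extension : improvable C p l1 l2 N a -> exists h : plane -> R,
  [/\ H1 h, has_trace h c & WDP l1 l2 h - (l1 + l2) * (pi / 2) <=
    (1 - kappa / 3) * (WDP l1 l2 (one_homogeneous_extension c) - (l1 + l2) * (pi / 2))].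
Proof.
move=> [D [H [Q [[w0 [w0' [m0 [[pw0 [w0a w0b]] [mm0 [m01 im0]] sg0 En0 [Tr0 Ph0]]]]] HD QD]]]].
have HR : prim a b C p := prim_period pC a02.
have [w [w' [cw mw' pw wE]]] := prim_regular ab pw0.
pose m : R -> R := m0 \_ `[a, b].
have mab : measurable (`[a, b]%classic : set (measurableTypeR R)) by [].
have mE x : a <= x <= b -> m x = m0 x by move=> xI; rewrite /m patchE mem_set.
have mm : measurable_fun setT m.
  by apply/(measurable_restrictT m0 mab); exact: measurable_funS mm0.
have m1 x : `|m x| <= 1 by rewrite /m patchE; case: ifP => _; rewrite ?normr0.
have m_out x : x < a -> m x = 0.
  by move=> xa; rewrite /m patchE memNset// /= in_itv/= leNgt xa.
have imx x : a <= x <= b -> \int[mu]_(t in `[a, x]) m t = \int[mu]_(t in `[a, x]) m0 t.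
  move=> /andP[_ xb]; apply: eq_Rintegral => t; rewrite inE/= in_itv/= => /andP[at_ tx].
  by rewrite mE// at_ (le_trans tx).
have m_mean : \int[mu]_(x in `[a, a + 2 * pi]) m x = 0 by rewrite imx ?lexx ?ab.
have kN := small_kappa.
have k12 : 0 <= kappa <= 1 / 2.
  rewrite k0 (le_trans kN)// ler_pdivrMr ?mulr_gt0 ?(lt_le_trans _ N8)//.
  by move: N8; lra.
have Cab := cC_period perC a02.
have aI : a <= a <= b by rewrite lexx ab.
have bI : a <= b <= b by rewrite lexx ab.
have wa : w a = C a by have [-> _] := wE a aI.
have wb : w b = C b by have [-> _] := wE b bI.
have wab : w a = w b by rewrite wa wb.
have mlam := measurable_weight l1 l2 cC.
have blam x : 0 <= weight C l1 l2 x <= l1 + l2.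
  by rewrite /weight; case: ifP => _; [|case: ifP => _]; rewrite ?l1_ge0 ?l2_ge0 ?lexx ?lerDl ?lerDr ?addr_ge0.
have cint_eq (f g : R -> R) : (forall x, a <= x <= b -> f x = g x) ->
    \int[mu]_(x in `[a, b]) f x = \int[mu]_(x in `[a, b]) g x.
  by move=> fg; apply: eq_Rintegral => x; rewrite inE/= in_itv/= => /fg.
have En s : 0 <= s <= 1 / (2 * N) ->
    \int[mu]_(x in `[a, b]) stretched_energy N s C p w w' m x <=
    (1 - s) * \int[mu]_(x in `[a, b]) (p x ^+ 2 - C x ^+ 2) - s * D.
  move=> /En0; rewrite (cint_eq _ (stretched_energy N s C p w0 w0' m0))// => x xI.
  by rewrite /stretched_energy mE//; have [-> ->] := wE x xI.
have Tr : \int[mu]_(x in `[a, b]) ((C x - w x) ^+ 2 + (p x - w' x) ^+ 2 +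
    (0 + \int[mu]_(t in `[a, x]) m t) ^+ 2 * w' x ^+ 2) <= H.
  apply: le_trans Tr0; rewrite le_eqVlt; apply/orP; left; apply/eqP; apply: cint_eq => x xI.
  by rewrite imx//; have [-> ->] := wE x xI.
have Ph : \int[mu]_(x in `[a, b]) (weight C l1 l2 x * (1 + m x)) <= Q.
  apply: le_trans Ph0; rewrite le_eqVlt; apply/orP; left; apply/eqP; apply: cint_eq => x xI.
  by rewrite mE.
have H0 : 0 <= H.
  apply: le_trans Tr; apply: Rintegral_ge0 => x _.
  by rewrite !addr_ge0 ?sqr_ge0// mulr_ge0// sqr_ge0.
pose h := competitor a kappa N m C w.
have Hh : H1 h := H1_competitor N a02 k12 mm m1 m_out m_mean HR pw cC cw mp mw' Cab wab.
have ch : {within cball1, continuous h} := continuous_competitor a02 k12 mm m1 m_out m_mean cC cw Cab wab.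
have circh x : a <= x <= b -> h (circ x) = C x by exact: (competitor_circle N w a02 k12 mm m1 m_out m_mean Cab).
have uc := circle_values perC cCE a02 circh.
have Lh : L2 mu2 ball1 h by apply/L2_leb2; case: Hh.
have Lc : L2 mu `[0, 2 * pi] (c \o circ) by case: Hc.
have hh : {ae mu2, forall z, ball1 z -> h z = h z}.
  by apply: aeW.
have th := has_trace_ae Hh ch Lh hh Lc uc.
exists h; split => //.
rewrite (WDP_extension Hc cC mp pC perC cCE a02 l1_ge0 l2_ge0).
have wg := competitor_weak_gradient N a02 k12 mm m1 m_out m_mean HR pw cC cw mp mw' Cab wab.
rewrite (WDP_weak_gradient l1 l2 wg Hh th) (cint_sqr Hc cC perC cCE a02).
rewrite (competitor_energy N a02 k12 mm m1 m_out m_mean HR pw cC cw mp mw') addrK.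
rewrite (competitor_phases a02 k12 mm m1 m_out m_mean HR pw cC cw mp mw' l1_ge0 l2_ge0); last first.
  move=> r x r0 r1 /andP[ax xb]; rewrite /comp_val /=.
  have xI : a <= x <= b by rewrite ax ltW.
  rewrite pmulr_rgt0// pmulr_rlt0//; have [wx _] := wE x xI; have [z1 z2] := sg0 x xI.
  have s1 : 0 <= kappa * (1 - r) by rewrite mulr_ge0// subr_ge0 ltW.
  have s2 : kappa * (1 - r) <= kappa by rewrite ler_piMr// lerBlDr lerDl ltW.
  have N0 : 0 < 2 * N by rewrite mulr_gt0// (lt_le_trans _ N8).
  have Ns : N * (kappa * (1 - r)) < 1.
    exact: step_lt1 N0 (le_trans s2 kN).
  apply: convex_sign => //; rewrite ?wx//.
  by rewrite mulr_ge0// (le_trans _ N8).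
have bound := comp_total_bound mm m1 m_out HR pw cC cw mp mw' mlam blam N8 En Tr Ph k12 kN.
apply: le_trans (improvement_arithmetic _ k0 _ kA H0 HD QD); last first.
  apply: addr_ge0; last exact: ler0n.
  by apply: mulr_ge0; [exact: ler0n|exact: sqr_ge0].
by rewrite lerD2r; exact: bound.
Qed.

End Improvement.

Section Main.
Context {R : realType}.
Notation mu := (@lebesgue_measure R).
Notation plane := (R * R)%type.

Lemma H1_circle_regular (c : plane -> R) : H1_circle c -> exists C p : R -> R,
  [/\ continuous C, measurable_fun setT p, prim 0 (4 * pi) C p,
      forall t, 0 <= t <= 2 * pi -> C (t + 2 * pi) = C t &
      {ae mu, forall t, `[0, 2 * pi]%classic t -> c (circ t) = C t}].
Proof.
move=> /H1_circle_periodic[C0 [p0 [pC0 per0 ae0]]]; have pi0 := pi_gt0 R.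
have h4 : 0 <= 4 * pi :> R by lra.
have [C [p [cC mp pC CE]]] := prim_regular h4 pC0.
exists C, p; split => //.
- move=> t /andP[t0 t2].
  have I1 : 0 <= t + 2 * pi <= 4 * pi by apply/andP; split; lra.
  have I2 : 0 <= t <= 4 * pi by apply/andP; split; lra.
  have [-> _] := CE _ I1; have [-> _] := CE _ I2.
  by apply: per0; rewrite t0.
- move: ae0; apply: (@filterS _ (almost_everywhere mu)) => t h tI; rewrite h//.
  move: tI; rewrite /= in_itv/= => /andP[t0 t2].
  have I2 : 0 <= t <= 4 * pi by apply/andP; split; lra.
  by have [-> _] := CE _ I2.
Qed.

Lemma signed_part_max (C : R -> R) b (t : R) :
  signed_part C b t = Num.max (signed b (C t)) 0.
Proof.
rewrite /signed_part; have -> : `|C t| = `|signed b (C t)| by case: b; rewrite /= ?normrN.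
move: (signed b (C t)) => y; have [y0|y0] := leP y 0; first by rewrite ler0_norm// addNr mul0r.
by rewrite gtr0_norm//; field.
Qed.

Lemma both_signs (c : plane -> R) (C : R -> R) (alpha : R) : H1_circle c -> continuous C ->
  {ae mu, forall t, `[0, 2 * pi]%classic t -> c (circ t) = C t} ->
  alpha < cint (c^\+) -> alpha < cint (c^\-) ->
  forall b, alpha <= \int[mu]_(x in `[0, 2 * pi]) signed_part C b x.
Proof.
move=> Hc cC cCE pos neg b.
have part (h : R -> R) : measurable_fun setT h -> (forall t, signed_part C b t = h (C t)) ->
    \int[mu]_(x in `[0, 2 * pi]) signed_part C b x = cint (fun x => h (c x)).
  move=> mh hE; rewrite (cint_ae Hc cC cCE mh).
  by congr (Rintegral _ _ _); apply/funext => t; rewrite hE.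
have mid : measurable_fun setT (fun y : R => y) by exact: measurable_id.
case: b part => part.
- rewrite (part (fun y => Num.max y 0)).
  + exact: ltW pos.
  + by apply: measurable_maxr.
  + by move=> t; rewrite signed_part_max.
- rewrite (part (fun y => Num.max (- y) 0)).
  + exact: ltW neg.
  + by apply: measurable_maxr.
  + by move=> t; rewrite signed_part_max.
Qed.

End Main.

Theorem theorem2 (R : realType) (l1 l2 : R)
    (l1_gt0 : 0 < l1) (l2_gt0 : 0 < l2) (l1_neq_l2 : l1 <> l2) :
  forall alpha : R, 0 < alpha ->
  exists2 eps : R, 0 < eps &
  forall c : R * R -> R, H1_circle c ->
    alpha < cint (c^\+) -> alpha < cint (c^\-) ->
    let z := one_homogeneous_extension c in
    H1 z /\
    exists h : R * R -> R,
      [/\ H1 h, has_trace h c &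
          WDP l1 l2 h - (l1 + l2) * (pi / 2) <=
          (1 - eps) * (WDP l1 l2 z - (l1 + l2) * (pi / 2))].
Proof.
(* [N] satisfies the requirement of [gaps_dominate], and [kappa] the one of
   [improvement_arithmetic] for the constant of [transport_bound]. *)
move=> alpha alpha0; pose N : R := 9 + 64 * (l1 + l2) / alpha ^+ 2.
pose A := 5 * N ^+ 2 + 400; pose kappa := (7500 * A)^-1.
have a2 : 0 < alpha ^+ 2 by rewrite exprn_gt0.
have N8 : 8 <= N.
  have : 0 <= 64 * (l1 + l2) / alpha ^+ 2 by rewrite divr_ge0 ?(ltW a2)// mulr_ge0// addr_ge0 ?ltW.
  by rewrite /N; lra.
have N_large : 64 * (l1 + l2) <= (N - 1) * alpha ^+ 2.
  have -> : (N - 1) * alpha ^+ 2 = 64 * (l1 + l2) + 8 * alpha ^+ 2 by rewrite /N; field; rewrite gt_eqF.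
  by rewrite lerDl mulr_ge0// ltW.
have A0 : 0 < A.
  apply: ltr_wpDl; last exact: ltr0n.
  by apply: mulr_ge0; [exact: ler0n|exact: sqr_ge0].
have c0 : 0 < 7500 :> R by rewrite ltr0n.
have cA0 := mulr_gt0 c0 A0.
have k0 : 0 < kappa by rewrite invr_gt0.
have kA : 7500 * (kappa * A) <= 1 by rewrite mulrCA mulVf ?(gt_eqF cA0).
exists (kappa / 3); first by rewrite divr_gt0.
move=> c Hc pos neg; have [C [p [cC mp pC perC cCE]]] := H1_circle_regular Hc.
have phases := both_signs Hc cC cCE pos neg.
have [a a02 imp] := exists_improvable cC pC perC l1_gt0 l2_gt0 N8 alpha0 N_large phases.
split; first exact: (H1_extension Hc cC mp pC perC cCE a02).
exact: (improved_extension Hc cC mp pC perC cCE a02 (ltW l1_gt0) (ltW l2_gt0) N8 (ltW k0) kA imp).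
Qed.
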